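(* Let $\Omega=(0,L)\times(0,1)$ and let $u_0\in C^\infty([0,1])$ be even with respect to $y=\tfrac12$ and satisfy $u_0>0$ on $(0,1)$, $u_0(0)=u_0(1)=0$, $u_0'(0)=-u_0'(1)>0$, $\|u_0'''/u_0\|_{L^\infty}<\infty$. Let $A>0$. There is $L_0>0$ such that for every $L\in(0,L_0)$ there is $\varepsilon_0>0$ such that for all $\varepsilon\in(0,\varepsilon_0)$ the following holds. Let $(u_s,v_s)$ be a steady state as described in the context, and let $\phi(t,x,y)$ satisfy $$\Delta\phi_t+u_s\Delta\phi_x-\Delta u_s\,\phi_x+v_s\Delta\phi_y-\Delta v_s\,\phi_y-\varepsilon\Delta^2\phi=0\ \text{ in }\Omega\times(0,\infty),\qquad \phi|_{t=0}=\phi_0,$$ with boundary conditions $$\phi|_{x=0}=\phi_x|_{x=L}=\phi_{xx}|_{x=0}=\phi_{xxx}|_{x=L}=0,$$ $$(\phi_y-A\varepsilon^{1/3}\Delta\phi)|_{y=0}=(\phi_y+A\varepsilon^{1/3}\Delta\phi)|_{y=1}=\phi|_{y=0}=\phi|_{y=1}=0.$$ Then there is a constant $C$, depending only on $u_0$, such that for all $T>0$ $$\|\sqrt{u_0}\Delta\phi\|_{L^2}^2(T)+\frac1L\int_0^T\|u_0\Delta\phi\|_{L^2}^2\,dt+\varepsilon\int_0^T\|\sqrt{u_0}\nabla\Delta\phi\|_{L^2}^2\,dt\le C\|\sqrt{u_0}\Delta\phi_0\|_{L^2}^2 .$$ Moreover, for some $c_1>0$ (independent of $\varepsilon$, $T$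 and $\phi$), $$\|\nabla\phi\|_{L^2}(T)+\|\sqrt{u_0}\Delta\phi\|_{L^2}(T)\le Ce^{-c_1\varepsilon^{1/3}T}\|\sqrt{u_0}\Delta\phi_0\|_{L^2}\qquad\text{for all }T>0.$$
   Context: $\|\cdot\|_{L^2}$ is the $L^2(\Omega)$ norm in $(x,y)$; $\|f\|_{L^\infty_xL^2_y}=\sup_x(\int|f(x,y)|^2dy)^{1/2}$. Steady state $(u_s,v_s)$: fix a small $\delta>0$. $(u_s,v_s)$ solves (with some pressure $p_s$) $u_s\partial_xu_s+v_s\partial_yu_s+\partial_xp_s-\varepsilon\Delta u_s=0$, $u_s\partial_xv_s+v_s\partial_yv_s+\partial_yp_s-\varepsilon\Delta v_s=0$, $\partial_xu_s+\partial_yv_s=0$ in $\Omega$, with $u_s(x,0)-A\varepsilon^{1/3}\partial_yu_s(x,0)=0$, $u_s(x,1)+A\varepsilon^{1/3}\partial_yu_s(x,1)=0$, $v_s(x,0)=v_s(x,1)=0$; $u_s$ is even and $v_s$ is odd about $y=\frac12$; and, with a constant $K$ depending only on $u_0,A,\delta$: $0<u_s-u_0\le K\varepsilon^{1/3}$, $|v_s|\le K\varepsilon$, $|\partial_yu_s-u_0'|\le K\varepsilon^{2/3}$, $|\partial_xu_s|+|\partial_xv_s|\le K\varepsilon^{1-\delta}$, $|\Delta u_a|\le K$, $|\Delta\partial_xu_a|+|\Delta u_a-u_0''|\le K\varepsilon^{1/3}$, $|\Delta v_a|+|\Delta\partial_xv_a|\le K\varepsilon^{2/3}$, $\|\sqrt{u_0}\Delta(u_s-u_a)\|_{L^\infty_xL^2_y}+\|\sqrt{u_0}\Delta(v_s-v_a)\|_{L^\infty_xL^2_y}\le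 K\varepsilon^{5/6-\delta}$, $\|\sqrt{u_0}\Delta\partial_x(u_s-u_a)\|_{L^2}+\|\sqrt{u_0}\Delta\partial_x(v_s-v_a)\|_{L^2}\le K\varepsilon^{5/6-\delta}$. (The paper proves that such a steady state exists.) Approximate solution $(u_a,v_a)$ (here $H=1$). Put $u_e^0(y)=u_0(y)+Au_0'(0)\varepsilon^{1/3}$. Let $v_e^1=v_e^1(y)$ be the solution, odd about $y=H/2$, of $-u_e^0(v_e^1)''+(u_e^0)''v_e^1=(u_e^0)'''$ on $(0,H)$ with $v_e^1(0)=v_e^1(H)=0$, and set $u_e^1(x,y)=-x\,(v_e^1)'(y)$ and $g(x)=u_e^1(x,0)-A\varepsilon^{1/3}\partial_yu_e^1(x,0)$. Let $(U,V)(x,Y)$, $0<x<L$, $Y>0$, solve $u_0'(0)(A+Y)U_x+u_0'(0)V-U_{YY}=0$, $U_x+V_Y=0$, $\lim_{Y\to\infty}U=\lim_{Y\to\infty}V=0$, $U(x,0)-AU_Y(x,0)=-g(x)$, $U(0,Y)=U_0(Y)$, where $U_0$ is a chosen datum with $|e^Y\partial_Y^kU_0|\le C$ for $0\le k\le N_0$ ($N_0$ a fixed large integer, $C$ independent of $\varepsilon$) satisfying the standard parabolic compatibility conditions at the corner $(0,0)$. Let $\tilde\chi\ge0$ be a smooth cutoff on $[0,\infty)$ with $\tilde\chi=1$ on $[0,1]$, $\tilde\chi=0$ on $[2,\infty)$, let $N=\varepsilon^{-1/3}/100$, and set $u_p^-(x,Y)=\tilde\chi(Y/N)U-\frac1N\tilde\chi'(Y/N)\int_0^xV(x',Y)dx'$,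 $v_p^-(x,Y)=\tilde\chi(Y/N)V$. Then $u_a=u_e^0+\varepsilon u_e^1+\varepsilon[u_p^-(x,\frac{y}{\varepsilon^{1/3}})+u_p^-(x,\frac{H-y}{\varepsilon^{1/3}})]$ and $v_a=\varepsilon v_e^1+\varepsilon^{4/3}[v_p^-(x,\frac{y}{\varepsilon^{1/3}})-v_p^-(x,\frac{H-y}{\varepsilon^{1/3}})]$. *)

(* Defs.v *)
From mathcomp Require Export all_boot all_order all_algebra.
From mathcomp Require Export all_classical all_reals all_analysis.

Set Implicit Arguments.
Unset Strict Implicit.
Unset Printing Implicit Defensive.

Export Order.TTheory GRing.Theory Num.Theory.
Export numFieldNormedType.Exports.

Local Open Scope ring_scope.
Local Open Scope classical_set_scope.

(* In ring_scope these would denote the derivatives of polynomials. *)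
Local Notation "f ^` ()" := (derive1 f) : ring_scope.
Local Notation "f ^` ( n )" := (derive1n n f) : ring_scope.

Definition dx (R : realType) (f : R -> R -> R) (x y : R) : R := (f^~ y)^`() x.
Definition dy (R : realType) (f : R -> R -> R) (x y : R) : R := (f x)^`() y.
Definition dt (R : realType) (f : R -> R -> R -> R) (t x y : R) : R :=
  (fun s => f s x y)^`() t.

Definition lap (R : realType) (f : R -> R -> R) (x y : R) : R :=
  dx (dx f) x y + dy (dy f) x y.

Definition grad_norm (R : realType) (f : R -> R -> R) (x y : R) : R :=
  Num.sqrt (dx f x y ^+ 2 + dy f x y ^+ 2).

(* A word [:: b1; ...; bm] over bool stands for the operator D_b1 ... D_bm,
   where D_true is the x-derivative and D_false the y-derivative. *)
Definition pder (R : realType) (w : seq bool) (f : R -> R -> R) : R -> R -> R :=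
  foldr (fun (b : bool) g => if b then dx g else dy g) f w.

Definition partially_derivable (R : realType) (f : R -> R -> R) (z : R * R) :=
  derivable (f^~ z.2) z.1 1 /\ derivable (f z.1) z.2 1.

Definition Ck (R : realType) (k : nat) (S : set (R * R)) (f : R -> R -> R) :=
  forall w : seq bool, (size w <= k)%N -> forall z : R * R, S z ->
    ((size w < k)%N -> partially_derivable (pder w f) z) /\
    {for z, continuous (fun z' : R * R => pder w f z'.1 z'.2)}.

(* Elements of C^oo([0,1]) and C^oo([0,+oo[) are represented by smooth
   functions on the whole line; only their restrictions matter. *)
Definition smooth (R : realType) (f : R -> R) :=
  forall (k : nat) (x : R), derivable (f^`(k)) x 1.

(* f, a priori meaningful on S only, has the boundary value l at p. *)
Definition trace (R : realType) (T : topologicalType) (S : set T) (f : T -> R)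
    (p : T) (l : R) :=
  f z @[z --> within S (nbhs p)] --> l.

(* f is continuous on S and extends continuously to S', for S `<=` S' and
   S' `<=` closure S. *)
Definition extends_to (R : realType) (T : topologicalType) (S S' : set T)
    (f : T -> R) :=
  forall p, S' p -> exists l : R, trace S f p l.

Definition Omega (R : realType) (L : R) : set (R * R) := `]0, L[ `*` `]0, 1[.
Definition clOmega (R : realType) (L : R) : set (R * R) := `[0, L] `*` `[0, 1].
Definition corners (R : realType) (L : R) : set (R * R) :=
  [set 0; L] `*` [set 0; 1].

Definition sqrt_wt (R : realType) (u0 : R -> R) (f : R -> R -> R) (x y : R) : R :=
  Num.sqrt (u0 y) * f x y.

Definition wt (R : realType) (u0 : R -> R) (f : R -> R -> R) (x y : R) : R :=
  u0 y * f x y.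

Definition sub2 (R : realType) (f g : R -> R -> R) (x y : R) : R :=
  f x y - g x y.

Definition L2norm (R : realType) (L : R) (f : R -> R -> R) : \bar R :=
  'N[(@lebesgue_measure R \x @lebesgue_measure R)%E]_(2%:E)
    [(fun z : R * R => (f z.1 z.2)%:E) \_ (Omega L)]%E.

Definition LinfxL2y (R : realType) (L : R) (f : R -> R -> R) : \bar R :=
  ereal_sup [set 'N[@lebesgue_measure R]_(2%:E)
    [(fun y : R => (f x y)%:E) \_ `]0%R, 1%R[]%E | x in `]0, L[].

Record base_flow (R : realType) (u0 : R -> R) : Prop := BaseFlow {
  base_smooth : smooth u0;
  base_even : forall y, 0 <= y <= 1 -> u0 (1 - y) = u0 y;
  base_pos : forall y, 0 < y < 1 -> 0 < u0 y;
  base_0 : u0 0 = 0;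
  base_1 : u0 1 = 0;
  base_slope : u0^`() 0 = - u0^`() 1;
  base_slope_pos : 0 < u0^`() 0;
  base_d3 : ('N[@lebesgue_measure R]_(+oo)
    [(fun y : R => (u0^`(3) y / u0 y)%:E) \_ `]0%R, 1%R[] < +oo)%E
}.

Record cutoff (R : realType) (chi : R -> R) : Prop := Cutoff {
  cutoff_smooth : smooth chi;
  cutoff_ge0 : forall Y, 0 <= Y -> 0 <= chi Y;
  cutoff_1 : forall Y, 0 <= Y <= 1 -> chi Y = 1;
  cutoff_0 : forall Y, 2 <= Y -> chi Y = 0
}.

Definition cbrt (R : realType) (eps : R) : R := eps `^ 3^-1.

Definition ue0 (R : realType) (u0 : R -> R) (A eps y : R) : R :=
  u0 y + A * u0^`() 0 * cbrt eps.

Record euler_corrector (R : realType) (u0 : R -> R) (A eps : R) (ve1 : R -> R)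
    : Prop := EulerCorrector {
  ec_smooth : smooth ve1;
  ec_odd : forall y, 0 <= y <= 1 -> ve1 (1 - y) = - ve1 y;
  ec_ode : forall y, 0 < y < 1 ->
    - ue0 u0 A eps y * ve1^`(2) y + (ue0 u0 A eps)^`(2) y * ve1 y
      = (ue0 u0 A eps)^`(3) y;
  ec_0 : ve1 0 = 0;
  ec_1 : ve1 1 = 0
}.

Definition ue1 (R : realType) (ve1 : R -> R) (x y : R) : R := - x * ve1^`() y.

Definition slip_defect (R : realType) (A eps : R) (ve1 : R -> R) (x : R) : R :=
  ue1 ve1 x 0 - A * cbrt eps * dy (ue1 ve1) x 0.

Record layer_datum (R : realType) (N0 : nat) (C0 : R) (U0 : R -> R) : Prop :=
  LayerDatum {
  ld_derivable : forall (k : nat) Y, (k < N0)%N -> 0 < Y -> derivable (U0^`(k)) Y 1;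
  ld_bound : forall (k : nat) Y, (k <= N0)%N -> 0 < Y ->
    `|expR Y * U0^`(k) Y| <= C0
}.

(* The x-direction is the evolution direction of the layer equation.  W k is
   the value at x = 0 of the k-th x-derivative of U computed from U0 with the
   equation, Z k that of the k-th x-derivative of V; the equation for the former
   is integrated with Z decaying, and costs two Y-derivatives at each step.
   The condition of order k is the k-th x-derivative of the slip condition at
   the corner, imposed as long as the derivatives of U0 available allow. *)
Definition compatible (R : realType) (kappa A : R) (g : R -> R) (N0 : nat)
    (U0 : R -> R) :=
  exists W Z : nat -> R -> R,
  [/\ forall Y, 0 < Y -> W 0%N Y = U0 Y,
      forall k, ((2 * k).+1 < N0)%N ->
        W k Y - A * (W k)^`() Y @[Y --> 0^'+] --> - g^`(k) 0 &
      forall k, ((2 * k).+3 < N0)%N ->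
        [/\ forall Y, 0 < Y ->
              kappa * (A + Y) * W k.+1 Y + kappa * Z k.+1 Y = (W k)^`(2) Y,
            forall Y, 0 < Y ->
              derivable (Z k.+1) Y 1 /\ W k.+1 Y + (Z k.+1)^`() Y = 0,
            W k.+1 Y @[Y --> +oo] --> (0 : R) &
            Z k.+1 Y @[Y --> +oo] --> (0 : R)]].

Definition strip (R : realType) (L : R) : set (R * R) := `]0, L[ `*` `]0, +oo[.
Definition clstrip (R : realType) (L : R) : set (R * R) :=
  `[0, L] `*` `[0, +oo[.

Definition Ck_upto (R : realType) (k : nat) (S S' : set (R * R))
    (f : R -> R -> R) :=
  Ck k S f /\ forall w : seq bool, (size w <= k)%N ->
    extends_to S S' (fun z : R * R => pder w f z.1 z.2).

(* Three derivatives are those entering the Laplacian of the x-derivative of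
   the approximate solution. *)
Record layer_corrector (R : realType) (kappa A L : R) (g U0 : R -> R)
    (U V : R -> R -> R) : Prop := LayerCorrector {
  lc_regU : Ck_upto 3 (strip L) (clstrip L) U;
  lc_regV : Ck_upto 3 (strip L) (clstrip L) V;
  lc_eq : forall x Y, strip L (x, Y) ->
    kappa * (A + Y) * dx U x Y + kappa * V x Y - dy (dy U) x Y = 0;
  lc_div : forall x Y, strip L (x, Y) -> dx U x Y + dy V x Y = 0;
  lc_Uoo : forall x, 0 < x < L -> U x Y @[Y --> +oo] --> (0 : R);
  lc_Voo : forall x, 0 < x < L -> V x Y @[Y --> +oo] --> (0 : R);
  lc_slip : forall x, 0 < x < L ->
    trace (strip L) (fun z => U z.1 z.2 - A * dy U z.1 z.2) (x, 0) (- g x);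
  lc_init : forall Y, 0 < Y ->
    trace (strip L) (fun z => U z.1 z.2) (0, Y) (U0 Y)
}.

Definition layer_cut (R : realType) (eps : R) : R := eps `^ (- 3^-1) / 100.

Definition upm (R : realType) (chi : R -> R) (eps : R) (U V : R -> R -> R)
    (x Y : R) : R :=
  let N := layer_cut eps in
  chi (Y / N) * U x Y
  - N^-1 * chi^`() (Y / N) * (\int[@lebesgue_measure R]_(s in `[0, x]) V s Y).

Definition vpm (R : realType) (chi : R -> R) (eps : R) (V : R -> R -> R)
    (x Y : R) : R :=
  chi (Y / layer_cut eps) * V x Y.

Definition uapp (R : realType) (u0 chi : R -> R) (A eps : R) (ve1 : R -> R)
    (U V : R -> R -> R) (x y : R) : R :=
  ue0 u0 A eps y + eps * ue1 ve1 x y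
  + eps * (upm chi eps U V x (y / cbrt eps)
           + upm chi eps U V x ((1 - y) / cbrt eps)).

Definition vapp (R : realType) (chi : R -> R) (eps : R) (ve1 : R -> R)
    (V : R -> R -> R) (x y : R) : R :=
  eps * ve1 y
  + eps `^ (4 / 3) * (vpm chi eps V x (y / cbrt eps)
                      - vpm chi eps V x ((1 - y) / cbrt eps)).

Definition approximate_solution (R : realType) (u0 chi : R -> R) (A L C0 : R)
    (N0 : nat) (eps : R) (ua va : R -> R -> R) : Prop :=
  exists (ve1 U0 : R -> R) (U V : R -> R -> R),
    [/\ euler_corrector u0 A eps ve1,
        layer_datum N0 C0 U0,
        compatible (u0^`() 0) A (slip_defect A eps ve1) N0 U0,
        layer_corrector (u0^`() 0) A L (slip_defect A eps ve1) U0 U V &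
        ua = uapp u0 chi A eps ve1 U V /\ va = vapp chi eps ve1 V].

Record navier_stokes_slip (R : realType) (A L eps : R) (us vs : R -> R -> R)
    : Prop := NavierStokesSlip {
  ns_regu : Ck 3 (Omega L) us;
  ns_regv : Ck 3 (Omega L) vs;
  ns_momentum : exists2 ps : R -> R -> R, Ck 1 (Omega L) ps &
    forall x y, Omega L (x, y) ->
      us x y * dx us x y + vs x y * dy us x y + dx ps x y
        - eps * lap us x y = 0 /\
      us x y * dx vs x y + vs x y * dy vs x y + dy ps x y
        - eps * lap vs x y = 0;
  ns_div : forall x y, Omega L (x, y) -> dx us x y + dy vs x y = 0;
  ns_slip0 : forall x, 0 < x < L -> trace (Omega L)
    (fun z => us z.1 z.2 - A * cbrt eps * dy us z.1 z.2) (x, 0) 0;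
  ns_slip1 : forall x, 0 < x < L -> trace (Omega L)
    (fun z => us z.1 z.2 + A * cbrt eps * dy us z.1 z.2) (x, 1) 0;
  ns_v0 : forall x, 0 < x < L -> trace (Omega L) (fun z => vs z.1 z.2) (x, 0) 0;
  ns_v1 : forall x, 0 < x < L -> trace (Omega L) (fun z => vs z.1 z.2) (x, 1) 0;
  ns_even : forall x y, Omega L (x, y) -> us x (1 - y) = us x y;
  ns_odd : forall x y, Omega L (x, y) -> vs x (1 - y) = - vs x y
}.

Record steady_bounds (R : realType) (u0 : R -> R) (delta K L eps : R)
    (us vs ua va : R -> R -> R) : Prop := SteadyBounds {
  sb_u : forall x y, Omega L (x, y) ->
    0 < us x y - u0 y /\ us x y - u0 y <= K * eps `^ (1 / 3);
  sb_v : forall x y, Omega L (x, y) -> `|vs x y| <= K * eps;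
  sb_uy : forall x y, Omega L (x, y) ->
    `|dy us x y - u0^`() y| <= K * eps `^ (2 / 3);
  sb_x : forall x y, Omega L (x, y) ->
    `|dx us x y| + `|dx vs x y| <= K * eps `^ (1 - delta);
  sb_lap_ua : forall x y, Omega L (x, y) -> `|lap ua x y| <= K;
  sb_lapx_ua : forall x y, Omega L (x, y) ->
    `|lap (dx ua) x y| + `|lap ua x y - u0^`(2) y| <= K * eps `^ (1 / 3);
  sb_lap_va : forall x y, Omega L (x, y) ->
    `|lap va x y| + `|lap (dx va) x y| <= K * eps `^ (2 / 3);
  sb_rem : (LinfxL2y L (sqrt_wt u0 (lap (sub2 us ua)))
            + LinfxL2y L (sqrt_wt u0 (lap (sub2 vs va)))
            <= (K * eps `^ (5 / 6 - delta))%:E)%E;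
  sb_remx : (L2norm L (sqrt_wt u0 (lap (dx (sub2 us ua))))
             + L2norm L (sqrt_wt u0 (lap (dx (sub2 vs va))))
             <= (K * eps `^ (5 / 6 - delta))%:E)%E
}.

Definition steady_state (R : realType) (u0 chi : R -> R) (A delta K L C0 : R)
    (N0 : nat) (eps : R) (us vs : R -> R -> R) : Prop :=
  navier_stokes_slip A L eps us vs /\
  exists ua va : R -> R -> R,
    approximate_solution u0 chi A L C0 N0 eps ua va /\
    steady_bounds u0 delta K L eps us vs ua va.

Definition spacetime (R : realType) (S : set (R * R)) : set (R * (R * R)) :=
  `]0, +oo[ `*` S.

Definition spacetime0 (R : realType) (S : set (R * R)) : set (R * (R * R)) :=
  `[0, +oo[ `*` S.

Definition unc3 (R : realType) (f : R -> R -> R -> R) (q : R * (R * R)) : R :=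
  f q.1 q.2.1 q.2.2.

(* Strong solutions for positive times.  At a corner of the rectangle the
   equation and the boundary conditions on two sides are generically
   incompatible (C^4 regularity at (0,0) would force phi_xy = 0 there), so
   regularity up to the boundary is asked for the second derivatives only, for
   the third ones away from the corners, and replaced there by local in time
   square integrability. *)
Record strong_regularity (R : realType) (L : R) (phi : R -> R -> R -> R)
    : Prop := StrongRegularity {
  sr_x : forall t, 0 < t -> Ck 4 (Omega L) (phi t);
  sr_x_cont : forall w : seq bool, (size w <= 4)%N ->
    extends_to (spacetime (Omega L)) (spacetime (Omega L))
      (unc3 (fun t => pder w (phi t)));
  sr_x2_bd : forall w : seq bool, (size w <= 2)%N ->
    extends_to (spacetime (Omega L)) (spacetime (clOmega L))
      (unc3 (fun t => pder w (phi t)));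
  sr_x3_bd : forall w : seq bool, (size w <= 3)%N ->
    extends_to (spacetime (Omega L)) (spacetime (clOmega L `\` corners L))
      (unc3 (fun t => pder w (phi t)));
  sr_t : forall t x y, 0 < t -> Omega L (x, y) ->
    derivable (fun s => phi s x y) t 1;
  sr_tx : forall t, 0 < t -> Ck 2 (Omega L) (dt phi t);
  sr_tx_cont : forall w : seq bool, (size w <= 2)%N ->
    extends_to (spacetime (Omega L)) (spacetime (Omega L))
      (unc3 (fun t => pder w (dt phi t)));
  sr_L2 : forall tau T : R, 0 < tau -> tau < T ->
    (\int[@lebesgue_measure R]_(t in `]tau, T[)
       (L2norm L (grad_norm (lap (phi t))) ^+ 2
        + L2norm L (lap (dt phi t)) ^+ 2) < +oo)%E
}.

(* The initial value is attained pointwise and in the weighted norm of the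
   energy. *)
Record initial_value (R : realType) (u0 : R -> R) (L : R)
    (phi : R -> R -> R -> R) (phi0 : R -> R -> R) : Prop := InitialValue {
  iv_reg : Ck 2 (Omega L) phi0;
  iv_eq : forall x y, Omega L (x, y) -> phi 0 x y = phi0 x y;
  iv_cont : forall x y, Omega L (x, y) ->
    trace (spacetime0 (Omega L)) (unc3 phi) (0, (x, y)) (phi0 x y);
  iv_energy : L2norm L (sqrt_wt u0 (sub2 (lap (phi t)) (lap phi0)))
                @[t --> 0^'+] --> (0 : \bar R)%E
}.

Record boundary_conditions (R : realType) (A L eps : R)
    (phi : R -> R -> R -> R) : Prop := BoundaryConditions {
  bc_x0 : forall t y, 0 < t -> 0 < y < 1 ->
    trace (spacetime (Omega L)) (unc3 phi) (t, (0, y)) 0;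
  bc_xL : forall t y, 0 < t -> 0 < y < 1 ->
    trace (spacetime (Omega L)) (unc3 (fun t' => dx (phi t'))) (t, (L, y)) 0;
  bc_xx0 : forall t y, 0 < t -> 0 < y < 1 ->
    trace (spacetime (Omega L)) (unc3 (fun t' => dx (dx (phi t'))))
      (t, (0, y)) 0;
  bc_xxxL : forall t y, 0 < t -> 0 < y < 1 ->
    trace (spacetime (Omega L)) (unc3 (fun t' => dx (dx (dx (phi t')))))
      (t, (L, y)) 0;
  bc_slip0 : forall t x, 0 < t -> 0 < x < L ->
    trace (spacetime (Omega L)) (unc3 (fun t' x' y' =>
      dy (phi t') x' y' - A * cbrt eps * lap (phi t') x' y')) (t, (x, 0)) 0;
  bc_slip1 : forall t x, 0 < t -> 0 < x < L ->
    trace (spacetime (Omega L)) (unc3 (fun t' x' y' =>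
      dy (phi t') x' y' + A * cbrt eps * lap (phi t') x' y')) (t, (x, 1)) 0;
  bc_y0 : forall t x, 0 < t -> 0 < x < L ->
    trace (spacetime (Omega L)) (unc3 phi) (t, (x, 0)) 0;
  bc_y1 : forall t x, 0 < t -> 0 < x < L ->
    trace (spacetime (Omega L)) (unc3 phi) (t, (x, 1)) 0
}.

Definition linearized_equation (R : realType) (L eps : R)
    (us vs : R -> R -> R) (phi : R -> R -> R -> R) : Prop :=
  forall t x y, 0 < t -> Omega L (x, y) ->
    lap (dt phi t) x y
    + us x y * lap (dx (phi t)) x y - lap us x y * dx (phi t) x y
    + vs x y * lap (dy (phi t)) x y - lap vs x y * dy (phi t) x y
    - eps * lap (lap (phi t)) x y = 0.

Definition linearized_problem (R : realType) (u0 : R -> R) (A L eps : R)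
    (us vs : R -> R -> R) (phi : R -> R -> R -> R) (phi0 : R -> R -> R) :=
  [/\ strong_regularity L phi,
      linearized_equation L eps us vs phi,
      initial_value u0 L phi phi0 &
      boundary_conditions A L eps phi].

(* Main.v *)
From HB Require Import structures.
Require Import Defs.
From mathcomp Require Import measurable_realfun ring lra.

Set Implicit Arguments.
Unset Strict Implicit.
Unset Printing Implicit Defensive.

Local Open Scope ring_scope.
Local Open Scope classical_set_scope.

(** * One-variable calculus and the Schwarz inequality *)

Section one_variable.
Context {R : realType}.
Implicit Types (f g : R -> R) (x y a b l : R).

Lemma der_derive1 f x l : is_derive x 1 f l -> f^`()%classic x = l.
Proof. by move=> h; rewrite derive1E; exact: derive_val. Qed.

Lemma der_of_derivable f x : derivable f x 1 -> is_derive x 1 f (f^`()%classic x).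
Proof. by move=> h; rewrite derive1E; exact: derivableP. Qed.

Lemma der_cst (c : R) x : is_derive x 1 (fun=> c) 0.
Proof. exact: is_derive_cst. Qed.

Lemma der_id x : is_derive x 1 (fun y => y) 1.
Proof. exact: is_derive_id. Qed.

Lemma derD f g x l m : is_derive x 1 f l -> is_derive x 1 g m ->
  is_derive x 1 (fun y => f y + g y) (l + m).
Proof. by move=> *; exact: is_deriveD. Qed.

Lemma derN f x l : is_derive x 1 f l -> is_derive x 1 (fun y => - f y) (- l).
Proof. by move=> *; exact: is_deriveN. Qed.

Lemma derB f g x l m : is_derive x 1 f l -> is_derive x 1 g m ->
  is_derive x 1 (fun y => f y - g y) (l - m).
Proof. by move=> *; exact: is_deriveB. Qed.

Lemma derM f g x l m : is_derive x 1 f l -> is_derive x 1 g m ->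
  is_derive x 1 (fun y => f y * g y) (l * g x + f x * m).
Proof.
move=> hf hg; have h := @is_deriveM _ _ f g x 1 l m hf hg.
suff <- : f x *: m + g x *: l = l * g x + f x * m by exact h.
by rewrite /GRing.scale/= addrC [g x * l]mulrC.
Qed.

Lemma derX f n x l : is_derive x 1 f l ->
  is_derive x 1 (fun y => f y ^+ n.+1) (n.+1%:R * f x ^+ n * l).
Proof.
move=> hf; have h := @is_deriveX _ _ f n.+1 x 1 l hf.
suff E : (fun y => f y ^+ n.+1) = f ^+ n.+1 by rewrite E; exact h.
by apply/funext => y; rewrite fctE.
Qed.

Lemma derV f x l : f x != 0 -> is_derive x 1 f l ->
  is_derive x 1 (fun y => (f y)^-1) (- l / f x ^+ 2).
Proof.
move=> f0 hf; apply: DeriveDef; first by apply: derivableV => //; exact: ex_derive.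
rewrite deriveV// derive_val /GRing.scale/=.
by rewrite mulNr mulrC mulNr.
Qed.

Lemma der_comp f g x l m : is_derive x 1 f l -> is_derive (f x) 1 g m ->
  is_derive x 1 (fun y => g (f y)) (m * l).
Proof.
move=> hf hg; have df : derivable f x 1 by exact: ex_derive.
have dg : derivable g (f x) 1 by exact: ex_derive.
apply: DeriveDef.
  apply/derivable1_diffP; apply: differentiable_comp; exact/derivable1_diffP.
have := derive1_comp df dg; rewrite !derive1E.
by rewrite (@derive_val _ _ _ _ _ _ _ hf) (@derive_val _ _ _ _ _ _ _ hg) => <-.
Qed.

Lemma der_near_eq f g x l : (\forall y \near x, f y = g y) ->
  is_derive x 1 f l -> is_derive x 1 g l.
Proof. by move=> fg; apply: near_eq_is_derive => //; exact: oner_neq0. Qed.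

Lemma der_continuous f x l : is_derive x 1 f l -> {for x, continuous f}.
Proof.
move=> h; apply: differentiable_continuous; apply/derivable1_diffP.
exact: ex_derive.
Qed.

Lemma der_within f a b : (forall x, a <= x <= b -> exists l, is_derive x 1 f l) ->
  {within `[a, b], continuous f}.
Proof.
move=> h; apply: continuous_in_subspaceT => x; rewrite inE/= in_itv/= => xab.
by have [l /der_continuous] := h _ xab.
Qed.

Lemma mvt_any f df a b :
  (forall x, Num.min a b <= x <= Num.max a b -> is_derive x 1 f (df x)) ->
  exists2 c, Num.min a b <= c <= Num.max a b & f b - f a = df c * (b - a).
Proof.
have key u v : u <= v -> (forall x, u <= x <= v -> is_derive x 1 f (df x)) ->
    exists2 c, u <= c <= v & f v - f u = df c * (v - u).
  move=> uv h; have [||c + ->] := @MVT_segment R f df u v uv.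
  - by move=> x; rewrite in_itv/= => /andP[ax xb]; apply: h; rewrite !ltW.
  - by apply: der_within => x xab; exists (df x); exact: h.
  by rewrite in_itv/= => cuv; exists c.
case: (leP a b) => [ab|/ltW ba] h; first exact: key.
have [c cab E] := key _ _ ba h; exists c => //.
by rewrite -(opprB (f a)) E -mulrN opprB.
Qed.

Lemma EFin_ftc (F f : R -> R) a b : a <= b ->
  (forall x, a <= x <= b -> is_derive x 1 F (f x)) ->
  (forall x, a <= x <= b -> {for x, continuous f}) ->
  (\int[@lebesgue_measure R]_(x in `[a, b]) (f x)%:E = (F b - F a)%:E)%E.
Proof.
rewrite le_eqVlt => /predU1P[-> _ _|ab hF hf].
  by rewrite set_itv1 integral_set1 subrr.
rewrite (@continuous_FTC2 R f F)//.
- apply: continuous_in_subspaceT => x; rewrite inE/= in_itv/= => xab.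
  exact: hf.
- have c x : a <= x <= b -> {for x, continuous F}.
    by move=> /hF/der_continuous.
  split.
  + move=> x; rewrite in_itv/= => /andP[ax xb].
    have /hF h : a <= x <= b by rewrite !ltW.
    exact: ex_derive.
  + by apply: cvg_at_right_filter; apply: c; rewrite lexx ltW.
  + by apply: cvg_at_left_filter; apply: c; rewrite lexx ltW.
- move=> x; rewrite in_itv/= => /andP[ax xb].
  by apply: der_derive1; apply: hF; rewrite !ltW.
Qed.

Lemma ftc (F f : R -> R) a b : a <= b ->
  (forall x, a <= x <= b -> is_derive x 1 F (f x)) ->
  (forall x, a <= x <= b -> {for x, continuous f}) ->
  \int[@lebesgue_measure R]_(x in `[a, b]) f x = F b - F a.
Proof. by move=> ab hF hf; rewrite /Rintegral (EFin_ftc ab hF hf). Qed.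

End one_variable.

Section schwarz.
Context {R : realType}.

(** Peano's form of the symmetry of second derivatives. *)
Lemma schwarz (f f1 f2 f21 : R -> R -> R) (a b : R) :
  nbhs (a, b) [set z : R * R | is_derive z.1 1 (fun s => f s z.2) (f1 z.1 z.2)] ->
  nbhs a [set s : R | is_derive b 1 (f s) (f2 s b)] ->
  nbhs (a, b) [set z : R * R | is_derive z.2 1 (f1 z.1) (f21 z.1 z.2)] ->
  {for (a, b), continuous (fun z : R * R => f21 z.1 z.2)} ->
  is_derive a 1 (fun s => f2 s b) (f21 a b).
Proof.
move=> h1 h2 h21 c21.
suff H : h^-1 *: (((fun s => f2 s b) \o shift a) (h *: (1 : R)) - f2 a b)
    @[h --> 0^'] --> f21 a b.
  by apply: DeriveDef; [apply/cvg_ex; exists (f21 a b)|apply: cvg_lim].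
apply/cvgrPdist_le => e e0.
have /cvgrPdist_lt/(_ _ e0) {}c21 := c21.
have : nbhs (a, b) [set z : R * R | [/\ is_derive z.1 1 (fun s => f s z.2) (f1 z.1 z.2),
    is_derive z.2 1 (f1 z.1) (f21 z.1 z.2) & `|f21 a b - f21 z.1 z.2| < e]].
  by near=> z; split; near: z.
move=> -[/= [U V] /= [/nbhs_ballP[r r0 rU] /nbhs_ballP[s s0 sV]] UV].
have UVb x y : `|a - x| < r -> `|b - y| < s ->
    [/\ is_derive x 1 (fun s => f s y) (f1 x y),
    is_derive y 1 (f1 x) (f21 x y) & `|f21 a b - f21 x y| < e].
  by move=> xr ys; apply: (UV (x, y)); split => /=; [exact: rU|exact: sV].
have h2' : \forall h \near (0:R), is_derive b 1 (f (h + a)) (f2 (h + a) b).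
  have : (h + a) @[h --> (0:R)] --> a.
    rewrite -{2}[a]add0r; apply: cvgD; [exact: cvg_id|exact: cvg_cst].
  by move=> /(_ _ h2).
near=> h.
have h0 : h != 0 by near: h; exact: nbhs_dnbhs_neq.
have hr : `|h| < r.
  near: h; apply/dnbhs0_lt => //.
have dfh : is_derive b 1 (f (h + a)) (f2 (h + a) b).
  by near: h; apply: nbhs_dnbhs.
have dfa : is_derive b 1 (f a) (f2 a b) by apply: nbhs_singleton h2.
rewrite /= /GRing.scale/= mulr1.
(* second differences divided by h, then let the second increment tend to 0 *)
pose q k := (f (h + a) (k + b) - f a (k + b) - (f (h + a) b - f a b)) / k.
have qc : q k @[k --> 0^'] --> f2 (h + a) b - f2 a b.
  have := derB dfh dfa => dd.
  have := @ex_derive _ _ _ _ _ _ _ dd; rewrite /derivable => /cvg_ex[l hl].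
  have -> : f2 (h + a) b - f2 a b = l.
    by rewrite -(@derive_val _ _ _ _ _ _ _ dd); apply: cvg_lim.
  apply: cvg_trans hl; apply: near_eq_cvg; near=> k.
  by rewrite /q /= /GRing.scale/= mulr1 mulrC.
have qb : \forall k \near 0^', `|h * f21 a b - q k| <= e * `|h|.
  near=> k.
  have k0 : k != 0 by near: k; exact: nbhs_dnbhs_neq.
  have ks : `|k| < s by near: k; apply/dnbhs0_lt.
  have btw x : Num.min a (h + a) <= x <= Num.max a (h + a) -> `|a - x| < r.
    move: hr; rewrite !ltr_norml; case: (leP a (h + a)) => ? /andP[? ?] /andP[? ?];
    apply/andP; split; lra.
  have [x xh E1] := @mvt_any R (fun x => f x (k + b) - f x b)
    (fun x => f1 x (k + b) - f1 x b) a (h + a) (fun x hx => ltac:(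
      apply: derB; [have [] // := UVb x (k + b) (btw _ hx) ltac:(by rewrite opprD addrC subrK normrN)
       | have [] // := UVb x b (btw _ hx) ltac:(by rewrite subrr normr0)])).
  have btwy y : Num.min b (k + b) <= y <= Num.max b (k + b) -> `|b - y| < s.
    move: ks; rewrite !ltr_norml; case: (leP b (k + b)) => ? /andP[? ?] /andP[? ?];
    apply/andP; split; lra.
  have [y yk E2] := @mvt_any R (f1 x) (f21 x) b (k + b) (fun y hy => ltac:(
     have [] // := UVb x y (btw _ xh) (btwy _ hy))).
  have [_ _ lte] := UVb x y (btw _ xh) (btwy _ yk).
  have -> : q k = h * f21 x y.
    rewrite /q (_ : _ - _ = f (h + a) (k + b) - f (h + a) b - (f a (k + b) - f a b)); last by ring.
    by rewrite E1 E2 !addrK mulrAC mulfK// mulrC.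
  by rewrite -mulrBr normrM mulrC ler_wpM2r// ltW.
have : `|h * f21 a b - (f2 (h + a) b - f2 a b)| <= e * `|h|.
  have cc : `|h * f21 a b - q k| @[k --> 0^'] -->
      `|h * f21 a b - (f2 (h + a) b - f2 a b)|.
    by apply: cvg_norm; apply: cvgB => //; exact: cvg_cst.
  rewrite -(cvg_lim _ cc)//; apply: limr_le => //.
  by apply/cvg_ex; eexists; exact: cc.
have -> : f21 a b - h^-1 * (f2 (h + a) b - f2 a b) =
   h^-1 * (h * f21 a b - (f2 (h + a) b - f2 a b)).
  by rewrite [RHS]mulrBr mulKf.
rewrite normrM normfV => H; rewrite mulrC ler_pdivrMr// normr_gt0//.
Unshelve. all: end_near. Qed.

End schwarz.

(** * Measurability, Tonelli and Fubini theorems, exhaustion *)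

Section measurability.
Context {R : realType}.

Lemma rat_itv_around (x e : R) : 0 < e ->
  exists p q : rat, x - e < ratr p < x /\ x < ratr q < x + e.
Proof.
move=> e0.
have [|p] := @rat_in_itvoo _ (x - e) x; first by lra.
have [|q] := @rat_in_itvoo _ x (x + e); first by lra.
rewrite !in_itv/= => ? ?; by exists p, q.
Qed.

Lemma open_measurable3 (U : set (R * (R * R))) : open U -> measurable U.
Proof.
move=> oU.
pose box (i : (rat * rat) * ((rat * rat) * (rat * rat))) : set (R * (R * R)) :=
  `]ratr i.1.1, ratr i.1.2[ `*` (`]ratr i.2.1.1, ratr i.2.1.2[
    `*` `]ratr i.2.2.1, ratr i.2.2.2[).
have -> : U = \bigcup_(i in [set i | box i `<=` U]) box i.
  apply/seteqP; split; last by move=> z [i /= iU /iU].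
  move=> [t [x y]] Uz; have : nbhs (t, (x, y)) U by move: oU; rewrite openE; apply.
  move=> [[/= P Q] /= [nP [[/= P' Q'] /= [nP' nQ'] PQ']] PQ].
  move: nP nP' nQ' => /nbhs_ballP[r/= r0 rP] /nbhs_ballP[r'/= r'0 rP'] /nbhs_ballP[s/= s0 sQ'].
  have [p1 [p2 [/andP[? ?] /andP[? ?]]]] := rat_itv_around t r0.
  have [q1 [q2 [/andP[? ?] /andP[? ?]]]] := rat_itv_around x r'0.
  have [m1 [m2 [/andP[? ?] /andP[? ?]]]] := rat_itv_around y s0.
  exists ((p1, p2), ((q1, q2), (m1, m2))); last first.
    by rewrite /box/=; split; [|split]; rewrite /= in_itv/=; apply/andP; split.
  move=> [t' [x' y']] [/= + [/= + +]]; rewrite !in_itv/= => /andP[? ?] /andP[? ?] /andP[? ?].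
  apply: (PQ (t', (x', y'))); split => /=.
    by apply: rP; rewrite /ball/= ltr_norml; apply/andP; split; lra.
  apply: (PQ' (x', y')); split => /=.
    by apply: rP'; rewrite /ball/= ltr_norml; apply/andP; split; lra.
  by apply: sQ'; rewrite /ball/= ltr_norml; apply/andP; split; lra.
rewrite bigcup_mkcond; apply: countable_bigcupT_measurable => // i.
case: ifPn => // _.
by apply: measurableX => //; exact: measurableX.
Qed.

Lemma open_measurable2 (U : set (R * R)) : open U -> measurable U.
Proof.
move=> oU; have oV : open ([set: R] `*` U).
  rewrite openE => -[t z] [_ /= Uz]; exists (setT, U) => [|[? ?] //=]; split => /=.
    exact: filterT.
  by move: oU; rewrite openE; apply.
have := pair1_measurable (0 : R) measurableT (open_measurable3 oV).
rewrite setTI; congr (measurable _); apply/seteqP; split => z /=; first by case.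
by move=> Uz; split.
Qed.

Lemma measurable_fun_of_open d (T : measurableType d) (S : set T) (f : T -> R) :
  (forall V : set R, open V -> measurable (S `&` f @^-1` V)) -> measurable_fun S f.
Proof.
move=> h mS; apply: (measurability _ (RGenOpens.measurableE R)) mS => _ [_ [a [b ->]] <-].
exact/h/interval_open.
Qed.

Lemma open_preimage (T : topologicalType) (S : set T) (f : T -> R) (V : set R) :
  open S -> (forall z, S z -> {for z, continuous f}) -> open V ->
  open (S `&` f @^-1` V).
Proof.
rewrite !openE => oS cf oV z [Sz Vfz]; apply: filterI; first exact: oS.
by apply: cf => //; exact: oV.
Qed.

Lemma continuous_measurable3 (S : set (R * (R * R))) (f : R * (R * R) -> R) :
  open S -> (forall z, S z -> {for z, continuous f}) -> measurable_fun S f.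
Proof.
move=> oS cf; apply: measurable_fun_of_open => V oV.
by apply: open_measurable3; exact: open_preimage.
Qed.

Lemma continuous_measurable2 (S : set (R * R)) (f : R * R -> R) :
  open S -> (forall z, S z -> {for z, continuous f}) -> measurable_fun S f.
Proof.
move=> oS cf; apply: measurable_fun_of_open => V oV.
by apply: open_measurable2; exact: open_preimage.
Qed.

End measurability.

Section integration.
Context {R : realType}.
Local Open Scope ereal_scope.

Import HBNNSimple.

(** The comparison of integrals does not need the larger function measurable:
  the integral is a supremum over simple minorants. *)
Lemma ge0_le_integral_nonmeas d (T : measurableType d)
    (mu : {measure set T -> \bar R}) (D : set T) (f g : T -> \bar R) :
  (forall x, D x -> 0 <= f x) -> (forall x, D x -> f x <= g x) ->
  \int[mu]_(x in D) f x <= \int[mu]_(x in D) g x.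
Proof.
move=> f0 fg; rewrite !(integral_mkcond D).
have f0' x : 0 <= (f \_ D) x by exact: erestrict_ge0.
have g0' x : 0 <= (g \_ D) x.
  by apply: erestrict_ge0 => y Dy; apply: le_trans (fg _ Dy); exact: f0.
rewrite !ge0_integralTE//; apply: ereal_sup_le => _ [h /= hf <-].
exists h => //= x.
by apply: le_trans (hf x) _; rewrite /patch; case: ifPn => // /set_mem; exact: fg.
Qed.

Lemma bounded_integrable d (T : measurableType d) (mu : {measure set T -> \bar R})
    (D : set T) (f : T -> R) (M : R) :
  measurable D -> mu D < +oo -> measurable_fun D f ->
  (forall x, D x -> (`|f x| <= M)%R) -> mu.-integrable D (EFin \o f).
Proof.
move=> mD muD mf fM; apply: measurable_bounded_integrable => //.
exists M; split; first exact: num_real.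
by move=> N MN x Dx; apply: le_trans (fM _ Dx) (ltW MN).
Qed.

Lemma le_integral_of_exhaustion d (T : measurableType d)
    (mu : {measure set T -> \bar R}) (E : (set T)^nat) (D : set T)
    (f : T -> \bar R) (X : \bar R) :
  nondecreasing_seq E -> (forall n, measurable (E n)) -> \bigcup_n E n = D ->
  measurable_fun D f -> (forall x, D x -> 0 <= f x) ->
  (forall n, \int[mu]_(x in E n) f x <= X) -> \int[mu]_(x in D) f x <= X.
Proof.
move=> ndE mE ED mf f0 fX; rewrite -ED.
have ED' n : E n `<=` D by rewrite -ED; exact: bigcup_sup.
have := @ge0_nondecreasing_set_cvg_integral _ _ _ E f mu ndE mE.
have mD : measurable D by rewrite -ED; exact: bigcupT_measurable.
have h1 : forall i, measurable_fun (E i) f.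
  by move=> n; exact: measurable_funS mf.
have h2 : forall i x, E i x -> 0 <= f x by move=> n x /ED'; exact: f0.
move=> /(_ h1 h2) => cv.
rewrite -(cvg_lim _ cv)//; apply: lime_le; first by apply/cvg_ex; eexists; exact: cv.
exact: nearW.
Qed.

Section rectangles.
Context d1 d2 (T1 : measurableType d1) (T2 : measurableType d2).
Variables (m1 : {sigma_finite_measure set T1 -> \bar R}).
Variables (m2 : {sigma_finite_measure set T2 -> \bar R}).
Variables (K1 : set T1) (K2 : set T2).
Hypotheses (mK1 : measurable K1) (mK2 : measurable K2).

Let restrictX (f : T1 * T2 -> \bar R) x y :
  (f \_ (K1 `*` K2)) (x, y) = if x \in K1 then ((fun y => f (x, y)) \_ K2) y else 0.
Proof. by rewrite !patchE in_setX; case: (x \in K1); case: (y \in K2). Qed.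

Let restrictX' (f : T1 * T2 -> \bar R) x y :
  (f \_ (K1 `*` K2)) (x, y) = if y \in K2 then ((fun x => f (x, y)) \_ K1) x else 0.
Proof. by rewrite !patchE in_setX; case: (x \in K1); case: (y \in K2). Qed.

Let innerE (f : T1 * T2 -> \bar R) x :
  \int[m2]_y (f \_ (K1 `*` K2)) (x, y) =
  ((fun x => \int[m2]_(y in K2) f (x, y)) \_ K1) x.
Proof.
under eq_integral do rewrite restrictX.
by rewrite patchE; case: ifPn => _; [rewrite [RHS]integral_mkcond|rewrite integral0].
Qed.

Let innerE' (f : T1 * T2 -> \bar R) y :
  \int[m1]_x (f \_ (K1 `*` K2)) (x, y) =
  ((fun y => \int[m1]_(x in K1) f (x, y)) \_ K2) y.
Proof.
under eq_integral do rewrite restrictX'.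
by rewrite patchE; case: ifPn => _; [rewrite [RHS]integral_mkcond|rewrite integral0].
Qed.

Section nonnegative.
Variable f : T1 * T2 -> \bar R.
Hypothesis mf : measurable_fun (K1 `*` K2) f.
Hypothesis f0 : forall z, (K1 `*` K2) z -> 0 <= f z.

Let mK : measurable (K1 `*` K2). Proof. exact: measurableX. Qed.
Let mf' : measurable_fun setT (f \_ (K1 `*` K2)).
Proof. exact/(measurable_restrictT _ mK). Qed.
Let f0' z : 0 <= (f \_ (K1 `*` K2)) z. Proof. exact: erestrict_ge0. Qed.

Lemma tonelli_setX : \int[m1 \x m2]_(z in K1 `*` K2) f z =
  \int[m1]_(x in K1) \int[m2]_(y in K2) f (x, y).
Proof.
rewrite [LHS]integral_mkcond fubini_tonelli1// [RHS]integral_mkcond.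
by apply: eq_integral => x _; exact: innerE.
Qed.

Lemma tonelli_setX_swap : \int[m1 \x m2]_(z in K1 `*` K2) f z =
  \int[m2]_(y in K2) \int[m1]_(x in K1) f (x, y).
Proof.
rewrite [LHS]integral_mkcond fubini_tonelli2// [RHS]integral_mkcond.
by apply: eq_integral => x _; exact: innerE'.
Qed.

Lemma measurable_tonelli_setX :
  measurable_fun K1 (fun x => \int[m2]_(y in K2) f (x, y)).
Proof.
apply/(measurable_restrictT _ mK1).
have := measurable_fun_fubini_tonelli_F (m2 := m2) _ mf' f0'.
by apply: eq_measurable_fun => x _; exact: innerE.
Qed.

End nonnegative.

Section signed.
Variables (f : T1 * T2 -> R).
Hypothesis intf : (m1 \x m2).-integrable (K1 `*` K2) (EFin \o f).

Let mK : measurable (K1 `*` K2). Proof. exact: measurableX. Qed.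
Let ff : T1 * T2 -> \bar R := (EFin \o f) \_ (K1 `*` K2).
Let intff : (m1 \x m2).-integrable setT ff.
Proof. exact/(integrable_mkcond _ mK). Qed.

Lemma EFin_fubini_setX : \int[m1 \x m2]_(z in K1 `*` K2) (f z)%:E =
  \int[m1]_(x in K1) \int[m2]_(y in K2) (f (x, y))%:E.
Proof.
rewrite [LHS]integral_mkcond [RHS]integral_mkcond.
rewrite -[LHS](integral12_prod_meas1 intff).
by apply: eq_integral => x _; exact: innerE.
Qed.

Lemma EFin_fubini_setX_swap : \int[m1 \x m2]_(z in K1 `*` K2) (f z)%:E =
  \int[m2]_(y in K2) \int[m1]_(x in K1) (f (x, y))%:E.
Proof.
rewrite [LHS]integral_mkcond [RHS]integral_mkcond.
rewrite -[LHS](integral21_prod_meas1 intff).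
by apply: eq_integral => x _; exact: innerE'.
Qed.

Lemma integrable_fubini_setX :
  m1.-integrable K1 (fun x => \int[m2]_(y in K2) (f (x, y))%:E).
Proof.
apply/(integrable_mkcond _ mK1).
have := integrable_fubini_F intff.
by apply: eq_integrable => // x _; exact: innerE.
Qed.

End signed.
End rectangles.
End integration.

(** * Boundedness and uniform decay read off from boundary traces *)

Section traces.
Context {R : realType}.

Definition bounded_on (T : Type) (S : set T) (f : T -> R) :=
  exists M : R, forall z, S z -> `|f z| <= M.

(** The function f tends to 0, uniformly on S, where the function dist tends
  to 0. *)
Definition vanishes (T : Type) (S : set T) (dist f : T -> R) :=
  forall eta : R, 0 < eta ->
  exists2 rho : R, 0 < rho & forall z, S z -> dist z < rho -> `|f z| <= eta.

Lemma bounded_onD T (S : set T) f g : bounded_on S f -> bounded_on S g ->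
  bounded_on S (fun z => f z + g z).
Proof.
move=> [M hM] [N hN]; exists (M + N) => z Sz.
by apply: le_trans (ler_normD _ _) _; rewrite lerD ?hM ?hN.
Qed.

Lemma bounded_onN T (S : set T) f : bounded_on S f -> bounded_on S (fun z => - f z).
Proof. by move=> [M hM]; exists M => z /hM; rewrite normrN. Qed.

Lemma bounded_onM T (S : set T) f g : bounded_on S f -> bounded_on S g ->
  bounded_on S (fun z => f z * g z).
Proof.
move=> [M hM] [N hN]; exists (M * N) => z Sz.
by rewrite normrM ler_pM ?hM ?hN.
Qed.

Lemma bounded_on_cst T (S : set T) (k : R) : bounded_on S (fun=> k).
Proof. by exists `|k|. Qed.

Lemma bounded_onS T (S S' : set T) f : S' `<=` S -> bounded_on S f -> bounded_on S' f.
Proof. by move=> SS [M hM]; exists M => z /SS; exact: hM. Qed.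

Lemma bounded_on_comp T U (S : set T) (S' : set U) (k : U -> T) f :
  (forall z, S' z -> S (k z)) -> bounded_on S f -> bounded_on S' (f \o k).
Proof. by move=> kS [M hM]; exists M => z /kS; exact: hM. Qed.

Lemma vanishesD T (S : set T) dist f g : vanishes S dist f -> vanishes S dist g ->
  vanishes S dist (fun z => f z + g z).
Proof.
move=> vf vg eta eta0.
have [r r0 hr] := vf (eta / 2) ltac:(by rewrite divr_gt0).
have [s s0 hs] := vg (eta / 2) ltac:(by rewrite divr_gt0).
exists (Num.min r s) => [|z Sz]; first by rewrite lt_min r0.
rewrite lt_min => /andP[zr zs]; rewrite (splitr eta).
by apply: le_trans (ler_normD _ _) _; rewrite lerD ?hr ?hs.
Qed.

Lemma vanishesN T (S : set T) dist f : vanishes S dist f ->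
  vanishes S dist (fun z => - f z).
Proof.
move=> vf eta /vf[r r0 h]; exists r => // z Sz zr.
by rewrite normrN; exact: h.
Qed.

Lemma vanishesMr T (S : set T) dist f g : vanishes S dist f -> bounded_on S g ->
  vanishes S dist (fun z => f z * g z).
Proof.
move=> vf [M hM] eta eta0; have M0 : 0 < `|M| + 1 by rewrite ltr_wpDl.
have [r r0 hr] := vf (eta / (`|M| + 1)) ltac:(by rewrite divr_gt0).
exists r => // z Sz zr; rewrite normrM -(divfK (lt0r_neq0 M0) eta).
by rewrite ler_pM ?hr// (le_trans (hM _ Sz))// (le_trans (ler_norm _))// lerDl.
Qed.

Lemma vanishesMl T (S : set T) dist f g : vanishes S dist f -> bounded_on S g ->
  vanishes S dist (fun z => g z * f z).
Proof.
move=> vf bg eta eta0; have [r r0 h] := vanishesMr vf bg eta0.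
by exists r => // z Sz zr; rewrite mulrC h.
Qed.

Lemma vanishes_comp T U (S : set T) (S' : set U) (k : U -> T) dist f :
  (forall z, S' z -> S (k z)) -> vanishes S dist f ->
  vanishes S' (dist \o k) (f \o k).
Proof.
move=> kS v eta /v[r r0 h]; exists r => // z /kS Sz zr; exact: h.
Qed.

Lemma bounded_on_compact (T : topologicalType) (S C : set T) (f : T -> R) :
  compact C -> extends_to S C f -> bounded_on (S `&` C) f.
Proof.
move=> /compact_near_coveringP cC ext.
have := cC R (+oo : set_system R) (fun M z => S z -> `|f z| <= M) _.
case=> [z Cz|M [_ hM]].
  have [l /cvgrPdist_lt/(_ 1 ltr01) nl] := ext _ Cz.
  exists ([set z' | S z' -> `|l - f z'| < 1], [set M | `|l| + 1 <= M]).
    by split => //=; apply: nbhs_pinfty_ge; exact: num_real.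
  move=> [z' M]/= [hz hM] /hz lz; apply: le_trans hM.
  rewrite -lerBlDl; apply: le_trans (ltW lz).
  by rewrite distrC; exact: lerB_dist.
exists (M + 1) => z [Sz Cz]; apply: (hM (M + 1)) => //=.
by rewrite ltrDl.
Qed.

Lemma bounded_on_continuous (T : topologicalType) (C : set T) (f : T -> R) :
  compact C -> (forall z, C z -> {for z, continuous f}) -> bounded_on C f.
Proof.
move=> cC cf.
have -> : C = [set: T] `&` C by rewrite setTI.
apply: bounded_on_compact => // z Cz; exists (f z).
by apply: cvg_within_filter; exact: cf.
Qed.

Lemma vanishes_of_trace (T : topologicalType) (S C : set T) (dist f : T -> R) :
  compact C -> continuous dist -> (forall z, C z -> dist z <= 0 -> trace S f z 0) ->
  vanishes (S `&` C) dist f.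
Proof.
move=> /compact_near_coveringP cC cd tr eta eta0.
have := cC R (0^'+) (fun rho z => S z -> dist z < rho -> `|f z| <= eta) _.
case=> [z Cz|rho /= rho0 hr].
  have [d0|d0] := ltP 0 (dist z).
    have h : \forall z' \near z, dist z / 2 < dist z'.
      by move/(_ z)/cvgrPdist_lt: cd => /(_ (dist z / 2) ltac:(by rewrite divr_gt0));
        apply: filterS => y; rewrite ltr_norml => /andP[? ?]; lra.
    exists ([set z' | dist z / 2 < dist z'], [set rho | rho < dist z / 2]).
      by split => //=; apply: nbhs_right_lt; rewrite divr_gt0.
    by move=> [z' r]/= [h1 h2] _ /lt_trans/(_ h2); rewrite ltNge (ltW h1).
  have /cvgrPdist_lt/(_ _ eta0) h := tr _ Cz d0.
  exists ([set z' | S z' -> `|0 - f z'| < eta], setT).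
    by split => //=; exact: filterT.
  by move=> [z' r]/= [+ _] Sz _ => /(_ Sz); rewrite sub0r normrN => /ltW.
exists (rho / 2); first by rewrite divr_gt0.
move=> z [Sz Cz]; apply: hr => //=; last by rewrite divr_gt0.
by rewrite sub0r normrN gtr0_norm ?divr_gt0// ltr_pdivrMr// ltr_pMr// ltr1n.
Qed.

(** A trace that vanishes on a part of the boundary also vanishes at its limit
  points: this covers the corners of the rectangle. *)
Lemma trace_limit_point (T : topologicalType) (S Z : set T) (f : T -> R) (p : T) :
  (forall z, Z z -> closure S z /\ trace S f z 0) -> closure Z p ->
  (exists l : R, trace S f p l) -> trace S f p 0.
Proof.
move=> trZ Zp [l lp]; suff -> : 0 = l by [].
apply/eqP; rewrite eq_sym -normr_le0; apply/ler_addgt0Pr => e e0.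
have e20 : 0 < e / 2 by rewrite divr_gt0.
rewrite add0r.
have /cvgrPdist_lt/(_ _ e20) h := lp.
move: h; rewrite /within/= nbhsE => -[U [oU Up] hU].
have [z [Zz Uz]] := Zp _ (open_nbhs_nbhs (conj oU Up)).
have [Sz /cvgrPdist_lt/(_ _ e20) h] := trZ _ Zz.
have [q [Sq [Uq hq]]] := Sz _ (filterI (open_nbhs_nbhs (conj oU Uz)) h).
have := hq Sq; have := hU _ Uq Sq; rewrite /= sub0r normrN => h1 h2.
rewrite (splitr e) -[l](subrK (f q)); apply: le_trans (ler_normD _ _) _.
by rewrite lerD// ltW.
Qed.

(** The tangential derivative of a function with vanishing trace has vanishing
  trace. The map E parametrises the vicinity of a side by the tangential
  coordinate s and the normal coordinate r, the latter running along F. *)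
Lemma tangential_trace (T : topologicalType) (E : R -> R -> T) (F : set_system R)
    (S : set T) (f f' : T -> R) (p : R -> T) (H s l : R) :
  ProperFilter F ->
  (forall s, 0 < s < H -> \forall r \near F, S (E s r)) ->
  (forall s, 0 < s < H -> E z.1 z.2 @[z --> (nbhs s, F)] --> p s) ->
  (forall s r, S (E s r) -> is_derive s 1 (fun s => f (E s r)) (f' (E s r))) ->
  (forall s r, 0 < s < H -> (exists s', 0 < s' < H /\ S (E s' r)) -> S (E s r)) ->
  (forall s, 0 < s < H -> trace S f (p s) 0) ->
  0 < s < H -> trace S f' (p s) l -> l = 0.
Proof.
move=> FF SE Ep df SEE tr sH tl.
apply/eqP; rewrite -normr_le0; apply/ler_addgt0Pr => e e0; rewrite add0r.
have /cvgrPdist_le/(_ _ e0) h := tl.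
have [[/= U V] [/nbhs_ballP[d /= d0 dU] FV] UV] := Ep _ sH _ h.
have [h0 h00 /andP[hd hH]] : exists2 h0, 0 < h0 & (h0 < d) && (s + h0 < H).
  exists (Num.min d (H - s) / 2).
    by rewrite divr_gt0// lt_min d0/= subr_gt0; case/andP: sH.
  have m0 : 0 < Num.min d (H - s).
    by rewrite lt_min d0/= subr_gt0; case/andP: sH.
  have : Num.min d (H - s) <= d by rewrite ge_min lexx.
  have : Num.min d (H - s) <= H - s by rewrite ge_min lexx orbT.
  by move: m0; set m := Num.min _ _ => ? ? ?; apply/andP; split; lra.
have shH : 0 < s + h0 < H by move: sH => /andP[? ?]; apply/andP; split; lra.
have cv s' : 0 < s' < H -> f (E s' r) @[r --> F] --> (0 : R).
  move=> s'H; have := tr _ s'H; apply: cvg_comp.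
  move=> A /= hA; have := Ep _ s'H _ hA; move=> [[/= P Q] [Ps FQ] PQ].
  near=> r; apply: (PQ (s', r)); last by near: r; exact: SE.
  split; first exact: nbhs_singleton.
  by near: r.
have key : \forall r \near F, `|h0 * l - (f (E (s + h0) r) - f (E s r))| <= e * h0.
  near=> r.
  have Ss : S (E s r) by near: r; exact: SE.
  have [c + Ec] := @mvt_any R (fun s => f (E s r)) (fun s => f' (E s r)) s (s + h0)
    (fun x hx => ltac:(apply: df; apply: (SEE); [
      move: (hx) (sH) (shH); case: (leP s (s + h0)) => ? /andP[? ?] /andP[? ?] /andP[? ?];
      apply/andP; split; lra | by exists s])).
  rewrite min_l ?lerDl ?(ltW h00)// max_r ?lerDl ?(ltW h00)// => /andP[sc ch].
  rewrite Ec addrAC subrr add0r mulrC -mulrBl normrM (gtr0_norm h00).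
  rewrite ler_wpM2r ?(ltW h00)//.
  have hc : `|l - f' (E c r)| <= e.
    apply: (UV (c, r)); last first.
      apply: SEE; last by exists s.
      by move: (sH) (shH) => /andP[? ?] /andP[? ?] /=; apply/andP; split; lra.
    split => /=; last by near: r.
    by apply: dU; rewrite /ball/= distrC ger0_norm ?subr_ge0//; lra.
  exact: hc.
have : `|h0 * l - (0 - 0)| <= e * h0.
  have cc : `|h0 * l - (f (E (s + h0) r) - f (E s r))| @[r --> F] -->
      `|h0 * l - (0 - 0)|.
    by apply: cvg_norm; apply: cvgB; [exact: cvg_cst|apply: cvgB; exact: cv].
  rewrite -(cvg_lim _ cc)//; apply: limr_le => //.
  by apply/cvg_ex; eexists; exact: cc.
by rewrite !subr0 normrM (gtr0_norm h00) mulrC ler_pM2r.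
Unshelve. all: end_near. Qed.

End traces.

(** * Boxes and the divergence inequality *)

Notation leb R := (@lebesgue_measure R).
Notation leb2 R := (@lebesgue_measure R \x @lebesgue_measure R)%E.

Definition box (R : realType) (a b c d : R) : set (R * R) := `[a, b] `*` `[c, d].

Definition cont_on (R : realType) (S : set (R * R)) (f : R -> R -> R) :=
  forall z, S z -> {for z, continuous (fun z : R * R => f z.1 z.2)}.

Section continuity_on_sets.
Context {R : realType}.
Variable S : set (R * R).
Implicit Types f g : R -> R -> R.

Lemma cont_onD f g : cont_on S f -> cont_on S g ->
  cont_on S (fun x y => f x y + g x y).
Proof. by move=> cf cg z Sz; apply: cvgD; [exact: cf|exact: cg]. Qed.

Lemma cont_onN f : cont_on S f -> cont_on S (fun x y => - f x y).
Proof. by move=> cf z Sz; apply: cvgN; exact: cf. Qed.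

Lemma cont_onM f g : cont_on S f -> cont_on S g ->
  cont_on S (fun x y => f x y * g x y).
Proof. by move=> cf cg z Sz; apply: cvgM; [exact: cf|exact: cg]. Qed.

Lemma cont_onB f g : cont_on S f -> cont_on S g ->
  cont_on S (fun x y => f x y - g x y).
Proof. by move=> cf cg; apply: cont_onD => //; exact: cont_onN. Qed.

Lemma cont_onX f n : cont_on S f -> cont_on S (fun x y => f x y ^+ n).
Proof.
move=> cf z Sz; apply: (@continuous_comp _ _ _ (fun z : R * R => f z.1 z.2) (fun u => u ^+ n)).
  exact: cf.
exact: exprn_continuous.
Qed.

Lemma cont_on_norm f : cont_on S f -> cont_on S (fun x y => `|f x y|).
Proof. by move=> cf z Sz; apply: cvg_norm; exact: cf. Qed.

Lemma cont_on_cst (k : R) : cont_on S (fun=> fun=> k).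
Proof. by move=> z _; exact: cvg_cst. Qed.

Lemma cont_on_snd (k : R -> R) :
  (forall z, S z -> {for z.2, continuous k}) -> cont_on S (fun=> k).
Proof.
move=> ck z Sz; apply: (@continuous_comp _ _ _ (fun z : R * R => z.2) k).
  exact: cvg_snd.
exact: ck.
Qed.

Lemma cont_on_fst (k : R -> R) :
  (forall z, S z -> {for z.1, continuous k}) -> cont_on S (fun x _ => k x).
Proof.
move=> ck z Sz; apply: (@continuous_comp _ _ _ (fun z : R * R => z.1) k).
  exact: cvg_fst.
exact: ck.
Qed.

Lemma cont_on_eq f g : open S -> (forall z, S z -> f z.1 z.2 = g z.1 z.2) ->
  cont_on S f -> cont_on S g.
Proof.
rewrite openE => oS fg cf z Sz.
rewrite /prop_for /continuous_at/= -(fg _ Sz).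
apply: cvg_trans (cf _ Sz); apply: near_eq_cvg.
by apply: filterS (oS _ Sz) => y; exact: fg.
Qed.

Lemma cont_on_slice2 f x y : cont_on S f -> S (x, y) -> {for y, continuous (f x)}.
Proof.
move=> cf Sxy.
apply: (@continuous_comp _ _ _ (fun y => (x, y)) (fun z : R * R => f z.1 z.2) y).
  by apply: (@cvg_pair _ _ _ _ (nbhs x) (nbhs y) _ _ _ (fun=> x) (fun y => y)); [exact: cvg_cst|exact: cvg_id].
exact: cf.
Qed.

Lemma cont_on_slice1 f x y : cont_on S f -> S (x, y) -> {for x, continuous (f^~ y)}.
Proof.
move=> cf Sxy.
apply: (@continuous_comp _ _ _ (fun x => (x, y)) (fun z : R * R => f z.1 z.2) x).
  by apply: (@cvg_pair _ _ _ _ (nbhs x) (nbhs y) _ _ _ (fun x => x) (fun=> y)); [exact: cvg_id|exact: cvg_cst].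
exact: cf.
Qed.

End continuity_on_sets.

Section boxes.
Context {R : realType}.
Variable L : R.
Implicit Types (f g : R -> R -> R) (a b c d : R).

Lemma openX (A B : set R) : open A -> open B -> open (A `*` B).
Proof.
rewrite !openE => oA oB [x y] [/= Ax By]; exists (A, B) => //; split => /=.
  exact: oA.
exact: oB.
Qed.

Lemma open_Omega : open (Omega L).
Proof. by apply: openX; exact: interval_open. Qed.

Lemma OmegaP x y : Omega L (x, y) <-> (0 < x < L) /\ (0 < y < 1).
Proof. by rewrite /Omega/=; split => -[]; rewrite /= !in_itv/=. Qed.

Lemma boxP a b c d x y : box a b c d (x, y) <-> (a <= x <= b) /\ (c <= y <= d).
Proof. by rewrite /box/=; split => -[]; rewrite /= !in_itv/=. Qed.

Lemma box_sides a b c d x y : a <= x <= b -> c <= y <= d ->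
  [/\ box a b c d (a, y), box a b c d (b, y), box a b c d (x, c) &
      box a b c d (x, d)].
Proof.
move=> /[dup] xab /andP[/le_trans h /h ab] /[dup] ycd /andP[/le_trans k /k cd].
by split; apply/boxP; rewrite ?lexx ?ab ?cd.
Qed.

Lemma diff_le_half (A B e : R) : `|A| <= e / 4 -> `|B| <= e / 4 -> A - B <= e / 2.
Proof. rewrite !ler_norml => /andP[? ?] /andP[? ?]; lra. Qed.

Lemma measurable_Omega : measurable (Omega L).
Proof. by apply: measurableX; exact: measurable_itv. Qed.

Lemma measurable_box a b c d : measurable (box a b c d).
Proof. by apply: measurableX; exact: measurable_itv. Qed.

Lemma compact_box a b c d : compact (box a b c d).
Proof. by apply: compact_setX; exact: segment_compact. Qed.

Lemma box_Omega a b c d : 0 < a -> b < L -> 0 < c -> d < 1 ->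
  box a b c d `<=` Omega L.
Proof.
move=> a0 bL c0 d1 [x y] /boxP[/andP[? ?] /andP[? ?]]; apply/OmegaP.
by split; apply/andP; split; lra.
Qed.

Lemma leb_itv_cc a b : a <= b -> leb R `[a, b] = (b - a)%:E.
Proof. by move=> ab; rewrite lebesgue_measure_itv/= lte_fin; move: ab; rewrite le_eqVlt => /predU1P[->|->]; rewrite ?ltxx ?subrr// EFinB. Qed.

Lemma integral_itv_cst a b (k : R) : a <= b ->
  (\int[leb R]_(_ in `[a, b]) k%:E = (k * (b - a))%:E)%E.
Proof.
move=> ab; rewrite integral_cst; last exact: measurable_itv.
by rewrite EFinM; congr (_ * _)%E; exact: leb_itv_cc.
Qed.

Lemma leb2_box a b c d : a <= b -> c <= d ->
  leb2 R (box a b c d) = ((b - a) * (d - c))%:E.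
Proof.
move=> ab cd; rewrite product_measure1E; try exact: measurable_itv.
by rewrite EFinM; congr (_ * _)%E; exact: leb_itv_cc.
Qed.

Lemma cont_measurable f : cont_on (Omega L) f ->
  measurable_fun (Omega L) (fun z => f z.1 z.2).
Proof. move=> cf; apply: continuous_measurable2 => //; exact: open_Omega. Qed.

Section one_box.
Variables (a b c d : R).
Hypotheses (ab : a <= b) (cd : c <= d) (bO : box a b c d `<=` Omega L).

Lemma integrable_box f : cont_on (Omega L) f ->
  (leb2 R).-integrable (box a b c d) (EFin \o (fun z => f z.1 z.2)).
Proof.
move=> cf; have [M hM] : bounded_on (box a b c d) (fun z => f z.1 z.2).
  apply: bounded_on_continuous; first exact: compact_box.
  by move=> z /bO; exact: cf.
apply: (@bounded_integrable _ _ _ _ _ _ M) => //.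
- exact: measurable_box.
- have H : (leb2 R (box a b c d) < +oo)%E by rewrite leb2_box// ltry.
  exact: H.
- apply: (@measurable_funS _ _ _ _ (Omega L)) => //; first exact: measurable_Omega.
  exact: cont_measurable.
Qed.

Definition bint f : R := \int[leb2 R]_(z in box a b c d) f z.1 z.2.

Lemma EFin_bint f : cont_on (Omega L) f ->
  (\int[leb2 R]_(z in box a b c d) (f z.1 z.2)%:E = (bint f)%:E)%E.
Proof.
move=> cf; rewrite /bint /Rintegral fineK//.
by apply: integrable_fin_num; [exact: measurable_box|exact: integrable_box].
Qed.

Lemma bintD f g : cont_on (Omega L) f -> cont_on (Omega L) g ->
  bint (fun x y => f x y + g x y) = bint f + bint g.
Proof. by move=> cf cg; apply: RintegralD; [exact: measurable_box|exact: integrable_box..]. Qed.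

Lemma bintZ k f : cont_on (Omega L) f -> bint (fun x y => k * f x y) = k * bint f.
Proof. by move=> cf; apply: RintegralZl; [exact: measurable_box|exact: integrable_box]. Qed.

Lemma le_bint f g : cont_on (Omega L) f -> cont_on (Omega L) g ->
  (forall x y, a <= x <= b -> c <= y <= d -> f x y <= g x y) -> bint f <= bint g.
Proof.
move=> cf cg fg; apply: le_Rintegral; [exact: measurable_box|exact: integrable_box..|].
by move=> [x y] /boxP[? ?]; exact: fg.
Qed.

Lemma eq_bint f g : (forall x y, a <= x <= b -> c <= y <= d -> f x y = g x y) ->
  bint f = bint g.
Proof.
by move=> fg; apply: eq_Rintegral => -[x y] /set_mem/boxP[? ?]; exact: fg.
Qed.

Lemma bint_le_Omega f : cont_on (Omega L) f ->
  (forall x y, Omega L (x, y) -> 0 <= f x y) ->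
  ((bint f)%:E <= \int[leb2 R]_(z in Omega L) (f z.1 z.2)%:E)%E.
Proof.
move=> cf f0; rewrite -EFin_bint//.
apply: ge0_subset_integral => //.
- exact: measurable_box.
- exact: measurable_Omega.
- by apply/measurable_EFinP; exact: cont_measurable.
- by move=> [x y] Oxy; rewrite lee_fin; exact: f0.
Qed.

Lemma bint_dx (F f : R -> R -> R) :
  (forall x y, Omega L (x, y) -> is_derive x 1 (F^~ y) (f x y)) ->
  cont_on (Omega L) f ->
  ((bint f)%:E = \int[leb R]_(y in `[c, d]) (F b y - F a y)%:E)%E.
Proof.
move=> dF cf; rewrite -EFin_bint// EFin_fubini_setX_swap; last exact: integrable_box.
- apply: eq_integral => y /set_mem/=; rewrite in_itv/= => ycd.
  apply: (@EFin_ftc _ (F^~ y) (f^~ y)) => // x xab.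
    by apply: dF; apply: bO; apply/boxP.
  by apply: (cont_on_slice1 cf); apply: bO; apply/boxP.
- exact: measurable_itv.
- exact: measurable_itv.
Qed.

Lemma bint_dy (F f : R -> R -> R) :
  (forall x y, Omega L (x, y) -> is_derive y 1 (F x) (f x y)) ->
  cont_on (Omega L) f ->
  ((bint f)%:E = \int[leb R]_(x in `[a, b]) (F x d - F x c)%:E)%E.
Proof.
move=> dF cf; rewrite -EFin_bint// EFin_fubini_setX; last exact: integrable_box.
- apply: eq_integral => x /set_mem/=; rewrite in_itv/= => xab.
  apply: (@EFin_ftc _ (F x) (f x)) => // y ycd.
    by apply: dF; apply: bO; apply/boxP.
  by apply: (cont_on_slice2 cf); apply: bO; apply/boxP.
- exact: measurable_itv.
- exact: measurable_itv.
Qed.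

Lemma bint_dx_le (F f : R -> R -> R) (eta : R) : d - c <= 1 -> 0 <= eta ->
  (forall x y, Omega L (x, y) -> is_derive x 1 (F^~ y) (f x y)) ->
  cont_on (Omega L) f -> cont_on (Omega L) F ->
  (forall y, c <= y <= d -> F b y - F a y <= eta) -> bint f <= eta.
Proof.
move=> cd1 eta0 dF cf cF Fe; rewrite -lee_fin bint_dx//.
have ca y : c <= y <= d -> {for y, continuous (F a)}.
  by move=> ?; apply: cont_on_slice2 cF _; apply: bO; apply/boxP; rewrite lexx.
have cb y : c <= y <= d -> {for y, continuous (F b)}.
  by move=> ?; apply: cont_on_slice2 cF _; apply: bO; apply/boxP; rewrite lexx ab.
apply: (@le_trans _ _ (\int[leb R]_(y in `[c, d]) eta%:E)%E).
  apply: le_integral.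
  - exact: measurable_itv.
  - apply: continuous_compact_integrable; first exact: segment_compact.
    apply: continuous_in_subspaceT => y; rewrite inE/= in_itv/= => ycd.
    by apply: cvgB; [exact: cb|exact: ca].
  - apply: continuous_compact_integrable; first exact: segment_compact.
    by apply: continuous_in_subspaceT => y _; exact: cvg_cst.
  - by move=> y /set_mem/=; rewrite in_itv/= lee_fin; exact: Fe.
by rewrite integral_itv_cst// lee_fin ler_piMr.
Qed.

Lemma bint_dy_le (F f : R -> R -> R) (h : R -> \bar R) :
  (forall x y, Omega L (x, y) -> is_derive y 1 (F x) (f x y)) ->
  cont_on (Omega L) f -> cont_on (Omega L) F ->
  measurable_fun `[a, b] h -> (forall x, a <= x <= b -> (0 <= h x)%E) ->
  (forall x, a <= x <= b -> ((F x d - F x c)%:E <= h x)%E) ->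
  ((bint f)%:E <= \int[leb R]_(x in `[a, b]) h x)%E.
Proof.
move=> dF cf cF mh h0 Fe; rewrite (bint_dy dF)//.
have [->|hoo] := eqVneq (\int[leb R]_(x in `[a, b]) h x)%E +oo%E; first exact: leey.
have ca x : a <= x <= b -> {for x, continuous (F^~ c)}.
  by move=> ?; apply: cont_on_slice1 cF _; apply: bO; apply/boxP; rewrite lexx.
have cb x : a <= x <= b -> {for x, continuous (F^~ d)}.
  by move=> ?; apply: cont_on_slice1 cF _; apply: bO; apply/boxP; rewrite lexx andbT.
apply: le_integral.
- exact: measurable_itv.
- apply: continuous_compact_integrable; first exact: segment_compact.
  apply: continuous_in_subspaceT => x; rewrite inE/= in_itv/= => xab.
  by apply: cvgB; [exact: cb|exact: ca].
- apply/integrableP; split => //.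
  under eq_integral => x /set_mem/=.
    rewrite in_itv/= => /h0 hx; rewrite gee0_abs//; over.
  by rewrite ltey.
- by move=> x /set_mem/=; rewrite in_itv/=; exact: Fe.
Qed.

Lemma bint_dy_le_cst (F f : R -> R -> R) (eta : R) : b - a <= 1 -> 0 <= eta ->
  (forall x y, Omega L (x, y) -> is_derive y 1 (F x) (f x y)) ->
  cont_on (Omega L) f -> cont_on (Omega L) F ->
  (forall x, a <= x <= b -> F x d - F x c <= eta) -> bint f <= eta.
Proof.
move=> ab1 eta0 dF cf cF Fe; rewrite -lee_fin.
apply: le_trans (@bint_dy_le F f (fun=> eta%:E) _ _ _ _ _ _) _ => //.
by rewrite integral_itv_cst// lee_fin ler_piMr.
Qed.

End one_box.

Definition mesh (n : nat) : R := n.+3%:R^-1.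

Definition ebox n : set (R * R) :=
  box (L * mesh n) (L - L * mesh n) (mesh n) (1 - mesh n).

Hypothesis L0 : 0 < L.

Lemma mesh_gt0 n : 0 < mesh n. Proof. by rewrite invr_gt0. Qed.

Lemma mesh_lt n : mesh n < 2^-1.
Proof. by rewrite ltf_pV2 ?posrE// ltr_nat. Qed.

Lemma le_mesh m n : (m <= n)%N -> mesh n <= mesh m.
Proof. by move=> mn; rewrite lef_pV2 ?posrE// ler_nat. Qed.

Lemma mesh_small (r : R) : 0 < r -> exists n, mesh n <= r.
Proof.
move=> r0; have [n _ /(_ n (leqnn n))/= nr] := near_infty_natSinv_lt (PosNum r0).
exists n; apply: le_trans _ (ltW nr).
by rewrite lef_pV2 ?posrE// ler_nat ltnS; apply: leqW.
Qed.

Lemma ebox_nondecreasing : nondecreasing_seq ebox.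
Proof.
move=> m n mn; apply/subsetPset => -[x y] /boxP[/andP[? ?] /andP[? ?]].
have nm := le_mesh mn.
have ? : L * mesh n <= L * mesh m by rewrite ler_wpM2l// ltW.
by apply/boxP; split; apply/andP; split; lra.
Qed.

Lemma ebox_Omega n : ebox n `<=` Omega L.
Proof.
have i0 := mesh_gt0 n; have i1 := mesh_lt n.
have ? : 0 < L * mesh n by exact: mulr_gt0.
by apply: box_Omega => //; lra.
Qed.

Lemma bigcup_ebox : \bigcup_n ebox n = Omega L.
Proof.
apply/seteqP; split; first by move=> z [n _]; exact: ebox_Omega.
move=> [x y] /OmegaP[/andP[x0 xL] /andP[y0 y1]].
have [n] : exists n, mesh n <= Num.min (Num.min (x / L) (1 - x / L)) (Num.min y (1 - y)).
  apply: mesh_small.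
  by rewrite !lt_min !subr_gt0 y0 y1 divr_gt0//= ltr_pdivrMr// mul1r xL.
rewrite !le_min => /andP[/andP[xl xr] /andP[? ?]]; exists n => //.
have xl' : L * mesh n <= x by move: xl; rewrite ler_pdivlMr// mulrC.
have xr' : L * mesh n <= L - x.
  by move: xr; rewrite lerBrDl -lerBrDr ler_pdivrMr// mulrBl mul1r mulrC; lra.
by apply/boxP; split; apply/andP; split; lra.
Qed.

(** Integration over the rectangle of an inequality in divergence form, for
  fluxes F and G that vanish at the sides they cross. *)
Lemma divergence_inequality (N P F Fx G Gy : R -> R -> R) : L <= 1 ->
  (forall x y, Omega L (x, y) -> 0 <= N x y) ->
  (forall x y, Omega L (x, y) -> 0 <= P x y) ->
  cont_on (Omega L) N -> cont_on (Omega L) P -> cont_on (Omega L) F ->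
  cont_on (Omega L) Fx -> cont_on (Omega L) G -> cont_on (Omega L) Gy ->
  (forall x y, Omega L (x, y) -> is_derive x 1 (F^~ y) (Fx x y)) ->
  (forall x y, Omega L (x, y) -> is_derive y 1 (G x) (Gy x y)) ->
  (forall x y, Omega L (x, y) -> N x y <= P x y + Fx x y + Gy x y) ->
  vanishes (Omega L) (fun z => z.1) (fun z => F z.1 z.2) ->
  vanishes (Omega L) (fun z => L - z.1) (fun z => F z.1 z.2) ->
  vanishes (Omega L) (fun z => z.2) (fun z => G z.1 z.2) ->
  vanishes (Omega L) (fun z => 1 - z.2) (fun z => G z.1 z.2) ->
  (\int[leb2 R]_(z in Omega L) (N z.1 z.2)%:E <=
   \int[leb2 R]_(z in Omega L) (P z.1 z.2)%:E)%E.
Proof.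
move=> L1 N0 P0 cN cP cF cFx cG cGy dF dG NP vFw vFe vGs vGn.
refine (@le_integral_of_exhaustion R _ _ (leb2 R) ebox (Omega L) (fun z => (N z.1 z.2)%:E) _ _ _ _ _ _ _).
- exact: ebox_nondecreasing.
- by move=> n; exact: measurable_box.
- exact: bigcup_ebox.
- by apply/measurable_EFinP; exact: cont_measurable.
- by move=> [x y] /N0; rewrite lee_fin.
move=> n; apply/lee_addgt0Pr => e e0.
have e40 : 0 < e / 4 by rewrite divr_gt0.
have [r1 r10 h1] := vFw _ e40; have [r2 r20 h2] := vFe _ e40.
have [r3 r30 h3] := vGs _ e40; have [r4 r40 h4] := vGn _ e40.
have i0 := mesh_gt0 n; have i1 := mesh_lt n.
have [r [r0 rr1 rr2 [rr3 rr4] [rL rn]]] : exists r, [/\ 0 < r, r < r1, r < r2,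
    r < r3 /\ r < r4 & r <= L * mesh n /\ r <= mesh n].
  pose m := Num.min (Num.min (Num.min r1 r2) (Num.min r3 r4))
     (Num.min (L * mesh n) (mesh n)).
  have m0 : 0 < m by rewrite !lt_min r10 r20 r30 r40 i0 mulr_gt0.
  have : m <= m by [].
  rewrite {2}/m !le_min => /andP[/andP[/andP[? ?] /andP[? ?]] /andP[? ?]].
  have m2 : m / 2 < m by rewrite ltr_pdivrMr// ltr_pMr// ltr1n.
  exists (m / 2); split; rewrite ?divr_gt0//; try (by apply: lt_le_trans m2 _).
    by split; apply: lt_le_trans m2 _.
  by split; apply: le_trans (ltW m2) _.
have Lh : L * mesh n < L * 2^-1 by rewrite ltr_pM2l.
have ab : r <= L - r.
  by clear -Lh rL; lra.
have cd : r <= 1 - r by clear -i1 rn; lra.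
have bO : box r (L - r) r (1 - r) `<=` Omega L.
  by apply: box_Omega => //; rewrite gtrBl.
have sub : ebox n `<=` box r (L - r) r (1 - r).
  move=> [x y] /boxP[/andP[x1 x2] /andP[y1 y2]]; apply/boxP.
  rewrite (le_trans rL x1) (le_trans rn y1) (le_trans x2) ?(le_trans y2)//.
    by rewrite lerD2l lerN2.
  by rewrite lerD2l lerN2.
apply: (@le_trans _ _ (bint r (L - r) r (1 - r) N)%:E).
  rewrite -EFin_bint//; apply: ge0_subset_integral => //.
  - exact: measurable_box.
  - exact: measurable_box.
  - apply: (@measurable_funS _ _ _ _ (Omega L)) => //; first exact: measurable_Omega.
    by apply/measurable_EFinP; exact: cont_measurable.
  - by move=> [x y] /bO/N0; rewrite lee_fin.
have : bint r (L - r) r (1 - r) N <= bint r (L - r) r (1 - r) P + e.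
  apply: (@le_trans _ _ (bint r (L - r) r (1 - r) P +
     bint r (L - r) r (1 - r) Fx + bint r (L - r) r (1 - r) Gy)).
    rewrite -!bintD//; last exact: cont_onD.
    apply: le_bint => //; first by apply: cont_onD => //; exact: cont_onD.
    by move=> x y xr yr; apply: NP; apply: bO; apply/boxP.
  rewrite -addrA lerD2l (splitr e) lerD//.
    apply: (@bint_dx_le _ _ _ _ ab cd bO F) => //.
    - by rewrite -addrA -opprD gerBl addr_ge0// ltW.
    - by rewrite divr_ge0// ltW.
    move=> y yr; have [lft rgt _ _] := box_sides (introT andP (conj (lexx r) ab)) yr.
    apply: diff_le_half; first by apply: (h2 (L - r, y)); [exact: bO|rewrite /= subKr].
    by apply: (h1 (r, y)); first exact: bO.
  apply: (@bint_dy_le_cst _ _ _ _ ab cd bO G) => //.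
  - by rewrite -addrA -opprD (le_trans _ L1)// gerBl addr_ge0// ltW.
  - by rewrite divr_ge0// ltW.
  move=> x xr; have [_ _ bot top] := box_sides xr (introT andP (conj (lexx r) cd)).
  apply: diff_le_half; first by apply: (h4 (x, 1 - r)); [exact: bO|rewrite /= subKr].
  by apply: (h3 (x, r)); first exact: bO.
rewrite -lee_fin EFinD => /le_trans; apply.
by rewrite leeD2r//; exact: bint_le_Omega.
Qed.

End boxes.

(** * Pointwise inequalities *)

Section pointwise.
Context {R : realType}.

Lemma young (e a b : R) : 0 < e -> 2 * (a * b) <= e * a ^+ 2 + e^-1 * b ^+ 2.
Proof.
move=> e0; have : 0 <= e^-1 * (e * a - b) ^+ 2.
  by rewrite mulr_ge0 ?sqr_ge0// invr_ge0 ltW.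
suff -> : e^-1 * (e * a - b) ^+ 2 = e * a ^+ 2 + e^-1 * b ^+ 2 - 2 * (a * b) by rewrite subr_ge0.
by field; rewrite gt_eqF.
Qed.

Lemma young_norm (e a b : R) : 0 < e ->
  `|2 * (a * b)| <= e * a ^+ 2 + e^-1 * b ^+ 2.
Proof.
move=> e0; rewrite ler_norml young// andbT lerNl.
by have := young a (- b) e0; rewrite sqrrN !mulrN.
Qed.

Lemma sqr_le_of_norm (a M : R) : `|a| <= M -> a ^+ 2 <= M ^+ 2.
Proof.
move=> aM; rewrite -[a ^+ 2]ger0_norm ?sqr_ge0// normrX.
by rewrite lerXn2r ?nnegrE ?normr_ge0// (le_trans _ aM).
Qed.

Definition hardyC (kap M : R) : R := 1 + M ^+ 2 / (2 * kap).
Definition gradC (kap M : R) : R := 4 / kap * (4 * hardyC kap M + 4 * M ^+ 2 / kap).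

Lemma hardyC_gt0 kap M : 0 < kap -> 0 < hardyC kap M.
Proof. by move=> k0; rewrite ltr_wpDr// divr_ge0 ?sqr_ge0// mulr_ge0// ltW. Qed.

Lemma gradC_gt0 kap M : 0 < kap -> 0 < gradC kap M.
Proof.
move=> k0; rewrite mulr_gt0 ?divr_gt0// ltr_wpDr ?mulr_gt0 ?hardyC_gt0//.
by apply: divr_ge0; [rewrite mulr_ge0 ?sqr_ge0|exact: ltW].
Qed.

(** A Hardy inequality with weight u + s in place of the distance to the walls,
  and a Poincare inequality, absorb the product f w: the y-derivatives are
  those of f fy and of a multiple of (- u1 / (u + s) + 2 c y) f ^ 2. *)
Lemma grad_pointwise (kap M u u1 u2 s f fx fy w y : R) : 0 < kap ->
  kap <= u1 ^+ 2 + u ^+ 2 -> `|u1| <= M -> `|u2| <= M -> 0 <= u -> 0 < s ->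
  0 <= y <= 1 ->
  2^-1 * (fx ^+ 2 + fy ^+ 2) <=
  gradC kap M / 2 * ((u + s) * w) ^+ 2 + (fx ^+ 2 + fy ^+ 2 + f * w)
  + 2 / (kap * gradC kap M) *
    ((- u2 / (u + s) + u1 ^+ 2 / (u + s) ^+ 2 + 2 * hardyC kap M) * f ^+ 2
     + (- u1 / (u + s) + 2 * hardyC kap M * y) * (2 * f * fy)).
Proof.
move=> k0 ku u1M u2M u0 s0 /andP[y0 y1].
have c0 := hardyC_gt0 M k0; have C0 := gradC_gt0 M k0.
set c := hardyC kap M in c0 *; set C := gradC kap M in C0 *.
have v0 : 0 < u + s by rewrite ltr_wpDl.
set v := u + s in v0 *; pose X := f / v.
have fE : f = X * v by rewrite /X divfK// gt_eqF.
have -> : (- u2 / v + u1 ^+ 2 / v ^+ 2 + 2 * c) * f ^+ 2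
     + (- u1 / v + 2 * c * y) * (2 * f * fy) =
   (u1 ^+ 2 - u2 * v) * X ^+ 2 + 2 * c * f ^+ 2 - 2 * (u1 * X * fy)
     + 4 * c * (y * f * fy).
  by rewrite fE; field; rewrite gt_eqF.
have E1 : kap / 2 * X ^+ 2 - c * f ^+ 2 <= (u1 ^+ 2 - u2 * v) * X ^+ 2.
  have -> : kap / 2 * X ^+ 2 - c * f ^+ 2 = (kap / 2 - c * v ^+ 2) * X ^+ 2.
    by rewrite fE; ring.
  rewrite ler_wpM2r ?sqr_ge0//.
  have h : u2 * v <= kap / 2 + M ^+ 2 / (2 * kap) * v ^+ 2.
    have : u2 * v <= M * v by rewrite ler_wpM2r ?(ltW v0)// (le_trans (ler_norm _)).
    have := @young kap^-1 (M * v) 1 ltac:(by rewrite invr_gt0).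
    rewrite expr1n !mulr1 invrK exprMn.
    rewrite (_ : M ^+ 2 / (2 * kap) * v ^+ 2 = 2^-1 * (kap^-1 * (M ^+ 2 * v ^+ 2))); first lra.
    by field; rewrite gt_eqF.
  have uv : u ^+ 2 <= v ^+ 2 by rewrite lerXn2r ?nnegrE ?(ltW v0)// /v lerDl ltW.
  have -> : c * v ^+ 2 = v ^+ 2 + M ^+ 2 / (2 * kap) * v ^+ 2.
    by rewrite /c /hardyC mulrDl mul1r.
  move: h ku uv; clear.
  move: (M ^+ 2 / (2 * kap) * v ^+ 2) (u2 * v) => a b; lra.
have E2 : c * f ^+ 2 - 4 * c * fy ^+ 2 <= 2 * c * f ^+ 2 + 4 * c * (y * f * fy).
  have h : - (2 * (y * f * fy)) <= 2^-1 * f ^+ 2 + 2 * fy ^+ 2.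
    have := @young_norm 2^-1 f (y * fy) ltac:(by rewrite invr_gt0).
    rewrite invrK ler_norml => /andP[+ _].
    have : (y * fy) ^+ 2 <= fy ^+ 2.
      by rewrite exprMn ler_piMl ?sqr_ge0// exprn_ile1.
    rewrite [f * (y * fy)]mulrCA mulrA; move: (y * f * fy) => q; lra.
  have -> : c * f ^+ 2 - 4 * c * fy ^+ 2 = c * (f ^+ 2 - 4 * fy ^+ 2) by ring.
  have -> : 2 * c * f ^+ 2 + 4 * c * (y * f * fy) = c * (2 * f ^+ 2 + 4 * (y * f * fy)) by ring.
  by rewrite ler_wpM2l ?(ltW c0)//; lra.
have E3 : - (kap / 4 * X ^+ 2) - 4 * M ^+ 2 / kap * fy ^+ 2 <= - (2 * (u1 * X * fy)).
  have k4 : 0 < kap / 4 by rewrite divr_gt0.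
  have := @young (kap / 4) X (u1 * fy) k4.
  have : u1 ^+ 2 <= M ^+ 2 by exact: sqr_le_of_norm.
  move=> /(ler_wpM2r (sqr_ge0 fy)); rewrite -exprMn.
  have ki : 0 <= (kap / 4)^-1 by rewrite invr_ge0 ltW.
  move=> /(ler_wpM2l ki).
  have -> : 4 * M ^+ 2 / kap * fy ^+ 2 = (kap / 4)^-1 * (M ^+ 2 * fy ^+ 2).
    by field; rewrite gt_eqF.
  rewrite [X * (u1 * fy)]mulrCA mulrA; lra.
have E4 : - (f * w) <= (2 * C)^-1 * X ^+ 2 + C / 2 * (v * w) ^+ 2.
  have := @young_norm C^-1 X (v * w) ltac:(by rewrite invr_gt0).
  rewrite invrK ler_norml [X * (v * w)]mulrA -fE => /andP[+ _].
  have -> : (2 * C)^-1 * X ^+ 2 = 2^-1 * (C^-1 * X ^+ 2) by rewrite invfM mulrA.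
  have -> : C / 2 * (v * w) ^+ 2 = 2^-1 * (C * (v * w) ^+ 2) by ring.
  move: (C^-1 * _) (C * _) => p q; clear; lra.
have CE : kap / 4 * C = 4 * c + 4 * M ^+ 2 / kap.
  by rewrite /C /gradC -/c; field; rewrite gt_eqF.
have b0 : 0 <= 2 / (kap * C) by rewrite divr_ge0// mulr_ge0// ltW.
have E5 : (2 * C)^-1 * X ^+ 2 - 2^-1 * fy ^+ 2 <= 2 / (kap * C) *
   ((u1 ^+ 2 - u2 * v) * X ^+ 2 + 2 * c * f ^+ 2 - 2 * (u1 * X * fy)
     + 4 * c * (y * f * fy)).
  have -> : (2 * C)^-1 * X ^+ 2 - 2^-1 * fy ^+ 2 =
      2 / (kap * C) * (kap / 4 * X ^+ 2 - kap / 4 * C * fy ^+ 2).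
    by field; rewrite !gt_eqF.
  rewrite ler_wpM2l// CE; clear -E1 E2 E3; lra.
have := sqr_ge0 fx; clear -E4 E5; lra.
Qed.

Definition vortC (kap M : R) : R :=
  16 / kap * ((1 + kap) / 4 + 2 * M ^+ 2 / kap) + (16 / kap) ^+ 2 * M ^+ 2.

Lemma vortC_ge0 kap M : 0 < kap -> 0 <= vortC kap M.
Proof.
move=> k0; have a0 : 0 <= 16 / kap by rewrite divr_ge0// ltW.
have b0 : 0 <= (1 + kap) / 4 by rewrite divr_ge0// addr_ge0// ltW.
have c0 : 0 <= 2 * M ^+ 2 / kap by apply: divr_ge0; [apply: mulr_ge0; [|exact: sqr_ge0]|exact: ltW].
rewrite /vortC; apply: addr_ge0; last by apply: mulr_ge0; exact: sqr_ge0.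
by apply: mulr_ge0 => //; exact: addr_ge0.
Qed.

(** Interpolation between the weights u ^ 2 and u: the flux s u1 u / (u + s) w ^ 2
  has a y-derivative that is bounded below by w ^ 2 in the layer u <= s. *)
Lemma vort_pointwise (kap M u u1 u2 s w wy : R) : 0 < kap ->
  kap <= u1 ^+ 2 + u ^+ 2 -> `|u1| <= M -> `|u2| <= M -> 0 <= u -> 0 < s <= 1 ->
  w ^+ 2 <= vortC kap M * (s * (u * wy ^+ 2) + s ^- 2 * (u * w) ^+ 2)
  + 16 / kap * ((s * (u2 * u / (u + s)) + s ^+ 2 * u1 ^+ 2 / (u + s) ^+ 2) * w ^+ 2
     + s * (u1 * u / (u + s)) * (2 * w * wy)).
Proof.
move=> k0 ku u1M u2M u0 /andP[s0 s1].
have M0 : 0 <= M by exact: le_trans u1M.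
have v0 : 0 < u + s by rewrite ltr_wpDl.
pose r := u / (u + s); pose z := u / s.
have r0 : 0 <= r by rewrite divr_ge0// ltW.
have z0 : 0 <= z by rewrite divr_ge0// ltW.
have r1 : r <= 1 by rewrite ler_pdivrMr// mul1r lerDl ltW.
have uE : u = s * z by rewrite /z mulrC divfK// gt_eqF.
have sru : s * r <= u.
  rewrite /r mulrA ler_pdivrMr// mulrC ler_wpM2l// lerDr//.
have sr0 : 0 <= s * r by apply: mulr_ge0 => //; exact: ltW.
have srs : s * r <= s by rewrite ler_piMr// ltW.
have -> : s * (u2 * u / (u + s)) + s ^+ 2 * u1 ^+ 2 / (u + s) ^+ 2 =
    u2 * (s * r) + u1 ^+ 2 * (1 - r) ^+ 2.
  by rewrite /r; field; rewrite gt_eqF.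
have -> : s * (u1 * u / (u + s)) = u1 * (s * r) by rewrite /r; field; rewrite gt_eqF.
have uz : u ^+ 2 <= z ^+ 2.
  by rewrite uE exprMn ler_piMl ?sqr_ge0// exprn_ile1// ltW.
have A1 : kap / 4 - (1 + kap) / 4 * z ^+ 2 <= u1 ^+ 2 * (1 - r) ^+ 2.
  have [z1|z1] := leP z 1.
    have hr : 2^-1 <= 1 - r.
      have : r <= 2^-1.
        rewrite /r ler_pdivrMr//; have : u <= s by rewrite -[s]mul1r -ler_pdivrMr.
        lra.
      lra.
    have : 2^-1 ^+ 2 <= (1 - r) ^+ 2 by rewrite lerXn2r ?nnegrE//; lra.
    move=> /(ler_wpM2l (sqr_ge0 u1)); move: (sqr_ge0 z) uz ku.
    have : 0 <= kap * z ^+ 2 by rewrite mulr_ge0 ?sqr_ge0// ltW.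
    rewrite (_ : 2^-1 ^+ 2 = 4^-1); last by field.
    clear; move: (u1 ^+ 2 * (1 - r) ^+ 2) (u1 ^+ 2) (z ^+ 2) (u ^+ 2) => P p q o.
    have -> : kap / 4 - (1 + kap) / 4 * q = kap / 4 - q / 4 - kap * q / 4 by ring.
    move: (kap * q) => kq; lra.
  have : 0 <= u1 ^+ 2 * (1 - r) ^+ 2 by rewrite mulr_ge0 ?sqr_ge0.
  have z21 : 1 <= z ^+ 2 by rewrite exprn_ege1// ltW.
  have : kap * 1 <= kap * z ^+ 2 by rewrite ler_wpM2l// ltW.
  move: z21; clear; move: (u1 ^+ 2 * (1 - r) ^+ 2) (z ^+ 2) => P q.
  have -> : kap / 4 - (1 + kap) / 4 * q = kap / 4 - q / 4 - kap * q / 4 by ring.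
  move: (kap * q) => kq; lra.
have A2 : - (kap / 8) - 2 * M ^+ 2 / kap * z ^+ 2 <= u2 * (s * r).
  have h1 : `|u2 * (s * r)| <= M * z.
    rewrite normrM ler_pM// ger0_norm//.
    by apply: le_trans sru _; rewrite uE ler_piMl.
  have := @young (kap / 4) 1 (M * z) ltac:(by rewrite divr_gt0).
  rewrite mul1r expr1n mulr1 exprMn.
  have -> : (kap / 4)^-1 * (M ^+ 2 * z ^+ 2) = 2 * (2 * M ^+ 2 / kap * z ^+ 2).
    by field; rewrite gt_eqF.
  by move: h1; rewrite ler_norml => /andP[+ _]; lra.
have A3 : - (kap / 16 * w ^+ 2) - 16 / kap * M ^+ 2 * (s * (u * wy ^+ 2)) <=
    u1 * (s * r) * (2 * w * wy).
  have := @young_norm (kap / 16) w (u1 * (s * r) * wy) ltac:(by rewrite divr_gt0).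
  rewrite ler_norml => /andP[+ _].
  have : (u1 * (s * r) * wy) ^+ 2 <= M ^+ 2 * (s * (u * wy ^+ 2)).
    have -> : (u1 * (s * r) * wy) ^+ 2 = u1 ^+ 2 * ((s * r) ^+ 2 * wy ^+ 2) by ring.
    apply: ler_pM; [exact: sqr_ge0|by rewrite mulr_ge0 ?sqr_ge0|exact: sqr_le_of_norm|].
    by rewrite mulrA ler_wpM2r ?sqr_ge0// expr2 ler_pM.
  have ki : 0 <= (kap / 16)^-1 by rewrite invr_ge0 divr_ge0// ltW.
  move=> /(ler_wpM2l ki); rewrite [in X in X -> _]mulrA invf_div.
  rewrite (_ : 2 * (w * (u1 * (s * r) * wy)) = u1 * (s * r) * (2 * w * wy)); last by ring.
  lra.
set q' := u2 * (s * r) + _; set Q := u1 * (s * r) * _ in A3 *.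
have B : kap / 16 * w ^+ 2 <= ((1 + kap) / 4 + 2 * M ^+ 2 / kap) * (z ^+ 2 * w ^+ 2)
    + 16 / kap * M ^+ 2 * (s * (u * wy ^+ 2)) + (q' * w ^+ 2 + Q).
  have : kap / 8 - ((1 + kap) / 4 + 2 * M ^+ 2 / kap) * z ^+ 2 <= q'.
    rewrite /q'; clear -A1 A2; lra.
  move=> /(ler_wpM2r (sqr_ge0 w)).
  move: A3; clear.
  rewrite mulrBl -[_ * z ^+ 2 * _]mulrA; move: (_ * (z ^+ 2 * w ^+ 2)) (q' * _) => a b.
  lra.
have c0 : 0 <= 16 / kap by rewrite divr_ge0// ltW.
have := ler_wpM2l c0 B.
have -> : 16 / kap * (kap / 16 * w ^+ 2) = w ^+ 2 by field; rewrite gt_eqF.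
move=> /le_trans; apply.
rewrite [in X in X <= _]mulrDr lerD2r.
have -> : s ^- 2 * (u * w) ^+ 2 = z ^+ 2 * w ^+ 2.
  by rewrite /z; field; rewrite gt_eqF.
have a0 : 0 <= s * (u * wy ^+ 2).
  by apply: mulr_ge0; [exact: ltW|rewrite mulr_ge0 ?sqr_ge0].
have b0 : 0 <= z ^+ 2 * w ^+ 2 by rewrite mulr_ge0 ?sqr_ge0.
move: a0 b0; move: (s * (u * wy ^+ 2)) (z ^+ 2 * w ^+ 2) => a b a0 b0.
have d0 : 0 <= 16 / kap * ((1 + kap) / 4 + 2 * M ^+ 2 / kap).
  apply: mulr_ge0 => //; apply: addr_ge0; first by rewrite divr_ge0// addr_ge0// ltW.
  by apply: divr_ge0; [apply: mulr_ge0; [|exact: sqr_ge0]|exact: ltW].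
have e0 : 0 <= (16 / kap) ^+ 2 * M ^+ 2 by rewrite mulr_ge0 ?sqr_ge0.
have -> : 16 / kap * (((1 + kap) / 4 + 2 * M ^+ 2 / kap) * b + 16 / kap * M ^+ 2 * a) =
  16 / kap * ((1 + kap) / 4 + 2 * M ^+ 2 / kap) * b + (16 / kap) ^+ 2 * M ^+ 2 * a.
  by ring.
rewrite /vortC [leRHS]mulrDl; apply: lerD.
  by apply: ler_wpM2l => //; rewrite lerDr.
by apply: ler_wpM2l => //; rewrite lerDl.
Qed.

End pointwise.

(** * Functions of class C^k and the base flow *)

Section Ck_functions.
Context {R : realType}.
Implicit Types (S : set (R * R)) (f g : R -> R -> R) (k : nat).

Lemma Ck_cont k S f : Ck k S f -> cont_on S f.
Proof. by move=> Cf z Sz; have [_] := Cf [::] (leq0n k) z Sz. Qed.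

Lemma Ck_le k m S f : (m <= k)%N -> Ck k S f -> Ck m S f.
Proof.
move=> mk Cf w wm z Sz; have [h c] := Cf w (leq_trans wm mk) z Sz.
by split => // wm'; apply: h; exact: leq_trans mk.
Qed.

Lemma pder_rcons w (b : bool) f : pder (rcons w b) f = pder w (if b then dx f else dy f).
Proof. by rewrite /pder foldr_rcons. Qed.

Lemma Ck_dx k S f : Ck k.+1 S f -> Ck k S (dx f).
Proof.
move=> Cf w wk z Sz; have := Cf (rcons w true); rewrite size_rcons ltnS => /(_ wk z Sz).
by rewrite pder_rcons ltnS.
Qed.

Lemma Ck_dy k S f : Ck k.+1 S f -> Ck k S (dy f).
Proof.
move=> Cf w wk z Sz; have := Cf (rcons w false); rewrite size_rcons ltnS => /(_ wk z Sz).
by rewrite pder_rcons ltnS.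
Qed.

Lemma Ck_der k S f x y : Ck k.+1 S f -> S (x, y) ->
  is_derive x 1 (f^~ y) (dx f x y) /\ is_derive y 1 (f x) (dy f x y).
Proof.
move=> Cf Sxy; have [/(_ isT)[/= fx fy] _] := Cf [::] isT _ Sxy.
by split; exact: der_of_derivable.
Qed.

Lemma Ck_derx k S f x y : Ck k.+1 S f -> S (x, y) ->
  is_derive x 1 (f^~ y) (dx f x y).
Proof. by move=> Cf /(Ck_der Cf)[]. Qed.

Lemma Ck_dery k S f x y : Ck k.+1 S f -> S (x, y) ->
  is_derive y 1 (f x) (dy f x y).
Proof. by move=> Cf /(Ck_der Cf)[]. Qed.

Lemma der_eq_on S f g x y l : open S -> (forall x y, S (x, y) -> f x y = g x y) ->
  S (x, y) -> (is_derive x 1 (f^~ y) l -> is_derive x 1 (g^~ y) l) /\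
    (is_derive y 1 (f x) l -> is_derive y 1 (g x) l).
Proof.
rewrite openE => oS fg Sxy; have [[/= U V] [/= nU nV] UV] := oS _ Sxy.
split; apply: der_near_eq.
  by apply: filterS nU => x' Ux'; apply: fg; apply: (UV (x', y)); split => //=; exact: nbhs_singleton.
by apply: filterS nV => y' Vy'; apply: fg; apply: (UV (x, y')); split => //=; exact: nbhs_singleton.
Qed.

Lemma derive1_near_eq (u v : R -> R) a : (\forall y \near a, u y = v y) ->
  u^`()%classic a = v^`()%classic a.
Proof. by move=> uv; rewrite !derive1E; apply: near_eq_derive => //; exact: oner_neq0. Qed.

Lemma dxy_eq_on S f g : open S -> (forall x y, S (x, y) -> f x y = g x y) ->
  (forall x y, S (x, y) -> dx f x y = dx g x y) /\
  (forall x y, S (x, y) -> dy f x y = dy g x y).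
Proof.
rewrite openE => oS fg.
split => x y Sxy; have [[/= U V] [/= nU nV] UV] := oS _ Sxy; apply: derive1_near_eq.
  by apply: filterS nU => x' Ux'; apply: fg; apply: (UV (x', y)); split => //=; exact: nbhs_singleton.
by apply: filterS nV => y' Vy'; apply: fg; apply: (UV (x, y')); split => //=; exact: nbhs_singleton.
Qed.

Lemma pder_eq_on S f g w : open S -> (forall x y, S (x, y) -> f x y = g x y) ->
  forall x y, S (x, y) -> pder w f x y = pder w g x y.
Proof.
move=> oS fg; elim: w => [//|b w IH] x y Sxy.
have [h1 h2] := dxy_eq_on oS IH.
by case: b => /=; [exact: h1|exact: h2].
Qed.

Lemma Ck_eq_on k S f g : open S -> (forall x y, S (x, y) -> f x y = g x y) ->
  Ck k S f -> Ck k S g.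
Proof.
move=> oS fg Cf w wk [x y] Sxy; have [h c] := Cf w wk _ Sxy.
have E := pder_eq_on w oS fg.
split; last by apply: (@cont_on_eq _ S (pder w f)) => // [[? ?]|z Sz]; [exact: E|have [] := Cf w wk z Sz].
move=> wk'; have [/= hx hy] := h wk'.
have [kx _] := der_eq_on (dx (pder w f) x y) oS E Sxy.
have [_ ky] := der_eq_on (dy (pder w f) x y) oS E Sxy.
have hkx := kx (der_of_derivable hx); have hky := ky (der_of_derivable hy).
split; [exact: (@ex_derive _ _ _ _ _ _ _ hkx)|exact: (@ex_derive _ _ _ _ _ _ _ hky)].
Qed.

Lemma pderD k S f g w : open S -> Ck k S f -> Ck k S g -> (size w <= k)%N ->
  forall x y, S (x, y) -> pder w (fun x y => f x y + g x y) x y = pder w f x y + pder w g x y.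
Proof.
move=> oS Cf Cg; elim: w => [//|b w IH] wk x y Sxy /=.
have [h1 h2] := dxy_eq_on oS (IH (ltnW wk)).
have [/(_ wk)[/= fx fy] _] := Cf w (ltnW wk) _ Sxy.
have [/(_ wk)[/= gx gy] _] := Cg w (ltnW wk) _ Sxy.
case: b {wk} => /=; [rewrite h1//|rewrite h2//]; apply: der_derive1; apply: derD; exact: der_of_derivable.
Qed.

Lemma CkD k S f g : open S -> Ck k S f -> Ck k S g -> Ck k S (fun x y => f x y + g x y).
Proof.
move=> oS Cf Cg w wk [x y] Sxy.
have E := pderD oS Cf Cg wk.
have [hf cf] := Cf w wk _ Sxy; have [hg cg] := Cg w wk _ Sxy.
have E' x' y' : S (x', y') -> pder w f x' y' + pder w g x' y' =
    pder w (fun x y => f x y + g x y) x' y' by move/E.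
split; last first.
  apply: (@cont_on_eq _ S (fun x y => pder w f x y + pder w g x y)) => // [[? ?]|z Sz]; first exact: E'.
  by apply: cvgD; [have [] := Cf w wk z Sz|have [] := Cg w wk z Sz].
move=> wk'; have [/= fx fy] := hf wk'; have [/= gx gy] := hg wk'.
have [kx _] := der_eq_on (dx (pder w f) x y + dx (pder w g) x y) oS E' Sxy.
have [_ ky] := der_eq_on (dy (pder w f) x y + dy (pder w g) x y) oS E' Sxy.
by split => /=; apply: ex_derive; [apply: kx|apply: ky]; apply: derD; exact: der_of_derivable.
Qed.

Lemma Ck_swap S f x y : open S -> Ck 2 S f -> S (x, y) ->
  dx (dy f) x y = dy (dx f) x y.
Proof.
move=> oS Cf Sxy; have nS : nbhs (x, y) S by move: oS; rewrite openE; apply.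
apply: der_derive1.
apply: (@schwarz _ f (dx f) (dy f) (dy (dx f))).
- by apply: filterS nS => -[a b] /= /(Ck_der Cf)[].
- have [[/= U V] [/= nU nV] UV] := nS; apply: filterS nU => a Ua /=.
  have /(Ck_der Cf)[] // : S (a, y) by apply: (UV (a, y)); split => //=; exact: nbhs_singleton.
- by apply: filterS nS => -[a b] /= /(Ck_der (Ck_dx Cf))[].
- exact: (Ck_cont (Ck_dy (Ck_dx Cf))) Sxy.
Qed.

Lemma Ck_lap k S f : open S -> Ck k.+2 S f -> Ck k S (lap f).
Proof.
by move=> oS Cf; apply: CkD => //; [exact: Ck_dx (Ck_dx Cf)|exact: Ck_dy (Ck_dy Cf)].
Qed.

Lemma Ck_swap3 S f x y : open S -> Ck 3 S f -> S (x, y) ->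
  dx (dy (dy f)) x y = dy (dy (dx f)) x y /\ dx (dx (dy f)) x y = dy (dx (dx f)) x y.
Proof.
move=> oS Cf Sxy.
have sw a b : S (a, b) -> dx (dy f) a b = dy (dx f) a b.
  by move=> Sab; apply: Ck_swap Sab => //; exact: Ck_le Cf.
have [swx swy] := dxy_eq_on oS sw; split.
  exact: (etrans (Ck_swap oS (Ck_dy Cf) Sxy) (swy _ _ Sxy)).
exact: (etrans (swx _ _ Sxy) (Ck_swap oS (Ck_dx Cf) Sxy)).
Qed.

Lemma der_lap S f x y : open S -> Ck 3 S f -> S (x, y) ->
  is_derive x 1 ((lap f)^~ y) (lap (dx f) x y) /\
  is_derive y 1 (lap f x) (lap (dy f) x y).
Proof.
move=> oS Cf Sxy; have [E1 E2] := Ck_swap3 oS Cf Sxy.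
have Cx := Ck_dx Cf; have Cy := Ck_dy Cf.
split.
  rewrite /lap -E1; apply: derD; first exact: (Ck_derx (Ck_dx Cx)).
  exact: (Ck_derx (Ck_dy Cy)).
rewrite /lap E2; apply: derD; first exact: (Ck_dery (Ck_dx Cx)).
exact: (Ck_dery (Ck_dy Cy)).
Qed.

End Ck_functions.

Section base_flow_facts.
Context {R : realType}.
Variable u0 : R -> R.
Hypothesis bf : base_flow u0.
Let u1 := u0^`()%classic.
Let u2 := u0^`(2)%classic.

Lemma base_der (y : R) : is_derive y 1 u0 (u1 y) /\ is_derive y 1 u1 (u2 y).
Proof.
have h : smooth u0 := base_smooth bf.
split; first by have := h 0%N y; rewrite derive1n0 => /der_of_derivable.
by have := h 1%N y; rewrite /u2 (derive1nS _ 1) !derive1n1 => /der_of_derivable.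
Qed.

Lemma base_cont2 (y : R) : {for y, continuous u2}.
Proof.
have h : smooth u0 := base_smooth bf.
exact: (der_continuous (der_of_derivable (h 2%N y))).
Qed.

Lemma base_cont (y : R) : {for y, continuous u0} /\ {for y, continuous u1}.
Proof. by have [h1 h2] := base_der y; split; [exact: der_continuous h1|exact: der_continuous h2]. Qed.

Lemma base_bounds : exists2 M, 0 < M &
  forall y, 0 <= y <= 1 -> [/\ `|u0 y| <= M, `|u1 y| <= M & `|u2 y| <= M].
Proof.
have bd (f : R -> R) : (forall y, {for y, continuous f}) -> exists M, forall y, 0 <= y <= 1 -> `|f y| <= M.
  move=> cf; have [M hM] : bounded_on `[0, 1] f.
    by apply: bounded_on_continuous => [|? _]; [exact: segment_compact|exact: cf].
  by exists M => y y01; apply: hM; rewrite /= in_itv.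
have [M0 h0] := bd u0 (fun y => (base_cont y).1).
have [M1 h1] := bd u1 (fun y => (base_cont y).2).
have [M2 h2] := bd u2 base_cont2.
exists (Num.max 1 (Num.max M0 (Num.max M1 M2))); first by rewrite lt_max ltr01.
by move=> y y01; rewrite !le_max (h0 _ y01) (h1 _ y01) (h2 _ y01) !orbT; split.
Qed.

Lemma base_ge0 (y : R) : 0 <= y <= 1 -> 0 <= u0 y.
Proof.
move=> /andP[]; rewrite le_eqVlt => /predU1P[<-|y0]; first by rewrite (base_0 bf).
rewrite le_eqVlt => /predU1P[->|y1]; first by rewrite (base_1 bf).
by apply/ltW/(base_pos bf)/andP.
Qed.

Lemma base_kappa : exists2 kap, 0 < kap &
  forall y, 0 <= y <= 1 -> kap <= u1 y ^+ 2 + u0 y ^+ 2.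
Proof.
have [||c c01 hc] := @EVT_min R (fun y => u1 y * u1 y + u0 y * u0 y) 0 1 => //.
  apply: continuous_in_subspaceT => y _.
  have [c0 c1] := base_cont y.
  by apply: cvgD; apply: cvgM; [exact: c1|exact: c1|exact: c0|exact: c0].
exists (u1 c ^+ 2 + u0 c ^+ 2); last by move=> y y01; rewrite !expr2; apply: hc; rewrite in_itv.
move: c01; rewrite in_itv/= => /andP[].
rewrite le_eqVlt => /predU1P[<-|c0].
  by rewrite ltr_pwDl ?sqr_ge0// exprn_gt0// (base_slope_pos bf).
rewrite le_eqVlt => /predU1P[->|c1].
  rewrite ltr_pwDl ?sqr_ge0// exprn_even_gt0//= -oppr_eq0 -(base_slope bf).
  by rewrite gt_eqF// (base_slope_pos bf).
by rewrite ltr_wpDl ?sqr_ge0// exprn_gt0// (base_pos bf)// c0.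
Qed.

Lemma base_wall (e : R) : 0 < e -> exists2 r, 0 < r &
  forall y, 0 <= y <= 1 -> y < r \/ 1 - y < r -> `|u0 y| <= e.
Proof.
move=> e0.
have /cvgrPdist_le/(_ _ e0)/nbhs_ballP[r /= r0 hr] := (base_cont 0).1.
exists r => // y /andP[y0 y1] [yr|yr].
  have := hr y; rewrite /ball/= sub0r normrN ger0_norm// => /(_ yr).
  by rewrite (base_0 bf) sub0r normrN.
have := hr (1 - y); rewrite /ball/= sub0r normrN ger0_norm ?subr_ge0// => /(_ yr).
by rewrite (base_even bf) ?y0// (base_0 bf) sub0r normrN.
Qed.

(** Levels of u0: near the walls there are points c for which [c, 1 - c] lies in
  the superlevel set of u0 c. *)
Lemma base_level (r : R) : 0 < r -> exists c, [/\ 0 < c, c < r, c < 2^-1,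
  u0 c <= r & forall y, c <= y <= 1 - c -> u0 c <= u0 y].
Proof.
move=> r0; pose r' := Num.min r 4^-1.
have r'0 : 0 < r' by rewrite lt_min r0 invr_gt0 ltr0n.
have r'r : r' <= r by rewrite ge_min lexx.
have r'4 : r' <= 4^-1 by rewrite ge_min lexx orbT.
have cu : forall a b, {within `[a, b], continuous u0}.
  by move=> a b; apply: continuous_in_subspaceT => y _; exact: (base_cont y).1.
have [|m mr hm] := @EVT_min R u0 r' (1 - r') _ (cu _ _); first by lra.
have um : 0 < u0 m.
  by move: mr; rewrite in_itv/= => /andP[? ?]; apply: (base_pos bf); apply/andP; split; lra.
have [g g0 hg] := base_wall (e := Num.min r' (u0 m / 2)) ltac:(by rewrite lt_min r'0 divr_gt0).
pose b := Num.min (g / 2) (r' / 2).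
have b0 : 0 < b by rewrite lt_min !divr_gt0.
have bg : b < g by rewrite gt_min ltr_pdivrMr// ltr_pMr// ltr1n.
have br : b <= r' / 2 by rewrite ge_min lexx orbT.
have [|n nb hn] := @EVT_min R u0 b (1 - b) _ (cu _ _); first by lra.
have b01 : 0 <= b <= 1 by apply/andP; split; lra.
have ub : u0 b <= Num.min r' (u0 m / 2).
  by have := hg b b01 (or_introl bg); rewrite ger0_norm// base_ge0.
have nb' := nb; move: nb; rewrite in_itv/= => /andP[nb nb1].
have nb2 : u0 n <= u0 b by apply: hn; rewrite in_itv/= lexx; lra.
have nE : u0 (1 - n) = u0 n by apply: (base_even bf); apply/andP; split; lra.
have nr : ~~ (r' <= n <= 1 - r').
  apply/negP => nr; have := hm n; rewrite in_itv/= => /(_ nr).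
  have : u0 b <= u0 m / 2 by apply: le_trans ub _; rewrite ge_min lexx orbT.
  lra.
have ur : u0 n <= r.
  by apply: le_trans nb2 (le_trans ub _); rewrite ge_min r'r.
have [n2|n2] := leP n 2^-1.
  have nr' : n < r' by move: nr; rewrite negb_and -!ltNge => /orP[//|?]; lra.
  exists n; split => //; [lra|lra|lra|].
  by move=> y /andP[? ?]; apply: hn; rewrite in_itv/=; apply/andP; split; lra.
have nr' : 1 - n < r' by move: nr; rewrite negb_and -!ltNge => /orP[?|?]; lra.
exists (1 - n); split => //; [lra|lra|lra|by rewrite nE|].
by move=> y /andP[? ?]; rewrite nE; apply: hn; rewrite in_itv/=; apply/andP; split; lra.
Qed.

End base_flow_facts.

(** * Integrals over the channel and over its slices *)

Notation IO L f := (\int[leb2 _]_(z in Omega L) (f z.1 z.2)%:E)%E.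

Notation I01 R := (`]0%R, (1 : R)%R[%classic : set R).

Section Omega_integrals.
Context {R : realType}.
Variable L : R.
Implicit Types f g h : R -> R -> R.

Lemma measurable_EFin_cont f : cont_on (Omega L) f ->
  measurable_fun (Omega L) (fun z => (f z.1 z.2)%:E).
Proof. by move=> cf; apply/measurable_EFinP; exact: cont_measurable. Qed.

Lemma IO_ge0 f : (forall x y, Omega L (x, y) -> 0 <= f x y) -> (0 <= IO L f)%E.
Proof. by move=> f0; apply: integral_ge0 => -[x y] /f0; rewrite lee_fin. Qed.

Lemma IO_le f g : cont_on (Omega L) f -> cont_on (Omega L) g ->
  (forall x y, Omega L (x, y) -> 0 <= f x y) ->
  (forall x y, Omega L (x, y) -> f x y <= g x y) -> (IO L f <= IO L g)%E.
Proof.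
move=> cf cg f0 fg; apply: ge0_le_integral_nonmeas => -[x y] Oxy; rewrite lee_fin.
  exact: f0.
exact: fg.
Qed.

Lemma IO_D f g : cont_on (Omega L) f -> cont_on (Omega L) g ->
  (forall x y, Omega L (x, y) -> 0 <= f x y) ->
  (forall x y, Omega L (x, y) -> 0 <= g x y) ->
  IO L (fun x y => f x y + g x y) = (IO L f + IO L g)%E.
Proof.
move=> cf cg f0 g0.
under eq_integral do rewrite EFinD.
apply: ge0_integralD; first exact: measurable_Omega.
- by move=> [x y] /f0; rewrite lee_fin.
- exact: measurable_EFin_cont.
- by move=> [x y] /g0; rewrite lee_fin.
- exact: measurable_EFin_cont.
Qed.

Lemma IO_Z (k : R) f : 0 <= k -> cont_on (Omega L) f ->
  (forall x y, Omega L (x, y) -> 0 <= f x y) ->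
  IO L (fun x y => k * f x y) = (k%:E * IO L f)%E.
Proof.
move=> k0 cf f0; under eq_integral do rewrite EFinM.
apply: ge0_integralZl_EFin => //; first exact: measurable_Omega.
- by move=> [x y] /f0; rewrite lee_fin.
- exact: measurable_EFin_cont.
Qed.

Lemma leb2_Omega : 0 < L -> leb2 R (Omega L) = L%:E.
Proof.
move=> L0; rewrite product_measure1E; try exact: measurable_itv.
have h (a : R) : 0 < a -> leb R `]0, a[ = a%:E.
  by move=> a0; rewrite lebesgue_measure_itv/= lte_fin a0 sube0.
by rewrite -[RHS]mule1; congr (_ * _)%E; exact: h.
Qed.

Lemma IO_lty f : 0 < L -> cont_on (Omega L) f ->
  bounded_on (Omega L) (fun z => f z.1 z.2) -> (IO L f < +oo)%E.
Proof.
move=> L0 cf [M hM]; apply: integrable_lty; first exact: measurable_Omega.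
refine (@bounded_integrable _ _ _ (leb2 R) (Omega L) (fun z => f z.1 z.2) M _ _ _ _) => //.
- exact: measurable_Omega.
- have H : (leb2 R (Omega L) < +oo)%E by rewrite leb2_Omega// ltry.
  exact: H.
- exact: cont_measurable.
Qed.

Lemma IO_iterated f : cont_on (Omega L) f ->
  (forall x y, Omega L (x, y) -> 0 <= f x y) ->
  IO L f = (\int[leb R]_(x in `]0%R, L[) \int[leb R]_(y in (I01 R)) (f x y)%:E)%E /\
  measurable_fun `]0%R, L[ (fun x => \int[leb R]_(y in (I01 R)) (f x y)%:E)%E.
Proof.
move=> cf f0.
have h : (forall z, (`]0, L[ `*` `]0, 1[) z -> (0 <= (f z.1 z.2)%:E)%E).
  by move=> [x y] /f0; rewrite lee_fin.
split.
  by rewrite [LHS]tonelli_setX//; exact: measurable_EFin_cont.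
apply: (@measurable_tonelli_setX _ _ _ _ _ (leb R) _ _ _ _ (fun z => (f z.1 z.2)%:E)) => //.
exact: measurable_EFin_cont.
Qed.

Lemma slice_cont f x : cont_on (Omega L) f -> 0 < x < L ->
  forall y, 0 < y < 1 -> {for y, continuous (f x)}.
Proof. by move=> cf x0 y y0; apply: (cont_on_slice2 cf); apply/OmegaP. Qed.

Lemma slice_measurable f x : cont_on (Omega L) f -> 0 < x < L ->
  measurable_fun (I01 R) (fun y => (f x y)%:E).
Proof.
move=> cf x0; apply/measurable_EFinP; apply: open_continuous_measurable_fun.
  exact: interval_open.
by move=> y; rewrite inE/= in_itv/=; exact: slice_cont.
Qed.

(** Tonelli for a product of a weight k whose slices have mass at most B and of
  a square bounded on each slice by the integral of m over that slice. *)
Lemma slice_product (B : R) k g m : 0 <= B -> cont_on (Omega L) k ->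
  cont_on (Omega L) g -> cont_on (Omega L) m ->
  (forall x y, Omega L (x, y) -> 0 <= k x y) ->
  (forall x y, Omega L (x, y) -> 0 <= m x y) ->
  (forall x, 0 < x < L -> (\int[leb R]_(y in (I01 R)) (k x y)%:E <= B%:E)%E) ->
  (forall x y, Omega L (x, y) ->
    ((g x y ^+ 2)%:E <= \int[leb R]_(r in (I01 R)) (m x r)%:E)%E) ->
  (IO L (fun x y => (k x y * g x y ^+ 2)) <= B%:E * IO L m)%E.
Proof.
move=> B0 ck cg cm k0 m0 kB gm.
have ckg : cont_on (Omega L) (fun x y => k x y * g x y ^+ 2).
  by apply: cont_onM => //; exact: cont_onX.
have [-> mkg] := IO_iterated ckg ltac:(by move=> x y /k0 ?; rewrite mulr_ge0 ?sqr_ge0).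
have [-> mm] := IO_iterated cm m0.
have mO : forall x, 0 < x < L -> (0 <= \int[leb R]_(r in (I01 R)) (m x r)%:E)%E.
  move=> x x0; apply: integral_ge0 => y /=; rewrite in_itv/= lee_fin => y0.
  by apply: m0; apply/OmegaP.
rewrite -ge0_integralZl_EFin//.
apply: ge0_le_integral_nonmeas => x /=; rewrite in_itv/= => x0.
  apply: integral_ge0 => y /=; rewrite in_itv/= lee_fin => y0.
  by rewrite mulr_ge0 ?sqr_ge0// k0//; apply/OmegaP.
apply: (@le_trans _ _ (\int[leb R]_(y in (I01 R))
  ((k x y)%:E * \int[leb R]_(r in (I01 R)) (m x r)%:E))%E).
  apply: ge0_le_integral_nonmeas => y /=; rewrite in_itv/= => y0.
    rewrite lee_fin; rewrite mulr_ge0 ?sqr_ge0// k0//; exact/OmegaP.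
  rewrite EFinM; apply: lee_wpmul2l; first by rewrite lee_fin k0//; exact/OmegaP.
  by apply: gm; apply/OmegaP.
rewrite ge0_integralZr//.
- by apply: lee_wpmul2r; [exact: mO|exact: kB].
- exact: slice_measurable.
- by move=> y /=; rewrite in_itv/= lee_fin => y0; apply: k0; apply/OmegaP.
- exact: mO.
Qed.

End Omega_integrals.

Section slices.
Context {R : realType}.

Lemma slice_diff (g g' : R -> R) (a b : R) : 0 < a < 1 -> 0 < b < 1 ->
  (forall y : R, 0 < y < 1 -> is_derive y 1 g (g' y)) ->
  (forall y : R, 0 < y < 1 -> {for y, continuous g'}) ->
  (((g a - g b) ^+ 2)%:E <= \int[leb R]_(r in (I01 R)) ((g' r) ^+ 2)%:E)%E.
Proof.
wlog ba : a b / b <= a => [th a0 b0 dg cg|].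
  have [ba|/ltW ab] := leP b a; first exact: th.
  by rewrite -sqrrN opprB; exact: th.
move=> /andP[a0 a1] /andP[b0 b1] dg cg.
pose Z := g a - g b.
have sub (y : R) : b <= y <= a -> 0 < y < 1.
  by move=> /andP[by_ ya]; rewrite (lt_le_trans b0 by_) (le_lt_trans ya a1).
have cgi : {within `[b, a], continuous g'}.
  by apply: continuous_in_subspaceT => y; rewrite inE/= in_itv/= => /sub; exact: cg.
have cg2 : {within `[b, a], continuous (fun r => g' r ^+ 2)}.
  apply: continuous_in_subspaceT => y; rewrite inE/= in_itv/= => /sub y0.
  by apply: (@continuous_comp _ _ _ g' (fun u => u ^+ 2)); [exact: cg|exact: exprn_continuous].
have int2 : (leb R).-integrable `[b, a] (EFin \o (fun r => g' r ^+ 2)).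
  by apply: continuous_compact_integrable => //; exact: segment_compact.
have int1 : (leb R).-integrable `[b, a] (EFin \o g').
  by apply: continuous_compact_integrable => //; exact: segment_compact.
have intc (k : R) : (leb R).-integrable `[b, a] (EFin \o (fun=> k)).
  apply: continuous_compact_integrable; first exact: segment_compact.
  by apply: continuous_in_subspaceT => y _; exact: cvg_cst.
have E : \int[leb R]_(r in `[b, a]) g' r = Z.
  by apply: ftc => // y /sub; [exact: dg|exact: cg].
have key : Z ^+ 2 <= \int[leb R]_(r in `[b, a]) (g' r ^+ 2).
  have : \int[leb R]_(r in `[b, a]) ((2 * Z) * g' r) <=
      \int[leb R]_(r in `[b, a]) (g' r ^+ 2 + Z ^+ 2).
    apply: le_Rintegral => //.
    - apply: continuous_compact_integrable; first exact: segment_compact.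
      apply: continuous_in_subspaceT => y; rewrite inE/= in_itv/= => /sub y0.
      by apply: cvgM; [exact: cvg_cst|exact: cg].
    - apply: continuous_compact_integrable; first exact: segment_compact.
      apply: continuous_in_subspaceT => y; rewrite inE/= in_itv/= => /sub y0.
      apply: cvgD; last exact: cvg_cst.
      by apply: (@continuous_comp _ _ _ g' (fun u => u ^+ 2)); [exact: cg|exact: exprn_continuous].
    - move=> y _ ; have := sqr_ge0 (g' y - Z); rewrite sqrrB; lra.
  have Ec : \int[leb R]_(r in `[b, a]) (Z ^+ 2) = Z ^+ 2 * (a - b).
    by rewrite /Rintegral integral_itv_cst.
  rewrite RintegralZl// RintegralD// E Ec.
  have h : Z ^+ 2 * (a - b) <= Z ^+ 2 by rewrite ler_piMr ?sqr_ge0//; lra.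
  move: h; rewrite expr2; lra.
apply: (@le_trans _ _ (\int[leb R]_(r in `[b, a]) (g' r ^+ 2))%:E); first by rewrite lee_fin.
rewrite /Rintegral fineK; last exact: integrable_fin_num.
apply: ge0_subset_integral => //.
- apply/measurable_EFinP; apply: open_continuous_measurable_fun => // y.
  rewrite inE/= in_itv/= => y0.
  by apply: (@continuous_comp _ _ _ g' (fun u => u ^+ 2)); [exact: cg|exact: exprn_continuous].
- by move=> y _; rewrite lee_fin sqr_ge0.
Qed.

Lemma slice_sup (g g' : R -> R) (a : R) : 0 < a < 1 ->
  (forall y : R, 0 < y < 1 -> is_derive y 1 g (g' y)) ->
  (forall y : R, 0 < y < 1 -> {for y, continuous g'}) ->
  (forall eta : R, 0 < eta -> exists2 b : R, 0 < b < 1 & `|g b| <= eta) ->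
  ((g a ^+ 2)%:E <= \int[leb R]_(r in (I01 R)) ((g' r) ^+ 2)%:E)%E.
Proof.
move=> a0 dg cg z; apply/lee_addgt0Pr => e e0.
have [eta eta0 he] : exists2 eta, 0 < eta & 2 * `|g a| * eta <= e.
  have k0 : 0 < 2 * `|g a| + 1 by rewrite ltr_wpDl// mulr_ge0.
  exists (e / (2 * `|g a| + 1)); first by rewrite divr_gt0.
  rewrite mulrCA ler_piMr ?(ltW e0)// ler_pdivrMr// mul1r lerDl//.
have [b b0 gb] := z _ eta0.
apply: (@le_trans _ _ ((g a - g b) ^+ 2 + e)%:E); last first.
  by rewrite EFinD leeD2r//; exact: slice_diff.
rewrite lee_fin sqrrB.
have : `|g a * g b| <= `|g a| * eta by rewrite normrM ler_wpM2l.
rewrite ler_norml => /andP[_ h]; have := sqr_ge0 (g b).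
by rewrite -mulr_natl; lra.
Qed.

Lemma slice_sup_prod (g g' : R -> R) (a : R) : 0 < a < 1 ->
  (forall y : R, 0 < y < 1 -> is_derive y 1 g (g' y)) ->
  (forall y : R, 0 < y < 1 -> {for y, continuous g'}) ->
  (forall eta : R, 0 < eta -> exists2 b : R, 0 < b < 1 & `|g b| <= eta) ->
  ((g a ^+ 2)%:E <= \int[leb R]_(r in (I01 R)) (2 * (`|g r| * `|g' r|))%:E)%E.
Proof.
move=> a0 dg cg z; apply/lee_addgt0Pr => e e0.
have [eta eta0 he] : exists2 eta, 0 < eta & eta ^+ 2 <= e.
  exists (Num.min 1 e); first by rewrite lt_min ltr01.
  rewrite expr2; apply: (@le_trans _ _ (1 * e)); last by rewrite mul1r.
  apply: ler_pM; rewrite ?le_min ?ler01 ?(ltW e0)//.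
    by rewrite ge_min lexx.
  by rewrite ge_min lexx orbT.
have [b b0 gb] := z _ eta0.
pose h y := 2 * (g y * g' y).
have dg2 (y : R) : 0 < y < 1 -> is_derive y 1 (fun y => g y ^+ 2) (h y).
  move=> /dg d; have := derX 1 d; rewrite /h expr1 => dd.
  by apply: (is_derive_eq dd); rewrite mulrA.
have cgg (y : R) : 0 < y < 1 -> {for y, continuous g}.
  by move=> /dg; exact: der_continuous.
have ch (y : R) : 0 < y < 1 -> {for y, continuous h}.
  move=> y0; apply: cvgM; first exact: cvg_cst.
  by apply: cvgM; [exact: cgg|exact: cg].
have cH (y : R) : 0 < y < 1 -> {for y, continuous (fun r => 2 * (`|g r| * `|g' r|))}.
  move=> y0; apply: cvgM; first exact: cvg_cst.
  by apply: cvgM; apply: cvg_norm; [exact: cgg|exact: cg].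
have le_seg (p q : R) : p <= q -> 0 < p < 1 -> 0 < q < 1 ->
   (`|g q ^+ 2 - g p ^+ 2|%:E <= \int[leb R]_(r in (I01 R)) (2 * (`|g r| * `|g' r|))%:E)%E.
  move=> pq /andP[p0 p1] /andP[q0 q1].
  have sub (y : R) : p <= y <= q -> 0 < y < 1.
    by move=> /andP[py yq]; rewrite (lt_le_trans p0 py) (le_lt_trans yq q1).
  have inth : (leb R).-integrable `[p, q] (EFin \o h).
    apply: continuous_compact_integrable; first exact: segment_compact.
    by apply: continuous_in_subspaceT => y; rewrite inE/= in_itv/= => /sub; exact: ch.
  have <- : \int[leb R]_(r in `[p, q]) h r = g q ^+ 2 - g p ^+ 2.
    by apply: (@ftc _ (fun y => g y ^+ 2) h) => // y /sub; [exact: dg2|exact: ch].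
  rewrite EFin_normr_Rintegral//.
  have mh : measurable_fun `[p, q] (EFin \o h) by exact: measurable_int inth.
  have mI : measurable (`[p, q]%classic : set R) by exact: measurable_itv.
  have := le_abse_integral (leb R) mI mh.
  move=> /le_trans; apply.
  have -> : (\int[leb R]_(x in `[p, q]) `|(h x)%:E| =
      \int[leb R]_(r in `[p, q]) (2 * (`|g r| * `|g' r|))%:E)%E.
    by apply: eq_integral => r _ /=; rewrite /h !normrM ger0_norm.
  apply: ge0_subset_integral => //.
  - apply/measurable_EFinP; apply: open_continuous_measurable_fun => // y.
    by rewrite inE/= in_itv/=; exact: cH.
have {}le_seg : (`|g a ^+ 2 - g b ^+ 2|%:E <=
    \int[leb R]_(r in (I01 R)) (2 * (`|g r| * `|g' r|))%:E)%E.
  have [ab|/ltW ba] := leP a b; last exact: le_seg.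
  by rewrite distrC; exact: le_seg.
apply: (@le_trans _ _ (`|g a ^+ 2 - g b ^+ 2| + e)%:E); last first.
  by rewrite EFinD leeD2r.
rewrite lee_fin.
have : g b ^+ 2 <= e by apply: le_trans he; exact: sqr_le_of_norm.
have := ler_norm (g a ^+ 2 - g b ^+ 2); lra.
Qed.

End slices.

(** * Elliptic estimates for stream functions *)

Lemma cont_onV (R : realType) (S : set (R * R)) (f : R -> R -> R) :
  (forall z, S z -> f z.1 z.2 != 0) -> cont_on S f ->
  cont_on S (fun x y => (f x y)^-1).
Proof. by move=> f0 cf z Sz; apply: cvgV; [exact: f0|exact: cf]. Qed.

Lemma vanishes_eq (R : realType) T (S : set T) (dist f g : T -> R) :
  (forall z, S z -> f z = g z) -> vanishes S dist f -> vanishes S dist g.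
Proof.
by move=> fg v eta /v[r r0 h]; exists r => // z Sz; rewrite -fg//; exact: h.
Qed.

Lemma vanishes0 (R : realType) T (S : set T) (dist : T -> R) : vanishes S dist (fun=> 0).
Proof. by move=> eta eta0; exists 1 => // z _ _; rewrite normr0 ltW. Qed.

(** Stream functions: the regularity up to the boundary and the vanishing traces
  that the elliptic estimates use. *)
Record stream (R : realType) (L : R) (f : R -> R -> R) : Prop := Stream {
  st_reg : Ck 4 (Omega L) f;
  st_bd : forall w, (size w <= 2)%N -> bounded_on (Omega L) (fun z => pder w f z.1 z.2);
  st_W : vanishes (Omega L) (fun z => z.1) (fun z => f z.1 z.2);
  st_S : vanishes (Omega L) (fun z => z.2) (fun z => f z.1 z.2);
  st_N : vanishes (Omega L) (fun z => 1 - z.2) (fun z => f z.1 z.2);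
  st_xE : vanishes (Omega L) (fun z => L - z.1) (fun z => dx f z.1 z.2);
  st_xS : vanishes (Omega L) (fun z => z.2) (fun z => dx f z.1 z.2);
  st_xN : vanishes (Omega L) (fun z => 1 - z.2) (fun z => dx f z.1 z.2);
  st_yyW : vanishes (Omega L) (fun z => z.1) (fun z => dy (dy f) z.1 z.2)
}.

Lemma cont_on_x (R : realType) (S : set (R * R)) : cont_on S (fun x _ => x).
Proof. by apply: (@cont_on_fst _ _ (fun x => x)) => z _; exact: cvg_id. Qed.

Lemma cont_on_y (R : realType) (S : set (R * R)) : cont_on S (fun _ y => y).
Proof. by apply: (@cont_on_snd _ _ (fun y => y)) => z _; exact: cvg_id. Qed.

(* Continuity of polynomial expressions in functions that are continuous by
  hypothesis.  Matching is syntactic: unification would unfold derivatives. *)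
Ltac cont :=
  lazymatch goal with
  | |- cont_on _ (fun _ _ => ?c) => exact: cont_on_cst
  | |- cont_on _ (fun x _ => x) => exact: cont_on_x
  | |- cont_on _ (fun _ y => y) => exact: cont_on_y
  | |- cont_on ?S (fun x y => @?a x y + @?b x y) =>
      apply: (@cont_onD _ S a b); cont
  | |- cont_on ?S (fun x y => - @?a x y) => apply: (@cont_onN _ S a); cont
  | |- cont_on ?S (fun x y => @?a x y ^+ ?n) => apply: (@cont_onX _ S a n); cont
  | |- cont_on ?S (fun x y => @?a x y * @?b x y) =>
      apply: (@cont_onM _ S a b); cont
  | |- cont_on ?S (fun x y => (@?a x y)^-1) =>
      match goal with H : cont_on S (fun x y => (@?b x y)^-1) |- _ => exact H end
  | |- cont_on ?S (fun x y => ?h x y) =>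
      match goal with H : cont_on S h |- _ => exact H end
  | |- cont_on ?S (fun x y => ?k y) =>
      match goal with H : cont_on S (fun _ => k) |- _ => exact H end
  | |- cont_on ?S ?h => match goal with H : cont_on S h |- _ => exact H end
  end.

Lemma hessian_ge (R : realType) (a b c : R) :
  b ^+ 2 <= a ^+ 2 + 2 * b ^+ 2 + c ^+ 2 /\ c ^+ 2 <= a ^+ 2 + 2 * b ^+ 2 + c ^+ 2.
Proof.
by have := sqr_ge0 a; have := sqr_ge0 b; have := sqr_ge0 c; split; lra.
Qed.

Section elliptic_estimates.
Context {R : realType}.
Variables (u0 : R -> R) (L kap M : R) (f : R -> R -> R).
Hypothesis bf : base_flow u0.
Hypotheses (L0 : 0 < L) (L1 : L <= 1).
Hypothesis sf : stream L f.
Let u1 := u0^`()%classic.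
Let u2 := u0^`(2)%classic.
Hypothesis kap0 : 0 < kap.
Hypothesis hkap : forall y : R, 0 <= y <= 1 -> kap <= u1 y ^+ 2 + u0 y ^+ 2.
Hypothesis M0 : 0 < M.
Hypothesis hM : forall y : R, 0 <= y <= 1 -> [/\ `|u0 y| <= M, `|u1 y| <= M & `|u2 y| <= M].

Let oO := @open_Omega R L.
Let C4 := st_reg sf.
Let C3 : Ck 3 (Omega L) f := Ck_le (isT : (3 <= 4)%N) C4.
Let Cx : Ck 3 (Omega L) (dx f) := Ck_dx C4.
Let Cy : Ck 3 (Omega L) (dy f) := Ck_dy C4.
Let Cw : Ck 2 (Omega L) (lap f) := Ck_lap oO C4.
Let cf : cont_on (Omega L) f := Ck_cont C4.
Let cx : cont_on (Omega L) (dx f) := Ck_cont Cx.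
Let cy : cont_on (Omega L) (dy f) := Ck_cont Cy.
Let cxx : cont_on (Omega L) (dx (dx f)) := Ck_cont (Ck_dx Cx).
Let cxy : cont_on (Omega L) (dy (dx f)) := Ck_cont (Ck_dy Cx).
Let cyy : cont_on (Omega L) (dy (dy f)) := Ck_cont (Ck_dy Cy).
Let cxyy : cont_on (Omega L) (dy (dy (dx f))) := Ck_cont (Ck_dy (Ck_dy Cx)).
Let cw : cont_on (Omega L) (lap f) := Ck_cont Cw.
Let cwy : cont_on (Omega L) (dy (lap f)) := Ck_cont (Ck_dy Cw).

Lemma Omega_y x y : Omega L (x, y) -> 0 <= y <= 1.
Proof. by move=> /OmegaP[_ /andP[? ?]]; rewrite !ltW. Qed.

Lemma Omega_u0 x y : Omega L (x, y) -> 0 < u0 y.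
Proof. by move=> /OmegaP[_ y0]; exact: base_pos bf _ y0. Qed.

Let cu0 : cont_on (Omega L) (fun=> u0).
Proof. by apply: cont_on_snd => z _; exact: (base_cont bf z.2).1. Qed.
Let cu1 : cont_on (Omega L) (fun=> u1).
Proof. by apply: cont_on_snd => z _; exact: (base_cont bf z.2).2. Qed.
Let cu2 : cont_on (Omega L) (fun=> u2).
Proof. by apply: cont_on_snd => z _; exact: (base_cont2 bf). Qed.

Lemma bounded_lap : bounded_on (Omega L) (fun z => lap f z.1 z.2).
Proof.
by apply: bounded_onD; [exact: (st_bd sf (w := [:: true; true]))
  |exact: (st_bd sf (w := [:: false; false]))].
Qed.

Lemma IO_vort_lty : (IO L (fun x y => (lap f x y ^+ 2)) < +oo)%E.
Proof.
apply: (@IO_lty _ _ (fun x y => lap f x y ^+ 2)); [exact: L0|by cont|].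
have [N hN] := bounded_lap; exists (N ^+ 2) => z /hN h.
by rewrite ger0_norm ?sqr_ge0//; exact: sqr_le_of_norm.
Qed.

Lemma hessian_le_vort :
  (IO L (fun x y => (dx (dx f) x y ^+ 2 + 2 * dy (dx f) x y ^+ 2 + dy (dy f) x y ^+ 2)) <=
   IO L (fun x y => (lap f x y ^+ 2)))%E.
Proof.
pose F x y := - (2 * (dx f x y * dy (dy f) x y)).
pose Fx x y := - (2 * (dx (dx f) x y * dy (dy f) x y + dx f x y * dy (dy (dx f)) x y)).
pose G x y := 2 * (dx f x y * dy (dx f) x y).
pose Gy x y := 2 * (dy (dx f) x y * dy (dx f) x y + dx f x y * dy (dy (dx f)) x y).
apply: (@divergence_inequality _ L L0
  (fun x y => dx (dx f) x y ^+ 2 + 2 * dy (dx f) x y ^+ 2 + dy (dy f) x y ^+ 2)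
  (fun x y => lap f x y ^+ 2) F Fx G Gy L1).
- by move=> x y _ /=; rewrite addr_ge0 ?sqr_ge0// addr_ge0 ?sqr_ge0// mulr_ge0 ?sqr_ge0.
- by move=> x y _; rewrite sqr_ge0.
- by cont.
- by cont.
- by rewrite /F; cont.
- by rewrite /Fx; cont.
- by rewrite /G; cont.
- by rewrite /Gy; cont.
- move=> x y Oxy; have [E _] := Ck_swap3 oO C3 Oxy.
  have d1 := Ck_derx Cx Oxy; have d2 := Ck_derx (Ck_dy Cy) Oxy; rewrite E in d2.
  have := derN (derM (der_cst 2 x) (derM d1 d2)).
  by rewrite mul0r add0r.
- move=> x y Oxy.
  have d1 := Ck_dery Cx Oxy; have d2 := Ck_dery (Ck_dy Cx) Oxy.
  have := derM (der_cst 2 y) (derM d1 d2).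
  by rewrite mul0r add0r.
- move=> x y _; rewrite /Fx /Gy /lap.
  rewrite le_eqVlt; apply/orP; left; apply/eqP.
  generalize (dx (dx f) x y) (dy (dy f) x y) (dy (dx f) x y) (dx f x y)
    (dy (dy (dx f)) x y) => a b c d e; ring.
- apply: vanishesN; apply: vanishesMl; last exact: bounded_on_cst.
  apply: vanishesMl; first exact: st_yyW sf.
  exact: (st_bd sf (w := [:: true])).
- apply: vanishesN; apply: vanishesMl; last exact: bounded_on_cst.
  apply: vanishesMr; first exact: st_xE sf.
  exact: (st_bd sf (w := [:: false; false])).
- apply: vanishesMl; last exact: bounded_on_cst.
  apply: vanishesMr; first exact: st_xS sf.
  exact: (st_bd sf (w := [:: false; true])).
- apply: vanishesMl; last exact: bounded_on_cst.
  apply: vanishesMr; first exact: st_xN sf.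
  exact: (st_bd sf (w := [:: false; true])).
Qed.

Lemma mixed_le_vort : (IO L (fun x y => (dy (dx f) x y ^+ 2)) <=
   IO L (fun x y => (lap f x y ^+ 2)))%E.
Proof.
apply: le_trans _ hessian_le_vort.
apply: (@IO_le _ L (fun x y => dy (dx f) x y ^+ 2)
  (fun x y => dx (dx f) x y ^+ 2 + 2 * dy (dx f) x y ^+ 2 + dy (dy f) x y ^+ 2));
  [by cont|by cont| |] => x y _ /=.
  exact: sqr_ge0.
exact: (hessian_ge _ _ _).1.
Qed.

Lemma normal_le_vort : (IO L (fun x y => (dy (dy f) x y ^+ 2)) <=
   IO L (fun x y => (lap f x y ^+ 2)))%E.
Proof.
apply: le_trans _ hessian_le_vort.
apply: (@IO_le _ L (fun x y => dy (dy f) x y ^+ 2)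
  (fun x y => dx (dx f) x y ^+ 2 + 2 * dy (dx f) x y ^+ 2 + dy (dy f) x y ^+ 2));
  [by cont|by cont| |] => x y _ /=.
  exact: sqr_ge0.
exact: (hessian_ge _ _ _).2.
Qed.

Lemma shifted_gradient_le (s : R) : 0 < s ->
  (IO L (fun x y => (2^-1 * (dx f x y ^+ 2 + dy f x y ^+ 2))) <=
   IO L (fun x y => (gradC kap M / 2 * ((u0 y + s) * lap f x y) ^+ 2)))%E.
Proof.
move=> s0; have C0 := gradC_gt0 M kap0.
pose b := 2 / (kap * gradC kap M); pose c := 2 * hardyC kap M.
pose g y := - u1 y / (u0 y + s) + c * y.
pose gy y := - u2 y / (u0 y + s) + u1 y ^+ 2 / (u0 y + s) ^+ 2 + c.
have v0 x y : Omega L (x, y) -> u0 y + s != 0.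
  by move=> /Omega_u0 h; rewrite gt_eqF// addr_gt0.
have civ : cont_on (Omega L) (fun x y => (u0 y + s)^-1).
  by apply: (@cont_onV _ _ (fun x y => u0 y + s)) => [[x y]|]; [exact: v0|cont].
have cg : cont_on (Omega L) (fun=> g) by rewrite /g; cont.
have cgy : cont_on (Omega L) (fun=> gy).
  apply: (@cont_on_eq _ _ (fun x y => - u2 y / (u0 y + s) + u1 y ^+ 2 * (u0 y + s)^-1 ^+ 2 + c)) => //.
    by move=> z _; rewrite /gy exprVn.
  by cont.
have dg x y : Omega L (x, y) -> is_derive y 1 g (gy y).
  move=> Oxy; have [d0 d1] := base_der bf y.
  have dv := @derV _ (fun y => u0 y + s) _ _ (v0 _ _ Oxy) (derD d0 (der_cst s y)).
  have := derD (derM (derN d1) dv) (derM (der_cst c y) (der_id y)).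
  move=> d; apply: (is_derive_eq d); rewrite /gy addr0 mul0r add0r mulr1.
  congr (_ + _ + _); by rewrite mulrA mulrNN expr2.
pose F x y := f x y * dx f x y.
pose Fx x y := dx f x y * dx f x y + f x y * dx (dx f) x y.
pose G x y := f x y * dy f x y + b * (g y * f x y ^+ 2).
pose Gy x y := dy f x y * dy f x y + f x y * dy (dy f) x y +
  b * (gy y * f x y ^+ 2 + g y * (2 * f x y * dy f x y)).
have bg : bounded_on (Omega L) (fun z => g z.2).
  exists (M / s + `|c|) => -[x y] /= Oxy.
  apply: le_trans (ler_normD _ _) _; apply: lerD.
    rewrite normrM normrN normfV; have [_ h _] := hM (Omega_y Oxy).
    apply: ler_pM => //; rewrite lef_pV2 ?posrE//.
      by rewrite ger0_norm ?lerDr ?addr_ge0 ?(ltW s0)// ltW// (Omega_u0 Oxy).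
    by rewrite normr_gt0; exact: v0 Oxy.
  rewrite normrM ler_piMr// ger0_norm; by have /andP[] := Omega_y Oxy.
have vG (dist : R * R -> R) : vanishes (Omega L) dist (fun z => f z.1 z.2) ->
    vanishes (Omega L) dist (fun z => G z.1 z.2).
  move=> vf.
  apply: (@vanishes_eq _ _ _ _ (fun z => f z.1 z.2 *
    (dy f z.1 z.2 + b * (g z.2 * f z.1 z.2)))).
    by move=> z _; rewrite /G; ring.
  apply: vanishesMr => //; apply: bounded_onD.
    exact: (st_bd sf (w := [:: false])).
  apply: bounded_onM; first exact: bounded_on_cst.
  by apply: bounded_onM => //; exact: (st_bd sf (w := [::])).
apply: (@divergence_inequality _ L L0
  (fun x y => 2^-1 * (dx f x y ^+ 2 + dy f x y ^+ 2))
  (fun x y => gradC kap M / 2 * ((u0 y + s) * lap f x y) ^+ 2) F Fx G Gy L1).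
- by move=> x y _; rewrite mulr_ge0 ?invr_ge0 ?addr_ge0 ?sqr_ge0.
- by move=> x y _; rewrite mulr_ge0 ?sqr_ge0// divr_ge0// ltW.
- by cont.
- by cont.
- by rewrite /F; cont.
- by rewrite /Fx; cont.
- by rewrite /G; cont.
- by rewrite /Gy; cont.
- by move=> x y Oxy; exact: (derM (Ck_derx C4 Oxy) (Ck_derx Cx Oxy)).
- move=> x y Oxy.
  have d1 := derM (Ck_dery C4 Oxy) (Ck_dery Cy Oxy).
  have d2 := derM (dg _ _ Oxy) (derX 1 (Ck_dery C4 Oxy)).
  have := derD d1 (derM (der_cst b y) d2).
  by rewrite mul0r add0r expr1.
- move=> x y Oxy; have [_ h1 h2] := hM (Omega_y Oxy).
  have := @grad_pointwise R kap M (u0 y) (u1 y) (u2 y) s (f x y) (dx f x y) (dy f x y)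
    (lap f x y) y kap0 (hkap (Omega_y Oxy)) h1 h2 (ltW (Omega_u0 Oxy)) s0 (Omega_y Oxy).
  move=> /le_trans; apply; rewrite -/b -/c -/(g y) -/(gy y) /Fx /Gy /lap.
  rewrite le_eqVlt; apply/orP; left; apply/eqP; ring.
- apply: vanishesMr; first exact: st_W sf.
  exact: (st_bd sf (w := [:: true])).
- apply: vanishesMl; first exact: st_xE sf.
  exact: (st_bd sf (w := [::])).
- by apply: vG; exact: st_S sf.
- by apply: vG; exact: st_N sf.
Qed.

Lemma gradient_le :
  (IO L (fun x y => (dx f x y ^+ 2 + dy f x y ^+ 2)) <=
   (2 * gradC kap M)%:E * IO L (fun x y => ((u0 y * lap f x y) ^+ 2)))%E.
Proof.
have C0 := gradC_gt0 M kap0.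
have hfin := IO_vort_lty; have h0 := @IO_ge0 _ L (fun x y => lap f x y ^+ 2) (fun x y _ => sqr_ge0 _).
set h := IO L (fun x y => lap f x y ^+ 2) in hfin h0 *.
have hE : h = (fine h)%:E by rewrite fineK// ge0_fin_numE.
have hh0 : 0 <= fine h by exact: fine_ge0.
apply/lee_addgt0Pr => e e0.
have [s s0 he] : exists2 s, 0 < s & 2 * gradC kap M * s ^+ 2 * fine h <= e.
  have K0 : 0 <= 2 * gradC kap M by apply: mulr_ge0 => //; exact: ltW.
  have Kh : 0 <= 2 * gradC kap M * fine h by exact: mulr_ge0.
  have k0 : 0 < 2 * gradC kap M * fine h + 1 by rewrite ltr_wpDl.
  exists (Num.min 1 (e / (2 * gradC kap M * fine h + 1))).
    by rewrite lt_min ltr01 divr_gt0.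
  set s := Num.min _ _.
  have s1 : s <= 1 by rewrite ge_min lexx.
  have se : s <= e / (2 * gradC kap M * fine h + 1) by rewrite ge_min lexx orbT.
  have s0 : 0 <= s by rewrite le_min ler01 divr_ge0// ltW.
  rewrite mulrAC; apply: (@le_trans _ _ (2 * gradC kap M * fine h * s)).
    by apply: ler_wpM2l => //; rewrite expr2 ler_piMl.
  apply: (@le_trans _ _ ((2 * gradC kap M * fine h + 1) * s)).
    by rewrite ler_wpM2r// lerDl.
  by rewrite mulrC -ler_pdivlMr.
have cg : cont_on (Omega L) (fun x y => dx f x y ^+ 2 + dy f x y ^+ 2) by cont.
have cuw : cont_on (Omega L) (fun x y => (u0 y * lap f x y) ^+ 2) by cont.
have cws : cont_on (Omega L) (fun x y => lap f x y ^+ 2) by cont.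
have g0 x y : Omega L (x, y) -> 0 <= dx f x y ^+ 2 + dy f x y ^+ 2.
  by move=> _; rewrite addr_ge0 ?sqr_ge0.
have uw0 x y : Omega L (x, y) -> 0 <= (u0 y * lap f x y) ^+ 2.
  by move=> _; exact: sqr_ge0.
have ws0 x y : Omega L (x, y) -> 0 <= lap f x y ^+ 2.
  by move=> _; exact: sqr_ge0.
have Cs0 : 0 <= gradC kap M * s ^+ 2.
  by apply: mulr_ge0; [exact: ltW|exact: sqr_ge0].
have C20 : 0 <= gradC kap M / 2 by rewrite divr_ge0// ltW.
have i20 : 0 <= 2^-1 :> R by rewrite invr_ge0.
have sh := shifted_gradient_le s0.
rewrite (IO_Z i20 cg g0) in sh.
have sh2 : (IO L (fun x y => (gradC kap M / 2 * ((u0 y + s) * lap f x y) ^+ 2)) <=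
   IO L (fun x y => (gradC kap M * (u0 y * lap f x y) ^+ 2 +
      gradC kap M * s ^+ 2 * lap f x y ^+ 2)))%E.
  apply: (@IO_le _ L (fun x y => (gradC kap M / 2 * ((u0 y + s) * lap f x y) ^+ 2))
     (fun x y => (gradC kap M * (u0 y * lap f x y) ^+ 2 +
      gradC kap M * s ^+ 2 * lap f x y ^+ 2))); [by cont|by cont| |] => x y _.
    by apply: mulr_ge0 => //; exact: sqr_ge0.
  have -> : gradC kap M * (u0 y * lap f x y) ^+ 2 + gradC kap M * s ^+ 2 * lap f x y ^+ 2
    = gradC kap M / 2 * (((u0 y + s) * lap f x y) ^+ 2 + ((u0 y - s) * lap f x y) ^+ 2).
    by field.
  by apply: ler_wpM2l => //; rewrite lerDl sqr_ge0.
have cC : cont_on (Omega L) (fun x y => gradC kap M * (u0 y * lap f x y) ^+ 2) by cont.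
have cCs : cont_on (Omega L) (fun x y => gradC kap M * s ^+ 2 * lap f x y ^+ 2) by cont.
have pC x y : Omega L (x, y) -> 0 <= gradC kap M * (u0 y * lap f x y) ^+ 2.
  by move=> _; apply: mulr_ge0; [exact: ltW|exact: sqr_ge0].
have pCs x y : Omega L (x, y) -> 0 <= gradC kap M * s ^+ 2 * lap f x y ^+ 2.
  by move=> _; apply: mulr_ge0 => //; exact: sqr_ge0.
rewrite (IO_D cC cCs pC pCs) (IO_Z (ltW C0) cuw uw0) (IO_Z Cs0 cws ws0) in sh2.
have {sh sh2} := le_trans sh sh2.
rewrite -/h hE => sh.
have {sh} := lee_wpmul2l (x := 2%:E) (ltac:(by rewrite lee_fin)) sh.
rewrite muleA -EFinM divff// mul1e => /le_trans; apply.
rewrite ge0_muleDr; last 2 first.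
- by apply: mule_ge0; [rewrite lee_fin ltW|
    exact: (@IO_ge0 _ L (fun x y => (u0 y * lap f x y) ^+ 2))].
- by apply: mule_ge0; rewrite lee_fin.
rewrite muleA -EFinM leeD2l// -!EFinM lee_fin.
by move: he; rewrite -!mulrA.
Qed.

Lemma vort_interpolation (s : R) : 0 < s <= 1 ->
  (IO L (fun x y => (lap f x y ^+ 2)) <=
   (vortC kap M)%:E * (s%:E * IO L (fun x y => (u0 y * dy (lap f) x y ^+ 2)) +
     (s ^- 2)%:E * IO L (fun x y => ((u0 y * lap f x y) ^+ 2))))%E.
Proof.
move=> /[dup] s01 /andP[s0 s1]; have V0 := vortC_ge0 M kap0.
pose q y := s * (u1 y * u0 y / (u0 y + s)).
pose qy y := s * (u2 y * u0 y / (u0 y + s)) + s ^+ 2 * u1 y ^+ 2 / (u0 y + s) ^+ 2.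
have v0 x y : Omega L (x, y) -> u0 y + s != 0.
  by move=> /Omega_u0 h; rewrite gt_eqF// addr_gt0.
have civ : cont_on (Omega L) (fun x y => (u0 y + s)^-1).
  by apply: (@cont_onV _ _ (fun x y => u0 y + s)) => [[x y]|]; [exact: v0|cont].
have cq : cont_on (Omega L) (fun=> q) by rewrite /q; cont.
have cqy : cont_on (Omega L) (fun=> qy).
  apply: (@cont_on_eq _ _ (fun x y => s * (u2 y * u0 y / (u0 y + s)) + s ^+ 2 * u1 y ^+ 2 * (u0 y + s)^-1 ^+ 2)) => //.
    by move=> z _; rewrite /qy exprVn.
  by cont.
have dq x y : Omega L (x, y) -> is_derive y 1 q (qy y).
  move=> Oxy; have [d0 d1] := base_der bf y.
  have dv := @derV _ (fun y => u0 y + s) _ _ (v0 _ _ Oxy) (derD d0 (der_cst s y)).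
  have := derM (der_cst s y) (derM (derM d1 d0) dv).
  move=> d; apply: (is_derive_eq d); rewrite /qy -/u1 -/(u2 y).
  have := v0 _ _ Oxy; generalize (u0 y) (u1 y) (u2 y) => a b e h.
  by field.
have k0 : 0 <= 16 / kap by rewrite divr_ge0// ltW.
pose G x y := 16 / kap * (q y * lap f x y ^+ 2).
pose Gy x y := 16 / kap * (qy y * lap f x y ^+ 2 + q y * (2 * lap f x y * dy (lap f) x y)).
have vq (dist : R * R -> R) : (forall r : R, 0 < r -> forall x y, Omega L (x, y) ->
     dist (x, y) < r -> y < r \/ 1 - y < r) ->
    vanishes (Omega L) dist (fun z => G z.1 z.2).
  move=> hd; apply: vanishesMl; last exact: bounded_on_cst.
  apply: vanishesMr; last first.
    have [N hN] := bounded_lap; exists (N ^+ 2) => z /hN h.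
    by rewrite ger0_norm ?sqr_ge0//; exact: sqr_le_of_norm.
  move=> eta eta0.
  have [r r0 hr] := base_wall bf (e := eta / M) ltac:(by rewrite divr_gt0).
  exists r => // -[x y] Oxy /(hd _ r0 _ _ Oxy) /(hr _ (Omega_y Oxy)) /= uy.
  have [_ h1 _] := hM (Omega_y Oxy); have u00 := Omega_u0 Oxy.
  have -> : q y = u1 y * u0 y * (s / (u0 y + s)) by rewrite /q; ring.
  have sv : `|s / (u0 y + s)| <= 1.
    rewrite ger0_norm ?divr_ge0 ?addr_ge0 ?(ltW s0) ?(ltW u00)//.
    by rewrite ler_pdivrMr ?addr_gt0// mul1r lerDr ltW.
  rewrite normrM -[eta]mulr1 ler_pM// normrM -[eta](divfK (lt0r_neq0 M0)) mulrC.
  by rewrite ler_pM.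
have si0 : 0 <= s ^- 2 by rewrite invr_ge0 exprn_ge0// ltW.
have c1 : cont_on (Omega L) (fun x y => u0 y * dy (lap f) x y ^+ 2) by cont.
have c2 : cont_on (Omega L) (fun x y => (u0 y * lap f x y) ^+ 2) by cont.
have p1 x y : Omega L (x, y) -> 0 <= u0 y * dy (lap f) x y ^+ 2.
  by move=> /Omega_u0/ltW u00; apply: mulr_ge0 => //; exact: sqr_ge0.
have p2 x y : Omega L (x, y) -> 0 <= (u0 y * lap f x y) ^+ 2.
  by move=> _; exact: sqr_ge0.
have c3 : cont_on (Omega L) (fun x y => s * (u0 y * dy (lap f) x y ^+ 2)) by cont.
have c4 : cont_on (Omega L) (fun x y => s ^- 2 * (u0 y * lap f x y) ^+ 2) by cont.
have p3 x y : Omega L (x, y) -> 0 <= s * (u0 y * dy (lap f) x y ^+ 2).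
  by move=> /p1; apply: mulr_ge0; exact: ltW.
have p4 x y : Omega L (x, y) -> 0 <= s ^- 2 * (u0 y * lap f x y) ^+ 2.
  by move=> /p2; exact: mulr_ge0.
have p5 x y : Omega L (x, y) -> 0 <= s * (u0 y * dy (lap f) x y ^+ 2) + s ^- 2 * (u0 y * lap f x y) ^+ 2.
  by move=> Oxy; apply: addr_ge0; [exact: p3|exact: p4].
rewrite -(IO_Z (ltW s0) c1 p1) -(IO_Z si0 c2 p2) -(IO_D c3 c4 p3 p4).
rewrite -(IO_Z V0 (cont_onD c3 c4) p5).
apply: (@divergence_inequality _ L L0 (fun x y => lap f x y ^+ 2)
  (fun x y => vortC kap M * (s * (u0 y * dy (lap f) x y ^+ 2) +
     s ^- 2 * (u0 y * lap f x y) ^+ 2)) (fun=> fun=> 0) (fun=> fun=> 0) G Gy L1).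
- by move=> x y _; exact: sqr_ge0.
- by move=> x y /p5; exact: mulr_ge0.
- by cont.
- by cont.
- by cont.
- by cont.
- by rewrite /G; cont.
- by rewrite /Gy; cont.
- by move=> x y _; exact: der_cst.
- move=> x y Oxy.
  have d := derM (der_cst (16 / kap) y) (derM (dq _ _ Oxy) (derX 1 (Ck_dery Cw Oxy))).
  by apply: (is_derive_eq d); rewrite mul0r add0r expr1.
- move=> x y Oxy; have [_ h1 h2] := hM (Omega_y Oxy); rewrite addr0.
  exact: (@vort_pointwise R kap M (u0 y) (u1 y) (u2 y) s (lap f x y) (dy (lap f) x y)
    kap0 (hkap (Omega_y Oxy)) h1 h2 (ltW (Omega_u0 Oxy)) s01).
- exact: vanishes0.
- exact: vanishes0.
- by apply: vq => r _ x y _ /=; left.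
- by apply: vq => r _ x y _ /=; right.
Qed.

Lemma dx_slice_sup x y : Omega L (x, y) ->
  ((dx f x y ^+ 2)%:E <= \int[leb R]_(r in (I01 R)) (dy (dx f) x r ^+ 2)%:E)%E.
Proof.
move=> /OmegaP[x0 y0].
apply: (@slice_sup _ (dx f x) (dy (dx f) x)); [exact: y0|move=> r r0|move=> r r0|move=> eta eta0].
- by apply: (Ck_dery Cx); apply/OmegaP.
- exact: (slice_cont cxy).
have [rho rho0 h] := st_xS sf eta0.
exists (Num.min (rho / 2) 2^-1).
  apply/andP; split; first by rewrite lt_min divr_gt0//= invr_gt0.
  by rewrite gt_min invf_lt1// ltr1n orbT.
apply: (h (x, _)).
  apply/OmegaP; split=> //; apply/andP; split.
    by rewrite lt_min divr_gt0//= invr_gt0.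
  by rewrite gt_min invf_lt1// ltr1n orbT.
by rewrite /= gt_min ltr_pdivrMr// ltr_pMr// ltr1n.
Qed.

Lemma dy_almost_zero (x eta : R) : 0 < x < L -> 0 < eta ->
  exists2 b : R, 0 < b < 1 & `|dy f x b| <= eta.
Proof.
move=> x0 eta0; have e4 : 0 < eta / 4 by rewrite divr_gt0.
have [r1 r10 h1] := st_S sf e4; have [r2 r20 h2] := st_N sf e4.
pose m := Num.min (Num.min (r1 / 2) (r2 / 2)) 4^-1.
have m0 : 0 < m by rewrite !lt_min !divr_gt0//= invr_gt0.
have m1 : m < r1.
  by apply: le_lt_trans (_ : r1 / 2 < _); [rewrite !ge_min lexx|lra].
have m2 : m < r2.
  by apply: le_lt_trans (_ : r2 / 2 < _); [rewrite !ge_min lexx orbT|lra].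
have m4 : m <= 4^-1 by rewrite ge_min lexx orbT.
have OO y : m <= y <= 1 - m -> Omega L (x, y).
  by move=> /andP[? ?]; apply/OmegaP; split => //; apply/andP; split; lra.
have [c + E] := @mvt_any R (f x) (dy f x) m (1 - m)
  (fun y hy => Ck_dery C4 (OO y ltac:(move: hy; rewrite min_l ?max_r//; lra))).
rewrite min_l ?max_r; [|lra|lra] => cm.
exists c; first by move: cm => /andP[? ?]; apply/andP; split; lra.
have k1 : `|f x m| <= eta / 4 by apply: (h1 (x, m)) => //=; apply: OO; lra.
have k2 : `|f x (1 - m)| <= eta / 4.
  by apply: (h2 (x, 1 - m)) => /=; [apply: OO; lra|rewrite subKr].
have l0 : 2^-1 <= 1 - m - m by lra.
have : `|dy f x c| * (1 - m - m) <= eta * 2^-1.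
  rewrite -[X in _ * X <= _]ger0_norm; last by lra.
  rewrite -normrM -E; apply: le_trans (ler_normB _ _) _; lra.
move=> h; have l00 : 0 < 1 - m - m by lra.
rewrite -(ler_pM2r l00); apply: le_trans h _.
by rewrite ler_wpM2l// ltW.
Qed.

Lemma dy_slice_sup x y : Omega L (x, y) ->
  ((dy f x y ^+ 2)%:E <= \int[leb R]_(r in (I01 R)) (dy (dy f) x r ^+ 2)%:E)%E /\
  ((dy f x y ^+ 2)%:E <=
    \int[leb R]_(r in (I01 R)) (2 * (`|dy f x r| * `|dy (dy f) x r|))%:E)%E.
Proof.
move=> /OmegaP[x0 y0].
have d (r : R) : 0 < r < 1 -> is_derive r 1 (dy f x) (dy (dy f) x r).
  by move=> r0; apply: (Ck_dery Cy); apply/OmegaP.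
have c (r : R) : 0 < r < 1 -> {for r, continuous (dy (dy f) x)}.
  exact: (slice_cont cyy).
have z eta := @dy_almost_zero x eta x0.
split; first exact: (@slice_sup _ (dy f x) (dy (dy f) x)).
exact: (@slice_sup_prod _ (dy f x) (dy (dy f) x)).
Qed.

End elliptic_estimates.

(** * Regularity of the approximate solution *)

Section twice_derivable.
Context {R : realType}.

(** Pure second derivatives exist on S: what is needed for the Laplacian of a
  difference to be the difference of the Laplacians. *)
Definition twice_derivable (S : set (R * R)) (f : R -> R -> R) :=
  exists fx fxx fy fyy : R -> R -> R, forall x y : R, S (x, y) ->
  [/\ is_derive x 1 (f^~ y) (fx x y), is_derive x 1 (fx^~ y) (fxx x y),
      is_derive y 1 (f x) (fy x y) & is_derive y 1 (fy x) (fyy x y)].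

Lemma twice_derivableD S f g : twice_derivable S f -> twice_derivable S g ->
  twice_derivable S (fun x y => f x y + g x y).
Proof.
move=> [fx [fxx [fy [fyy hf]]]] [gx [gxx [gy [gyy hg]]]].
exists (fun x y => fx x y + gx x y), (fun x y => fxx x y + gxx x y),
  (fun x y => fy x y + gy x y), (fun x y => fyy x y + gyy x y) => x y Sxy.
have [f1 f2 f3 f4] := hf _ _ Sxy; have [g1 g2 g3 g4] := hg _ _ Sxy.
by split; [exact: derD f1 g1|exact: derD f2 g2|exact: derD f3 g3|exact: derD f4 g4].
Qed.

Lemma twice_derivableM S f g : twice_derivable S f -> twice_derivable S g ->
  twice_derivable S (fun x y => f x y * g x y).
Proof.
move=> [fx [fxx [fy [fyy hf]]]] [gx [gxx [gy [gyy hg]]]].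
exists (fun x y => fx x y * g x y + f x y * gx x y),
  (fun x y => (fxx x y * g x y + fx x y * gx x y) + (fx x y * gx x y + f x y * gxx x y)),
  (fun x y => fy x y * g x y + f x y * gy x y),
  (fun x y => (fyy x y * g x y + fy x y * gy x y) + (fy x y * gy x y + f x y * gyy x y)) => x y Sxy.
have [f1 f2 f3 f4] := hf _ _ Sxy; have [g1 g2 g3 g4] := hg _ _ Sxy.
split; [exact: derM f1 g1| |exact: derM f3 g3|].
  exact: derD (derM f2 g1) (derM f1 g2).
exact: derD (derM f4 g3) (derM f3 g4).
Qed.

Lemma twice_derivable_cst S (k : R) : twice_derivable S (fun=> fun=> k).
Proof.
exists (fun=> fun=> 0), (fun=> fun=> 0), (fun=> fun=> 0), (fun=> fun=> 0) => x y _.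
split; exact: der_cst.
Qed.

Lemma twice_derivable_fst S : twice_derivable S (fun x _ => x).
Proof.
exists (fun=> fun=> 1), (fun=> fun=> 0), (fun=> fun=> 0), (fun=> fun=> 0) => x y _.
by split; [exact: der_id|exact: der_cst|exact: der_cst|exact: der_cst].
Qed.

Lemma twice_derivableN S f : twice_derivable S f ->
  twice_derivable S (fun x y => - f x y).
Proof.
move=> [fx [fxx [fy [fyy hf]]]].
exists (fun x y => - fx x y), (fun x y => - fxx x y),
  (fun x y => - fy x y), (fun x y => - fyy x y) => x y Sxy.
have [f1 f2 f3 f4] := hf _ _ Sxy.
by split; [exact: derN f1|exact: derN f2|exact: derN f3|exact: derN f4].
Qed.

Lemma smooth_derive1 (k : R -> R) : smooth k -> smooth k^`()%classic.
Proof. by move=> sk n x; rewrite -derive1Sn; exact: sk. Qed.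

Lemma smooth_der (k : R -> R) (y : R) : smooth k -> is_derive y 1 k (k^`()%classic y).
Proof. by move=> sk; have := sk 0%N y; rewrite derive1n0 => /der_of_derivable. Qed.

Lemma twice_derivable_smooth S (k : R -> R) : smooth k -> twice_derivable S (fun=> k).
Proof.
move=> sk.
exists (fun=> fun=> 0), (fun=> fun=> 0), (fun=> k^`()%classic), (fun=> (k^`()%classic)^`()%classic) => x y _.
split; [exact: der_cst|exact: der_cst|exact: smooth_der|].
exact: smooth_der (smooth_derive1 sk).
Qed.

(** Change of the y-variable by an affine map. *)
Lemma twice_derivable_affine S S' f (s t : R) : twice_derivable S f ->
  (forall x y, S' (x, y) -> S (x, s * y + t)) ->
  twice_derivable S' (fun x y => f x (s * y + t)).
Proof.
move=> [fx [fxx [fy [fyy hf]]]] SS.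
exists (fun x y => fx x (s * y + t)), (fun x y => fxx x (s * y + t)),
  (fun x y => fy x (s * y + t) * s), (fun x y => fyy x (s * y + t) * s * s) => x y Sxy.
have [f1 f2 f3 f4] := hf _ _ (SS _ _ Sxy).
have da : is_derive y 1 (fun y => s * y + t) s.
  have := derD (derM (der_cst s y) (der_id y)) (der_cst t y).
  by rewrite mul0r add0r addr0 mulr1.
split => //; first exact: der_comp da f3.
have d := derM (der_comp da f4) (der_cst s y).
by apply: (is_derive_eq d); rewrite mulr0 addr0.
Qed.

Lemma twice_derivable_Ck S f : Ck 2 S f -> twice_derivable S f.
Proof.
move=> Cf; exists (dx f), (dx (dx f)), (dy f), (dy (dy f)) => x y Sxy.
by split; [exact: (Ck_derx Cf)|exact: (Ck_derx (Ck_dx Cf))|exact: (Ck_dery Cf)|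
  exact: (Ck_dery (Ck_dy Cf))].
Qed.

Lemma lap_sub2 S f g x y : open S -> twice_derivable S f -> twice_derivable S g ->
  S (x, y) -> lap (sub2 f g) x y = lap f x y - lap g x y.
Proof.
move=> oS [fx [fxx [fy [fyy hf]]]] [gx [gxx [gy [gyy hg]]]] Sxy.
have key h hx hxx hy hyy : (forall x y : R, S (x, y) ->
  [/\ is_derive x 1 (h^~ y) (hx x y), is_derive x 1 (hx^~ y) (hxx x y),
      is_derive y 1 (h x) (hy x y) & is_derive y 1 (hy x) (hyy x y)]) ->
  lap h x y = hxx x y + hyy x y.
  move=> hh; rewrite /lap; have [_ h2 _ h4] := hh _ _ Sxy.
  have [E1 _] := @dxy_eq_on _ S (dx h) hx oS (fun a b Sab => ltac:(
    have [h1 _ _ _] := hh _ _ Sab; exact: der_derive1 h1)).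
  have [_ E2] := @dxy_eq_on _ S (dy h) hy oS (fun a b Sab => ltac:(
    have [_ _ h3 _] := hh _ _ Sab; exact: der_derive1 h3)).
  by rewrite E1// E2//; congr (_ + _); exact: der_derive1.
rewrite (key f fx fxx fy fyy)// (key g gx gxx gy gyy)//.
rewrite (key (sub2 f g) (fun x y => fx x y - gx x y) (fun x y => fxx x y - gxx x y)
  (fun x y => fy x y - gy x y) (fun x y => fyy x y - gyy x y)); first by ring.
move=> a b Sab; have [f1 f2 f3 f4] := hf _ _ Sab; have [g1 g2 g3 g4] := hg _ _ Sab.
by split; [exact: derB f1 g1|exact: derB f2 g2|exact: derB f3 g3|exact: derB f4 g4].
Qed.

End twice_derivable.

Section layer_primitive.
Context {R : realType}.
Variable L : R.

Lemma stripP (x Y : R) : strip L (x, Y) <-> 0 < x < L /\ 0 < Y.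
Proof. by rewrite /strip/=; split => -[]; rewrite /= !in_itv/= andbT. Qed.

Lemma open_strip : open (strip L).
Proof. by apply: openX; exact: interval_open. Qed.

Lemma strip_bounded (W : R -> R -> R) (p q : R) : 0 < p ->
  extends_to (strip L) (clstrip L) (fun z => W z.1 z.2) ->
  exists2 m, 0 <= m & forall s Y, 0 < s < L -> p <= Y <= q -> `|W s Y| <= m.
Proof.
move=> p0 eW; pose C := `[0, L] `*` `[p, q].
have cC : compact C by apply: compact_setX; exact: segment_compact.
have [|m hm] := bounded_on_compact (S := strip L) (C := C) (f := fun z => W z.1 z.2) cC.
  move=> [s Y] [/= sL]; rewrite in_itv/= => /andP[pY _]; apply: eW; split => //=.
  by rewrite in_itv/= andbT (le_trans (ltW p0)).
exists `|m| => // s Y sL pY; apply: le_trans (ler_norm m).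
apply: (hm (s, Y)); split; first by apply/stripP; split => //; have /andP[pY' _] := pY; exact: lt_le_trans pY'.
by split; rewrite /= in_itv//=; case/andP: sL => ? ?; rewrite !ltW.
Qed.

Lemma strip_slice_integrable (W : R -> R -> R) (x Y : R) : 0 < x <= L -> 0 < Y ->
  cont_on (strip L) W -> extends_to (strip L) (clstrip L) (fun z => W z.1 z.2) ->
  (leb R).-integrable `]0, x[ (EFin \o W^~ Y).
Proof.
move=> /andP[x0 xL] Y0 cW eW; have [m m0 hm] := strip_bounded Y Y0 eW.
apply: (@bounded_integrable _ _ _ (leb R) `]0, x[%classic (W^~ Y) m) => //.
- by rewrite /= lebesgue_measure_itv/= lte_fin x0 ltry.
- apply: open_continuous_measurable_fun => // s; rewrite inE/= in_itv/= => /andP[s0 sx].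
  by apply: (cont_on_slice1 cW); apply/stripP; rewrite s0 (lt_le_trans sx).
- move=> s /=; rewrite in_itv/= => /andP[s0 sx]; apply: hm; last by rewrite lexx.
  by rewrite s0 (lt_le_trans sx).
Qed.

Definition xprim (W : R -> R -> R) (x Y : R) : R :=
  \int[leb R]_(s in `[0, x]) W s Y.

Lemma xprim_open (W : R -> R -> R) (x Y : R) : 0 < x <= L -> 0 < Y ->
  cont_on (strip L) W -> extends_to (strip L) (clstrip L) (fun z => W z.1 z.2) ->
  xprim W x Y = \int[leb R]_(s in `]0, x[) W s Y.
Proof.
move=> xL Y0 cW eW; rewrite /xprim /Rintegral integral_itv_bndoo//.
exact: measurable_int (strip_slice_integrable xL Y0 cW eW).
Qed.

Lemma der_xprim_x (W : R -> R -> R) (x Y : R) : 0 < x < L -> 0 < Y ->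
  cont_on (strip L) W -> extends_to (strip L) (clstrip L) (fun z => W z.1 z.2) ->
  is_derive x 1 (xprim W ^~ Y) (W x Y).
Proof.
move=> /andP[x0 xL] Y0 cW eW.
have ii : (leb R).-integrable `[0, L] (EFin \o W^~ Y).
  have [mW oo] := integrableP _ _ _ (strip_slice_integrable (x := L) ltac:(by rewrite (lt_trans x0 xL) lexx) Y0 cW eW).
  apply/integrableP; split.
    apply/measurable_EFinP/measurable_fun_itv_bndo_bndcP/measurable_fun_itv_obnd_cbndP.
    exact/measurable_EFinP.
  rewrite (@integral_itv_bndoo _ 0 L (fun s => `|(EFin \o W^~ Y) s|)%E)//.
  exact: measurableT_comp.
have cx : {for x, continuous (W^~ Y)}.
  by apply: (cont_on_slice1 cW); apply/stripP; rewrite x0.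
have [d <-] := continuous_FTC1_closed xL ii x0 cx.
exact: der_of_derivable d.
Qed.

Lemma der_xprim_y (W WY : R -> R -> R) (x Y : R) : 0 < x < L -> 0 < Y ->
  cont_on (strip L) W -> extends_to (strip L) (clstrip L) (fun z => W z.1 z.2) ->
  cont_on (strip L) WY -> extends_to (strip L) (clstrip L) (fun z => WY z.1 z.2) ->
  (forall s r : R, strip L (s, r) -> is_derive r 1 (W s) (WY s r)) ->
  is_derive Y 1 (xprim W x) (xprim WY x Y).
Proof.
move=> x0L Y0 cW eW cWY eWY dW.
have xL : 0 < x <= L by case/andP: x0L => -> /ltW.
pose p := Y / 2; pose q := Y * 2.
have p0 : 0 < p by rewrite divr_gt0.
have pY : p < Y by rewrite ltr_pdivrMr// ltr_pMr// ltr1n.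
have Yq : Y < q by rewrite ltr_pMr// ltr1n.
have [m m0 hm] := strip_bounded q p0 eWY.
have sub (s : R) : `]0, x[%classic s -> 0 < s < L.
  by rewrite /= in_itv/= => /andP[-> /lt_trans]; apply; case/andP: x0L.
have pos (r : R) : `]p, q[%classic r -> 0 < r.
  by rewrite /= in_itv/= => /andP[/(lt_trans p0)].
pose F (r : R) : R := \int[leb R]_(s in `]0, x[) W s r.
have E (r s : R) : `]p, q[%classic r -> `]0, x[%classic s -> partial1of2 (fun r s => W s r) r s = WY s r.
  move=> hr hs; apply: der_derive1; apply: dW; apply/stripP; split; first exact: sub.
  exact: pos.
have Ip : `]p, q[%classic Y by rewrite /= in_itv/= pY Yq.
have intW (r : R) : `]p, q[%classic r -> (leb R).-integrable `]0, x[ (EFin \o (fun s => W s r)).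
  by move=> hr; apply: (strip_slice_integrable xL) => //; exact: pos.
have derW (r s : R) : `]p, q[%classic r -> `]0, x[%classic s -> derivable (W s) r 1.
  move=> hr hs; have h : strip L (s, r) by apply/stripP; split; [exact: sub|exact: pos].
  exact: (@ex_derive _ _ _ _ _ _ _ (dW _ _ h)).
have intm : (leb R).-integrable `]0, x[ (EFin \o (fun=> m)).
  apply: (@bounded_integrable _ _ _ (leb R) `]0, x[%classic (fun=> m) m) => //.
  - by rewrite /= lebesgue_measure_itv/= lte_fin; case: ifPn => // _; rewrite ltry.
  - by move=> s _; rewrite ger0_norm.
have ub (r s : R) : `]p, q[%classic r -> `]0, x[%classic s ->
    `|partial1of2 (fun r s => W s r) r s| <= m.
  move=> hr hs; rewrite E//; apply: hm; first exact: sub.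
  by move: hr; rewrite /= in_itv/= => /andP[/ltW -> /ltW ->].
have dF : derivable F Y 1.
  exact: (@derivable_under_integral R _ _ (leb R) (fun r s => W s r) `]0, x[%classic
    (measurable_itv _) Y p q Ip intW derW (fun=> m) (fun=> m0) intm ub).
have vF : F^`()%classic Y = \int[leb R]_(s in `]0, x[) WY s Y.
  have := @differentiation_under_integral R _ _ (leb R) (fun r s => W s r) `]0, x[%classic
    (measurable_itv _) Y p q Ip intW derW (fun=> m) (fun=> m0) intm ub.
  move=> ->; apply: eq_Rintegral => s /set_mem hs; exact: E.
rewrite (xprim_open xL Y0 cWY eWY) -vF.
apply: der_near_eq (der_of_derivable dF).
have : \forall r \near Y, `]p, q[%classic r.
  by apply: open_nbhs_nbhs; split => //; exact: interval_open.
apply: filterS => r hr; rewrite /F (xprim_open xL _ cW eW)//; exact: pos.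
Qed.

Lemma twice_derivable_xprim V : Ck_upto 3 (strip L) (clstrip L) V ->
  twice_derivable (strip L) (xprim V).
Proof.
move=> [CV eV].
have cV := Ck_cont CV; have cVx := Ck_cont (Ck_dx CV).
have cVy := Ck_cont (Ck_dy CV); have cVyy := Ck_cont (Ck_dy (Ck_dy CV)).
exists V, (dx V), (xprim (dy V)), (xprim (dy (dy V))) => x Y sxY.
have [x0 Y0] := (stripP x Y).1 sxY.
split.
- exact: der_xprim_x (eV [::] isT).
- exact: Ck_derx CV sxY.
- apply: (der_xprim_y x0 Y0 cV (eV [::] isT) cVy (eV [:: false] isT)) => s r.
  exact: (Ck_dery CV).
- apply: (der_xprim_y x0 Y0 cVy (eV [:: false] isT) cVyy (eV [:: false; false] isT)) => s r.
  exact: (Ck_dery (Ck_dy CV)).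
Qed.

End layer_primitive.

Section approximate_solutions.
Context {R : realType}.
Variables (u0 chi : R -> R) (A L C0 eps : R) (N0 : nat).
Hypotheses (bf : base_flow u0) (cc : cutoff chi) (eps0 : 0 < eps).

Lemma cbrt_gt0 : 0 < cbrt eps.
Proof. exact: powR_gt0. Qed.

Lemma twice_derivable_layer (W : R -> R -> R) : twice_derivable (strip L) W ->
  twice_derivable (Omega L) (fun x y => W x (y / cbrt eps)) /\
  twice_derivable (Omega L) (fun x y => W x ((1 - y) / cbrt eps)).
Proof.
move=> tW; have c0 := cbrt_gt0.
have ci : 0 < (cbrt eps)^-1 by rewrite invr_gt0.
split.
  have -> : (fun x y => W x (y / cbrt eps)) = (fun x y => W x ((cbrt eps)^-1 * y + 0)).
    by apply/funext => x; apply/funext => y; rewrite addr0 mulrC.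
  apply: twice_derivable_affine tW _ => x y /OmegaP[x0 /andP[y0 _]].
  by apply/stripP; rewrite addr0 mulr_gt0.
have -> : (fun x y => W x ((1 - y) / cbrt eps)) =
    (fun x y => W x (- (cbrt eps)^-1 * y + (cbrt eps)^-1)).
  apply/funext => x; apply/funext => y; congr (W x _).
  by rewrite mulrBl mul1r addrC mulNr [y * _]mulrC.
apply: twice_derivable_affine tW _ => x y /OmegaP[x0 /andP[_ y1]].
by apply/stripP; split => //; rewrite mulNr addrC subr_gt0 gtr_pMr.
Qed.

Lemma twice_derivable_approximate ua va :
  approximate_solution u0 chi A L C0 N0 eps ua va ->
  twice_derivable (Omega L) ua /\ twice_derivable (Omega L) va.
Proof.
move=> [ve1 [U0 [U [V [ec _ _ lc [-> ->]]]]]].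
have tU : twice_derivable (strip L) U.
  by apply: twice_derivable_Ck; exact: Ck_le (lc_regU lc).1.
have tV : twice_derivable (strip L) V.
  by apply: twice_derivable_Ck; exact: Ck_le (lc_regV lc).1.
have tI := twice_derivable_xprim (lc_regV lc).
have tchi (k : R -> R) : smooth k ->
    twice_derivable (strip L) (fun x Y => k (Y / layer_cut eps)).
  move=> sk.
  have -> : (fun (_ : R) Y => k (Y / layer_cut eps)) = (fun (_ : R) Y => k ((layer_cut eps)^-1 * Y + 0)).
    by apply/funext => x; apply/funext => y; rewrite addr0 mulrC.
  exact: (@twice_derivable_affine _ setT _ (fun=> k) _ _ (twice_derivable_smooth _ sk)).
have sc := cutoff_smooth cc.
have tup : twice_derivable (strip L) (upm chi eps U V).
  apply: twice_derivableD; first exact: twice_derivableM (tchi _ sc) tU.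
  apply: twice_derivableN; apply: twice_derivableM tI.
  apply: twice_derivableM; first exact: twice_derivable_cst.
  exact: tchi (smooth_derive1 sc).
have tvp : twice_derivable (strip L) (vpm chi eps V).
  exact: twice_derivableM (tchi _ sc) tV.
have [tu1 tu2] := twice_derivable_layer tup.
have [tv1 tv2] := twice_derivable_layer tvp.
split.
- apply: twice_derivableD; first apply: twice_derivableD.
  + apply: twice_derivableD; last exact: twice_derivable_cst.
    exact: twice_derivable_smooth (base_smooth bf).
  + apply: twice_derivableM; first exact: twice_derivable_cst.
    apply: twice_derivableM; first exact: twice_derivableN (twice_derivable_fst _).
    exact: twice_derivable_smooth (smooth_derive1 (ec_smooth ec)).
  + apply: twice_derivableM; first exact: twice_derivable_cst.
    exact: twice_derivableD.
- apply: twice_derivableD.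
    apply: twice_derivableM; first exact: twice_derivable_cst.
    exact: twice_derivable_smooth (ec_smooth ec).
  apply: twice_derivableM; first exact: twice_derivable_cst.
  by apply: twice_derivableD => //; exact: twice_derivableN.
Qed.

End approximate_solutions.

(** * Norms and the background flow *)

Section L2_norms.
Context {R : realType}.
Local Open Scope ereal_scope.

Lemma poweR2 (x : \bar R) : 0 <= x -> x `^ 2 = x ^+ 2.
Proof.
case: x => [r r0|_|//]; first by rewrite poweR_EFin powR_mulrn.
by rewrite poweRyr.
Qed.

Lemma Lnorm2_sqr d (T : measurableType d) (mu : {measure set T -> \bar R})
    (D : set T) (f : T -> R) :
  'N[mu]_(2%:E)[(fun z => (f z)%:E) \_ D] ^+ 2 = \int[mu]_(z in D) ((f z) ^+ 2)%:E.
Proof.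
rewrite -poweR2 ?Lnorm_ge0// poweR_Lnorm// [RHS]integral_mkcond.
apply: eq_integral => z _; rewrite !patchE; case: ifPn => _.
  rewrite poweR2// (_ : `|(f z)%:E| = `|f z|%:E)// -EFin_expe -normrX.
  by rewrite ger0_norm ?sqr_ge0.
by rewrite abse0 poweR2// expe2 mule0.
Qed.

Lemma L2norm_sqr (L : R) (f : R -> R -> R) :
  L2norm L f ^+ 2 = IO L (fun x y => (f x y ^+ 2)%R).
Proof. exact: Lnorm2_sqr. Qed.

Lemma L2norm_ge0 (L : R) (f : R -> R -> R) : 0 <= L2norm L f.
Proof. exact: Lnorm_ge0. Qed.

Lemma sqre_le (x y : \bar R) : 0 <= x -> 0 <= y -> x ^+ 2 <= y ^+ 2 -> x <= y.
Proof.
move: x y => [x| |] [y| |] // x0 y0; rewrite ?leey//.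
move: x0 y0; rewrite -!EFin_expe !lee_fin => x0 y0.
by rewrite ler_sqr ?nnegrE.
Qed.

Lemma LinfxL2y_slice (L b : R) (f : R -> R -> R) (x : R) : (0 < x < L)%R ->
  LinfxL2y L f <= b%:E ->
  \int[leb R]_(y in (I01 R)) ((f x y) ^+ 2)%:E <= (b ^+ 2)%:E.
Proof.
move=> xL h; rewrite -Lnorm2_sqr.
have : 'N[@lebesgue_measure R]_(2%:E)[(fun y : R => (f x y)%:E) \_ (I01 R)] <= b%:E.
  by apply: le_trans h; apply: ereal_sup_ubound; exists x => //=; rewrite in_itv.
have := @Lnorm_ge0 _ _ R (leb R) 2%:E ((fun y : R => (f x y)%:E) \_ (I01 R)).
case: (Lnorm _ _ _) => [r| |]//; rewrite -EFin_expe !lee_fin => r0 rb.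
by rewrite ler_sqr ?nnegrE// (le_trans r0).
Qed.

Lemma LinfxL2y_ge0 (L : R) (f : R -> R -> R) : (0 < L)%R -> 0 <= LinfxL2y L f.
Proof.
move=> L0; apply: le_trans (ereal_sup_ubound _); last first.
  by exists (L / 2)%R => //=; rewrite in_itv/= divr_gt0//= ltr_pdivrMr// ltr_pMr// ltr1n.
exact: Lnorm_ge0.
Qed.

End L2_norms.

Section background.
Context {R : realType}.

(** The part of |g| above the level k; it is measurable as soon as g is. *)
Definition excess (k : R) (g : R -> R -> R) (x y : R) : R :=
  2^-1 * ((`|g x y| - k) + `| `|g x y| - k |).

Lemma excess_ge0 k g x y : 0 <= excess k g x y.
Proof.
rewrite mulr_ge0 ?invr_ge0//; have := ler_norm (- (`|g x y| - k)); rewrite normrN.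
by move: (`|g x y| - k) => a; lra.
Qed.

Lemma le_excess k g x y : `|g x y| <= k + excess k g x y.
Proof.
rewrite /excess; have := ler_norm (`|g x y| - k).
by move: `|g x y| => a; move: `|a - k| => b; lra.
Qed.

Lemma excess_le k g x y w : 0 <= w -> `|g x y| <= k + w -> excess k g x y <= w.
Proof.
rewrite /excess => w0; move: `|g x y| => a ak.
case: (ger0P (a - k)) => ?; lra.
Qed.

Lemma cont_excess S k g : cont_on S g -> cont_on S (excess k g).
Proof.
move=> cg; apply: (@cont_onM _ S (fun=> fun=> 2^-1) (fun x y => (`|g x y| - k) + `| `|g x y| - k |)).
  exact: cont_on_cst.
have c1 : cont_on S (fun x y => `|g x y| - k).
  by apply: cont_onB; [exact: cont_on_norm|exact: cont_on_cst].
by apply: cont_onD => //; exact: cont_on_norm.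
Qed.

(** What the energy estimate retains of the steady flow: B bounds the part of
  the Laplacian that is not controlled pointwise. *)
Record background (u0 : R -> R) (L eps K B : R) (us vs : R -> R -> R) : Prop :=
  Background {
  bg_regu : Ck 3 (Omega L) us;
  bg_regv : Ck 3 (Omega L) vs;
  bg_div : forall x y, Omega L (x, y) -> dx us x y + dy vs x y = 0;
  bg_u : forall x y, Omega L (x, y) -> u0 y <= us x y <= u0 y + K;
  bg_v : forall x y, Omega L (x, y) -> `|vs x y| <= K * eps;
  bg_lapu : forall x, 0 < x < L ->
    (\int[leb R]_(y in (I01 R)) (u0 y * excess K (lap us) x y ^+ 2)%:E <= (B ^+ 2)%:E)%E;
  bg_lapv : forall x, 0 < x < L ->
    (\int[leb R]_(y in (I01 R)) (u0 y * excess K (lap vs) x y ^+ 2)%:E <= (B ^+ 2)%:E)%E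
}.

Lemma steady_background (u0 chi : R -> R) (A delta K L C0 : R) (N0 : nat)
    (eps : R) (us vs : R -> R -> R) :
  base_flow u0 -> cutoff chi -> 0 < L -> 0 < eps < 1 ->
  steady_state u0 chi A delta K L C0 N0 eps us vs ->
  background u0 L eps (1 + `|K|) ((1 + `|K|) * eps `^ (5 / 6 - delta)) us vs.
Proof.
move=> bf cc L0 /andP[e0 e1] [ns [ua [va [app sb]]]].
have K1 : K <= 1 + `|K| by rewrite (le_trans (ler_norm K))// lerDr.
have K0 : 0 < 1 + `|K| by rewrite ltr_pwDl.
have pw (p : R) : 0 <= p -> eps `^ p <= 1.
  by move=> p0; rewrite -[leRHS](powRr0 eps); apply: ger_powR => //; rewrite e0 ltW.
have [tua tva] := twice_derivable_approximate bf cc e0 app.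
have oO := @open_Omega R L.
have lapu x y : Omega L (x, y) -> lap (sub2 us ua) x y = lap us x y - lap ua x y.
  move=> Oxy; apply: lap_sub2 Oxy => //; apply: twice_derivable_Ck.
  exact: Ck_le (ns_regu ns).
have lapv x y : Omega L (x, y) -> lap (sub2 vs va) x y = lap vs x y - lap va x y.
  move=> Oxy; apply: lap_sub2 Oxy => //; apply: twice_derivable_Ck.
  exact: Ck_le (ns_regv ns).
set B := _ * eps `^ _.
have [Bu Bv] : (LinfxL2y L (sqrt_wt u0 (lap (sub2 us ua))) <= B%:E)%E /\
    (LinfxL2y L (sqrt_wt u0 (lap (sub2 vs va))) <= B%:E)%E.
  have h : (LinfxL2y L (sqrt_wt u0 (lap (sub2 us ua)))
            + LinfxL2y L (sqrt_wt u0 (lap (sub2 vs va))) <= B%:E)%E.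
    by apply: le_trans (sb_rem sb) _; rewrite lee_fin ler_wpM2r// powR_ge0.
  by split; apply: le_trans h; [rewrite leeDl|rewrite leeDr]; rewrite ?LinfxL2y_ge0.
have slice (g ga gr : R -> R -> R) (x : R) : 0 < x < L ->
   (LinfxL2y L (sqrt_wt u0 gr) <= B%:E)%E ->
   (forall y, Omega L (x, y) -> gr x y = g x y - ga x y) ->
   (forall y, Omega L (x, y) -> `|ga x y| <= 1 + `|K|) ->
   (\int[leb R]_(y in (I01 R)) (u0 y * excess (1 + `|K|) g x y ^+ 2)%:E <= (B ^+ 2)%:E)%E.
  move=> x0 hB hg hga; apply: le_trans (LinfxL2y_slice x0 hB).
  have Oy (y : R) : I01 R y -> Omega L (x, y).
    by rewrite /= in_itv/= => y0; apply/OmegaP.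
  apply: ge0_le_integral_nonmeas => y /Oy Oxy; rewrite lee_fin.
    by rewrite mulr_ge0 ?sqr_ge0// ltW// (Omega_u0 bf Oxy).
  rewrite /sqrt_wt [leRHS]exprMn sqr_sqrtr; last by rewrite ltW// (Omega_u0 bf Oxy).
  apply: ler_wpM2l; first by rewrite ltW// (Omega_u0 bf Oxy).
  rewrite -[leRHS]ger0_norm ?sqr_ge0// normrX lerXn2r ?nnegrE ?excess_ge0//.
  apply: excess_le => //; rewrite hg//.
  have : `|g x y| <= `|g x y - ga x y| + `|ga x y|.
    by rewrite -{1}(subrK (ga x y) (g x y)) ler_normD.
  by move=> /le_trans; apply; rewrite addrC lerD2r; exact: hga.
split.
- exact: ns_regu ns.
- exact: ns_regv ns.
- exact: ns_div ns.
- move=> x y Oxy; have [h1 h2] := sb_u sb Oxy.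
  rewrite -subr_ge0 (ltW h1)/= -lerBlDl (le_trans h2)//.
  apply: (@le_trans _ _ ((1 + `|K|) * eps `^ (1 / 3))).
    by rewrite ler_wpM2r// powR_ge0.
  by rewrite ler_piMr ?(ltW K0)// pw.
- move=> x y Oxy; apply: le_trans (sb_v sb Oxy) _.
  by rewrite ler_wpM2r// ltW.
- move=> x x0; apply: (slice (lap us) (lap ua) _ x x0 Bu) => y Oxy; first exact: lapu.
  exact: le_trans (sb_lap_ua sb Oxy) K1.
- move=> x x0; apply: (slice (lap vs) (lap va) _ x x0 Bv) => y Oxy; first exact: lapv.
  have := sb_lap_va sb Oxy.
  move=> h; apply: (@le_trans _ _ (K * eps `^ (2 / 3))).
    by apply: le_trans h; rewrite lerDl.
  apply: (@le_trans _ _ ((1 + `|K|) * eps `^ (2 / 3))).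
    by rewrite ler_wpM2r// powR_ge0.
  by rewrite ler_piMr ?(ltW K0)// pw.
Qed.

End background.

(** * Traces and continuity in space-time *)

Section space_time.
Context {R : realType}.
Variable L : R.
Hypothesis L0 : 0 < L.
Implicit Types g : R -> R -> R -> R.

Let ST := spacetime (Omega L).

Lemma STP t x y : ST (t, (x, y)) <-> 0 < t /\ Omega L (x, y).
Proof. by rewrite /ST/spacetime/=; split => -[]; rewrite /= in_itv/= andbT. Qed.

Lemma open_ST : open ST.
Proof.
rewrite openE => -[t z] [/= t0 Oz].
exists (`]0, +oo[%classic, Omega L); last by move=> [t' z'] [].
split => /=; first by apply: open_nbhs_nbhs; split => //; exact: interval_open.
by apply: open_nbhs_nbhs; split => //; exact: open_Omega.
Qed.

Lemma nbhs_triple (t x y : R) (U : set (R * (R * R))) : nbhs (t, (x, y)) U ->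
  exists A B C : set R, [/\ nbhs t A, nbhs x B, nbhs y C &
    forall t' x' y', A t' -> B x' -> C y' -> U (t', (x', y'))].
Proof.
move=> [[/= A V] [nA [[/= B C] [nB nC] BC]] AV]; exists A, B, C; split => // t' x' y' At Bx Cy.
by apply: (AV (t', (x', y'))); split => //=; apply: (BC (x', y')).
Qed.

Lemma closure_itv (a b y : R) : a < b -> a <= y <= b -> closure `]a, b[ y.
Proof.
move=> ab /andP[ay yb] U /nbhs_ballP[e /= e0 eU].
have [y0|y0] := ltP y b.
  pose m := Num.min (e / 2) ((b - y) / 2).
  have m0 : 0 < m by rewrite lt_min !divr_gt0// subr_gt0.
  have me : m <= e / 2 by rewrite ge_min lexx.
  have mb : m <= (b - y) / 2 by rewrite ge_min lexx orbT.
  exists (y + m); split; first by rewrite /= in_itv/=; apply/andP; split; lra.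
  by apply: eU; rewrite /ball/= opprD addNKr normrN gtr0_norm//; lra.
pose m := Num.min (e / 2) ((b - a) / 2).
have m0 : 0 < m by rewrite lt_min !divr_gt0// subr_gt0.
have me : m <= e / 2 by rewrite ge_min lexx.
have mb : m <= (b - a) / 2 by rewrite ge_min lexx orbT.
exists (y - m); split; first by rewrite /= in_itv/=; apply/andP; split; lra.
by apply: eU; rewrite /ball/= opprB addrC subrK gtr0_norm//; lra.
Qed.

(** Sides of the rectangle: open sides where the boundary conditions hold, and
  the passage to the closed sides. *)
Lemma trace_closed_side_x g (x0 : R) : x0 = 0 \/ x0 = L ->
  (forall t y, 0 < t -> 0 < y < 1 -> trace ST (unc3 g) (t, (x0, y)) 0) ->
  extends_to ST (spacetime (clOmega L)) (unc3 g) ->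
  forall t y, 0 < t -> 0 <= y <= 1 -> trace ST (unc3 g) (t, (x0, y)) 0.
Proof.
move=> x0E tr ext t y t0 y01.
apply: (@trace_limit_point _ _ ST [set q | q.1 = t /\ q.2.1 = x0 /\ 0 < q.2.2 < 1]).
- move=> [t' [x' y']] /= [-> [-> y0]]; split; last exact: tr.
  move=> U /nbhs_triple[A [B [C [nA nB nC h]]]].
  have [|r [/= r0 Br]] := closure_itv L0 (_ : 0 <= x0 <= L) nB.
    by case: x0E => ->; rewrite lexx ltW.
  exists (t, (r, y')); split.
    by apply/STP; split => //; apply/OmegaP; split => //; move: r0; rewrite in_itv.
  by apply: h => //; exact: nbhs_singleton.
- move=> U /nbhs_triple[A [B [C [nA nB nC h]]]].
  have [r [/= r0 Cr]] := closure_itv ltr01 y01 nC.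
  exists (t, (x0, r)); split; first by split => //; split => //; move: r0; rewrite in_itv.
  by apply: h => //; exact: nbhs_singleton.
- apply: ext; split; first by rewrite /= in_itv/= t0.
  split; rewrite /= in_itv//=; by case: x0E => ->; rewrite lexx ltW.
Qed.

Lemma trace_closed_side_y g (y0 : R) : y0 = 0 \/ y0 = 1 ->
  (forall t x, 0 < t -> 0 < x < L -> trace ST (unc3 g) (t, (x, y0)) 0) ->
  extends_to ST (spacetime (clOmega L)) (unc3 g) ->
  forall t x, 0 < t -> 0 <= x <= L -> trace ST (unc3 g) (t, (x, y0)) 0.
Proof.
move=> y0E tr ext t x t0 x0L.
apply: (@trace_limit_point _ _ ST [set q | q.1 = t /\ q.2.2 = y0 /\ 0 < q.2.1 < L]).
- move=> [t' [x' y']] /= [-> [-> x0]]; split; last exact: tr.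
  move=> U /nbhs_triple[A [B [C [nA nB nC h]]]].
  have [|r [/= r0 Br]] := closure_itv ltr01 (_ : 0 <= y0 <= 1) nC.
    by case: y0E => ->; rewrite lexx ?ltW.
  exists (t, (x', r)); split.
    by apply/STP; split => //; apply/OmegaP; split => //; move: r0; rewrite in_itv.
  by apply: h => //; exact: nbhs_singleton.
- move=> U /nbhs_triple[A [B [C [nA nB nC h]]]].
  have [r [/= r0 Cr]] := closure_itv L0 x0L nB.
  exists (t, (r, y0)); split; first by split => //; split => //; move: r0; rewrite in_itv.
  by apply: h => //; exact: nbhs_singleton.
- apply: ext; split; first by rewrite /= in_itv/= t0.
  split; rewrite /= in_itv//=; by case: y0E => ->; rewrite lexx ?ler01.
Qed.

Let side_filter (b : R) (F : set_system R) (l : R) :=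
  [/\ ProperFilter F, F --> b & \forall r \near F, 0 < r < l].

Lemma side_filter_right (l : R) : 0 < l -> side_filter 0 (0^'+) l.
Proof.
move=> l0; split; first exact: at_right_proper_filter.
  exact: cvg_within.
near=> r; apply/andP; split; near: r; [exact: nbhs_right_gt|exact: nbhs_right_lt].
Unshelve. all: end_near. Qed.

Lemma side_filter_left (l : R) : 0 < l -> side_filter l (l^'-) l.
Proof.
move=> l0; split; first exact: at_left_proper_filter.
  exact: cvg_within.
near=> r; apply/andP; split; near: r; [exact: nbhs_left_gt|exact: nbhs_left_lt].
Unshelve. all: end_near. Qed.

Lemma side_filterP (b l : R) : 0 < l -> b = 0 \/ b = l -> exists F, side_filter b F l.
Proof.
move=> l0 [->|->]; first by exists (0^'+); exact: side_filter_right.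
by exists (l^'-); exact: side_filter_left.
Qed.

Lemma tangential_x g (x0 : R) : x0 = 0 \/ x0 = L ->
  (forall t y, 0 < t -> 0 < y < 1 -> trace ST (unc3 g) (t, (x0, y)) 0) ->
  (forall t x y : R, ST (t, (x, y)) -> is_derive y 1 (g t x) (dy (g t) x y)) ->
  (forall t y, 0 < t -> 0 < y < 1 ->
    exists l : R, trace ST (unc3 (fun t => dy (g t))) (t, (x0, y)) l) ->
  forall t y, 0 < t -> 0 < y < 1 -> trace ST (unc3 (fun t => dy (g t))) (t, (x0, y)) 0.
Proof.
move=> x0E tr dg ext t y t0 y01; have [l hl] := ext t y t0 y01.
have [F [FF Fx Fr]] := side_filterP L0 x0E.
suff E : l = 0 by rewrite E in hl.
have dg' (s r q : R) : ST (s, (r, q)) ->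
  is_derive q 1 (g s r) (unc3 (fun t => dy (g t)) (s, (r, q))) by exact: dg.
move: hl dg'; generalize (unc3 (fun t => dy (g t))) => g' hl dg'.
have key := @tangential_trace R _ (fun s r : R => (t, (r, s))) F ST (unc3 g) g'
  (fun s : R => (t, (x0, s))) 1 y l FF.
have {}key : _ -> _ -> _ -> _ -> _ -> l = 0 := fun h1 h2 h3 h4 h5 => key h1 h2 h3 h4 h5 y01 hl.
apply key.
- move=> s s0; apply: filterS Fr => r r0; apply/STP; split; [exact: t0|exact/OmegaP].
- move=> s s0 U /nbhs_triple[A [B [C [nA nB nC h]]]].
  exists (C, B); first by split; [exact: nC|exact: Fx].
  move=> [s' r'] /= [Cs Br]; apply: h; [exact: nbhs_singleton|exact: Br|exact: Cs].
- by move=> s r Ssr; exact: (dg' t r s Ssr).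
- move=> s r s0 [s' [s'0 /STP[_ /OmegaP[r0 _]]]].
  by apply/STP; split; [exact: t0|exact/OmegaP].
- by move=> s s0; exact: tr.
Qed.

Lemma tangential_y g (y0 : R) : y0 = 0 \/ y0 = 1 ->
  (forall t x, 0 < t -> 0 < x < L -> trace ST (unc3 g) (t, (x, y0)) 0) ->
  (forall t x y : R, ST (t, (x, y)) -> is_derive x 1 ((g t)^~ y) (dx (g t) x y)) ->
  (forall t x, 0 < t -> 0 < x < L ->
    exists l : R, trace ST (unc3 (fun t => dx (g t))) (t, (x, y0)) l) ->
  forall t x, 0 < t -> 0 < x < L -> trace ST (unc3 (fun t => dx (g t))) (t, (x, y0)) 0.
Proof.
move=> y0E tr dg ext t x t0 x0L; have [l hl] := ext t x t0 x0L.
have [F [FF Fx Fr]] := side_filterP ltr01 y0E.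
suff E : l = 0 by rewrite E in hl.
have dg' (s r q : R) : ST (s, (r, q)) ->
  is_derive r 1 ((g s)^~ q) (unc3 (fun t => dx (g t)) (s, (r, q))) by exact: dg.
move: hl dg'; generalize (unc3 (fun t => dx (g t))) => g' hl dg'.
have key := @tangential_trace R _ (fun s r : R => (t, (s, r))) F ST (unc3 g) g'
  (fun s : R => (t, (s, y0))) L x l FF.
have {}key : _ -> _ -> _ -> _ -> _ -> l = 0 := fun h1 h2 h3 h4 h5 => key h1 h2 h3 h4 h5 x0L hl.
apply key.
- move=> s s0; apply: filterS Fr => r r0; apply/STP; split; [exact: t0|exact/OmegaP].
- move=> s s0 U /nbhs_triple[A [B [C [nA nB nC h]]]].
  exists (B, C); first by split; [exact: nB|exact: Fx].
  move=> [s' r'] /= [Bs Cr]; apply: h; [exact: nbhs_singleton|exact: Bs|exact: Cr].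
- by move=> s r Ssr; exact: (dg' t s r Ssr).
- move=> s r s0 [s' [s'0 /STP[_ /OmegaP[_ r0]]]].
  by apply/STP; split; [exact: t0|exact/OmegaP].
- by move=> s s0; exact: tr.
Qed.

Definition cont3 g := forall q, ST q -> {for q, continuous (unc3 g)}.

Lemma cont3_extends g : extends_to ST ST (unc3 g) -> cont3 g.
Proof.
move=> ext q Sq; have [l hl] := ext q Sq.
have nS : nbhs q ST by move: open_ST; rewrite openE; apply.
have cl : unc3 g z @[z --> q] --> l.
  move=> U /hl; rewrite /= /within/= => h.
  by apply: filterS (filterI nS h) => z [Sz]; apply.
suff E : l = unc3 g q by rewrite /prop_for /continuous_at -E; exact: cl.
apply/eqP; rewrite -subr_eq0 -normr_le0; apply/ler_addgt0Pr => e e0; rewrite add0r.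
have /cvgrPdist_le/(_ _ e0) h := cl.
exact: (nbhs_singleton h).
Qed.

Lemma cont3_eq g h : (forall t x y, ST (t, (x, y)) -> g t x y = h t x y) ->
  cont3 g -> cont3 h.
Proof.
move=> gh cg [t [x y]] Sq; rewrite /prop_for /continuous_at /unc3/= -gh//.
apply: cvg_trans (cg _ Sq); apply: near_eq_cvg.
have nS : nbhs (t, (x, y)) ST by move: open_ST; rewrite openE; apply.
by apply: filterS nS => -[t' [x' y']]; exact: gh.
Qed.

Lemma cont3D g h : cont3 g -> cont3 h -> cont3 (fun t x y => g t x y + h t x y).
Proof. by move=> cg ch q Sq; apply: cvgD; [exact: cg|exact: ch]. Qed.

Lemma cont3M g h : cont3 g -> cont3 h -> cont3 (fun t x y => g t x y * h t x y).
Proof. by move=> cg ch q Sq; apply: cvgM; [exact: cg|exact: ch]. Qed.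

Lemma cont3_cst (k : R) : cont3 (fun _ _ _ => k).
Proof. by move=> q _; exact: cvg_cst. Qed.

Lemma cont3_t (k : R -> R) : (forall t, 0 < t -> {for t, continuous k}) ->
  cont3 (fun t _ _ => k t).
Proof.
move=> ck [t [x y]] /STP[t0 _].
apply: (@continuous_comp _ _ _ (fun q : R * (R * R) => q.1) k); first exact: cvg_fst.
exact: ck.
Qed.

Lemma cont3_xy (k : R -> R -> R) : cont_on (Omega L) k -> cont3 (fun=> k).
Proof.
move=> ck [t [x y]] /STP[_ Oxy].
apply: (@continuous_comp _ _ _ (fun q : R * (R * R) => q.2) (fun z => k z.1 z.2)).
  exact: cvg_snd.
exact: ck.
Qed.

Lemma cont3_slice g t : 0 < t -> cont3 g -> cont_on (Omega L) (g t).
Proof.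
move=> t0 cg [x y] Oxy.
apply: (@continuous_comp _ _ _ (fun z : R * R => (t, z)) (unc3 g)).
  move=> U [/= [A B] /= [nA nB] AB]; apply: filterS nB => z Bz.
  by apply: (AB (t, z)); split => //; exact: nbhs_singleton.
by apply: cg; apply/STP.
Qed.

Lemma cont3_slice_t g x y t : Omega L (x, y) -> 0 < t -> cont3 g ->
  {for t, continuous (fun t => g t x y)}.
Proof.
move=> Oxy t0 cg.
apply: (@continuous_comp _ _ _ (fun t : R => (t, (x, y))) (unc3 g)).
  move=> U [/= [A B] /= [nA nB] AB]; apply: filterS nA => s As.
  by apply: (AB (s, (x, y))); split => //; exact: nbhs_singleton.
by apply: cg; apply/STP.
Qed.

Lemma cont3_measurable g : cont3 g -> measurable_fun ST (unc3 g).
Proof. by move=> cg; apply: continuous_measurable3 => //; exact: open_ST. Qed.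

End space_time.

(** * Energy fluxes *)

Section fluxes.
Context {R : realType}.

Lemma der_xflux (u w w' m : R -> R) (p eps x u' w'' m' : R) :
  is_derive x 1 u u' -> is_derive x 1 w (w' x) -> is_derive x 1 w' w'' ->
  is_derive x 1 m m' ->
  is_derive x 1 (fun x => 2^-1 * (u x * p * m x * w x ^+ 2) - eps * (p * m x * w x * w' x))
   (2^-1 * (u' * p * m x * w x ^+ 2 + u x * p * m' * w x ^+ 2 + 2 * (u x * p * m x * w x * w' x))
    - eps * (p * m' * w x * w' x + p * m x * w' x ^+ 2 + p * m x * w x * w'')).
Proof.
move=> du dw dw' dm.
have d1 := derM (der_cst 2^-1 x) (derM (derM (derM du (der_cst p x)) dm) (derX 1 dw)).
have d2 := derM (der_cst eps x) (derM (derM (derM (der_cst p x) dm) dw) dw').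
by apply: (is_derive_eq (derB d1 d2)); ring.
Qed.

Lemma der_yflux (v w w' p p' : R -> R) (m eps y v' w'' p'' : R) :
  is_derive y 1 v v' -> is_derive y 1 w (w' y) -> is_derive y 1 w' w'' ->
  is_derive y 1 p (p' y) -> is_derive y 1 p' p'' ->
  is_derive y 1 (fun y => 2^-1 * (v y * p y * m * w y ^+ 2) - eps * (p y * m * w y * w' y)
      + 2^-1 * (eps * (p' y * m * w y ^+ 2)))
   (2^-1 * (v' * p y * m * w y ^+ 2 + v y * p' y * m * w y ^+ 2 + 2 * (v y * p y * m * w y * w' y))
    - eps * (p y * m * w' y ^+ 2 + p y * m * w y * w'')
    + 2^-1 * (eps * (p'' * m * w y ^+ 2))).
Proof.
move=> dv dw dw' dp dp'.
have d1 := derM (der_cst 2^-1 y) (derM (derM (derM dv dp) (der_cst m y)) (derX 1 dw)).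
have d2 := derM (der_cst eps y) (derM (derM (derM dp (der_cst m y)) dw) dw').
have d3 := derM (der_cst 2^-1 y) (derM (der_cst eps y) (derM (derM dp' (der_cst m y)) (derX 1 dw))).
by apply: (is_derive_eq (derD (derB d1 d2) d3)); field.
Qed.

Lemma bulk_transport (K eps M L p m w wx v p' p'' u0 : R) : 0 < L -> 0 < eps ->
  0 <= K -> 0 < M -> 0 <= p <= u0 -> u0 <= M -> 1 <= m <= 2 -> `|v| <= K * eps ->
  `|p'| <= M -> `|p''| <= M ->
  2^-1 * (v * p' * m * w ^+ 2) + eps / L * (p * w * wx) + 2^-1 * (eps * (p'' * m * w ^+ 2)) <=
  4^-1 * eps * (u0 * wx ^+ 2) + eps * (M * K + M / L ^+ 2 + M) * w ^+ 2.
Proof.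
move=> L0 e0 K0 M0 /andP[p0 pu] uM /andP[m1 m2] hv hp hp'.
have w0 := sqr_ge0 w.
have t1 : 2^-1 * (v * p' * m * w ^+ 2) <= eps * (M * K) * w ^+ 2.
  have h : v * p' <= K * eps * M.
    by apply: le_trans (ler_norm _) _; rewrite normrM ler_pM.
  have h2 : v * p' * m <= K * eps * M * 2.
    apply: (@le_trans _ _ (K * eps * M * m)); first by rewrite ler_wpM2r//; lra.
    by rewrite ler_wpM2l// !mulr_ge0// ltW.
  have := ler_wpM2r w0 h2; move: (v * p' * m * _) => X; lra.
have t3 : 2^-1 * (eps * (p'' * m * w ^+ 2)) <= eps * M * w ^+ 2.
  have h : p'' * m <= M * 2.
    apply: (@le_trans _ _ (M * m)); last by rewrite ler_wpM2l// ltW.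
    rewrite ler_wpM2r; [by []|by lra|exact: le_trans (ler_norm _) hp'].
  have := ler_wpM2r w0 h => /(ler_wpM2l (ltW e0)); move: (eps * (p'' * _ * _)) => X; lra.
have t2 : eps / L * (p * w * wx) <= 4^-1 * eps * (u0 * wx ^+ 2) + eps * (M / L ^+ 2) * w ^+ 2.
  have y1 : p * (w / L * wx) <= u0 * (4^-1 * wx ^+ 2 + (w / L) ^+ 2).
    apply: (@le_trans _ _ (p * (4^-1 * wx ^+ 2 + (w / L) ^+ 2))).
      apply: ler_wpM2l => //; have := sqr_ge0 (2^-1 * wx - w / L).
      by move: (w / L) => r; lra.
    by rewrite ler_wpM2r// addr_ge0 ?sqr_ge0// mulr_ge0 ?sqr_ge0.
  have y2 : u0 * (w / L) ^+ 2 <= M * (w / L) ^+ 2 by rewrite ler_wpM2r ?sqr_ge0.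
  have -> : eps / L * (p * w * wx) = eps * (p * (w / L * wx)) by ring.
  have -> : eps * (M / L ^+ 2) * w ^+ 2 = eps * (M * (w / L) ^+ 2).
    by rewrite expr_div_n; ring.
  apply: (@le_trans _ _ (eps * (4^-1 * (u0 * wx ^+ 2) + M * (w / L) ^+ 2))); last by rewrite mulrDr !mulrA (mulrC eps 4^-1).
  apply: ler_wpM2l; first exact: ltW.
  by move: y1 y2; rewrite mulrDr; move: (_ * (w / L) ^+ 2) (_ * (w / L) ^+ 2) => X Y; lra.
have E : eps * (M * K + M / L ^+ 2 + M) * w ^+ 2 =
  eps * (M * K) * w ^+ 2 + eps * (M / L ^+ 2) * w ^+ 2 + eps * M * w ^+ 2 by ring.
rewrite E; move: (lerD (lerD t1 t2) t3); rewrite -subr_ge0 => h.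
by rewrite -subr_ge0; move: h; congr (0 <= _); ring.
Qed.

Lemma bulk_shear (K B M p m w u0 Q e fx : R) : 0 <= K -> 0 < B ->
  0 <= p <= u0 -> u0 <= M -> 1 <= m <= 2 -> 0 <= e -> `|Q| <= K + e ->
  p * m * w * (Q * fx) <= K * (u0 * w) ^+ 2 + K * fx ^+ 2 + B * M * w ^+ 2 +
    B^-1 * (u0 * e ^+ 2 * fx ^+ 2).
Proof.
move=> K0 B0 /andP[p0 pu] uM /andP[m1 m2] e0 hQ.
have u00 := le_trans p0 pu.
have h1 : p * m * w * (Q * fx) <= 2 * (u0 * `|w| * ((K + e) * `|fx|)).
  apply: le_trans (ler_norm _) _; rewrite !normrM (ger0_norm p0) (ger0_norm (le_trans ler01 m1)).
  rewrite (_ : 2 * (u0 * `|w| * ((K + e) * `|fx|)) = u0 * 2 * `|w| * ((K + e) * `|fx|)); last by ring.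
  by rewrite !ler_pM ?mulr_ge0// (le_trans ler01).
have h2 := young (u0 * `|w|) `|fx| ltr01.
have h3 := young `|w| (e * `|fx|) B0.
have h4 := ler_wpM2l K0 h2; have h5 := ler_wpM2l u00 h3.
have h6 : u0 * (B * `|w| ^+ 2) <= M * (B * `|w| ^+ 2).
  by rewrite ler_wpM2r// mulr_ge0 ?sqr_ge0// ltW.
apply: le_trans h1 _.
move: h4 h5 h6; rewrite invr1 !exprMn !real_normK ?num_real// => h4 h5 h6.
have -> : 2 * (u0 * `|w| * ((K + e) * `|fx|)) =
  K * (2 * (u0 * `|w| * `|fx|)) + u0 * (2 * (`|w| * (e * `|fx|))) by ring.
apply: le_trans (lerD h4 h5) _; rewrite -subr_ge0.
by move: h6; rewrite -subr_ge0; congr (0 <= _); ring.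
Qed.

(** The vorticity equation multiplied by p m w, p = u0 - k, in divergence form. *)
Lemma energy_pointwise (K B M L eps p m w wx wy wxx wyy g us vs usx vsy Lu Lv fx fy
    u0 u1 u2 eu ev : R) : 0 < L -> 0 < eps -> 0 <= K -> 0 < M -> 0 < B ->
  0 <= p <= u0 -> u0 <= M -> 1 <= m <= 2 -> `|vs| <= K * eps -> `|u1| <= M -> `|u2| <= M ->
  0 <= eu -> 0 <= ev -> `|Lu| <= K + eu -> `|Lv| <= K + ev ->
  usx + vsy = 0 ->
  g + us * wx - Lu * fx + vs * wy - Lv * fy - eps * (wxx + wyy) = 0 ->
  p * m * w * g + ((2 * L)^-1 * (us * p * w ^+ 2) + eps * (p * m * (wx ^+ 2 + wy ^+ 2))) <=
  - (2^-1 * (usx * p * m * w ^+ 2 + us * p * (- L^-1) * w ^+ 2 + 2 * (us * p * m * w * wx))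
    - eps * (p * (- L^-1) * w * wx + p * m * wx ^+ 2 + p * m * w * wxx))
  - (2^-1 * (vsy * p * m * w ^+ 2 + vs * u1 * m * w ^+ 2 + 2 * (vs * p * m * w * wy))
    - eps * (p * m * wy ^+ 2 + p * m * w * wyy)
    + 2^-1 * (eps * (u2 * m * w ^+ 2))) +
  (4^-1 * eps * (u0 * wx ^+ 2) + (eps * (M * K + M / L ^+ 2 + M) + 2 * (B * M)) * w ^+ 2
   + 2 * K * (u0 * w) ^+ 2 + K * (fx ^+ 2 + fy ^+ 2)
   + B^-1 * (u0 * eu ^+ 2 * fx ^+ 2) + B^-1 * (u0 * ev ^+ 2 * fy ^+ 2)).
Proof.
move=> L0 e0 K0 M0 B0 hp uM hm hv h1 h2 eu0 ev0 hLu hLv div eqn.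
have T := bulk_transport w wx L0 e0 K0 M0 hp uM hm hv h1 h2.
have Su := @bulk_shear K B M p m w u0 Lu eu fx K0 B0 hp uM hm eu0 hLu.
have Sv := @bulk_shear K B M p m w u0 Lv ev fy K0 B0 hp uM hm ev0 hLv.
have gE : g = - us * wx + Lu * fx - vs * wy + Lv * fy + eps * (wxx + wyy) by move: eqn; lra.
have vE : vsy = - usx by move: div; lra.
have i2 : (2 * L)^-1 = 2^-1 * L^-1 by rewrite invfM.
rewrite -subr_ge0 i2 gE vE; rewrite -subr_ge0 in T; rewrite -subr_ge0 in Su; rewrite -subr_ge0 in Sv.
move: (addr_ge0 (addr_ge0 T Su) Sv); congr (0 <= _); field.
by rewrite !gt_eqF.
Qed.

End fluxes.

(** * The energy inequality on a slab *)

Section slab_energy.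
Context {R : realType}.

Definition slope_wt (L x : R) : R := 2 + (- L^-1) * x.

Definition xflux (u0 : R -> R) (L eps k : R) (us w : R -> R -> R) (x y : R) : R :=
  2^-1 * (us x y * (u0 y - k) * slope_wt L x * w x y ^+ 2)
  - eps * ((u0 y - k) * slope_wt L x * w x y * dx w x y).

Lemma half_itv (c : R) : 0 < c -> c < 2^-1 -> 0 < c < 1 /\ 0 < 1 - c < 1.
Proof. by move=> *; split; apply/andP; split; lra. Qed.

Lemma growth_pointwise (p m u w s c1 : R) : 0 <= p <= u -> 1 <= m <= 2 ->
  0 < s -> 0 <= c1 ->
  2^-1 * (c1 * s) * (p * m * w ^+ 2) <= 2^-1 * c1 * s ^+ 2 * w ^+ 2 + 2^-1 * c1 * (u * w) ^+ 2.
Proof.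
move=> /andP[p0 pu] /andP[m1 m2] s0 c10.
have h : p * m * w ^+ 2 <= u * 2 * w ^+ 2.
  by rewrite ler_wpM2r ?sqr_ge0// ler_pM// (le_trans ler01).
have h1 := ler_wpM2l (ltW s0) h; have h2 := sqr_ge0 (s * w - u * w).
have h3 : s * (p * m * w ^+ 2) <= (s * w) ^+ 2 + (u * w) ^+ 2.
  apply: le_trans h1 _; rewrite -subr_ge0; move: h2; congr (0 <= _); ring.
have h4 : 0 <= 2^-1 * c1 by rewrite mulr_ge0// invr_ge0.
have := ler_wpM2l h4 h3; rewrite -subr_ge0 => h5.
by rewrite -subr_ge0; move: h5; congr (0 <= _); ring.
Qed.

Lemma production_arith (X T Y F G a1 ga w2 kk v t u a4 a5 a6 : R) :
  X + Y + T <= - F - G + (a1 + ga * w2 + kk * u + a4 + a5 + a6) + (t * w2 + v * u) ->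
  X + T + Y <= - F + - G + (a1 + (ga + t) * w2 + (kk + v) * u + a4 + a5 + a6).
Proof.
by rewrite -subr_ge0 => h; rewrite -subr_ge0; move: h; congr (0 <= _); ring.
Qed.

Lemma le_bint_comb (L a b c d k1 k2 k3 k4 k5 k6 : R)
    (N F G p1 p2 p3 p4 p5 p6 : R -> R -> R) :
  a <= b -> c <= d -> box a b c d `<=` Omega L ->
  cont_on (Omega L) N -> cont_on (Omega L) F -> cont_on (Omega L) G ->
  cont_on (Omega L) p1 -> cont_on (Omega L) p2 -> cont_on (Omega L) p3 ->
  cont_on (Omega L) p4 -> cont_on (Omega L) p5 -> cont_on (Omega L) p6 ->
  (forall x y, a <= x <= b -> c <= y <= d -> N x y <= F x y + G x y +
    (k1 * p1 x y + k2 * p2 x y + k3 * p3 x y + k4 * p4 x y + k5 * p5 x y + k6 * p6 x y)) ->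
  bint a b c d N <= bint a b c d F + bint a b c d G +
    (k1 * bint a b c d p1 + k2 * bint a b c d p2 + k3 * bint a b c d p3
     + k4 * bint a b c d p4 + k5 * bint a b c d p5 + k6 * bint a b c d p6).
Proof.
move=> ab cd bO cN cF cG h1 h2 h3 h4 h5 h6 le.
have z (r : R) (P : R -> R -> R) : cont_on (Omega L) P ->
    cont_on (Omega L) (fun x y => r * P x y) by move=> cP; cont.
have z1 := z k1 _ h1; have z2 := z k2 _ h2; have z3 := z k3 _ h3.
have z4 := z k4 _ h4; have z5 := z k5 _ h5; have z6 := z k6 _ h6.
have s2 := cont_onD z1 z2; have s3 := cont_onD s2 z3; have s4 := cont_onD s3 z4.
have s5 := cont_onD s4 z5; have s6 := cont_onD s5 z6.
rewrite -(bintZ ab cd bO k1 h1) -(bintZ ab cd bO k2 h2) -(bintZ ab cd bO k3 h3).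
rewrite -(bintZ ab cd bO k4 h4) -(bintZ ab cd bO k5 h5) -(bintZ ab cd bO k6 h6).
rewrite -(bintD ab cd bO z1 z2) -(bintD ab cd bO s2 z3) -(bintD ab cd bO s3 z4).
rewrite -(bintD ab cd bO s4 z5) -(bintD ab cd bO s5 z6).
rewrite -(bintD ab cd bO cF cG) -(bintD ab cd bO (cont_onD cF cG) s6).
exact: (le_bint ab cd bO cN (cont_onD (cont_onD cF cG) s6) le).
Qed.

Variables (u0 : R -> R) (L eps K B kap M : R) (us vs f g : R -> R -> R).
Hypothesis bf : base_flow u0.
Hypotheses (L0 : 0 < L) (L1 : L <= 1).
Hypothesis sf : stream L f.
Let u1 := u0^`()%classic.
Let u2 := u0^`(2)%classic.
Hypothesis kap0 : 0 < kap.
Hypothesis hkap : forall y : R, 0 <= y <= 1 -> kap <= u1 y ^+ 2 + u0 y ^+ 2.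
Hypothesis M0 : 0 < M.
Hypothesis hM : forall y : R, 0 <= y <= 1 -> [/\ `|u0 y| <= M, `|u1 y| <= M & `|u2 y| <= M].
Hypotheses (e0 : 0 < eps) (e1 : eps <= 1) (K0 : 0 <= K) (B0 : 0 < B).
Hypothesis bg : background u0 L eps K B us vs.
Hypothesis cg : cont_on (Omega L) g.
Hypothesis eqn : forall x y, Omega L (x, y) ->
  g x y + us x y * lap (dx f) x y - lap us x y * dx f x y
    + vs x y * lap (dy f) x y - lap vs x y * dy f x y - eps * lap (lap f) x y = 0.

Let oO := @open_Omega R L.
Let C4 := st_reg sf.
Let Cx : Ck 3 (Omega L) (dx f) := Ck_dx C4.
Let Cy : Ck 3 (Omega L) (dy f) := Ck_dy C4.
Let Cw : Ck 2 (Omega L) (lap f) := Ck_lap oO C4.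
Let cx : cont_on (Omega L) (dx f) := Ck_cont Cx.
Let cy : cont_on (Omega L) (dy f) := Ck_cont Cy.
Let cxy : cont_on (Omega L) (dy (dx f)) := Ck_cont (Ck_dy Cx).
Let cyy : cont_on (Omega L) (dy (dy f)) := Ck_cont (Ck_dy Cy).
Let cw : cont_on (Omega L) (lap f) := Ck_cont Cw.
Let cwx : cont_on (Omega L) (dx (lap f)) := Ck_cont (Ck_dx Cw).
Let cwy : cont_on (Omega L) (dy (lap f)) := Ck_cont (Ck_dy Cw).
Let cwxx : cont_on (Omega L) (dx (dx (lap f))) := Ck_cont (Ck_dx (Ck_dx Cw)).
Let cwyy : cont_on (Omega L) (dy (dy (lap f))) := Ck_cont (Ck_dy (Ck_dy Cw)).
Let cus : cont_on (Omega L) us := Ck_cont (bg_regu bg).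
Let cvs : cont_on (Omega L) vs := Ck_cont (bg_regv bg).
Let cusx : cont_on (Omega L) (dx us) := Ck_cont (Ck_dx (bg_regu bg)).
Let cvsy : cont_on (Omega L) (dy vs) := Ck_cont (Ck_dy (bg_regv bg)).
Let ceu : cont_on (Omega L) (excess K (lap us)) := @cont_excess _ _ K _ (Ck_cont (Ck_lap oO (bg_regu bg))).
Let cev : cont_on (Omega L) (excess K (lap vs)) := @cont_excess _ _ K _ (Ck_cont (Ck_lap oO (bg_regv bg))).
Let cu0 : cont_on (Omega L) (fun=> u0).
Proof. by apply: cont_on_snd => z _; exact: (base_cont bf z.2).1. Qed.
Let cu1 : cont_on (Omega L) (fun=> u1).
Proof. by apply: cont_on_snd => z _; exact: (base_cont bf z.2).2. Qed.
Let cu2 : cont_on (Omega L) (fun=> u2).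
Proof. by apply: cont_on_snd => z _; exact: (base_cont2 bf). Qed.
Let cm : cont_on (Omega L) (fun x _ => slope_wt L x).
Proof. by rewrite /slope_wt; cont. Qed.

Lemma slope_wt_bd x : 0 < x < L -> 1 <= slope_wt L x <= 2.
Proof.
rewrite /slope_wt => /andP[x0 xL].
have h0 : 0 <= L^-1 * x by rewrite mulr_ge0// ?invr_ge0 ltW.
have h1 : L^-1 * x <= 1 by rewrite mulrC ler_pdivrMr// mul1r ltW.
by rewrite mulNr; move: (L^-1 * x) h0 h1 => r ? ?; apply/andP; split; lra.
Qed.

Lemma sum_grad_le (a : R) : IO L (fun x y => (u0 y * lap f x y) ^+ 2) = a%:E ->
  (IO L (fun x y => dx f x y ^+ 2 + dy f x y ^+ 2) <= (2 * gradC kap M * a)%:E)%E.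
Proof. by move=> aE; rewrite EFinM -aE; exact: (gradient_le bf L0 L1 sf kap0 hkap hM). Qed.

Let u0_ge0 x y : Omega L (x, y) -> 0 <= u0 y.
Proof. by move=> /(Omega_u0 bf)/ltW. Qed.

Lemma shear_x (h : R) : IO L (fun x y => lap f x y ^+ 2) = h%:E ->
  (IO L (fun x y => u0 y * excess K (lap us) x y ^+ 2 * dx f x y ^+ 2) <= (B ^+ 2 * h)%:E)%E.
Proof.
move=> hE.
apply: (@le_trans _ _ ((B ^+ 2)%:E * IO L (fun x y => dy (dx f) x y ^+ 2))%E).
  apply: (@slice_product _ L (B ^+ 2) (fun x y => u0 y * excess K (lap us) x y ^+ 2) (dx f)
    (fun x y => dy (dx f) x y ^+ 2)).
  - exact: sqr_ge0.
  - by cont.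
  - exact: cx.
  - by cont.
  - by move=> x y /u0_ge0 h0; apply: mulr_ge0 => //; exact: sqr_ge0.
  - by move=> x y _; exact: sqr_ge0.
  - exact: (bg_lapu bg).
  - by move=> x y; exact: (dx_slice_sup sf).
rewrite [leRHS]EFinM -hE; apply: lee_wpmul2l; first by rewrite lee_fin sqr_ge0.
exact: (mixed_le_vort L0 L1 sf).
Qed.

Lemma shear_y (h : R) : IO L (fun x y => lap f x y ^+ 2) = h%:E ->
  (IO L (fun x y => u0 y * excess K (lap vs) x y ^+ 2 * dy f x y ^+ 2) <= (B ^+ 2 * h)%:E)%E.
Proof.
move=> hE.
apply: (@le_trans _ _ ((B ^+ 2)%:E * IO L (fun x y => dy (dy f) x y ^+ 2))%E).
  apply: (@slice_product _ L (B ^+ 2) (fun x y => u0 y * excess K (lap vs) x y ^+ 2) (dy f)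
    (fun x y => dy (dy f) x y ^+ 2)).
  - exact: sqr_ge0.
  - by cont.
  - exact: cy.
  - by cont.
  - by move=> x y /u0_ge0 h0; apply: mulr_ge0 => //; exact: sqr_ge0.
  - by move=> x y _; exact: sqr_ge0.
  - exact: (bg_lapv bg).
  - by move=> x y /(dy_slice_sup sf)[].
rewrite [leRHS]EFinM -hE; apply: lee_wpmul2l; first by rewrite lee_fin sqr_ge0.
exact: (normal_le_vort L0 L1 sf).
Qed.

Section one_slab.
Variables (a b c eta beta th : R).
Hypotheses (ha : 0 < a) (ab : a <= b) (hb : b < L) (hc : 0 < c) (c2 : c < 2^-1).
Hypotheses (eta0 : 0 <= eta) (beta0 : 0 < beta) (th0 : 0 < th).
Hypothesis level : forall y : R, c <= y <= 1 - c -> u0 c <= u0 y.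
Let k := u0 c.
Let c1c : c <= 1 - c. Proof. by move: c2; lra. Qed.
Let bO : box a b c (1 - c) `<=` Omega L.
Proof. by apply: box_Omega => //; rewrite ltrBlDr ltrDl. Qed.
Local Notation bintc := (bint a b c (1 - c)).

Hypothesis x_sides : forall y : R, c <= y <= 1 - c ->
  xflux u0 L eps k us (lap f) a y - xflux u0 L eps k us (lap f) b y <= eta.
Hypothesis y_sides : forall x : R, a <= x <= b ->
  lap f x c ^+ 2 <= beta * dy f x c ^+ 2 + eta /\
  lap f x (1 - c) ^+ 2 <= beta * dy f x (1 - c) ^+ 2 + eta.

Lemma bint_le_of_IO (q : R -> R -> R) (X : R) : cont_on (Omega L) q ->
  (forall x y, Omega L (x, y) -> 0 <= q x y) -> (IO L q <= X%:E)%E -> bintc q <= X.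
Proof.
move=> cq q0 qX; rewrite -lee_fin; apply: le_trans qX.
exact: (bint_le_Omega ab c1c bO cq q0).
Qed.

Let G (x y : R) := 2^-1 * (vs x y * (u0 y - k) * slope_wt L x * lap f x y ^+ 2)
  - eps * ((u0 y - k) * slope_wt L x * lap f x y * dy (lap f) x y)
  + 2^-1 * (eps * (u1 y * slope_wt L x * lap f x y ^+ 2)).
Let Fx (x y : R) :=
  2^-1 * (dx us x y * (u0 y - k) * slope_wt L x * lap f x y ^+ 2
    + us x y * (u0 y - k) * (- L^-1) * lap f x y ^+ 2
    + 2 * (us x y * (u0 y - k) * slope_wt L x * lap f x y * dx (lap f) x y))
  - eps * ((u0 y - k) * (- L^-1) * lap f x y * dx (lap f) x y
    + (u0 y - k) * slope_wt L x * dx (lap f) x y ^+ 2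
    + (u0 y - k) * slope_wt L x * lap f x y * dx (dx (lap f)) x y).
Let Gy (x y : R) :=
  2^-1 * (dy vs x y * (u0 y - k) * slope_wt L x * lap f x y ^+ 2
    + vs x y * u1 y * slope_wt L x * lap f x y ^+ 2
    + 2 * (vs x y * (u0 y - k) * slope_wt L x * lap f x y * dy (lap f) x y))
  - eps * ((u0 y - k) * slope_wt L x * dy (lap f) x y ^+ 2
    + (u0 y - k) * slope_wt L x * lap f x y * dy (dy (lap f)) x y)
  + 2^-1 * (eps * (u2 y * slope_wt L x * lap f x y ^+ 2)).

Let dF x y : Omega L (x, y) ->
  is_derive x 1 (fun x => xflux u0 L eps k us (lap f) x y) (Fx x y).
Proof.
move=> Oxy; have dm : is_derive x 1 (slope_wt L) (- L^-1).
  have d := derD (der_cst 2 x) (derM (der_cst (- L^-1) x) (der_id x)).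
  by apply: (is_derive_eq d); rewrite mul0r mulr1 !add0r.
exact: (@der_xflux _ (us^~ y) ((lap f)^~ y) ((dx (lap f))^~ y) (slope_wt L)
  (u0 y - k) eps x (dx us x y) (dx (dx (lap f)) x y) (- L^-1)
  (Ck_derx (bg_regu bg) Oxy) (Ck_derx Cw Oxy) (Ck_derx (Ck_dx Cw) Oxy) dm).
Qed.

Let dG x y : Omega L (x, y) -> is_derive y 1 (G x) (Gy x y).
Proof.
move=> Oxy; have [d0 d1] := base_der bf y.
have dp : is_derive y 1 (fun y => u0 y - k) (u1 y).
  by apply: (is_derive_eq (derB d0 (der_cst k y))); rewrite subr0.
exact: (@der_yflux _ (vs x) (lap f x) (dy (lap f) x) (fun y => u0 y - k) u1
  (slope_wt L x) eps y (dy vs x y) (dy (dy (lap f)) x y) (u2 y)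
  (Ck_dery (bg_regv bg) Oxy) (Ck_dery Cw Oxy) (Ck_dery (Ck_dy Cw) Oxy) dp d1).
Qed.

Let G_level x y : u0 y = k ->
  G x y = 2^-1 * (eps * (u1 y * slope_wt L x * lap f x y ^+ 2)).
Proof.
rewrite /G => ->; rewrite (subrr k).
generalize (vs x y) (slope_wt L x) (lap f x y) (dy (lap f) x y) (u1 y) => A1 A2 A3 A4 A5.
by ring.
Qed.

Let cG : cont_on (Omega L) G. Proof. by rewrite /G; cont. Qed.
Let cF : cont_on (Omega L) (xflux u0 L eps k us (lap f)). Proof. by rewrite /xflux; cont. Qed.
Let cGy : cont_on (Omega L) Gy. Proof. by rewrite /Gy; cont. Qed.
Let cFx : cont_on (Omega L) Fx. Proof. by rewrite /Fx; cont. Qed.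

Lemma x_flux_le : bintc (fun x y => - Fx x y) <= eta.
Proof.
apply: (@bint_dx_le _ L a b c (1 - c) ab c1c bO
  (fun x y => - xflux u0 L eps k us (lap f) x y) (fun x y => - Fx x y) eta).
- by move: hc; lra.
- exact: eta0.
- by move=> x y Oxy; apply: derN; exact: dF.
- exact: cont_onN cFx.
- exact: cont_onN cF.
- by move=> y /x_sides; rewrite opprK addrC.
Qed.

Let q x y := th^-1 * dy f x y ^+ 2 + th * dy (dy f) x y ^+ 2.
Let cq : cont_on (Omega L) q. Proof. by rewrite /q; cont. Qed.
Let q0 x y : Omega L (x, y) -> 0 <= q x y.
Proof.
have ti : 0 <= th^-1 by rewrite invr_ge0 ltW.
by move=> _; rewrite /q addr_ge0// mulr_ge0 ?sqr_ge0// ltW.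
Qed.

Lemma wall_pointwise (m w1 w2 : R) y1 y2 r1 r2 : 1 <= m <= 2 ->
  `|w1| <= M -> `|w2| <= M -> y1 ^+ 2 <= beta * r1 + eta -> y2 ^+ 2 <= beta * r2 + eta ->
  - (2^-1 * (eps * (w2 * m * y2 ^+ 2))) - - (2^-1 * (eps * (w1 * m * y1 ^+ 2))) <=
  2 * eps * M * eta + eps * M * beta * (r1 + r2).
Proof.
move=> /andP[m1 m2] h1 h2 k1 k2.
have aux (w y r : R) : `|w| <= M -> y ^+ 2 <= beta * r + eta ->
    2^-1 * (eps * (w * m * y ^+ 2)) <= eps * M * (beta * r + eta).
  move=> hw hy; have y0 := sqr_ge0 y.
  have t : w * m <= M * 2.
    apply: (@le_trans _ _ (M * m)); last by rewrite ler_wpM2l// ltW.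
    by rewrite ler_wpM2r ?(le_trans ler01)// (le_trans (ler_norm _)).
  have t2 : w * m * y ^+ 2 <= M * 2 * (beta * r + eta).
    apply: le_trans (ler_wpM2r y0 t) _.
    by rewrite ler_wpM2l// mulr_ge0// ltW.
  have t3 : 2^-1 * (eps * (w * m * y ^+ 2)) <= 2^-1 * (eps * (M * 2 * (beta * r + eta))).
    by rewrite ler_wpM2l// ler_wpM2l// ltW.
  by apply: (le_trans t3); rewrite le_eqVlt; apply/orP; left; apply/eqP; field.
have a1 := aux w1 y1 r1 h1 k1.
have a2 : 2^-1 * (eps * (- w2 * m * y2 ^+ 2)) <= eps * M * (beta * r2 + eta).
  by apply: aux; rewrite ?normrN.
have E : - (2^-1 * (eps * (w2 * m * y2 ^+ 2))) = 2^-1 * (eps * (- w2 * m * y2 ^+ 2)) by ring.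
rewrite opprK E -subr_ge0; rewrite -subr_ge0 in a1; rewrite -subr_ge0 in a2.
by move: (addr_ge0 a1 a2); congr (0 <= _); ring.
Qed.

Lemma y_flux_le : ((bintc (fun x y => - Gy x y))%:E <=
  (2 * eps * M * eta)%:E + (2 * eps * M * beta)%:E * IO L q)%E.
Proof.
pose sg (x : R) := (\int[leb R]_(r in (I01 R)) (q x r)%:E)%E.
have [qE msg] := IO_iterated cq q0.
have k10 : 0 <= 2 * eps * M * eta by rewrite !mulr_ge0// ltW.
have k20 : 0 <= 2 * eps * M * beta by rewrite !mulr_ge0// ltW.
have sub x : a <= x <= b -> 0 < x < L.
  by move=> /andP[h1 h2]; rewrite (lt_le_trans ha h1) (le_lt_trans h2 hb).
have subS : `[a, b] `<=` `]0, L[ by move=> x; rewrite /= !in_itv/=; exact: sub.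
have sg0 (x : R) : 0 < x < L -> (0 <= sg x)%E.
  move=> x0; apply: integral_ge0 => y; rewrite /= in_itv/= => y0; rewrite lee_fin.
  by apply: (q0 (y := y)); apply/OmegaP; split.
have msg' : measurable_fun `[a, b] sg.
  by apply: measurable_funS msg => //; exact: measurable_itv.
apply: le_trans (@bint_dy_le _ L a b c (1 - c) ab c1c bO (fun x y => - G x y)
   (fun x y => - Gy x y)
  (fun x => (2 * eps * M * eta)%:E + (2 * eps * M * beta)%:E * sg x)%E _ _ _ _ _ _) _.
- by move=> x y Oxy; apply: derN; exact: dG.
- exact: cont_onN cGy.
- exact: cont_onN cG.
- by apply: emeasurable_funD => //; exact: measurable_funeM.
- move=> x /sub x0; apply: adde_ge0; first by rewrite lee_fin.
  by apply: mule_ge0; [rewrite lee_fin|exact: sg0].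
- move=> x xab; have x0 := sub _ xab.
  have [s1 s2] := y_sides xab.
  have [w1 w2] := half_itv hc c2.
  have O1 : Omega L (x, c) by exact/OmegaP.
  have O2 : Omega L (x, 1 - c) by exact/OmegaP.
  have sgle y : Omega L (x, y) -> ((dy f x y ^+ 2)%:E <= sg x)%E.
    move=> Oy; apply: le_trans (dy_slice_sup sf Oy).2 _.
    apply: ge0_le_integral_nonmeas => r _; rewrite lee_fin; first by rewrite mulr_ge0// mulr_ge0.
    rewrite /q; have := young `|dy f x r| `|dy (dy f) x r| (_ : 0 < th^-1).
    by rewrite invr_gt0 invrK !real_normK ?num_real//; apply.
  have symc : u0 (1 - c) = k by rewrite (base_even bf)//; have /andP[? ?] := w1; rewrite !ltW.
  apply: (@le_trans _ _ (2 * eps * M * eta + eps * M * beta *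
     (dy f x c ^+ 2 + dy f x (1 - c) ^+ 2))%:E).
    rewrite lee_fin (G_level x (erefl k)) (G_level x symc).
    have [_ h1 _] := hM (Omega_y O1); have [_ h2 _] := hM (Omega_y O2).
    exact: (wall_pointwise (slope_wt_bd x0) h1 h2 s1 s2).
  have -> : 2 * eps * M * beta = eps * M * beta * 2 by ring.
  rewrite EFinD leeD2l// EFinM [(_ * 2)%:E]EFinM -muleA.
  apply: lee_wpmul2l; first by rewrite lee_fin !mulr_ge0// ltW.
  by rewrite mule_natl mule2n EFinD; apply: leeD; exact: sgle.
rewrite ge0_integralD//=; first last.
- exact: measurable_funeM.
- move=> x; rewrite in_itv/= => /sub x0; apply: mule_ge0; [by rewrite lee_fin|exact: sg0].
rewrite integral_itv_cst// ge0_integralZl_EFin//; last first.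
  by move=> x; rewrite /= in_itv/= => /sub; exact: sg0.
apply: leeD.
  rewrite lee_fin ler_piMr//; move: L1 hb ha; lra.
apply: lee_wpmul2l; first by rewrite lee_fin.
rewrite qE; apply: ge0_subset_integral => //.
Qed.

Let P1' x y := u0 y * dx (lap f) x y ^+ 2.
Let P2' x y := lap f x y ^+ 2.
Let P3' x y := (u0 y * lap f x y) ^+ 2.
Let P4' x y := dx f x y ^+ 2 + dy f x y ^+ 2.
Let P5' x y := u0 y * excess K (lap us) x y ^+ 2 * dx f x y ^+ 2.
Let P6' x y := u0 y * excess K (lap vs) x y ^+ 2 * dy f x y ^+ 2.

(** The energy production on a slab. *)
Definition production (cc k : R) (x y : R) : R :=
  (u0 y - k) * slope_wt L x * lap f x y * g x y
  + 2^-1 * cc * ((u0 y - k) * slope_wt L x * lap f x y ^+ 2)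
  + ((2 * L)^-1 * (us x y * (u0 y - k) * lap f x y ^+ 2)
     + eps * ((u0 y - k) * slope_wt L x * (dx (lap f) x y ^+ 2 + dy (lap f) x y ^+ 2))).

Variables (s c1 : R).
Hypotheses (s0 : 0 < s) (c10 : 0 <= c1).

Lemma production_pointwise x y : Omega L (x, y) -> k <= u0 y ->
  production (c1 * s) k x y <= - Fx x y + - Gy x y +
    (4^-1 * eps * P1' x y
     + (eps * (M * K + M / L ^+ 2 + M) + 2 * (B * M) + 2^-1 * c1 * s ^+ 2) * P2' x y
     + (2 * K + 2^-1 * c1) * P3' x y + K * P4' x y + B^-1 * P5' x y + B^-1 * P6' x y).
Proof.
move=> Oxy ky; have y01 := Omega_y Oxy; have [h0 h1 h2] := hM y01.
have [E1 E2] := der_lap oO (Ck_le (isT : (3 <= 4)%N) C4) Oxy.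
have X1 := der_derive1 E1; have X2 := der_derive1 E2.
rewrite -/(dx (lap f) x y) in X1; rewrite -/(dy (lap f) x y) in X2.
have [x0L y0L] := (OmegaP _ _ _).1 Oxy.
have m12 := slope_wt_bd x0L.
have k0 : 0 <= k.
  by have [w1 _] := half_itv hc c2; apply: (u0_ge0 (x := x)); exact/OmegaP.
have p01 : 0 <= u0 y - k <= u0 y by rewrite subr_ge0 ky/= lerBlDr lerDl.
have uM := le_trans (ler_norm _) h0.
have eL : lap (lap f) x y = dx (dx (lap f)) x y + dy (dy (lap f)) x y by exact: erefl.
have eq1 := eqn Oxy; rewrite -X1 -X2 eL in eq1.
have := @energy_pointwise R K B M L eps (u0 y - k) (slope_wt L x) (lap f x y)
  (dx (lap f) x y) (dy (lap f) x y) (dx (dx (lap f)) x y) (dy (dy (lap f)) x y) (g x y)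
  (us x y) (vs x y) (dx us x y) (dy vs x y) (lap us x y) (lap vs x y) (dx f x y) (dy f x y)
  (u0 y) (u1 y) (u2 y) (excess K (lap us) x y) (excess K (lap vs) x y) L0 e0 K0 M0 B0
  p01 uM m12 (bg_v bg Oxy) h1 h2 (excess_ge0 _ _ _ _) (excess_ge0 _ _ _ _)
  (le_excess _ _ _ _) (le_excess _ _ _ _) (bg_div bg Oxy) eq1.
have T : 2^-1 * (c1 * s) * ((u0 y - k) * slope_wt L x * lap f x y ^+ 2) <=
    2^-1 * c1 * s ^+ 2 * P2' x y + 2^-1 * c1 * P3' x y.
  exact: (@growth_pointwise _ _ _ _ _ _ p01 m12 s0 c10).
move=> H; exact: (production_arith (lerD H T)).
Qed.

Let Gam := eps * (M * K + M / L ^+ 2 + M) + 2 * (B * M) + 2^-1 * c1 * s ^+ 2.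

Let P_cont : [/\ cont_on (Omega L) P1', cont_on (Omega L) P2', cont_on (Omega L) P3' &
  [/\ cont_on (Omega L) P4', cont_on (Omega L) P5' & cont_on (Omega L) P6']].
Proof.
by do 2?split; [rewrite /P1'|rewrite /P2'|rewrite /P3'|rewrite /P4'|rewrite /P5'|rewrite /P6']; cont.
Qed.

Lemma cont_production cc k0 : cont_on (Omega L) (production cc k0).
Proof. by rewrite /production; cont. Qed.

Lemma production_le_bulk : bintc (production (c1 * s) k) <=
  bintc (fun x y => - Fx x y) + bintc (fun x y => - Gy x y) +
  (4^-1 * eps * bintc P1' + Gam * bintc P2' + (2 * K + 2^-1 * c1) * bintc P3'
   + K * bintc P4' + B^-1 * bintc P5' + B^-1 * bintc P6').
Proof.
have [p1 p2 p3 [p4 p5 p6]] := P_cont.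
refine (@le_bint_comb L a b c (1 - c) (4^-1 * eps) Gam (2 * K + 2^-1 * c1) K B^-1 B^-1
  (production (c1 * s) k) (fun x y => - Fx x y) (fun x y => - Gy x y) P1' P2' P3' P4' P5' P6'
  ab c1c bO (@cont_production _ _) (cont_onN cFx) (cont_onN cGy) p1 p2 p3 p4 p5 p6 _).
move=> x y xab ycd.
by apply: production_pointwise; [apply: bO; apply/boxP|exact: level].
Qed.

Lemma wall_energy_le (a0 h : R) : IO L P3' = a0%:E -> IO L P2' = h%:E ->
  (IO L q <= (th^-1 * (2 * gradC kap M * a0) + th * h)%:E)%E.
Proof.
move=> aE hE; have ti : 0 <= th^-1 by rewrite invr_ge0 ltW.
have s1 (F : R -> R -> R) x y : Omega L (x, y) -> 0 <= F x y ^+ 2 by move=> _; exact: sqr_ge0.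
have c1' : cont_on (Omega L) (fun x y => dy f x y ^+ 2) by cont.
have c2' : cont_on (Omega L) (fun x y => dy (dy f) x y ^+ 2) by cont.
have c3' : cont_on (Omega L) (fun x y => th^-1 * dy f x y ^+ 2) by cont.
have c4' : cont_on (Omega L) (fun x y => th * dy (dy f) x y ^+ 2) by cont.
have p3 x y : Omega L (x, y) -> 0 <= th^-1 * dy f x y ^+ 2.
  by move=> _; apply: mulr_ge0 => //; exact: sqr_ge0.
have p4 x y : Omega L (x, y) -> 0 <= th * dy (dy f) x y ^+ 2.
  by move=> _; apply: mulr_ge0; [exact: ltW|exact: sqr_ge0].
rewrite /q (IO_D c3' c4' p3 p4) (IO_Z ti c1' (s1 _)) (IO_Z (ltW th0) c2' (s1 _)) EFinD.
apply: leeD; rewrite EFinM; apply: lee_wpmul2l; rewrite ?lee_fin ?(ltW th0)//.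
  apply: le_trans _ (sum_grad_le aE).
  have [_ _ _ [c5 _ _]] := P_cont.
  apply: (@IO_le _ L (fun x y => dy f x y ^+ 2) P4' c1' c5 (s1 _)) => x y _.
  by rewrite lerDr; exact: sqr_ge0.
by rewrite -hE; exact: (normal_le_vort L0 L1 sf).
Qed.

Lemma slab_arith (N X Y A1 h A3 G4 A5 A6 a0 d1 d2 vC gC W : R) :
  N <= X + Y + (4^-1 * eps * A1 + Gam * h + (2 * K + 2^-1 * c1) * A3 + K * G4
     + B^-1 * A5 + B^-1 * A6) ->
  X <= eta -> Y <= 2 * eps * M * eta + 2 * eps * M * beta * W ->
  W <= th^-1 * (2 * gC * a0) + th * h ->
  A1 <= d1 -> A3 <= a0 -> G4 <= 2 * gC * a0 -> A5 <= B ^+ 2 * h -> A6 <= B ^+ 2 * h ->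
  0 <= h -> 0 <= a0 -> 0 <= d1 -> 0 <= d2 ->
  h <= vC * (s * d2 + s ^- 2 * a0) -> 0 <= vC -> eps = s ^+ 3 ->
  vC * (Gam + 2 * B + 2 * eps * M * beta * th) <= 4^-1 * s ^+ 2 ->
  4^-1 + (2 * K + 2^-1 * c1 + K * (2 * gC) + 2 * eps * M * beta * (th^-1 * (2 * gC)))
    <= (4 * L)^-1 ->
  N <= eta * (1 + 2 * M) + eps / 2 * (d1 + d2) + (4 * L)^-1 * a0.
Proof.
move=> hN hX hY hW h1 h3 h4 h5 h6 h0 a00 d10 d20 hv vC0 eE hG hU.
have k1 : 0 <= 4^-1 * eps by rewrite mulr_ge0 ?invr_ge0 // ltW.
have k2 : 0 <= 2 * K + 2^-1 * c1 by rewrite addr_ge0// mulr_ge0// invr_ge0.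
have k3 : 0 <= B^-1 by rewrite invr_ge0 ltW.
have k4 : 0 <= 2 * eps * M * beta by rewrite !mulr_ge0// ltW.
have B1 : B^-1 * (B ^+ 2 * h) = B * h by field; rewrite gt_eqF.
have t1 := ler_wpM2l k1 h1; have t3 := ler_wpM2l k2 h3; have t4 := ler_wpM2l K0 h4.
have t5 := ler_wpM2l k3 h5; have t6 := ler_wpM2l k3 h6; have tW := ler_wpM2l k4 hW.
rewrite B1 in t5 t6.
have Gt0 : 0 <= Gam + 2 * B + 2 * eps * M * beta * th.
  have ? : 0 <= M / L ^+ 2 by rewrite divr_ge0 ?sqr_ge0// ltW.
  have g1 : 0 <= eps * (M * K + M / L ^+ 2 + M).
    apply: mulr_ge0; first exact: ltW.
    apply: addr_ge0; last exact: ltW.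
    by apply: addr_ge0 => //; apply: mulr_ge0 => //; exact: ltW.
  have g2 : 0 <= 2 * (B * M) by apply: mulr_ge0 => //; apply: mulr_ge0; exact: ltW.
  have g3 : 0 <= 2^-1 * c1 * s ^+ 2 by apply: mulr_ge0; [exact: mulr_ge0|exact: sqr_ge0].
  have g4 : 0 <= 2 * B by rewrite mulr_ge0// ltW.
  have g5 : 0 <= 2 * eps * M * beta * th by rewrite mulr_ge0// ltW.
  apply: addr_ge0 => //; apply: addr_ge0 => //; apply: addr_ge0 => //.
  exact: addr_ge0.
have th1 : (Gam + 2 * B + 2 * eps * M * beta * th) * h <= 4^-1 * (eps * d2 + a0).
  apply: le_trans (ler_wpM2l Gt0 hv) _; rewrite mulrCA mulrA.
  have E : 4^-1 * (eps * d2 + a0) = 4^-1 * s ^+ 2 * (s * d2 + s ^- 2 * a0).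
    by rewrite eE; field; rewrite gt_eqF.
  rewrite E; apply: ler_wpM2r => //.
  by rewrite addr_ge0 ?mulr_ge0 ?invr_ge0 ?sqr_ge0// ltW.
have tU := ler_wpM2r a00 hU.
have te : 2 * eps * M * eta <= eta * (2 * M).
  have -> : 2 * eps * M * eta = eps * (eta * (2 * M)) by ring.
  by rewrite ler_piMl// !mulr_ge0// ltW.
apply: le_trans hN _.
have := lerD (lerD hX (le_trans hY (lerD te tW)))
  (lerD (lerD (lerD (lerD (lerD t1 (lexx (Gam * h))) t3) t4) t5) t6).
move=> /le_trans; apply; rewrite -subr_ge0.
rewrite -subr_ge0 in th1; rewrite -subr_ge0 in tU.
have d0 : 0 <= 4^-1 * eps * d1 + 4^-1 * eps * d2.
  by rewrite addr_ge0// mulr_ge0.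
move: (addr_ge0 (addr_ge0 th1 tU) d0); congr (0 <= _); field.
by rewrite !gt_eqF.
Qed.

Lemma slab_ereal (N X Y A1 h A3 G4 A5 A6 a' : R) (d1 d2 W : \bar R) :
  N <= X + Y + (4^-1 * eps * A1 + Gam * h + (2 * K + 2^-1 * c1) * A3 + K * G4
     + B^-1 * A5 + B^-1 * A6) ->
  X <= eta -> (Y%:E <= (2 * eps * M * eta)%:E + (2 * eps * M * beta)%:E * W)%E ->
  (W <= (th^-1 * (2 * gradC kap M * a') + th * h)%:E)%E ->
  (A1%:E <= d1)%E -> A3 <= a' -> G4 <= 2 * gradC kap M * a' ->
  A5 <= B ^+ 2 * h -> A6 <= B ^+ 2 * h ->
  0 <= h -> 0 <= a' -> (0 <= d1)%E -> (0 <= d2)%E ->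
  (h%:E <= (vortC kap M)%:E * (s%:E * d2 + (s ^- 2)%:E * a'%:E))%E -> eps = s ^+ 3 ->
  vortC kap M * (Gam + 2 * B + 2 * eps * M * beta * th) <= 4^-1 * s ^+ 2 ->
  4^-1 + (2 * K + 2^-1 * c1 + K * (2 * gradC kap M)
     + 2 * eps * M * beta * (th^-1 * (2 * gradC kap M))) <= (4 * L)^-1 ->
  (N%:E <= (eta * (1 + 2 * M))%:E + (eps / 2)%:E * (d1 + d2) + ((4 * L)^-1)%:E * a'%:E)%E.
Proof.
move=> hN hX yfl wl b1 b3 b4 b5 b6 h0 a00 d10 d20 vint eE hG hU.
case: d1 d10 b1 => [d1 d10 b1| _ _ |//]; last first.
  have -> : (+oo + d2 = +oo)%E by case: (d2) d20.
  by rewrite gt0_muley ?lte_fin ?divr_gt0// addey// addye// leey.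
case: d2 d20 vint => [d2 d20 vint| _ _ |//]; last first.
  by rewrite addey// gt0_muley ?lte_fin ?divr_gt0// addey// addye// leey.
rewrite lee_fin in d10; rewrite lee_fin in d20; rewrite lee_fin in b1.
have [w wE hw] : exists2 w : R, Y <= 2 * eps * M * eta + 2 * eps * M * beta * w &
    w <= th^-1 * (2 * gradC kap M * a') + th * h.
  exists (th^-1 * (2 * gradC kap M * a') + th * h) => //.
  rewrite -lee_fin; apply: le_trans yfl _; rewrite EFinD leeD2l// [leRHS]EFinM.
  by apply: lee_wpmul2l => //; rewrite lee_fin !mulr_ge0// ltW.
have {}vint : h <= vortC kap M * (s * d2 + s ^- 2 * a') by rewrite -lee_fin; exact: vint.
have := slab_arith hN hX wE hw b1 b3 b4 b5 b6 h0 a00 d10 d20 vint (vortC_ge0 M kap0) eE hG hU.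
by rewrite -lee_fin; exact.
Qed.

Lemma ereal_fin (x : \bar R) : (0 <= x)%E -> (x < +oo)%E -> exists r : R, x = r%:E.
Proof. by move=> x0 xoo; exists (fine x); rewrite fineK// ge0_fin_numE. Qed.

Lemma slab_energy : s <= 1 -> eps = s ^+ 3 ->
  vortC kap M * (eps * (M * K + M / L ^+ 2 + M) + 2 * (B * M) + 2^-1 * c1 * s ^+ 2
    + 2 * B + 2 * eps * M * beta * th) <= 4^-1 * s ^+ 2 ->
  4^-1 + (2 * K + 2^-1 * c1 + K * (2 * gradC kap M)
     + 2 * eps * M * beta * (th^-1 * (2 * gradC kap M))) <= (4 * L)^-1 ->
  ((bintc (production (c1 * s) (u0 c)))%:E <= (eta * (1 + 2 * M))%:E
    + (eps / 2)%:E * IO L (fun x y => (u0 y * (dx (lap f) x y ^+ 2 + dy (lap f) x y ^+ 2)%R)%R)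
    + ((4 * L)^-1)%:E * IO L (fun x y => (u0 y * lap f x y) ^+ 2)%R)%E.
Proof.
move=> s1 eE hG hU.
have [p1 p2 p3 [p4 p5 p6]] := P_cont.
have uu x y (r : R) : Omega L (x, y) -> 0 <= u0 y * r ^+ 2.
  by move=> /u0_ge0 h0; apply: mulr_ge0 => //; exact: sqr_ge0.
have pd1 x y : Omega L (x, y) -> 0 <= P1' x y by move=> Oxy; exact: (uu x y).
have pd2 x y : Omega L (x, y) -> 0 <= u0 y * dy (lap f) x y ^+ 2 by move=> Oxy; exact: (uu x y).
have cd2 : cont_on (Omega L) (fun x y => u0 y * dy (lap f) x y ^+ 2) by cont.
have dE : IO L (fun x y => u0 y * (dx (lap f) x y ^+ 2 + dy (lap f) x y ^+ 2)) =
    (IO L P1' + IO L (fun x y => u0 y * dy (lap f) x y ^+ 2)%R)%E.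
  rewrite -(IO_D p1 cd2 pd1 pd2); apply: eq_integral => -[x y] _.
  by rewrite /P1' /= mulrDr.
rewrite dE.
have hlt : (IO L P2' < +oo)%E by exact: (IO_vort_lty L0 sf).
have h0 : (0 <= IO L P2')%E by apply: (@IO_ge0 _ L P2') => x y _; exact: sqr_ge0.
have P30 x y : Omega L (x, y) -> 0 <= P3' x y by move=> _; exact: sqr_ge0.
have alt : (IO L P3' < +oo)%E.
  have cM : cont_on (Omega L) (fun x y => M ^+ 2 * P2' x y) by rewrite /P2'; cont.
  apply: le_lt_trans (@IO_le _ L P3' (fun x y => M ^+ 2 * P2' x y) p3 cM P30 _) _.
    move=> x y Oxy; rewrite /P3' exprMn; apply: ler_wpM2r; first exact: sqr_ge0.
    by have [h _ _] := hM (Omega_y Oxy); exact: sqr_le_of_norm.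
  rewrite (IO_Z (sqr_ge0 M) p2); last by move=> x y _; exact: sqr_ge0.
  by apply: lte_mul_pinfty => //; rewrite ?lee_fin ?sqr_ge0.
have a00 : (0 <= IO L P3')%E by exact: IO_ge0.
have d10 : (0 <= IO L P1')%E by exact: IO_ge0.
have d20 : (0 <= IO L (fun x y => u0 y * dy (lap f) x y ^+ 2)%R)%E.
  exact: (@IO_ge0 _ L (fun x y => u0 y * dy (lap f) x y ^+ 2) pd2).
have vint := vort_interpolation bf L0 L1 sf kap0 hkap M0 hM (s := s) ltac:(by rewrite s0 s1).
have yfl := y_flux_le.
rewrite -/P3' -/P2' in vint *.
have [h hE] := ereal_fin h0 hlt.
have [a' aE] := ereal_fin a00 alt.
have wl := wall_energy_le aE hE.
have g4 := sum_grad_le aE; have g5 := shear_x hE; have g6 := shear_y hE.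
have bulk := production_le_bulk.
have b1 := bint_le_Omega ab c1c bO p1 pd1.
have b4 : bintc P4' <= 2 * gradC kap M * a'.
  by apply: (bint_le_of_IO p4 _ g4) => x y _; apply: addr_ge0; exact: sqr_ge0.
have b5 : bintc P5' <= B ^+ 2 * h.
  apply: (bint_le_of_IO p5 _ g5) => x y /u0_ge0 k0.
  by apply: mulr_ge0; [apply: mulr_ge0 => //|]; exact: sqr_ge0.
have b6 : bintc P6' <= B ^+ 2 * h.
  apply: (bint_le_of_IO p6 _ g6) => x y /u0_ge0 k0.
  by apply: mulr_ge0; [apply: mulr_ge0 => //|]; exact: sqr_ge0.
have b3 : bintc P3' <= a' by apply: (bint_le_of_IO p3 P30); rewrite aE.
have b2 : bintc P2' <= h.
  by apply: (bint_le_of_IO p2); [move=> x y _; exact: sqr_ge0|rewrite hE].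
have Gam0 : 0 <= Gam.
  have g1 : 0 <= eps * (M * K + M / L ^+ 2 + M).
    apply: mulr_ge0; first exact: ltW.
    apply: addr_ge0; last exact: ltW.
    apply: addr_ge0; first by apply: mulr_ge0 => //; exact: ltW.
    by apply: divr_ge0; [exact: ltW|exact: sqr_ge0].
  apply: addr_ge0; last by apply: mulr_ge0; [exact: mulr_ge0|exact: sqr_ge0].
  by apply: addr_ge0 => //; apply: mulr_ge0 => //; apply: mulr_ge0; exact: ltW.
have bulk2 : bintc (production (c1 * s) k) <= bintc (fun x y => - Fx x y) +
    bintc (fun x y => - Gy x y) +
    (4^-1 * eps * bintc P1' + Gam * h + (2 * K + 2^-1 * c1) * bintc P3'
     + K * bintc P4' + B^-1 * bintc P5' + B^-1 * bintc P6').
  apply: le_trans bulk _; rewrite !lerD2l !lerD2r lerD2l.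
  exact: ler_wpM2l.
rewrite hE in vint h0; rewrite aE in vint a00; rewrite !lee_fin in h0 a00; rewrite aE.
exact: (slab_ereal bulk2 x_flux_le yfl wl b1 b3 b4 b5 b6 h0 a00 d10 d20 vint eE hG hU).
Qed.

End one_slab.
End slab_energy.

(** * Exchanging time and space derivatives *)

Section evolution.
Context {R : realType}.
Variables (u0 : R -> R) (L A eps : R) (us vs : R -> R -> R) (phi : R -> R -> R -> R)
  (phi0 : R -> R -> R).
Hypotheses (bf : base_flow u0) (L0 : 0 < L).
Hypothesis lp : linearized_problem u0 A L eps us vs phi phi0.

Local Notation ST := (spacetime (Omega L)).
Let sr : strong_regularity L phi. Proof. by case: lp. Qed.
Let bc : boundary_conditions A L eps phi. Proof. by case: lp. Qed.
Let oO := @open_Omega R L.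

Lemma Ck_phi t : 0 < t -> Ck 4 (Omega L) (phi t).
Proof. exact: (sr_x sr). Qed.

Lemma cont3_pder w : (size w <= 4)%N -> cont3 L (fun t => pder w (phi t)).
Proof. by move=> hw; apply: cont3_extends; exact: (sr_x_cont sr hw). Qed.

Lemma cont3_dt w : (size w <= 2)%N -> cont3 L (fun t => pder w (dt phi t)).
Proof. by move=> hw; apply: cont3_extends; exact: (sr_tx_cont sr hw). Qed.

Lemma cont3_slice_tx (k : R -> R -> R -> R) t x y : cont3 L k -> ST (t, (x, y)) ->
  {for (t, x), continuous (fun z : R * R => k z.1 z.2 y)}.
Proof.
move=> ck Sq.
apply: (@continuous_comp _ _ _ (fun z : R * R => (z.1, (z.2, y))) (unc3 k)); last exact: ck.
move=> U /nbhs_triple[U1 [V [W [nU nV nW h]]]]; exists (U1, V) => //= -[s r] /= [Us Vr].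
by apply: h => //; exact: nbhs_singleton.
Qed.

Lemma cont3_slice_ty (k : R -> R -> R -> R) t x y : cont3 L k -> ST (t, (x, y)) ->
  {for (t, y), continuous (fun z : R * R => k z.1 x z.2)}.
Proof.
move=> ck Sq.
apply: (@continuous_comp _ _ _ (fun z : R * R => (z.1, (x, z.2))) (unc3 k)); last exact: ck.
move=> U /nbhs_triple[U1 [V [W [nU nV nW h]]]]; exists (U1, W) => //= -[s r] /= [Us Wr].
by apply: h => //; exact: nbhs_singleton.
Qed.

(** Exchange of time and space derivatives. *)
Lemma time_der_dx (g gt : R -> R -> R -> R) :
  (forall t x y : R, ST (t, (x, y)) -> is_derive t 1 (fun s => g s x y) (gt t x y)) ->
  (forall t x y : R, ST (t, (x, y)) -> is_derive x 1 ((g t)^~ y) (dx (g t) x y)) ->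
  (forall t x y : R, ST (t, (x, y)) -> is_derive x 1 ((gt t)^~ y) (dx (gt t) x y)) ->
  cont3 L (fun t => dx (gt t)) ->
  forall t x y : R, ST (t, (x, y)) -> is_derive t 1 (fun s => dx (g s) x y) (dx (gt t) x y).
Proof.
move=> h1 h2 h3 cg t x y Sq.
have nS : nbhs (t, x) [set z : R * R | ST (z.1, (z.2, y))].
  have : nbhs (t, (x, y)) ST by move: (@open_ST _ L); rewrite openE; apply.
  move=> /nbhs_triple[U [V [W [nU nV nW h]]]]; exists (U, V) => //= -[s r] /= [Us Vr].
  by apply: h => //; exact: nbhs_singleton.
have nt : nbhs t [set s : R | ST (s, (x, y))].
  by case: nS => -[U V] /= [nU nV] UV; apply: filterS nU => s Us; apply: (UV (s, x)); split => //; exact: nbhs_singleton.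
apply: (@schwarz _ (fun s r => g s r y) (fun s r => gt s r y) (fun s r => dx (g s) r y)
  (fun s r => dx (gt s) r y) t x).
- by apply: filterS nS => -[s r] /= Ssr; exact: h1.
- by apply: filterS nt => s /= Ss; exact: h2.
- by apply: filterS nS => -[s r] /= Ssr; exact: h3.
- exact: (@cont3_slice_tx (fun t => dx (gt t)) _ _ _ cg Sq).
Qed.

Lemma time_der_dy (g gt : R -> R -> R -> R) :
  (forall t x y : R, ST (t, (x, y)) -> is_derive t 1 (fun s => g s x y) (gt t x y)) ->
  (forall t x y : R, ST (t, (x, y)) -> is_derive y 1 (g t x) (dy (g t) x y)) ->
  (forall t x y : R, ST (t, (x, y)) -> is_derive y 1 (gt t x) (dy (gt t) x y)) ->
  cont3 L (fun t => dy (gt t)) ->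
  forall t x y : R, ST (t, (x, y)) -> is_derive t 1 (fun s => dy (g s) x y) (dy (gt t) x y).
Proof.
move=> h1 h2 h3 cg t x y Sq.
have nS : nbhs (t, y) [set z : R * R | ST (z.1, (x, z.2))].
  have : nbhs (t, (x, y)) ST by move: (@open_ST _ L); rewrite openE; apply.
  move=> /nbhs_triple[U [V [W [nU nV nW h]]]]; exists (U, W) => //= -[s r] /= [Us Wr].
  by apply: h => //; exact: nbhs_singleton.
have nt : nbhs t [set s : R | ST (s, (x, y))].
  by case: nS => -[U V] /= [nU nV] UV; apply: filterS nU => s Us; apply: (UV (s, y)); split => //; exact: nbhs_singleton.
apply: (@schwarz _ (fun s r => g s x r) (fun s r => gt s x r) (fun s r => dy (g s) x r)
  (fun s r => dy (gt s) x r) t y).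
- by apply: filterS nS => -[s r] /= Ssr; exact: h1.
- by apply: filterS nt => s /= Ss; exact: h2.
- by apply: filterS nS => -[s r] /= Ssr; exact: h3.
- exact: (@cont3_slice_ty (fun t => dy (gt t)) _ _ _ cg Sq).
Qed.

Lemma time_der_lap (t x y : R) : 0 < t -> Omega L (x, y) ->
  is_derive t 1 (fun s => lap (phi s) x y) (lap (dt phi t) x y).
Proof.
have d0 (r a b : R) : ST (r, (a, b)) -> is_derive r 1 (fun s => phi s a b) (dt phi r a b).
  by move=> /STP[r0 Oab]; apply: der_of_derivable; exact: (sr_t sr r0 Oab).
have cxt : cont3 L (fun t => dx (dt phi t)) := cont3_dt (isT : (size [:: true] <= 2)%N).
have cyt : cont3 L (fun t => dy (dt phi t)) := cont3_dt (isT : (size [:: false] <= 2)%N).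
have cxxt : cont3 L (fun t => dx (dx (dt phi t))) :=
  cont3_dt (isT : (size [:: true; true] <= 2)%N).
have cyyt : cont3 L (fun t => dy (dy (dt phi t))) :=
  cont3_dt (isT : (size [:: false; false] <= 2)%N).
have x1 (r a b : R) : ST (r, (a, b)) -> is_derive a 1 ((phi r)^~ b) (dx (phi r) a b).
  by move=> /STP[r0 Oab]; exact: (Ck_derx (sr_x sr r0) Oab).
have y1 (r a b : R) : ST (r, (a, b)) -> is_derive b 1 (phi r a) (dy (phi r) a b).
  by move=> /STP[r0 Oab]; exact: (Ck_dery (sr_x sr r0) Oab).
have xt1 (r a b : R) : ST (r, (a, b)) -> is_derive a 1 ((dt phi r)^~ b) (dx (dt phi r) a b).
  by move=> /STP[r0 Oab]; exact: (Ck_derx (sr_tx sr r0) Oab).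
have yt1 (r a b : R) : ST (r, (a, b)) -> is_derive b 1 (dt phi r a) (dy (dt phi r) a b).
  by move=> /STP[r0 Oab]; exact: (Ck_dery (sr_tx sr r0) Oab).
have x2 (r a b : R) : ST (r, (a, b)) -> is_derive a 1 ((dx (phi r))^~ b) (dx (dx (phi r)) a b).
  by move=> /STP[r0 Oab]; exact: (Ck_derx (Ck_dx (sr_x sr r0)) Oab).
have y2 (r a b : R) : ST (r, (a, b)) -> is_derive b 1 (dy (phi r) a) (dy (dy (phi r)) a b).
  by move=> /STP[r0 Oab]; exact: (Ck_dery (Ck_dy (sr_x sr r0)) Oab).
have xt2 (r a b : R) : ST (r, (a, b)) ->
    is_derive a 1 ((dx (dt phi r))^~ b) (dx (dx (dt phi r)) a b).
  by move=> /STP[r0 Oab]; exact: (Ck_derx (Ck_dx (sr_tx sr r0)) Oab).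
have yt2 (r a b : R) : ST (r, (a, b)) ->
    is_derive b 1 (dy (dt phi r) a) (dy (dy (dt phi r)) a b).
  by move=> /STP[r0 Oab]; exact: (Ck_dery (Ck_dy (sr_tx sr r0)) Oab).
have d1x := @time_der_dx phi (dt phi) d0 x1 xt1 cxt.
have d1y := @time_der_dy phi (dt phi) d0 y1 yt1 cyt.
have d2x := @time_der_dx (fun t => dx (phi t)) (fun t => dx (dt phi t)) d1x x2 xt2 cxxt.
have d2y := @time_der_dy (fun t => dy (phi t)) (fun t => dy (dt phi t)) d1y y2 yt2 cyyt.
move=> t0 Oxy; have Sq : ST (t, (x, y)) by apply/STP.
exact: (derD (d2x _ _ _ Sq) (d2y _ _ _ Sq)).
Qed.

Lemma cont3_lap : cont3 L (fun t => lap (phi t)).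
Proof.
apply: (@cont3D _ L (fun t => dx (dx (phi t))) (fun t => dy (dy (phi t)))).
  exact: (cont3_pder (w := [:: true; true])).
exact: (cont3_pder (w := [:: false; false])).
Qed.

Lemma cont3_lapt : cont3 L (fun t => lap (dt phi t)).
Proof.
apply: (@cont3D _ L (fun t => dx (dx (dt phi t))) (fun t => dy (dy (dt phi t)))).
  exact: (cont3_dt (w := [:: true; true])).
exact: (cont3_dt (w := [:: false; false])).
Qed.

Let C3 t : 0 < t -> Ck 3 (Omega L) (phi t).
Proof. by move=> /Ck_phi; exact: Ck_le. Qed.

Lemma dx_lap t x y : 0 < t -> Omega L (x, y) ->
  dx (dx (dx (phi t))) x y + dy (dy (dx (phi t))) x y = dx (lap (phi t)) x y.
Proof.
by move=> t0 Oxy; have [d _] := der_lap oO (C3 t0) Oxy; have := der_derive1 d; exact: esym.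
Qed.

Lemma dy_lap t x y : 0 < t -> Omega L (x, y) ->
  dx (dx (dy (phi t))) x y + dy (dy (dy (phi t))) x y = dy (lap (phi t)) x y.
Proof.
by move=> t0 Oxy; have [_ d] := der_lap oO (C3 t0) Oxy; have := der_derive1 d; exact: esym.
Qed.

Lemma cont3_dx_lap : cont3 L (fun t => dx (lap (phi t))).
Proof.
apply: (@cont3_eq _ L (fun t x y => dx (dx (dx (phi t))) x y + dy (dy (dx (phi t))) x y)).
  by move=> t x y /STP[t0 Oxy]; exact: dx_lap.
apply: (@cont3D _ L (fun t => dx (dx (dx (phi t)))) (fun t => dy (dy (dx (phi t))))).
  exact: (cont3_pder (w := [:: true; true; true])).
exact: (cont3_pder (w := [:: false; false; true])).
Qed.

Lemma cont3_dy_lap : cont3 L (fun t => dy (lap (phi t))).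
Proof.
apply: (@cont3_eq _ L (fun t x y => dx (dx (dy (phi t))) x y + dy (dy (dy (phi t))) x y)).
  by move=> t x y /STP[t0 Oxy]; exact: dy_lap.
apply: (@cont3D _ L (fun t => dx (dx (dy (phi t)))) (fun t => dy (dy (dy (phi t))))).
  exact: (cont3_pder (w := [:: true; true; false])).
exact: (cont3_pder (w := [:: false; false; false])).
Qed.

End evolution.

(** * Boundary values of solutions *)

Section boundary_values.
Context {R : realType}.
Variables (u0 : R -> R) (L A eps : R) (us vs : R -> R -> R) (phi : R -> R -> R -> R)
  (phi0 : R -> R -> R).
Hypotheses (bf : base_flow u0) (L0 : 0 < L).
Hypothesis lp : linearized_problem u0 A L eps us vs phi phi0.

Local Notation ST := (spacetime (Omega L)).
Let sr : strong_regularity L phi. Proof. by case: lp. Qed.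
Let bc : boundary_conditions A L eps phi. Proof. by case: lp. Qed.
Let oO := @open_Omega R L.
Let C4 t : 0 < t -> Ck 4 (Omega L) (phi t). Proof. exact: (sr_x sr). Qed.

Lemma window_bounded (C : set (R * R)) (tau T : R) (g : R -> R -> R -> R) :
  compact C -> 0 < tau -> extends_to ST (spacetime C) (unc3 g) ->
  exists N : R, forall t x y, tau <= t <= T -> Omega L (x, y) -> C (x, y) -> `|g t x y| <= N.
Proof.
move=> cC tau0 ext.
have [|N hN] := @bounded_on_compact R _ ST (`[tau, T] `*` C) (unc3 g) (compact_setX (@segment_compact _ tau T) cC).
  move=> [t z] [/= tT Cz]; apply: ext; split => //=.
  by move: tT; rewrite !in_itv/= andbT => /andP[h _]; exact: lt_le_trans h.
exists N => t x y tT Oxy Cxy; apply: (hN (t, (x, y))); split.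
  by apply/STP; split => //; case/andP: tT => h _; exact: lt_le_trans h.
by split => //=; rewrite in_itv.
Qed.

Lemma window_vanish (C : set (R * R)) (tau T : R) (dist : R -> R -> R)
    (g : R -> R -> R -> R) :
  compact C -> 0 < tau -> continuous (fun z : R * R => dist z.1 z.2) ->
  (forall t x y, tau <= t <= T -> C (x, y) -> dist x y <= 0 ->
    trace ST (unc3 g) (t, (x, y)) 0) ->
  forall eta : R, 0 < eta -> exists2 rho : R, 0 < rho &
    forall t x y, tau <= t <= T -> Omega L (x, y) -> C (x, y) -> dist x y < rho ->
      `|g t x y| <= eta.
Proof.
move=> cC tau0 cd tr eta eta0.
have [||rho rho0 h] := @vanishes_of_trace R _ ST (`[tau, T] `*` C)
  (fun q => dist q.2.1 q.2.2) (unc3 g) (compact_setX (@segment_compact _ tau T) cC) _ _ eta eta0.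
- move=> q; apply: (@continuous_comp _ _ _ (fun q : R * (R * R) => q.2) (fun z : R * R => dist z.1 z.2)).
    exact: cvg_snd.
  exact: cd.
- move=> [t [x y]] [/= tT Cxy] d; exact: (tr t x y).
exists rho => // t x y tT Oxy Cxy d; apply: (h (t, (x, y))) => //; split.
  by apply/STP; split => //; case/andP: tT => h1 _; exact: lt_le_trans h1.
by split => //=; rewrite in_itv.
Qed.

Let cO : compact (clOmega L).
Proof. exact: compact_box. Qed.
Let clO x y : Omega L (x, y) -> clOmega L (x, y).
Proof.
move=> /OmegaP[/andP[h1 h2] /andP[h3 h4]].
by split; rewrite /= in_itv/= !ltW.
Qed.

Let dfst : continuous (fun z : R * R => z.1). Proof. by move=> z; exact: cvg_fst. Qed.
Let dsnd : continuous (fun z : R * R => z.2). Proof. by move=> z; exact: cvg_snd. Qed.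
Let dfstN (k : R) : continuous (fun z : R * R => k - z.1).
Proof. by move=> z; apply: cvgB; [exact: cvg_cst|exact: cvg_fst]. Qed.
Let dsndN (k : R) : continuous (fun z : R * R => k - z.2).
Proof. by move=> z; apply: cvgB; [exact: cvg_cst|exact: cvg_snd]. Qed.

Let clOP x y : clOmega L (x, y) -> (0 <= x <= L) /\ (0 <= y <= 1).
Proof. by move=> []; rewrite /= !in_itv. Qed.

Let ext2 w : (size w <= 2)%N ->
  extends_to ST (spacetime (clOmega L)) (unc3 (fun t => pder w (phi t))) := sr_x2_bd sr (w := w).

(* The four sides of the closed rectangle. *)
Let to_vanishes (dist : R * R -> R) (g : R -> R -> R -> R) t : 0 < t ->
  continuous dist ->
  (forall x y, clOmega L (x, y) -> dist (x, y) <= 0 -> trace ST (unc3 g) (t, (x, y)) 0) ->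
  vanishes (Omega L) dist (fun z => g t z.1 z.2).
Proof.
move=> t0 cd tr eta eta0.
have cd' : continuous (fun z : R * R => dist (z.1, z.2)).
  suff -> : (fun z : R * R => dist (z.1, z.2)) = dist by exact: cd.
  by apply/funext => -[].
have [|rho rho0 h] := @window_vanish (clOmega L) t t (fun x y => dist (x, y)) g cO t0 cd' _ eta eta0.
  move=> s x y ts Cxy d; have -> : s = t by apply/le_anti; rewrite andbC.
  exact: tr.
exists rho => // -[x y] Oxy d /=; apply: h => //; first by rewrite lexx.
exact: clO.
Qed.

Lemma phi_closed_x0 t y : 0 < t -> 0 <= y <= 1 -> trace ST (unc3 phi) (t, (0, y)) 0.
Proof.
apply: (@trace_closed_side_x _ _ L0 phi 0 (or_introl erefl)); first exact: (bc_x0 bc).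
exact: (ext2 (w := [::])).
Qed.

Lemma phi_closed_y y0 t x : y0 = 0 \/ y0 = 1 -> 0 < t -> 0 <= x <= L ->
  trace ST (unc3 phi) (t, (x, y0)) 0.
Proof.
move=> y0E; move: t x; apply: (@trace_closed_side_y _ _ L0 phi y0 y0E); last exact: (ext2 (w := [::])).
by case: y0E => ->; [exact: (bc_y0 bc)|exact: (bc_y1 bc)].
Qed.

Lemma dx_phi_closed_xL t y : 0 < t -> 0 <= y <= 1 ->
  trace ST (unc3 (fun t => dx (phi t))) (t, (L, y)) 0.
Proof.
apply: (@trace_closed_side_x _ _ L0 (fun t => dx (phi t)) L (or_intror erefl)).
  exact: (bc_xL bc).
exact: (ext2 (w := [:: true])).
Qed.

Lemma dx_phi_closed_y y0 t x : y0 = 0 \/ y0 = 1 -> 0 < t -> 0 <= x <= L ->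
  trace ST (unc3 (fun t => dx (phi t))) (t, (x, y0)) 0.
Proof.
move=> y0E; move: t x.
have ext := ext2 (w := [:: true]) isT.
apply: (@trace_closed_side_y _ _ L0 (fun t => dx (phi t)) y0 y0E); last exact: ext.
move=> t x t0 xL.
have tr (s r : R) : 0 < s -> 0 < r < L -> trace ST (unc3 phi) (s, (r, y0)) 0.
  by move=> s0 /andP[r0 r1]; apply: phi_closed_y => //; rewrite !ltW.
have d (s a b : R) : ST (s, (a, b)) -> is_derive a 1 ((phi s)^~ b) (dx (phi s) a b).
  by move=> /STP[s0 Oab]; exact: (Ck_derx (C4 s0) Oab).
have e (s r : R) : 0 < s -> 0 < r < L ->
    exists l : R, trace ST (unc3 (fun t => dx (phi t))) (s, (r, y0)) l.
  move=> s0 /andP[r0 rL]; apply: ext; split; first by rewrite /= in_itv/= s0.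
  by split; rewrite /= in_itv/=; [rewrite !ltW|case: y0E => ->; rewrite lexx ler01].
exact: (@tangential_y _ L phi y0 y0E tr d e t x t0 xL).
Qed.

(* Off the corners. *)
Let ext3 w : (size w <= 3)%N ->
  extends_to ST (spacetime (clOmega L `\` corners L)) (unc3 (fun t => pder w (phi t))) :=
  sr_x3_bd sr (w := w).

Let off_corner (x0 t y : R) : x0 = 0 \/ x0 = L -> 0 < t -> 0 < y < 1 ->
  spacetime (clOmega L `\` corners L) (t, (x0, y)).
Proof.
move=> x0E t0 /andP[y0 y1]; split; first by rewrite /= in_itv/= t0.
split; first by split; rewrite /= in_itv/= ?(ltW y0) ?(ltW y1)//; case: x0E => ->; rewrite lexx ?(ltW L0).
by move=> [_ /= [yE|yE]]; [move: y0|move: y1]; rewrite yE ltxx.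
Qed.

Lemma tangential2_x (x0 : R) (w : seq bool) : x0 = 0 \/ x0 = L -> (size w <= 1)%N ->
  (forall t y, 0 < t -> 0 < y < 1 -> trace ST (unc3 (fun t => pder w (phi t))) (t, (x0, y)) 0) ->
  forall t y, 0 < t -> 0 < y < 1 ->
    trace ST (unc3 (fun t => dy (dy (pder w (phi t))))) (t, (x0, y)) 0.
Proof.
move=> x0E hw tr.
have Cw t : 0 < t -> Ck 3 (Omega L) (pder w (phi t)).
  move=> t0; move: w hw {tr} => [|b [|//]] _ /=; first exact: Ck_le (C4 t0).
  by case: b; [exact: (Ck_dx (C4 t0))|exact: (Ck_dy (C4 t0))].
have d1 (s a b : R) : ST (s, (a, b)) ->
    is_derive b 1 (pder w (phi s) a) (dy (pder w (phi s)) a b).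
  by move=> /STP[s0 Oab]; exact: (Ck_dery (Cw _ s0) Oab).
have d2 (s a b : R) : ST (s, (a, b)) ->
    is_derive b 1 (dy (pder w (phi s)) a) (dy (dy (pder w (phi s))) a b).
  by move=> /STP[s0 Oab]; exact: (Ck_dery (Ck_dy (Cw _ s0)) Oab).
have e1 t y : 0 < t -> 0 < y < 1 -> exists l : R,
    trace ST (unc3 (fun t => dy (pder w (phi t)))) (t, (x0, y)) l.
  move=> t0 y0; have := ext3 (w := false :: w) (leqW hw); apply.
  exact: off_corner.
have e2 t y : 0 < t -> 0 < y < 1 -> exists l : R,
    trace ST (unc3 (fun t => dy (dy (pder w (phi t))))) (t, (x0, y)) l.
  move=> t0 y0; have := ext3 (w := [:: false, false & w]) hw; apply.
  exact: off_corner.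
have tr1 := @tangential_x _ _ L0 (fun t => pder w (phi t)) x0 x0E tr d1 e1.
exact: (@tangential_x _ _ L0 (fun t => dy (pder w (phi t))) x0 x0E tr1 d2 e2).
Qed.

Lemma dyy_phi_closed_x0 t y : 0 < t -> 0 <= y <= 1 ->
  trace ST (unc3 (fun t => dy (dy (phi t)))) (t, (0, y)) 0.
Proof.
apply: (@trace_closed_side_x _ _ L0 (fun t => dy (dy (phi t))) 0 (or_introl erefl)).
  exact: (@tangential2_x 0 [::] (or_introl erefl) isT (bc_x0 bc)).
exact: (ext2 (w := [:: false; false])).
Qed.

Lemma stream_phi t : 0 < t -> stream L (phi t).
Proof.
move=> t0.
have side (a b : R) : clOmega L (a, b) -> (0 <= a <= L) /\ (0 <= b <= 1) by exact: clOP.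
split.
- exact: C4.
- move=> w hw; have [N hN] := window_bounded (C := clOmega L) (tau := t) t cO t0 (ext2 hw).
  exists N => -[x y] Oxy; apply: hN => //; [by rewrite lexx|exact: clO].
- apply: (@to_vanishes (fun z : R * R => z.1) phi t t0 dfst) => x y /clOP[/andP[x0 _] y01] /= hx.
  have -> : x = 0 by apply/le_anti; rewrite hx.
  exact: phi_closed_x0.
- apply: (@to_vanishes (fun z : R * R => z.2) phi t t0 dsnd) => x y /clOP[x0 /andP[y0 _]] /= hy.
  have -> : y = 0 by apply/le_anti; rewrite hy.
  by apply: phi_closed_y => //; left.
- apply: (@to_vanishes (fun z : R * R => 1 - z.2) phi t t0 (@dsndN 1)) => x y /clOP[x0 /andP[_ y1]] /= hy.
  have -> : y = 1 by apply/le_anti; rewrite y1 -subr_le0.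
  by apply: phi_closed_y => //; right.
- apply: (@to_vanishes (fun z : R * R => L - z.1) (fun t => dx (phi t)) t t0 (@dfstN L))
    => x y /clOP[/andP[_ x1] y01] /= hx.
  have -> : x = L by apply/le_anti; rewrite x1 -subr_le0.
  exact: dx_phi_closed_xL.
- apply: (@to_vanishes (fun z : R * R => z.2) (fun t => dx (phi t)) t t0 dsnd)
    => x y /clOP[x0 /andP[y0 _]] /= hy.
  have -> : y = 0 by apply/le_anti; rewrite hy.
  by apply: dx_phi_closed_y => //; left.
- apply: (@to_vanishes (fun z : R * R => 1 - z.2) (fun t => dx (phi t)) t t0 (@dsndN 1))
    => x y /clOP[x0 /andP[_ y1]] /= hy.
  have -> : y = 1 by apply/le_anti; rewrite y1 -subr_le0.
  by apply: dx_phi_closed_y => //; right.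
- apply: (@to_vanishes (fun z : R * R => z.1) (fun t => dy (dy (phi t))) t t0 dfst)
    => x y /clOP[/andP[x0 _] y01] /= hx.
  have -> : x = 0 by apply/le_anti; rewrite hx.
  exact: dyy_phi_closed_x0.
Qed.


Lemma extends_to_add (S' : set (R * (R * R))) (g h : R -> R -> R -> R) :
  extends_to ST S' (unc3 g) -> extends_to ST S' (unc3 h) ->
  extends_to ST S' (unc3 (fun t x y => g t x y + h t x y)).
Proof.
by move=> eg eh q Sq; have [l hl] := eg _ Sq; have [m hm] := eh _ Sq; exists (l + m); exact: cvgD.
Qed.

Lemma extends_to_scale (S' : set (R * (R * R))) (k : R) (g : R -> R -> R -> R) :
  extends_to ST S' (unc3 g) -> extends_to ST S' (unc3 (fun t x y => k * g t x y)).
Proof.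
by move=> eg q Sq; have [l hl] := eg _ Sq; exists (k * l); apply: cvgM => //; exact: cvg_cst.
Qed.

Lemma xflux_small (M N K d u p m w wx : R) : 0 < M -> 0 <= u <= M + K -> 0 <= p <= M ->
  1 <= m <= 2 -> 0 <= N -> 0 <= d -> 0 <= eps ->
  (`|w| <= d -> `|w| <= N -> `|wx| <= N ->
    2^-1 * (u * p * m * w ^+ 2) - eps * (p * m * w * wx) <= d * (M * N * (M + K + 2 * eps))) /\
  (`|w| <= N -> `|wx| <= d ->
    - (2^-1 * (u * p * m * w ^+ 2) - eps * (p * m * w * wx)) <= d * (M * N * (2 * eps))).
Proof.
move=> M0 /andP[u_0 uM] /andP[p0 pM] /andP[m1 m2] N0 d0 e0.
have m0 : 0 <= m := le_trans ler01 m1.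
have pm : p * m <= M * 2 by rewrite ler_pM.
have pm0 : 0 <= p * m by rewrite mulr_ge0.
have upm : u * p * m <= (M + K) * (M * 2).
  by rewrite -mulrA ler_pM.
have aux (a b c : R) : `|a| <= b -> `|wx| <= c -> 0 <= b -> 0 <= c -> `|a| = `|w| ->
    eps * `|p * m * w * wx| <= eps * (M * 2 * b * c).
  move=> h1 h2 b0 c0 aw; apply: ler_wpM2l => //.
  by rewrite !normrM (ger0_norm p0) (ger0_norm m0) !ler_pM ?mulr_ge0// -aw.
split.
- move=> w1 w2 hx; have w22 : w ^+ 2 <= d * N.
    by rewrite -[w ^+ 2]ger0_norm ?sqr_ge0// normrX expr2 ler_pM.
  have t1 : u * p * m * w ^+ 2 <= (M + K) * (M * 2) * (d * N).
    by rewrite ler_pM ?sqr_ge0// !mulr_ge0.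
  have t2 := aux w d N w1 hx d0 N0 erefl.
  have t3 : - (eps * (p * m * w * wx)) <= eps * `|p * m * w * wx|.
    by rewrite -mulrN ler_wpM2l// -normrN ler_norm.
  have -> : d * (M * N * (M + K + 2 * eps)) =
    2^-1 * ((M + K) * (M * 2) * (d * N)) + eps * (M * 2 * d * N) by field.
  apply: lerD; first by rewrite ler_pM2l ?invr_gt0.
  exact: le_trans t3 t2.
- move=> w2 hx; have t2 := aux w N d w2 hx N0 d0 erefl.
  have t1 : 0 <= 2^-1 * (u * p * m * w ^+ 2).
    by rewrite mulr_ge0 ?invr_ge0// mulr_ge0 ?sqr_ge0// -mulrA mulr_ge0.
  have t3 : eps * (p * m * w * wx) <= eps * `|p * m * w * wx|.
    by rewrite ler_wpM2l// ler_norm.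
  have -> : d * (M * N * (2 * eps)) = eps * (M * 2 * N * d) by ring.
  rewrite opprB; apply: le_trans (le_trans t3 t2); by rewrite lerBlDr lerDl.
Qed.

Let ext_strip c w : 0 < c -> (size w <= 3)%N ->
  extends_to ST (spacetime (box 0 L c (1 - c))) (unc3 (fun t => pder w (phi t))).
Proof.
move=> c0 hw [t [x y]] [/= t0 /boxP[xL /andP[yc y1]]]; apply: (ext3 hw); split => //=.
split.
  split => //=; rewrite in_itv/=; apply/andP; split; first exact: le_trans (ltW c0) yc.
  by apply: le_trans y1 _; rewrite gerBl ltW.
move=> [_ /= [yE|yE]]; first by move: yc; rewrite yE leNgt c0.
by move: y1; rewrite yE lerBrDr gerDl leNgt c0.
Qed.

Let ext_lap c : 0 < c ->
  extends_to ST (spacetime (box 0 L c (1 - c))) (unc3 (fun t => lap (phi t))).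
Proof.
move=> c0; exact: (@extends_to_add _ (fun t => dx (dx (phi t))) (fun t => dy (dy (phi t)))
  (@ext_strip c [:: true; true] c0 isT) (@ext_strip c [:: false; false] c0 isT)).
Qed.

Let ext_dxlap c : 0 < c -> extends_to ST (spacetime (box 0 L c (1 - c)))
  (unc3 (fun t x y => dx (dx (dx (phi t))) x y + dy (dy (dx (phi t))) x y)).
Proof.
move=> c0; exact: (@extends_to_add _ (fun t => dx (dx (dx (phi t)))) (fun t => dy (dy (dx (phi t))))
  (@ext_strip c [:: true; true; true] c0 isT) (@ext_strip c [:: false; false; true] c0 isT)).
Qed.

Lemma traceD (g h : R -> R -> R -> R) q :
  trace ST (unc3 g) q 0 -> trace ST (unc3 h) q 0 ->
  trace ST (unc3 (fun t x y => g t x y + h t x y)) q 0.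
Proof.
move=> hg hh.
have H : trace ST (unc3 (fun t x y => g t x y + h t x y)) q (0 + 0) := cvgD hg hh.
by rewrite addr0 in H; exact: H.
Qed.

Lemma x_sides (M K tau T c eta : R) : 0 < M ->
  (forall y : R, 0 <= y <= 1 -> u0 y <= M) -> 0 < eps -> 0 <= K ->
  (forall x y, Omega L (x, y) -> u0 y <= us x y <= u0 y + K) ->
  0 < tau -> 0 < c -> c < 2^-1 -> (forall y : R, c <= y <= 1 - c -> u0 c <= u0 y) -> 0 < eta ->
  exists2 rho : R, 0 < rho & forall r t y, 0 < r < rho -> r < L -> tau <= t <= T ->
    c <= y <= 1 - c ->
    xflux u0 L eps (u0 c) us (lap (phi t)) r y
    - xflux u0 L eps (u0 c) us (lap (phi t)) (L - r) y <= eta.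
Proof.
move=> M0 hM e0 K0 hus tau0 c0 c2 level eta0.
have cC : compact (box 0 L c (1 - c)) by exact: compact_box.
have cI (y : R) : c <= y <= 1 - c -> 0 < y < 1.
  move=> /andP[h1 h2]; rewrite (lt_le_trans c0 h1)/=; apply: le_lt_trans h2 _.
  by rewrite gtrBl.
have [N1 hN1] := window_bounded T cC tau0 (ext_lap c0).
have [N2 hN2] := window_bounded T cC tau0 (ext_dxlap c0).
pose N := `|N1| + `|N2|.
have N0 : 0 <= N by rewrite addr_ge0.
pose D := M * N * (M + K + 4 * eps) + 1.
have D0 : 0 < D.
  by rewrite ltr_wpDl// mulr_ge0// ?mulr_ge0 ?addr_ge0 ?mulr_ge0 ?(ltW M0) ?(ltW e0).
pose d := eta / D.
have d0 : 0 < d by rewrite divr_gt0.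
have pos (t : R) : tau <= t <= T -> 0 < t by move=> /andP[h _]; exact: lt_le_trans h.
have tr1 t x y : tau <= t <= T -> box 0 L c (1 - c) (x, y) -> x <= 0 ->
    trace ST (unc3 (fun t => lap (phi t))) (t, (x, y)) 0.
  move=> /pos t0 /boxP[/andP[x0 _] /cI y0] hx.
  have -> : x = 0 by apply/le_anti; rewrite hx x0.
  exact: (@traceD (fun t => dx (dx (phi t))) (fun t => dy (dy (phi t))) (t, (0, y))
    (bc_xx0 bc t0 y0)
    (@tangential2_x 0 [::] (or_introl erefl) isT (bc_x0 bc) t y t0 y0)).
have tr2 t x y : tau <= t <= T -> box 0 L c (1 - c) (x, y) -> L - x <= 0 ->
    trace ST (unc3 (fun t x y => dx (dx (dx (phi t))) x y + dy (dy (dx (phi t))) x y))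
      (t, (x, y)) 0.
  move=> /pos t0 /boxP[/andP[_ x0] /cI y0] hx.
  have -> : x = L by apply/le_anti; rewrite x0 -subr_le0 hx.
  exact: (@traceD (fun t => dx (dx (dx (phi t)))) (fun t => dy (dy (dx (phi t)))) (t, (L, y))
    (bc_xxxL bc t0 y0)
    (@tangential2_x L [:: true] (or_intror erefl) isT (bc_xL bc) t y t0 y0)).
have [r1 r10 h1] := @window_vanish (box 0 L c (1 - c)) tau T (fun x _ => x)
  (fun t => lap (phi t)) cC tau0 dfst tr1 d d0.
have [r2 r20 h2] := @window_vanish (box 0 L c (1 - c)) tau T (fun x _ => L - x)
  (fun t x y => dx (dx (dx (phi t))) x y + dy (dy (dx (phi t))) x y) cC tau0 (@dfstN L)
  tr2 d d0.
exists (Num.min r1 r2) => [|r t y]; first by rewrite lt_min r10.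
rewrite lt_min => /andP[r0 /andP[rr1 rr2]] rL tT yc.
have y01 := cI _ yc; have y01' : 0 <= y <= 1 by case/andP: y01 => ? ?; rewrite !ltW.
have t0 : 0 < t by case/andP: tT => tt _; exact: lt_le_trans tt.
have O1 : Omega L (r, y) by apply/OmegaP; rewrite r0 rL.
have O2 : Omega L (L - r, y) by apply/OmegaP; rewrite subr_gt0 rL gtrBl r0.
have B1 : box 0 L c (1 - c) (r, y) by apply/boxP; split => //; rewrite (ltW r0) (ltW rL).
have B2 : box 0 L c (1 - c) (L - r, y).
  by apply/boxP; split => //; rewrite subr_ge0 (ltW rL) gerBl ltW.
have wN x : Omega L (x, y) -> box 0 L c (1 - c) (x, y) -> `|lap (phi t) x y| <= N.
  move=> Oxy Bxy; apply: le_trans (hN1 _ _ _ tT Oxy Bxy) _.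
  by apply: le_trans (ler_norm _) _; rewrite lerDl.
have wxN x : Omega L (x, y) -> box 0 L c (1 - c) (x, y) -> `|dx (lap (phi t)) x y| <= N.
  move=> Oxy Bxy; have := hN2 _ _ _ tT Oxy Bxy; rewrite (dx_lap lp t0 Oxy) => /le_trans; apply.
  by apply: le_trans (ler_norm _) _; rewrite lerDr.
have w1 := h1 _ _ _ tT O1 B1 rr1.
have w2 : `|dx (lap (phi t)) (L - r) y| <= d.
  have := h2 _ _ _ tT O2 B2; rewrite (dx_lap lp t0 O2); apply.
  by rewrite opprB addrC subrK.
have p01 : 0 <= u0 y - u0 c <= M.
  rewrite subr_ge0 level//=; apply: le_trans (hM _ y01'); rewrite gerBl.
  by apply: ltW; apply: (base_pos bf); case: (half_itv c0 c2).
have us01 x : Omega L (x, y) -> 0 <= us x y <= M + K.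
  move=> Oxy; have /andP[q1 q2] := hus _ _ Oxy.
  rewrite (le_trans _ q1) ?(ltW (Omega_u0 bf Oxy))//=.
  by apply: le_trans q2 _; rewrite lerD2r hM.
have m1 : 1 <= slope_wt L r <= 2 by apply: slope_wt_bd => //; rewrite r0.
have m2 : 1 <= slope_wt L (L - r) <= 2.
  by apply: slope_wt_bd => //; rewrite subr_gt0 rL gtrBl.
have [s1 _] := @xflux_small M N K d (us r y) (u0 y - u0 c) (slope_wt L r) (lap (phi t) r y)
  (dx (lap (phi t)) r y) M0 (us01 _ O1) p01 m1 N0 (ltW d0) (ltW e0).
have [_ s2] := @xflux_small M N K d (us (L - r) y) (u0 y - u0 c) (slope_wt L (L - r))
  (lap (phi t) (L - r) y) (dx (lap (phi t)) (L - r) y) M0 (us01 _ O2) p01 m2 N0 (ltW d0) (ltW e0).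
apply: le_trans (lerD (s1 w1 (wN _ O1 B1) (wxN _ O1 B1)) (s2 (wN _ O2 B2) w2)) _.
have -> : d * (M * N * (M + K + 2 * eps)) + d * (M * N * (2 * eps)) = d * (D - 1).
  by rewrite /D; ring.
by rewrite mulrBr mulr1 /d divfK ?gt_eqF// gerBl ltW.
Qed.

Lemma slip_sqr (k e w y r : R) : 0 < k -> 0 <= e -> `|r| <= e -> e ^+ 2 * (2 / k ^+ 2) <= e ->
  r = y - k * w \/ r = y + k * w -> w ^+ 2 <= 2 / k ^+ 2 * y ^+ 2 + e.
Proof.
move=> k0 e0 re he hr; have k20 : 0 < k ^+ 2 by rewrite exprn_gt0.
have rr := sqr_le_of_norm re.
have h : k ^+ 2 * w ^+ 2 <= 2 * y ^+ 2 + 2 * r ^+ 2.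
  case: hr => rE.
    have -> : k ^+ 2 * w ^+ 2 = (y - r) ^+ 2 by rewrite rE; ring.
    have := sqr_ge0 (y + r); move=> q; rewrite -subr_ge0; move: q; congr (0 <= _); ring.
  have -> : k ^+ 2 * w ^+ 2 = (y - r) ^+ 2 by rewrite rE; ring.
  have := sqr_ge0 (y + r); move=> q; rewrite -subr_ge0; move: q; congr (0 <= _); ring.
have h2 : 2 / k ^+ 2 * r ^+ 2 <= e.
  apply: le_trans he; rewrite mulrC; apply: ler_wpM2r => //.
  by apply: divr_ge0 => //; exact: ltW.
have h3 : w ^+ 2 <= 2 / k ^+ 2 * y ^+ 2 + 2 / k ^+ 2 * r ^+ 2.
  have -> : 2 / k ^+ 2 * y ^+ 2 + 2 / k ^+ 2 * r ^+ 2 = (2 * y ^+ 2 + 2 * r ^+ 2) / k ^+ 2 by ring.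
  by rewrite ler_pdivlMr// mulrC.
by apply: le_trans h3 _; rewrite lerD2l.
Qed.

Lemma y_sides (tau T eta : R) : 0 < A -> 0 < cbrt eps -> 0 < tau -> 0 < eta ->
  exists2 rho : R, 0 < rho & forall c t x, 0 < c < rho -> c < 1 -> tau <= t <= T -> 0 < x < L ->
    lap (phi t) x c ^+ 2 <= 2 / (A * cbrt eps) ^+ 2 * dy (phi t) x c ^+ 2 + eta /\
    lap (phi t) x (1 - c) ^+ 2 <=
      2 / (A * cbrt eps) ^+ 2 * dy (phi t) x (1 - c) ^+ 2 + eta.
Proof.
move=> A0 s0 tau0 eta0; set k := A * cbrt eps; have k0 : 0 < k by rewrite mulr_gt0.
have [e e0 [ee he]] : exists2 e : R, 0 < e & e <= eta /\ e ^+ 2 * (2 / k ^+ 2) <= e.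
  have h0 : 0 < k ^+ 2 / 2 by rewrite divr_gt0// exprn_gt0.
  exists (Num.min eta (k ^+ 2 / 2)); first by rewrite lt_min eta0.
  have m0 : 0 < Num.min eta (k ^+ 2 / 2) by rewrite lt_min eta0.
  split; first by rewrite ge_min lexx.
  rewrite expr2 -mulrA ler_piMr ?(ltW m0)//.
  by rewrite -[2 / _]invf_div ler_pdivrMr// mul1r ge_min lexx orbT.
have extl : extends_to ST (spacetime (clOmega L)) (unc3 (fun t => lap (phi t))).
  exact: (@extends_to_add _ (fun t => dx (dx (phi t))) (fun t => dy (dy (phi t)))
    (ext2 (w := [:: true; true]) isT) (ext2 (w := [:: false; false]) isT)).
have exty := ext2 (w := [:: false]) isT.
have extp (j : R) : extends_to ST (spacetime (clOmega L))
    (unc3 (fun t x y => dy (phi t) x y + j * lap (phi t) x y)).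
  exact: (@extends_to_add _ (fun t => dy (phi t)) (fun t x y => j * lap (phi t) x y) exty
    (@extends_to_scale _ j (fun t => lap (phi t)) extl)).
have tr0 (t x : R) : 0 < t -> 0 < x < L -> trace ST
    (unc3 (fun t x y => dy (phi t) x y + - k * lap (phi t) x y)) (t, (x, 0)) 0.
  move=> t0 xL; have := bc_slip0 bc t0 xL; congr (trace ST _ _ _).
  by apply/funext => -[s [a b]]; rewrite /unc3/= mulNr.
have tr1 (t x : R) : 0 < t -> 0 < x < L -> trace ST
    (unc3 (fun t x y => dy (phi t) x y + k * lap (phi t) x y)) (t, (x, 1)) 0.
  exact: (bc_slip1 bc).
have cl0 := @trace_closed_side_y _ L L0 _ 0 (or_introl erefl) tr0 (extp (- k)).
have cl1 := @trace_closed_side_y _ L L0 _ 1 (or_intror erefl) tr1 (extp k).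
have pos (t : R) : tau <= t <= T -> 0 < t by move=> /andP[h _]; exact: lt_le_trans h.
have tw0 t x y : tau <= t <= T -> clOmega L (x, y) -> y <= 0 ->
    trace ST (unc3 (fun t x y => dy (phi t) x y + - k * lap (phi t) x y)) (t, (x, y)) 0.
  move=> /pos t0 /clOP[x0 /andP[y0 _]] hy.
  have -> : y = 0 by apply/le_anti; rewrite hy y0.
  exact: cl0.
have tw1 t x y : tau <= t <= T -> clOmega L (x, y) -> 1 - y <= 0 ->
    trace ST (unc3 (fun t x y => dy (phi t) x y + k * lap (phi t) x y)) (t, (x, y)) 0.
  move=> /pos t0 /clOP[x0 /andP[_ y0]] hy.
  have -> : y = 1 by apply/le_anti; rewrite y0 -subr_le0 hy.
  exact: cl1.
have [r1 r10 h1] := @window_vanish (clOmega L) tau T (fun _ y => y)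
  (fun t x y => dy (phi t) x y + - k * lap (phi t) x y) cO tau0 dsnd tw0 e e0.
have [r2 r20 h2] := @window_vanish (clOmega L) tau T (fun _ y => 1 - y)
  (fun t x y => dy (phi t) x y + k * lap (phi t) x y) cO tau0 (@dsndN 1) tw1 e e0.
exists (Num.min r1 r2) => [|c t x]; first by rewrite lt_min r10.
rewrite lt_min => /andP[c0 /andP[cr1 cr2]] c1 tT x0.
have O1 : Omega L (x, c) by apply/OmegaP; rewrite c0.
have O2 : Omega L (x, 1 - c) by apply/OmegaP; rewrite subr_gt0 c1 gtrBl.
have q1 := h1 _ _ _ tT O1 (clO O1) cr1.
have q2 := h2 _ _ _ tT O2 (clO O2) ltac:(by rewrite opprB addrC subrK).
split.
- have hq : dy (phi t) x c + - k * lap (phi t) x c = dy (phi t) x c - k * lap (phi t) x c.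
    by rewrite mulNr.
  have := slip_sqr k0 (ltW e0) q1 he (or_introl hq).
  by move=> /le_trans; apply; rewrite lerD2l.
- have := slip_sqr k0 (ltW e0) q2 he (or_intror erefl).
  by move=> /le_trans; apply; rewrite lerD2l.
Qed.

End boundary_values.

(** * Cylinders and their product measure *)

Section sigma_finite_products.
Context {R : realType}.
Context d1 d2 (T1 : measurableType d1) (T2 : measurableType d2).
Variables (m1 : {sigma_finite_measure set T1 -> \bar R}).
Variables (m2 : {sigma_finite_measure set T2 -> \bar R}).

Lemma sigma_finite_product : sigma_finite setT (m1 \x m2)%E.
Proof.
have /sigma_finiteP[F [TF ndF Foo]] := sigma_finiteT m1.
have /sigma_finiteP[G [TG ndG Goo]] := sigma_finiteT m2.
exists (fun n => F n `*` G n).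
  rewrite -setXTT TF TG predeqE => -[x y]; split; last first.
    by move=> [n _ []/= ? ?]; split; exists n.
  move=> [/= [n _ Fnx] [k _ Gky]]; exists (maxn n k) => //; split.
    by move: x Fnx; exact/subsetPset/ndF/leq_maxl.
  by move: y Gky; exact/subsetPset/ndG/leq_maxr.
move=> k; have [? ?] := Foo k; have [? ?] := Goo k.
split; first exact: measurableX.
by rewrite product_measure1E// lte_mul_pinfty// ge0_fin_numE.
Qed.

(** The product measure with its structure of sigma-finite measure, so that the
  product with a third factor can be formed. *)
Definition product_measure : {sigma_finite_measure set (T1 * T2)%type -> \bar R} :=
  HB.pack (m1 \x m2)%E
    (@Measure_isSigmaFinite.Build _ _ R (m1 \x m2)%E sigma_finite_product).

End sigma_finite_products.

Notation leb2s R := (product_measure (leb R) (leb R)).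
Notation leb3 R := (leb R \x leb2s R)%E.

Section cylinders.
Context {R : realType}.
Variables (L tau T a b c d : R).
Hypotheses (tau0 : 0 < tau) (tauT : tau <= T) (ab : a <= b) (cd : c <= d).
Hypothesis bO : box a b c d `<=` Omega L.
Let cyl : set (R * (R * R)) := `[tau, T] `*` box a b c d.

Lemma cyl_ST : cyl `<=` spacetime (Omega L).
Proof.
move=> [t z] [/= tT Dz]; split; last exact: bO.
by move: tT; rewrite /= !in_itv/= andbT => /andP[h _]; exact: lt_le_trans h.
Qed.

Lemma measurable_cyl : measurable cyl.
Proof. by apply: measurableX; [exact: measurable_itv|exact: measurable_box]. Qed.

Lemma leb3_cyl : leb3 R cyl = ((T - tau) * ((b - a) * (d - c)))%:E.
Proof.
have h1 : leb R `[tau, T] = (T - tau)%:E by exact: leb_itv_cc.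
have h2 : leb2s R (box a b c d) = ((b - a) * (d - c))%:E by exact: leb2_box.
rewrite EFinM -h1 -h2.
by apply: product_measure1E; [exact: measurable_itv|exact: measurable_box].
Qed.

Lemma cyl_lty : (leb3 R cyl < +oo)%E.
Proof. by rewrite leb3_cyl ltry. Qed.

Lemma integrable_cyl (g : R -> R -> R -> R) : cont3 L g ->
  (leb3 R).-integrable cyl (EFin \o unc3 g).
Proof.
move=> cg; have [N hN] : bounded_on cyl (unc3 g).
  apply: bounded_on_continuous.
    by apply: compact_setX; [exact: segment_compact|exact: compact_box].
  by move=> q /cyl_ST; exact: cg.
refine (@bounded_integrable _ _ _ (leb3 R) cyl (unc3 g) N measurable_cyl cyl_lty _ hN).
by apply: measurable_funS (cont3_measurable cg); [apply: open_measurable3; exact: open_ST|exact: cyl_ST].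
Qed.

Definition cint (g : R -> R -> R -> R) : R := \int[leb3 R]_(q in cyl) unc3 g q.

Lemma EFin_cint g : cont3 L g -> (\int[leb3 R]_(q in cyl) (unc3 g q)%:E = (cint g)%:E)%E.
Proof.
move=> cg; rewrite /cint /Rintegral fineK//.
by apply: integrable_fin_num; [exact: measurable_cyl|exact: integrable_cyl].
Qed.

Lemma cintD g h : cont3 L g -> cont3 L h ->
  cint (fun t x y => g t x y + h t x y) = cint g + cint h.
Proof. by move=> cg ch; apply: RintegralD; [exact: measurable_cyl|exact: integrable_cyl..]. Qed.

Lemma le_cint g h : cont3 L g -> cont3 L h ->
  (forall t x y, tau <= t <= T -> box a b c d (x, y) -> g t x y <= h t x y) ->
  cint g <= cint h.
Proof.
move=> cg ch gh; apply: le_Rintegral; [exact: measurable_cyl|exact: integrable_cyl..|].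
move=> [t [x y]] [/= tT Dz]; apply: gh => //.
Qed.

Lemma cint_cst (k : R) : cint (fun _ _ _ => k) = k * ((T - tau) * ((b - a) * (d - c))).
Proof.
apply: EFin_inj; rewrite -EFin_cint; last exact: cont3_cst.
rewrite (@integral_cst _ _ _ (leb3 R) cyl measurable_cyl k%:E).
by rewrite EFinM; congr (_ * _)%E; exact: leb3_cyl.
Qed.

(** The time integral of the slices. *)
Lemma cint_slices_le g (r : R -> \bar R) : cont3 L g ->
  measurable_fun `[tau, T] r -> (forall t, tau <= t <= T -> (0 <= r t)%E) ->
  (forall t, tau <= t <= T -> ((bint a b c d (g t))%:E <= r t)%E) ->
  ((cint g)%:E <= \int[leb R]_(t in `[tau, T]) r t)%E.
Proof.
move=> cg mr r0 gr.
have [->|roo] := eqVneq (\int[leb R]_(t in `[tau, T]) r t)%E +oo%E; first exact: leey.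
have ig := integrable_cyl cg.
have t0 t : tau <= t <= T -> 0 < t by move=> /andP[h _]; exact: lt_le_trans h.
rewrite -EFin_cint// (@EFin_fubini_setX _ _ _ _ _ (leb R) (leb2s R)); first last.
- exact: ig.
- exact: measurable_box.
- exact: measurable_itv.
apply: le_integral.
- exact: measurable_itv.
- apply: (@integrable_fubini_setX _ _ _ _ _ (leb R) (leb2s R)); [exact: measurable_itv|exact: measurable_box|exact: ig].
- apply/integrableP; split => //.
  under eq_integral => t /set_mem/=.
    rewrite in_itv/= => /r0 hx; rewrite gee0_abs//; over.
  by rewrite ltey.
- move=> t /set_mem/=; rewrite in_itv/= => tT; apply: le_trans (gr _ tT).
  by rewrite -(EFin_bint ab cd bO (cont3_slice (t0 _ tT) cg)).
Qed.

Lemma cint_ftc (H h : R -> R -> R -> R) : cont3 L H -> cont3 L h ->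
  (forall t x y : R, 0 < t -> Omega L (x, y) -> is_derive t 1 (fun s => H s x y) (h t x y)) ->
  cint h = bint a b c d (H T) - bint a b c d (H tau).
Proof.
move=> cH ch dH; have T0 := lt_le_trans tau0 tauT.
have cT := cont3_slice T0 cH; have ct := cont3_slice tau0 cH.
have E : bint a b c d (fun x y => H T x y + - H tau x y) = bint a b c d (H T) - bint a b c d (H tau).
  have E2 : bint a b c d (fun x y => - H tau x y) = - bint a b c d (H tau).
    rewrite -mulN1r -(bintZ ab cd bO (-1) ct); apply: eq_bint => x y _ _; by rewrite mulN1r.
  by rewrite (bintD ab cd bO cT (cont_onN ct)) E2.
rewrite -E; apply: EFin_inj; rewrite -EFin_cint//.
rewrite (@EFin_fubini_setX_swap _ _ _ _ _ (leb R) (leb2s R)); first last.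
- exact: (integrable_cyl ch).
- exact: measurable_box.
- exact: measurable_itv.
rewrite -(EFin_bint ab cd bO (cont_onD cT (cont_onN ct))).
apply: eq_integral => -[x y] /set_mem /bO Oxy.
apply: (@EFin_ftc _ (fun t => H t x y) (fun t => h t x y) tau T tauT) => t /andP[t1 _].
  by apply: dH => //; exact: lt_le_trans t1.
by apply: (cont3_slice_t Oxy _ ch); exact: lt_le_trans t1.
Qed.

End cylinders.

(** * Energy on a cylinder *)

Section subdomains.
Context {R : realType}.
Variables (L tau T a b c d a' b' c' d' : R).
Hypotheses (tau0 : 0 < tau) (tauT : tau <= T).
Hypotheses (ab : a <= b) (cd : c <= d) (bO : box a b c d `<=` Omega L).
Hypotheses (ab' : a' <= b') (cd' : c' <= d').
Hypothesis sub : box a' b' c' d' `<=` box a b c d.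
Let bO' : box a' b' c' d' `<=` Omega L. Proof. exact: subset_trans sub bO. Qed.

Lemma bint_sub f : cont_on (Omega L) f -> (forall x y, box a b c d (x, y) -> 0 <= f x y) ->
  bint a' b' c' d' f <= bint a b c d f.
Proof.
move=> cf f0; rewrite -lee_fin -(EFin_bint ab' cd' bO' cf) -(EFin_bint ab cd bO cf).
apply: ge0_subset_integral => //.
- exact: measurable_box.
- exact: measurable_box.
- apply/measurable_EFinP; apply: measurable_funS (cont_measurable cf) => //.
  exact: measurable_Omega.
- by move=> [x y] Dxy; rewrite lee_fin; exact: f0.
Qed.

Lemma cint_sub g : cont3 L g ->
  (forall t x y, tau <= t <= T -> box a b c d (x, y) -> 0 <= g t x y) ->
  cint tau T a' b' c' d' g <= cint tau T a b c d g.
Proof.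
move=> cg g0; rewrite -lee_fin -(EFin_cint tau0 tauT ab' cd' bO' cg) -(EFin_cint tau0 tauT ab cd bO cg).
apply: ge0_subset_integral => //.
- exact: measurable_cyl.
- exact: measurable_cyl.
- apply/measurable_EFinP; apply: measurable_funS (cont3_measurable cg).
    by apply: open_measurable3; exact: open_ST.
  exact: (cyl_ST tau0 bO).
- by move=> [t [x y]] [/= tT Dxy]; rewrite lee_fin; apply: g0.
- by move=> [t z] [/= tT /sub Dz].
Qed.

End subdomains.

Lemma cont3X (R : realType) (L : R) g n : cont3 L g -> cont3 L (fun t x y => g t x y ^+ n).
Proof.
move=> cg q Sq; apply: (@continuous_comp _ _ _ (unc3 g) (fun u => u ^+ n)); first exact: cg.
exact: exprn_continuous.
Qed.

Lemma cont3N (R : realType) (L : R) g : cont3 L g -> cont3 L (fun t x y => - g t x y).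
Proof. by move=> cg q Sq; apply: cvgN; exact: cg. Qed.

Ltac cont3 :=
  lazymatch goal with
  | |- cont3 _ (fun _ _ _ => ?c) => exact: cont3_cst
  | |- cont3 ?L (fun t x y => @?a t x y + @?b t x y) => apply: (@cont3D _ L a b); cont3
  | |- cont3 ?L (fun t x y => - @?a t x y) => apply: (@cont3N _ L a); cont3
  | |- cont3 ?L (fun t x y => @?a t x y ^+ ?n) => apply: (@cont3X _ L a n); cont3
  | |- cont3 ?L (fun t x y => @?a t x y * @?b t x y) => apply: (@cont3M _ L a b); cont3
  | |- cont3 ?L (fun t x y => ?h t x y) =>
      match goal with H : cont3 L h |- _ => exact H end
  | |- cont3 ?L (fun t x y => ?h x y) =>
      match goal with H : cont3 L (fun=> h) |- _ => exact H end
  | |- cont3 ?L ?h => match goal with H : cont3 L h |- _ => exact H end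
  end.

Section cylinder_energy.
Context {R : realType}.
Variables (u0 : R -> R) (L eps tau T cc : R) (us : R -> R -> R).
Variables (w wt wx wy : R -> R -> R -> R).
Hypotheses (L0 : 0 < L) (tau0 : 0 < tau) (tauT : tau <= T) (e0 : 0 < eps).
Hypotheses (cu0 : cont3 L (fun _ _ y => u0 y)) (cus : cont3 L (fun=> us)).
Hypotheses (cw : cont3 L w) (cwt : cont3 L wt) (cwx : cont3 L wx) (cwy : cont3 L wy).
Hypothesis dw : forall t x y : R, 0 < t -> Omega L (x, y) ->
  is_derive t 1 (fun s => w s x y) (wt t x y).
Hypothesis u0_us : forall x y, Omega L (x, y) -> 0 <= u0 y <= us x y.

Definition density (k t x y : R) : R :=
  (u0 y - k) * slope_wt L x * w t x y * wt t x y
  + 2^-1 * cc * ((u0 y - k) * slope_wt L x * w t x y ^+ 2)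
  + ((2 * L)^-1 * (us x y * (u0 y - k) * w t x y ^+ 2)
     + eps * ((u0 y - k) * slope_wt L x * (wx t x y ^+ 2 + wy t x y ^+ 2))).

Definition growth (t : R) : R := expR (cc * t).

Lemma grow_gt0 (t : R) : 0 < growth t. Proof. exact: expR_gt0. Qed.

Lemma der_grow (t : R) : is_derive t 1 growth (cc * growth t).
Proof.
have d := @der_comp _ (fun t => cc * t) expR t _ _ (derM (der_cst cc t) (der_id t)) (is_derive_expR (cc * t)).
by apply: (is_derive_eq d); rewrite /growth mul0r add0r mulr1 mulrC.
Qed.

Lemma cont3_grow : cont3 L (fun t _ _ => growth t).
Proof. by apply: (@cont3_t _ L growth) => t _; exact: (der_continuous (der_grow t)). Qed.

Let cgr := cont3_grow.

Let csl : cont3 L (fun _ x _ => slope_wt L x).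
Proof.
apply: (@cont3_xy _ L (fun x _ => slope_wt L x)).
apply: cont_on_fst => z _; rewrite /slope_wt /prop_for /continuous_at.
apply: cvgD; first exact: cvg_cst.
by apply: cvgM; [exact: cvg_cst|exact: cvg_id].
Qed.

Variables (a b c d a' b' c' d' k : R) (r : R -> \bar R).
Hypotheses (ab : a <= b) (cd : c <= d) (bO : box a b c d `<=` Omega L).
Hypotheses (ab' : a' <= b') (cd' : c' <= d').
Hypothesis sub : box a' b' c' d' `<=` box a b c d.
Hypotheses (k0 : 0 <= k) (ku0 : forall y, c <= y <= d -> k <= u0 y).
Hypotheses (mr : measurable_fun `[tau, T] r) (r0 : forall t, tau <= t <= T -> (0 <= r t)%E).
Hypothesis density_le : forall t, tau <= t <= T -> ((bint a b c d (density k t))%:E <= r t)%E.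

Let H t x y := 2^-1 * ((u0 y - k) * slope_wt L x * (growth t * w t x y ^+ 2)).
Let Z1 t x y := growth t * ((u0 y - k) * slope_wt L x * w t x y * wt t x y
  + 2^-1 * cc * ((u0 y - k) * slope_wt L x * w t x y ^+ 2)).
Let Z2 t x y := growth t * ((2 * L)^-1 * (us x y * (u0 y - k) * w t x y ^+ 2)
     + eps * ((u0 y - k) * slope_wt L x * (wx t x y ^+ 2 + wy t x y ^+ 2))).
Let Y1 x y := 2^-1 * (growth T * ((u0 y - k) * w T x y ^+ 2)).
Let Y2 t x y := growth t * ((2 * L)^-1 * (u0 y * (u0 y - k) * w t x y ^+ 2)
     + eps * ((u0 y - k) * (wx t x y ^+ 2 + wy t x y ^+ 2))).

Let cH : cont3 L H. Proof. by rewrite /H; cont3. Qed.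
Let cZ1 : cont3 L Z1. Proof. by rewrite /Z1; cont3. Qed.
Let cZ2 : cont3 L Z2. Proof. by rewrite /Z2; cont3. Qed.
Let cY2 : cont3 L Y2. Proof. by rewrite /Y2; cont3. Qed.
Let cdens : cont3 L (density k). Proof. by rewrite /density; cont3. Qed.

Let dH (t x y : R) : 0 < t -> Omega L (x, y) -> is_derive t 1 (fun s => H s x y) (Z1 t x y).
Proof.
move=> t0 Oxy.
have d1 := derM (der_grow t) (derX 1 (dw t0 Oxy)).
have d2 := derM (der_cst 2^-1 t) (derM (der_cst ((u0 y - k) * slope_wt L x) t) d1).
by apply: (is_derive_eq d2); rewrite /Z1; field.
Qed.

Let T0 : 0 < T. Proof. exact: lt_le_trans tauT. Qed.

Let sl x y : Omega L (x, y) -> 1 <= slope_wt L x <= 2.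
Proof. by move=> /OmegaP[x0 _]; exact: slope_wt_bd. Qed.

Let p01 x y : box a b c d (x, y) -> 0 <= u0 y - k.
Proof. by move=> /boxP[_ yc]; rewrite subr_ge0; exact: ku0. Qed.

Lemma cylinder_energy :
  ((bint a' b' c' d' Y1 + cint tau T a' b' c' d' Y2)%:E <=
   (growth tau * bint a b c d (fun x y => u0 y * w tau x y ^+ 2))%:E +
   \int[leb R]_(t in `[tau, T]) ((growth t)%:E * r t))%E.
Proof.
have cwT := cont3_slice T0 cw; have cwtau := cont3_slice tau0 cw.
have cHT := cont3_slice T0 cH; have cHtau := cont3_slice tau0 cH.
have cu : cont_on (Omega L) (fun=> u0) := cont3_slice T0 cu0.
have cs : cont_on (Omega L) (fun x _ => slope_wt L x) := cont3_slice T0 csl.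
have cY1 : cont_on (Omega L) Y1 by rewrite /Y1; cont.
have h1 : bint a' b' c' d' Y1 <= bint a b c d (H T).
  apply: (@le_trans _ _ (bint a b c d Y1)).
    apply: (bint_sub ab cd bO ab' cd' sub cY1) => x y Dxy.
    by rewrite /Y1 mulr_ge0 ?invr_ge0// mulr_ge0 ?(ltW (grow_gt0 _))// mulr_ge0 ?sqr_ge0// (p01 Dxy).
  apply: (le_bint ab cd bO cY1 cHT) => x y xab ycd.
  have Dxy : box a b c d (x, y) by apply/boxP.
  have /andP[m1 _] := sl (bO Dxy); have p0 := p01 Dxy.
  rewrite /Y1 /H ler_pM2l ?invr_gt0//.
  have -> : (u0 y - k) * slope_wt L x * (growth T * w T x y ^+ 2) =
    slope_wt L x * (growth T * ((u0 y - k) * w T x y ^+ 2)) by ring.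
  apply: ler_peMl => //.
  by rewrite mulr_ge0 ?(ltW (grow_gt0 _))// mulr_ge0 ?sqr_ge0.
have h2 : bint a b c d (H tau) <= growth tau * bint a b c d (fun x y => u0 y * w tau x y ^+ 2).
  have cq : cont_on (Omega L) (fun x y => u0 y * w tau x y ^+ 2) by cont.
  have cq2 : cont_on (Omega L) (fun x y => growth tau * (u0 y * w tau x y ^+ 2)) by cont.
  rewrite -(bintZ ab cd bO (growth tau) cq).
  apply: (le_bint ab cd bO cHtau cq2) => x y xab ycd.
  have Dxy : box a b c d (x, y) by apply/boxP.
  have /andP[m1 m2] := sl (bO Dxy); have p0 := p01 Dxy.
  have hh : (u0 y - k) * slope_wt L x <= u0 y * 2.
    by rewrite ler_pM// ?(le_trans ler01)// lerBlDr lerDl.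
  rewrite /H; have g0 : 0 <= growth tau * w tau x y ^+ 2 by rewrite mulr_ge0 ?sqr_ge0// ltW// grow_gt0.
  have -> : growth tau * (u0 y * w tau x y ^+ 2) = 2^-1 * (u0 y * 2 * (growth tau * w tau x y ^+ 2)) by field.
  by rewrite ler_pM2l ?invr_gt0// ler_wpM2r.
have h3 : cint tau T a' b' c' d' Y2 <= cint tau T a b c d Z2.
  have Y20 t x y : box a b c d (x, y) -> 0 <= Y2 t x y.
    move=> Dxy; have p0 := p01 Dxy; have /andP[u00 _] := u0_us (bO Dxy).
    rewrite /Y2 mulr_ge0 ?(ltW (grow_gt0 _))// addr_ge0// mulr_ge0 ?(ltW e0)//.
    - by rewrite invr_ge0 mulr_ge0// ltW.
    - by rewrite mulr_ge0 ?sqr_ge0// mulr_ge0.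
    - by rewrite mulr_ge0// addr_ge0 ?sqr_ge0.
  apply: (@le_trans _ _ (cint tau T a b c d Y2)).
    by apply: (cint_sub tau0 tauT ab cd bO ab' cd' sub cY2) => t x y _; exact: Y20.
  apply: (le_cint tau0 tauT ab cd bO cY2 cZ2) => t x y _ Dxy.
  have p0 := p01 Dxy; have /andP[u00 uus] := u0_us (bO Dxy); have /andP[m1 _] := sl (bO Dxy).
  rewrite /Y2 /Z2; apply: ler_wpM2l; first exact/ltW/grow_gt0.
  apply: lerD.
    apply: ler_wpM2l; first by rewrite invr_ge0 mulr_ge0// ltW.
    by rewrite ler_wpM2r ?sqr_ge0// ler_wpM2r.
  apply: ler_wpM2l; first exact: ltW.
  rewrite ler_wpM2r ?addr_ge0 ?sqr_ge0//.
  by rewrite ler_peMr.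
have h4 : cint tau T a b c d Z1 = bint a b c d (H T) - bint a b c d (H tau).
  exact: (cint_ftc tau0 tauT ab cd bO cH cZ1 dH).
have cZ : cont3 L (fun t x y => Z1 t x y + Z2 t x y) by cont3.
have h5 : ((cint tau T a b c d (fun t x y => Z1 t x y + Z2 t x y))%:E <=
   \int[leb R]_(t in `[tau, T]) ((growth t)%:E * r t))%E.
  apply: (cint_slices_le tau0 tauT ab cd bO cZ).
  - apply: emeasurable_funM => //; apply/measurable_EFinP.
    apply: measurable_funTS; apply: continuous_measurable_fun => t.
    exact: (der_continuous (der_grow t)).
  - by move=> t /r0 rt; apply: mule_ge0 => //; rewrite lee_fin ltW// grow_gt0.
  - move=> t tT; have t0 : 0 < t by case/andP: tT => q _; exact: lt_le_trans q.
    have cde := cont3_slice t0 cdens.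
    have -> : bint a b c d (fun x y => Z1 t x y + Z2 t x y) = growth t * bint a b c d (density k t).
      rewrite -(bintZ ab cd bO (growth t) cde); apply: eq_bint => x y _ _.
      by rewrite /Z1 /Z2 /density; ring.
    rewrite EFinM; apply: lee_wpmul2l; first by rewrite lee_fin ltW// grow_gt0.
    exact: density_le.
rewrite (cintD tau0 tauT ab cd bO cZ1 cZ2) h4 in h5.
have h6 : bint a' b' c' d' Y1 + cint tau T a' b' c' d' Y2 <=
  bint a b c d (H tau) + (bint a b c d (H T) - bint a b c d (H tau) + cint tau T a b c d Z2).
  by move: (lerD h1 h3) => q; rewrite addrA addrCA subrr addr0.
apply: (@le_trans _ _ ((bint a b c d (H tau) + (bint a b c d (H T) - bint a b c d (H tau) + cint tau T a b c d Z2)))%:E).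
  by rewrite lee_fin.
by rewrite EFinD; apply: leeD; [rewrite lee_fin|exact: h5].
Qed.

End cylinder_energy.

(** * Energy over a time window *)

Section time_slices.
Context {R : realType}.
Variables (L : R) (J : set R) (g : R -> R -> R -> R).
Hypotheses (mJ : measurable J) (J0 : J `<=` `]0, +oo[) (cg : cont3 L g).
Hypothesis g0 : forall t x y, 0 < t -> Omega L (x, y) -> 0 <= g t x y.

Lemma measurable_JOmega : measurable_fun (J `*` Omega L) (fun q => (unc3 g q)%:E).
Proof.
apply/measurable_EFinP; apply: measurable_funS (cont3_measurable cg).
  by apply: open_measurable3; exact: open_ST.
by move=> [t z] [/= /J0 Jt Oz].
Qed.

Let g0' q : (J `*` Omega L) q -> (0 <= (unc3 g q)%:E)%E.
Proof.
move: q => [t [x y]] [/= /J0 Jt Oz]; rewrite lee_fin; apply: g0 => //.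
by move: Jt; rewrite /= in_itv/= andbT.
Qed.

Lemma measurable_IO : measurable_fun J (fun t => IO L (g t)).
Proof.
exact: (@measurable_tonelli_setX R _ _ _ _ (leb2s R) J (Omega L) mJ (@measurable_Omega R L)
  (fun q => (unc3 g q)%:E) measurable_JOmega g0').
Qed.

Lemma integral_IO : (\int[leb3 R]_(q in J `*` Omega L) (unc3 g q)%:E =
  \int[leb R]_(t in J) IO L (g t))%E.
Proof.
exact: (@tonelli_setX R _ _ _ _ (leb R) (leb2s R) J (Omega L) mJ (@measurable_Omega R L)
  (fun q => (unc3 g q)%:E) measurable_JOmega g0').
Qed.

End time_slices.

Section energy_window.
Context {R : realType}.
Variables (u0 : R -> R) (L eps tau T cc : R) (us : R -> R -> R).
Variables (w wt wx wy : R -> R -> R -> R).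
Hypotheses (L0 : 0 < L) (tau0 : 0 < tau) (tauT : tau <= T) (e0 : 0 < eps) (cc0 : 0 <= cc).
Hypotheses (cu0 : cont3 L (fun _ _ y => u0 y)) (cus : cont3 L (fun=> us)).
Hypotheses (cw : cont3 L w) (cwt : cont3 L wt) (cwx : cont3 L wx) (cwy : cont3 L wy).
Hypothesis dw : forall t x y : R, 0 < t -> Omega L (x, y) ->
  is_derive t 1 (fun s => w s x y) (wt t x y).
Hypothesis u0_us : forall x y, Omega L (x, y) -> 0 <= u0 y <= us x y.

Definition energy (t : R) : \bar R := IO L (fun x y => u0 y * w t x y ^+ 2).
Definition damping (t : R) : \bar R := IO L (fun x y => (u0 y * w t x y) ^+ 2).
Definition dissipation (t : R) : \bar R :=
  IO L (fun x y => u0 y * (wx t x y ^+ 2 + wy t x y ^+ 2)).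
Definition half_gain (t : R) : \bar R :=
  ((eps / 2)%:E * dissipation t + ((4 * L)^-1)%:E * damping t)%E.

Hypothesis local_balance : forall (r eta : R) n, 0 < r -> 0 < eta ->
  exists a b c d k, [/\ a <= b, c <= d, box a b c d `<=` Omega L, ebox L n `<=` box a b c d &
    [/\ 0 <= k, k <= r, forall y, c <= y <= d -> k <= u0 y &
      forall t, tau <= t <= T ->
        ((bint a b c d (density u0 L eps cc us w wt wx wy k t))%:E <= eta%:E + half_gain t)%E]].

Let grow := growth cc.
Let T0 : 0 < T. Proof. exact: lt_le_trans tauT. Qed.
Let pos t : tau <= t <= T -> 0 < t. Proof. by move=> /andP[h _]; exact: lt_le_trans h. Qed.
Let J0 : `[tau, T] `<=` `]0, +oo[.
Proof. by move=> t; rewrite /= !in_itv/= andbT; exact: pos. Qed.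
Let mtT : measurable (`[tau, T]%classic : set R). Proof. exact: measurable_itv. Qed.
Let u00 x y : Omega L (x, y) -> 0 <= u0 y. Proof. by move=> /u0_us/andP[]. Qed.
Let cgr : cont3 L (fun t _ _ => grow t). Proof. exact: cont3_grow. Qed.
Let gr0 t : 0 <= grow t. Proof. exact/ltW/grow_gt0. Qed.

Let G2 t x y := grow t * ((2 * L)^-1 * (u0 y * w t x y) ^+ 2
  + eps * (u0 y * (wx t x y ^+ 2 + wy t x y ^+ 2))).
Let G1 x y := 2^-1 * (grow T * (u0 y * w T x y ^+ 2)).
Let N1 x y := 2^-1 * (grow T * w T x y ^+ 2).
Let N2 t x y := grow t * ((2 * L)^-1 * (u0 y * w t x y ^+ 2)
  + eps * (wx t x y ^+ 2 + wy t x y ^+ 2)).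

Let cG2 : cont3 L G2. Proof. by rewrite /G2; cont3. Qed.
Let cN2 : cont3 L N2. Proof. by rewrite /N2; cont3. Qed.
Let cwT := cont3_slice T0 cw.
Let cu : cont_on (Omega L) (fun=> u0) := cont3_slice T0 cu0.
Let cG1 : cont_on (Omega L) G1. Proof. by rewrite /G1; cont. Qed.
Let cN1 : cont_on (Omega L) N1. Proof. by rewrite /N1; cont. Qed.

Let L2 : 0 <= (2 * L)^-1. Proof. by rewrite invr_ge0 mulr_ge0// ltW. Qed.
Let G20 t x y : 0 < t -> Omega L (x, y) -> 0 <= G2 t x y.
Proof.
move=> t0 /u00 h; apply: mulr_ge0 => //; apply: addr_ge0; apply: mulr_ge0 => //.
- exact: sqr_ge0.
- exact: ltW.
- by apply: mulr_ge0 => //; apply: addr_ge0; exact: sqr_ge0.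
Qed.
Let G10 x y : Omega L (x, y) -> 0 <= G1 x y.
Proof. by move=> /u00 h; rewrite /G1 mulr_ge0 ?invr_ge0// mulr_ge0// mulr_ge0 ?sqr_ge0. Qed.

Let cD : cont3 L (fun t x y => u0 y * (wx t x y ^+ 2 + wy t x y ^+ 2)). Proof. by cont3. Qed.
Let cA : cont3 L (fun t x y => (u0 y * w t x y) ^+ 2). Proof. by cont3. Qed.
Let D0 t x y : 0 < t -> Omega L (x, y) -> 0 <= u0 y * (wx t x y ^+ 2 + wy t x y ^+ 2).
Proof. by move=> _ /u00 h; rewrite mulr_ge0// addr_ge0 ?sqr_ge0. Qed.
Let A0 t x y : 0 < t -> Omega L (x, y) -> 0 <= (u0 y * w t x y) ^+ 2.
Proof. by move=> _ _; rewrite sqr_ge0. Qed.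

Lemma dissipation_ge0 t : 0 < t -> (0 <= dissipation t)%E.
Proof.
by move=> t0; apply: (@IO_ge0 _ L (fun x y => u0 y * (wx t x y ^+ 2 + wy t x y ^+ 2))) => x y; exact: D0.
Qed.

Lemma damping_ge0 t : (0 <= damping t)%E.
Proof. by apply: (@IO_ge0 _ L (fun x y => (u0 y * w t x y) ^+ 2)) => x y _; exact: sqr_ge0. Qed.

Lemma half_gain_ge0 t : 0 < t -> (0 <= half_gain t)%E.
Proof.
move=> t0; apply: adde_ge0; apply: mule_ge0.
- by rewrite lee_fin divr_ge0// ltW.
- exact: dissipation_ge0.
- by rewrite lee_fin invr_ge0 mulr_ge0// ltW.
- exact: damping_ge0.
Qed.

Lemma measurable_half_gain (J : set R) : measurable J -> J `<=` `]0, +oo[ ->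
  measurable_fun J half_gain.
Proof.
move=> mJ J0'; apply: emeasurable_funD; apply: measurable_funeM.
  exact: (measurable_IO mJ J0' cD D0).
exact: (measurable_IO mJ J0' cA A0).
Qed.

Let IO_G2 t : 0 < t -> IO L (G2 t) = ((grow t)%:E * (2%:E * half_gain t))%E.
Proof.
move=> t0; have cd := cont3_slice t0 cD; have ca := cont3_slice t0 cA.
have d0 x y (Oxy : Omega L (x, y)) := D0 t0 Oxy; have a0 x y (Oxy : Omega L (x, y)) := A0 t0 Oxy.
have c1 := cont_onM (@cont_on_cst _ (Omega L) (2 * L)^-1) ca.
have c2 := cont_onM (@cont_on_cst _ (Omega L) eps) cd.
have p1 x y : Omega L (x, y) -> 0 <= (2 * L)^-1 * (u0 y * w t x y) ^+ 2 by move=> h; rewrite mulr_ge0 ?sqr_ge0.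
have p2 x y : Omega L (x, y) -> 0 <= eps * (u0 y * (wx t x y ^+ 2 + wy t x y ^+ 2)).
  by move=> h; rewrite mulr_ge0 ?(ltW e0)// d0.
have p3 x y : Omega L (x, y) -> 0 <= (2 * L)^-1 * (u0 y * w t x y) ^+ 2 +
   eps * (u0 y * (wx t x y ^+ 2 + wy t x y ^+ 2)) by move=> h; rewrite addr_ge0 ?p1 ?p2.
rewrite /G2 (IO_Z (gr0 t) (cont_onD c1 c2) p3) (IO_D c1 c2 p1 p2) (IO_Z L2 ca a0) (IO_Z (ltW e0) cd d0).
rewrite -/(dissipation t) -/(damping t) /half_gain.
have dd0 := dissipation_ge0 t0; have aa0 := damping_ge0 t.
congr (_ * _)%E.
have h1 : (0 <= (eps / 2)%:E * dissipation t)%E.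
  by apply: mule_ge0 => //; rewrite lee_fin divr_ge0// ltW.
have h2 : (0 <= ((4 * L)^-1)%:E * damping t)%E.
  by apply: mule_ge0 => //; rewrite lee_fin invr_ge0 mulr_ge0// ltW.
rewrite (ge0_muleDr _ h1 h2) !muleA -!EFinM addeC; congr (_%:E * _ + _%:E * _)%E.
  by field.
by field; rewrite gt_eqF.
Qed.

Hypothesis gain_fin : (\int[leb R]_(t in `[tau, T]) ((grow t)%:E * half_gain t) < +oo)%E.
Hypothesis energy_fin : (energy tau < +oo)%E.

Let S0 : (0 <= \int[leb R]_(t in `[tau, T]) ((grow t)%:E * half_gain t))%E.
Proof.
apply: integral_ge0 => t; rewrite /= in_itv/= => /pos t0.
by apply: mule_ge0; [rewrite lee_fin|exact: half_gain_ge0].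
Qed.

Let E0 : (0 <= energy tau)%E.
Proof.
apply: (@IO_ge0 _ L (fun x y => u0 y * w tau x y ^+ 2)) => x y /u00 h.
by rewrite mulr_ge0 ?sqr_ge0.
Qed.

Let mab n : L * mesh n <= L - L * mesh n.
Proof.
have := @mesh_lt R n; have := @mesh_gt0 R n; move: (mesh n) => m m0 m1.
by rewrite lerBrDr -mulrDr ler_piMr// ?ltW//; lra.
Qed.
Let mcd n : (mesh n : R) <= 1 - mesh n.
Proof.
have := @mesh_lt R n; have := @mesh_gt0 R n; move: (mesh n) => m m0 m1; lra.
Qed.
Let bOn n : ebox L n `<=` Omega L := @ebox_Omega R L L0 n.

Local Notation bintn n := (bint (L * mesh n) (L - L * mesh n) (mesh n) (1 - mesh n)).
Local Notation cintn n := (cint tau T (L * mesh n) (L - L * mesh n) (mesh n) (1 - mesh n)).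

Lemma window_box (n : nat) (E S : R) : energy tau = E%:E ->
  (\int[leb R]_(t in `[tau, T]) ((grow t)%:E * half_gain t) = S%:E)%E ->
  bintn n G1 + cintn n G2 <= grow tau * E + S.
Proof.
move=> EE SE.
pose N := `|bintn n N1| + `|cintn n N2|.
have N0 : 0 <= N by rewrite addr_ge0.
apply/ler_addgt0Pr => e ep.
pose k0 := e / 2 / (N + 1); pose eta0 := e / 2 / (T - tau + 1).
have Np : 0 < N + 1 by rewrite ltr_wpDl.
have Tp : 0 < T - tau + 1 by rewrite ltr_wpDl// subr_ge0.
have k00 : 0 < k0 by rewrite !divr_gt0.
have eta00 : 0 < eta0 by rewrite !divr_gt0.
have gT : 0 < grow T by exact: grow_gt0.
have gle t : tau <= t <= T -> grow t <= grow T.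
  by move=> /andP[_ tT]; rewrite /grow /growth ler_expR ler_wpM2l.
have [a [b [c [d [k [ab cd bO sub [kp kr ku0 dens]]]]]]] := local_balance n k00 (divr_gt0 eta00 gT).
pose r t := ((eta0 / grow t)%:E + half_gain t)%E.
have cgrow : continuous grow by move=> t; exact: (der_continuous (der_grow cc t)).
have mgi : measurable_fun `[tau, T] (fun t => (eta0 / grow t)%:E).
  apply/measurable_EFinP; apply: measurable_funTS; apply: continuous_measurable_fun => t.
  apply: cvgM; first exact: cvg_cst.
  by apply: cvgV; [rewrite gt_eqF// grow_gt0|exact: cgrow].
have mh := measurable_half_gain mtT J0.
have mr : measurable_fun `[tau, T] r by apply: emeasurable_funD.
have r0 t : tau <= t <= T -> (0 <= r t)%E.
  move=> /pos t0; apply: adde_ge0; last exact: half_gain_ge0.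
  by rewrite lee_fin; apply: divr_ge0 => //; exact: ltW.
have dens' t : tau <= t <= T ->
    ((bint a b c d (density u0 L eps cc us w wt wx wy k t))%:E <= r t)%E.
  move=> tT; apply: le_trans (dens t tT) _; apply: leeD => //; rewrite lee_fin.
  by rewrite ler_pM2l// lef_pV2 ?posrE ?grow_gt0// gle.
have := cylinder_energy L0 tau0 tauT e0 cu0 cus cw cwt cwx cwy dw u0_us ab cd bO
  (mab n) (mcd n) sub kp ku0 mr r0 dens'.
set Y1 := (fun x y : R => 2^-1 * _); set Y2 := (fun t x y : R => _ * (_ + _)) => H.
have hr : (\int[leb R]_(t in `[tau, T]) ((grow t)%:E * r t) = (eta0 * (T - tau) + S)%:E)%E.
  have -> : (\int[leb R]_(t in `[tau, T]) ((grow t)%:E * r t) =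
      \int[leb R]_(t in `[tau, T]) (eta0%:E + (grow t)%:E * half_gain t))%E.
    apply: eq_integral => t; rewrite inE/= in_itv/= => /pos t0.
    have gz : (0 <= (eta0 / grow t)%:E)%E by rewrite lee_fin; apply: divr_ge0 => //; exact: ltW.
    rewrite /r (ge0_muleDr _ gz (half_gain_ge0 t0)).
    by rewrite -EFinM mulrC divfK// gt_eqF// grow_gt0.
  have p1 (q : R) : (`[tau, T]%classic : set R) q -> (0 <= eta0%:E)%E.
    by move=> _; rewrite lee_fin ltW.
  have p2 (q : R) : (`[tau, T]%classic : set R) q -> (0 <= (grow q)%:E * half_gain q)%E.
    rewrite /= in_itv/= => /pos qp.
    by apply: mule_ge0; [rewrite lee_fin|exact: half_gain_ge0].
  have m2 : measurable_fun (`[tau, T]%classic : set R) (fun t => (grow t)%:E * half_gain t)%E.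
    apply: emeasurable_funM => //; apply/measurable_EFinP; apply: measurable_funTS.
    exact: continuous_measurable_fun.
  have m1 : measurable_fun (`[tau, T]%classic : set R) (fun=> eta0%:E) by [].
  have D1 : (\int[leb R]_(t in `[tau, T]) (eta0%:E + (grow t)%:E * half_gain t) =
      \int[leb R]_(t in `[tau, T]) eta0%:E +
      \int[leb R]_(t in `[tau, T]) ((grow t)%:E * half_gain t))%E.
    exact: (ge0_integralD (leb R) mtT p1 m1 p2 m2).
  by rewrite D1 integral_itv_cst// SE -EFinD.
have hE : grow tau * bint a b c d (fun x y => u0 y * w tau x y ^+ 2) <= grow tau * E.
  apply: ler_wpM2l => //; rewrite -lee_fin -EE.
  have ct := cont3_slice tau0 cw.
  apply: (bint_le_Omega ab cd bO (f := fun x y => u0 y * w tau x y ^+ 2)); first by cont.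
  by move=> x y /u00 h; rewrite mulr_ge0 ?sqr_ge0.
have {}H : bintn n Y1 + cintn n Y2 <= grow tau * E + (eta0 * (T - tau) + S).
  rewrite -lee_fin; apply: le_trans H _; rewrite hr -EFinD lee_fin lerD2r.
  exact: hE.
have y1 : bintn n Y1 = bintn n G1 + - k * bintn n N1.
  rewrite -(bintZ (mab n) (mcd n) (bOn (n := n)) (- k) cN1).
  rewrite -(bintD (mab n) (mcd n) (bOn (n := n)) cG1 (cont_onM (@cont_on_cst _ (Omega L) (- k)) cN1)).
  by apply: eq_bint => x y _ _; rewrite /Y1 /G1 /N1 /grow; ring.
have ckN : cont3 L (fun t x y => - k * N2 t x y) by cont3.
have y2 : cintn n Y2 = cintn n G2 + - k * cintn n N2.
  have z : cintn n (fun t x y => - k * N2 t x y) = - k * cintn n N2.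
    apply: RintegralZl; first exact: measurable_cyl.
    exact: (integrable_cyl tau0 tauT (mab n) (mcd n) (bOn (n := n)) cN2).
  rewrite -z -(cintD tau0 tauT (mab n) (mcd n) (bOn (n := n)) cG2 ckN).
  by congr Rintegral; apply/funext => -[t [x y]]; rewrite /unc3 /Y2 /G2 /N2 /grow /=; ring.
have hN : k * bintn n N1 + k * cintn n N2 <= e / 2.
  rewrite -mulrDr; apply: (@le_trans _ _ (k0 * N)).
    apply: (@le_trans _ _ (k * N)); last by rewrite ler_wpM2r.
    by apply: ler_wpM2l => //; rewrite lerD// ler_norm.
  rewrite -[leRHS](divfK (lt0r_neq0 Np)) /k0; apply: ler_wpM2l; first by rewrite divr_ge0// ltW// divr_gt0.
  by rewrite lerDl.
have hT : eta0 * (T - tau) <= e / 2.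
  rewrite -[leRHS](divfK (lt0r_neq0 Tp)) /eta0; apply: ler_wpM2l; first by rewrite divr_ge0// ltW// divr_gt0.
  by rewrite lerDl.
move: H hN hT; rewrite y1 y2 !mulNr.
move: (bintn n G1) (cintn n G2) (k * bintn n N1) (k * cintn n N2) (grow tau * E) (eta0 * _) => *; lra.
Qed.

Lemma energy_window : ((grow T / 2)%:E * energy T +
  \int[leb R]_(t in `[tau, T]) ((grow t)%:E * half_gain t) <= (grow tau)%:E * energy tau)%E.
Proof.
have [E EE] := ereal_fin E0 energy_fin; have [S SE] := ereal_fin S0 gain_fin.
have box_le m n : (m <= n)%N -> ebox L m `<=` ebox L n.
  by move=> mn; apply/subsetPset; exact: (ebox_nondecreasing L0).
have key i j : bintn i G1 + cintn j G2 <= grow tau * E + S.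
  apply: le_trans (window_box (maxn i j) EE SE); apply: lerD.
    apply: (bint_sub (mab _) (mcd _) (bOn (n := maxn i j)) (mab _) (mcd _)) => //.
      exact: (box_le _ _ (leq_maxl _ _)).
    by move=> x y Dxy; apply: G10; exact: (bOn (n := maxn i j)).
  apply: (cint_sub tau0 tauT (mab _) (mcd _) (bOn (n := maxn i j)) (mab _) (mcd _)) => //.
    exact: (box_le _ _ (leq_maxr _ _)).
  by move=> t x y /pos t0 Dxy; apply: G20 => //; exact: (bOn (n := maxn i j)).
have two i : 2 * S <= grow tau * E + S - bintn i G1.
  rewrite -lee_fin.
  have -> : ((2 * S)%:E = \int[leb3 R]_(q in `[tau, T] `*` Omega L) (unc3 G2 q)%:E)%E.
    rewrite (integral_IO mtT J0 cG2 G20) EFinM -SE -ge0_integralZl_EFin//.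
    - apply: eq_integral => t; rewrite inE/= in_itv/= => /pos t0.
      by rewrite IO_G2// muleCA.
    - move=> t; rewrite /= in_itv/= => /pos t0; apply: mule_ge0; [by rewrite lee_fin|exact: half_gain_ge0].
    - apply: emeasurable_funM; last exact: measurable_half_gain.
      apply/measurable_EFinP; apply: measurable_funTS; apply: continuous_measurable_fun => t.
      exact: (der_continuous (der_grow cc t)).
  apply: (@le_integral_of_exhaustion R _ _ (leb3 R) (fun j => `[tau, T] `*` ebox L j)).
  - move=> m n mn; apply/subsetPset => -[t z] [/= ? /(box_le _ _ mn) ?]; by split.
  - by move=> n; apply: measurableX; [exact: measurable_itv|exact: measurable_box].
  - apply/seteqP; split => [[t z] [n _ [/= ? /bOn ?]]|[t z] [/= tT]]; first by split.
    by rewrite -(bigcup_ebox L0) => -[n _ nz]; exists n.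
  - exact: (measurable_JOmega J0 cG2).
  - move=> [t [x y]] [/= tT Oz]; rewrite lee_fin; apply: G20 => //.
    by move: tT; rewrite in_itv/=; exact: pos.
  - move=> j; rewrite (EFin_cint tau0 tauT (mab j) (mcd j) (bOn (n := j)) cG2) lee_fin.
    by rewrite lerBrDl.
have fin : (IO L G1 <= (grow tau * E - S)%:E)%E.
  apply: (@le_integral_of_exhaustion R _ _ (leb2 R) (ebox L)).
  - exact: ebox_nondecreasing.
  - by move=> n; exact: measurable_box.
  - exact: bigcup_ebox.
  - exact: measurable_EFin_cont.
  - by move=> [x y] Oxy; rewrite lee_fin; exact: G10.
  - move=> n; rewrite (EFin_bint (mab n) (mcd n) (bOn (n := n)) cG1) lee_fin.
    by move: (two n); move: (bintn n G1) (grow tau * E) => p q; lra.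
have -> : ((grow T / 2)%:E * energy T = IO L G1)%E.
  have c1 : cont_on (Omega L) (fun x y => u0 y * w T x y ^+ 2) by cont.
  have p1 x y : Omega L (x, y) -> 0 <= u0 y * w T x y ^+ 2 by move=> /u00 h; rewrite mulr_ge0 ?sqr_ge0.
  rewrite -(IO_Z _ c1 p1) ?divr_ge0//; apply: eq_integral => -[x y] _; congr (_%:E).
  by rewrite /G1 /=; ring.
rewrite EE SE; apply: le_trans (leeD2r _ fin) _.
by rewrite -EFinD -EFinM lee_fin subrK.
Qed.

End energy_window.

(** * Energy of a solution and the initial time *)

Section solution_energy.
Context {R : realType}.
Variables (u0 : R -> R) (L A eps K B kap M th c1 : R) (us vs : R -> R -> R)
  (phi : R -> R -> R -> R) (phi0 : R -> R -> R).
Hypothesis bf : base_flow u0.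
Hypotheses (L0 : 0 < L) (L1 : L <= 1) (kap0 : 0 < kap).
Hypothesis hkap : forall y : R, 0 <= y <= 1 -> kap <= u0^`()%classic y ^+ 2 + u0 y ^+ 2.
Hypothesis M0 : 0 < M.
Hypothesis hM : forall y : R, 0 <= y <= 1 ->
  [/\ `|u0 y| <= M, `|u0^`()%classic y| <= M & `|u0^`(2)%classic y| <= M].
Hypotheses (e0 : 0 < eps) (e1 : eps <= 1) (K0 : 0 <= K) (B0 : 0 < B) (A0 : 0 < A).
Hypotheses (th0 : 0 < th) (c10 : 0 <= c1).
Hypothesis bg : background u0 L eps K B us vs.
Hypothesis lp : linearized_problem u0 A L eps us vs phi phi0.
Let s := cbrt eps.
Let beta := 2 / (A * s) ^+ 2.
Hypotheses (s0 : 0 < s) (s1 : s <= 1) (eE : eps = s ^+ 3).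
Hypothesis hG : vortC kap M * (eps * (M * K + M / L ^+ 2 + M) + 2 * (B * M) + 2^-1 * c1 * s ^+ 2
    + 2 * B + 2 * eps * M * beta * th) <= 4^-1 * s ^+ 2.
Hypothesis hU : 4^-1 + (2 * K + 2^-1 * c1 + K * (2 * gradC kap M)
     + 2 * eps * M * beta * (th^-1 * (2 * gradC kap M))) <= (4 * L)^-1.

Let w t := lap (phi t).
Let wt t := lap (dt phi t).
Let wx t := dx (lap (phi t)).
Let wy t := dy (lap (phi t)).

Let cu0 : cont3 L (fun _ _ y => u0 y).
Proof.
apply: (@cont3_xy _ L (fun _ y => u0 y)); apply: cont_on_snd => z _.
exact: (base_cont bf z.2).1.
Qed.
Let cus : cont3 L (fun=> us).
Proof. by apply: (@cont3_xy _ L us); exact: (Ck_cont (bg_regu bg)). Qed.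
Let cw : cont3 L w := @cont3_lap _ _ _ _ _ _ _ _ _ lp.
Let cwt : cont3 L wt := @cont3_lapt _ _ _ _ _ _ _ _ _ lp.
Let cwx : cont3 L wx := @cont3_dx_lap _ _ _ _ _ _ _ _ _ lp.
Let cwy : cont3 L wy := @cont3_dy_lap _ _ _ _ _ _ _ _ _ lp.
Let dw (t x y : R) : 0 < t -> Omega L (x, y) ->
  is_derive t 1 (fun s => w s x y) (wt t x y).
Proof. exact: (time_der_lap lp). Qed.

Let beta0 : 0 < beta.
Proof. by rewrite divr_gt0// exprn_gt0// mulr_gt0. Qed.

Let u0_us x y : Omega L (x, y) -> 0 <= u0 y <= us x y.
Proof.
by move=> Oxy; have /andP[h _] := bg_u bg Oxy; rewrite h (ltW (Omega_u0 bf Oxy)).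
Qed.
Let u0M (y : R) : 0 <= y <= 1 -> u0 y <= M.
Proof. by move=> /hM[h _ _]; exact: le_trans (ler_norm _) h. Qed.

Lemma local_energy_balance (tau T r eta : R) (n : nat) : 0 < tau -> 0 < r -> 0 < eta ->
  exists a b c d k, [/\ a <= b, c <= d, box a b c d `<=` Omega L, ebox L n `<=` box a b c d &
    [/\ 0 <= k, k <= r, forall y, c <= y <= d -> k <= u0 y &
      forall t, tau <= t <= T ->
        ((bint a b c d (density u0 L eps (c1 * s) us w wt wx wy k t))%:E <=
          eta%:E + half_gain u0 L eps w wx wy t)%E]].
Proof.
move=> tau0 r0 eta0.
have m0 := @mesh_gt0 R n; have m1 := @mesh_lt R n.
have M1 : 0 < 1 + 2 * M by rewrite ltr_wpDr// mulr_ge0// ltW.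
pose eta' := eta / (1 + 2 * M); have eta'0 : 0 < eta' by rewrite divr_gt0.
have [ry ry0 hy] := y_sides L0 lp T A0 s0 tau0 eta'0.
pose r' := Num.min r (Num.min ry (mesh n)).
have r'0 : 0 < r' by rewrite !lt_min r0 ry0.
have r'r : r' <= r by rewrite ge_min lexx.
have r'y : r' <= ry by rewrite !ge_min lexx orbT.
have r'm : r' <= mesh n by rewrite !ge_min lexx !orbT.
have [c [c0 cr c2 uc level]] := base_level bf r'0.
have [rx rx0 hx] := x_sides bf L0 lp T M0 u0M e0 K0 (bg_u bg) tau0 c0 c2 level eta'0.
have Lm : 0 < L * mesh n by exact: mulr_gt0.
pose a := Num.min (rx / 2) (L * mesh n).
have a0 : 0 < a by rewrite lt_min divr_gt0.
have arx : a < rx.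
  by apply: (@le_lt_trans _ _ (rx / 2)); [rewrite ge_min lexx|rewrite ltr_pdivrMr// ltr_pMr// ltr1n].
have am : a <= L * mesh n by rewrite ge_min lexx orbT.
have Lm2 : L * mesh n < L / 2 by rewrite ltr_pM2l.
have aL : a < L.
  by apply: (le_lt_trans am); apply: (lt_trans Lm2); rewrite ltr_pdivrMr// ltr_pMr// ltr1n.
have ab : a <= L - a.
  rewrite lerBrDr; apply: (@le_trans _ _ (L / 2 + L / 2)); last by rewrite -splitr.
  by apply: lerD; apply: (le_trans am); exact: ltW.
have [cI1 cI2] := half_itv c0 c2.
have cm : c <= mesh n by apply: le_trans (ltW cr) r'm.
have cd : c <= 1 - c by apply: (le_trans cm); rewrite lerBrDr; move: cm m1; lra.
exists a, (L - a), c, (1 - c), (u0 c); split => //.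
- by apply: box_Omega => //; [rewrite gtrBl|case/andP: cI2].
- move=> [x y] /boxP[/andP[x1 x2] /andP[y1 y2]]; apply/boxP; split; apply/andP; split.
  + exact: le_trans x1.
  + by apply: (le_trans x2); rewrite lerD2l lerN2.
  + exact: le_trans y1.
  + by apply: (le_trans y2); rewrite lerD2l lerN2.
- split => //.
  + by apply/ltW/(base_pos bf).
  + exact: le_trans uc r'r.
  + move=> t tT; have t0 : 0 < t by case/andP: tT => h _; exact: lt_le_trans h.
    have sf := stream_phi L0 lp t0.
    have cg : cont_on (Omega L) (wt t) := cont3_slice t0 cwt.
    have eqn x y : Omega L (x, y) -> wt t x y + us x y * lap (dx (phi t)) x y
        - lap us x y * dx (phi t) x y + vs x y * lap (dy (phi t)) x y
        - lap vs x y * dy (phi t) x y - eps * lap (lap (phi t)) x y = 0.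
      by move=> Oxy; case: lp => _ h _ _; exact: h.
    have xs y : c <= y <= 1 - c -> xflux u0 L eps (u0 c) us (lap (phi t)) a y
        - xflux u0 L eps (u0 c) us (lap (phi t)) (L - a) y <= eta'.
      by move=> yc; apply: hx => //; rewrite a0.
    have ys x : a <= x <= L - a ->
        lap (phi t) x c ^+ 2 <= beta * dy (phi t) x c ^+ 2 + eta' /\
        lap (phi t) x (1 - c) ^+ 2 <= beta * dy (phi t) x (1 - c) ^+ 2 + eta'.
      move=> /andP[x1 x2]; apply: hy => //.
      * by rewrite c0 (lt_le_trans cr r'y).
      * by case/andP: cI1.
      * by rewrite (lt_le_trans a0 x1) (le_lt_trans x2)// gtrBl.
    have bL : L - a < L by rewrite gtrBl.
    have := slab_energy bf L0 L1 sf kap0 hkap M0 hM e0 e1 K0 B0 bg cg eqn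
      a0 ab bL c0 c2 (ltW eta'0) beta0 th0 level xs ys s0 c10 s1 eE hG hU.
    rewrite (_ : eta' * (1 + 2 * M) = eta); last by rewrite /eta' divfK// gt_eqF.
    by rewrite -addeA.
Qed.

Let e_ := energy u0 L w.
Let hg := half_gain u0 L eps w wx wy.

Lemma energy_lty t : 0 < t -> (e_ t < +oo)%E.
Proof.
move=> t0; have sf := stream_phi L0 lp t0.
have ct : cont_on (Omega L) (w t) := cont3_slice t0 cw.
have cu : cont_on (Omega L) (fun=> u0) := cont3_slice t0 cu0.
have c1' : cont_on (Omega L) (fun x y => u0 y * w t x y ^+ 2) by cont.
apply: (@IO_lty _ L (fun x y => u0 y * w t x y ^+ 2) L0 c1').
have [N hN] := bounded_lap sf; exists (M * N ^+ 2) => -[x y] Oxy /=.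
have [h _ _] := hM (Omega_y Oxy).
rewrite normrM ler_pM// ger0_norm ?sqr_ge0//; apply: sqr_le_of_norm; exact: (hN (x, y)).
Qed.

Lemma damping_bounded (tau T : R) : 0 < tau -> exists2 N : R, 0 <= N &
  forall t, tau <= t <= T -> (damping u0 L w t <= N%:E)%E.
Proof.
move=> tau0; case: (lp) => sr _ _ _.
have ext : extends_to (spacetime (Omega L)) (spacetime (clOmega L)) (unc3 w).
  exact: (@extends_to_add _ L _ (fun t => dx (dx (phi t))) (fun t => dy (dy (phi t)))
    (sr_x2_bd sr (w := [:: true; true]) isT) (sr_x2_bd sr (w := [:: false; false]) isT)).
have cO : compact (clOmega L) by exact: compact_box.
have [N hN] := window_bounded T cO tau0 ext.
have N0 : 0 <= (M * N) ^+ 2 by exact: sqr_ge0.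
exists ((M * N) ^+ 2 * L) => [|t tT]; first by rewrite mulr_ge0// ltW.
have t0 : 0 < t by case/andP: tT => h _; exact: lt_le_trans h.
have ct : cont_on (Omega L) (w t) := cont3_slice t0 cw.
have cu : cont_on (Omega L) (fun=> u0) := cont3_slice t0 cu0.
have ca : cont_on (Omega L) (fun x y => (u0 y * w t x y) ^+ 2) by cont.
have ck := @cont_on_cst _ (Omega L) ((M * N) ^+ 2).
apply: (@le_trans _ _ (IO L (fun _ _ => (M * N) ^+ 2))).
  apply: (IO_le ca ck) => x y Oxy; first exact: sqr_ge0.
  apply: sqr_le_of_norm; have [h _ _] := hM (Omega_y Oxy).
  rewrite normrM ler_pM//; apply: hN => //.
  move: Oxy => /OmegaP[/andP[h1 h2] /andP[h3 h4]].
  by split; rewrite /= in_itv/= !ltW.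
rewrite (@integral_cst _ _ _ (leb2 R) (Omega L) (@measurable_Omega R L) ((M * N) ^+ 2)%:E).
rewrite [leRHS]EFinM; apply: lee_wpmul2l; first by rewrite lee_fin.
have E : (leb2 R (Omega L) <= L%:E)%E by rewrite leb2_Omega.
exact: E.
Qed.

Let gradient t := IO L (fun x y => wx t x y ^+ 2 + wy t x y ^+ 2).

Lemma gradient_integral_lty (tau T : R) : 0 < tau -> tau < T ->
  (\int[leb R]_(t in `[tau, T]) gradient t < +oo)%E.
Proof.
move=> tau0 tauT; case: (lp) => sr _ _ _.
have cg : cont3 L (fun t x y => wx t x y ^+ 2 + wy t x y ^+ 2) by cont3.
have g0 t x y : 0 < t -> Omega L (x, y) -> 0 <= wx t x y ^+ 2 + wy t x y ^+ 2.
  by move=> _ _; rewrite addr_ge0 ?sqr_ge0.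
have J0 : `]tau, T[ `<=` `]0, +oo[.
  by move=> t; rewrite /= !in_itv/= andbT => /andP[h _]; exact: lt_trans h.
have mJ : measurable (`]tau, T[%classic : set R) by exact: measurable_itv.
rewrite (integral_itv_bndoo true false (measurable_IO mJ J0 cg g0)).
apply: le_lt_trans (sr_L2 sr tau0 tauT).
apply: ge0_le_integral_nonmeas => t _.
  apply: (@IO_ge0 _ L (fun x y => wx t x y ^+ 2 + wy t x y ^+ 2)) => x y _.
  by rewrite addr_ge0 ?sqr_ge0.
rewrite L2norm_sqr; apply: (@le_trans _ _ (IO L (fun x y => grad_norm (lap (phi t)) x y ^+ 2))).
  rewrite le_eqVlt; apply/orP; left; apply/eqP; apply: eq_integral => -[x y] _.
  by rewrite /grad_norm sqr_sqrtr// addr_ge0 ?sqr_ge0.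
by rewrite leeDl// sqre_ge0.
Qed.


Let gr := growth (c1 * s).
Let cs0 : 0 <= c1 * s. Proof. by rewrite mulr_ge0// ltW. Qed.
Let gr0 t : 0 <= gr t. Proof. exact/ltW/grow_gt0. Qed.

Lemma dissipation_le t : 0 < t -> (dissipation u0 L wx wy t <= M%:E * gradient t)%E.
Proof.
move=> t0; have cu : cont_on (Omega L) (fun=> u0) := cont3_slice t0 cu0.
have cx : cont_on (Omega L) (wx t) := cont3_slice t0 cwx.
have cy : cont_on (Omega L) (wy t) := cont3_slice t0 cwy.
have cg : cont_on (Omega L) (fun x y => wx t x y ^+ 2 + wy t x y ^+ 2) by cont.
have cd : cont_on (Omega L) (fun x y => u0 y * (wx t x y ^+ 2 + wy t x y ^+ 2)) by cont.
have cM : cont_on (Omega L) (fun x y => M * (wx t x y ^+ 2 + wy t x y ^+ 2)) by cont.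
have g0 x y : Omega L (x, y) -> 0 <= wx t x y ^+ 2 + wy t x y ^+ 2.
  by move=> _; rewrite addr_ge0 ?sqr_ge0.
rewrite /gradient -(IO_Z (ltW M0) cg g0).
apply: (IO_le cd cM) => x y Oxy.
  by apply: mulr_ge0 (g0 _ _ Oxy); exact/ltW/(Omega_u0 bf Oxy).
by apply: ler_wpM2r (g0 _ _ Oxy) _ _ _; apply: u0M; exact: Omega_y Oxy.
Qed.

Lemma gain_lty (tau T : R) : 0 < tau -> tau < T ->
  (\int[leb R]_(t in `[tau, T]) ((gr t)%:E * hg t) < +oo)%E.
Proof.
move=> tau0 tauT; have [N N0 hN] := damping_bounded T tau0.
have gT : 0 <= gr T by [].
have k10 : 0 <= gr T * (eps / 2 * M) by rewrite !mulr_ge0// ltW// divr_gt0.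
have k20 : 0 <= gr T * ((4 * L)^-1 * N) by rewrite !mulr_ge0// invr_ge0 mulr_ge0// ltW.
have gfin := gradient_integral_lty tau0 tauT.
have mJ : measurable (`[tau, T]%classic : set R) by exact: measurable_itv.
have J0 : `[tau, T] `<=` `]0, +oo[.
  by move=> t; rewrite /= !in_itv/= andbT => /andP[h _]; exact: lt_le_trans h.
have cg : cont3 L (fun t x y => wx t x y ^+ 2 + wy t x y ^+ 2) by cont3.
have g0 (q x y : R) : 0 < q -> Omega L (x, y) -> 0 <= wx q x y ^+ 2 + wy q x y ^+ 2.
  by move=> _ _; rewrite addr_ge0 ?sqr_ge0.
have gr_ge0 (q : R) : (0 <= gradient q)%E.
  apply: (@IO_ge0 _ L (fun x y => wx q x y ^+ 2 + wy q x y ^+ 2)) => x y _.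
  by rewrite addr_ge0 ?sqr_ge0.
have mg : measurable_fun (`[tau, T]%classic : set R) gradient := measurable_IO mJ J0 cg g0.
apply: (@le_lt_trans _ _ (\int[leb R]_(t in `[tau, T])
  ((gr T * (eps / 2 * M))%:E * gradient t + (gr T * ((4 * L)^-1 * N))%:E))%E).
  apply: ge0_le_integral_nonmeas => t; rewrite /= in_itv/= => tT.
    have t0 : 0 < t by case/andP: tT => h _; exact: lt_le_trans h.
    apply: mule_ge0; first by rewrite lee_fin.
    exact: (half_gain_ge0 w wx wy L0 e0 u0_us).
  have t0 : 0 < t by case/andP: tT => h _; exact: lt_le_trans h.
  apply: (@le_trans _ _ ((gr T)%:E * hg t)%E).
    apply: lee_wpmul2r; first exact: (half_gain_ge0 w wx wy L0 e0 u0_us).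
    by rewrite lee_fin /gr /growth ler_expR ler_wpM2l//; case/andP: tT.
  have h1 : ((eps / 2)%:E * dissipation u0 L wx wy t <= (eps / 2 * M)%:E * gradient t)%E.
    rewrite [(eps / 2 * M)%:E]EFinM -muleA; apply: lee_wpmul2l; last exact: dissipation_le.
    by rewrite lee_fin divr_ge0// ltW.
  have h2 : (((4 * L)^-1)%:E * damping u0 L w t <= ((4 * L)^-1 * N)%:E)%E.
    rewrite [leRHS]EFinM; apply: lee_wpmul2l; last exact: hN.
    by rewrite lee_fin invr_ge0 mulr_ge0// ltW.
  apply: (@le_trans _ _ ((gr T)%:E * ((eps / 2 * M)%:E * gradient t + ((4 * L)^-1 * N)%:E))%E).
    by apply: lee_wpmul2l; [rewrite lee_fin|exact: leeD].
  have x1 : (0 <= (eps / 2 * M)%:E * gradient t)%E.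
    by apply: mule_ge0 => //; rewrite lee_fin mulr_ge0// ltW// divr_gt0.
  have x2 : (0 <= ((4 * L)^-1 * N)%:E :> \bar R)%E.
    by rewrite lee_fin mulr_ge0// invr_ge0 mulr_ge0// ltW.
  by rewrite (ge0_muleDr _ x1 x2) muleA.
have p1 (q : R) : (`[tau, T]%classic : set R) q -> (0 <= (gr T * (eps / 2 * M))%:E * gradient q)%E.
  by move=> _; apply: mule_ge0 => //; rewrite lee_fin.
have m1 : measurable_fun (`[tau, T]%classic : set R)
    (fun q => (gr T * (eps / 2 * M))%:E * gradient q)%E by exact: measurable_funeM.
have p2 (q : R) : (`[tau, T]%classic : set R) q -> (0 <= (gr T * ((4 * L)^-1 * N))%:E :> \bar R)%E.
  by move=> _; rewrite lee_fin.
have m2 : measurable_fun (`[tau, T]%classic : set R)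
    (fun=> (gr T * ((4 * L)^-1 * N))%:E) by exact: measurable_cst.
have D1 : (\int[leb R]_(t in `[tau, T])
   ((gr T * (eps / 2 * M))%:E * gradient t + (gr T * ((4 * L)^-1 * N))%:E) =
   \int[leb R]_(t in `[tau, T]) ((gr T * (eps / 2 * M))%:E * gradient t) +
   \int[leb R]_(t in `[tau, T]) (gr T * ((4 * L)^-1 * N))%:E)%E.
  exact: (ge0_integralD (leb R) mJ p1 m1 p2 m2).
rewrite D1 integral_itv_cst ?ltW//.
have D2 : (\int[leb R]_(t in `[tau, T]) ((gr T * (eps / 2 * M))%:E * gradient t) =
   (gr T * (eps / 2 * M))%:E * \int[leb R]_(t in `[tau, T]) gradient t)%E.
  by apply: ge0_integralZl_EFin => // q _; exact: gr_ge0.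
rewrite D2; apply: lte_add_pinfty; last exact: ltry.
apply: lte_mul_pinfty => //.
Qed.

Lemma solution_window (tau T : R) : 0 < tau -> tau < T ->
  ((gr T / 2)%:E * e_ T + \int[leb R]_(t in `[tau, T]) ((gr t)%:E * hg t)
    <= (gr tau)%:E * e_ tau)%E.
Proof.
move=> tau0 tauT.
apply: (energy_window L0 tau0 (ltW tauT) e0 cs0 cu0 cus cw cwt cwx cwy dw u0_us).
- move=> r eta n r0 eta0; exact: local_energy_balance.
- exact: gain_lty.
- exact: energy_lty.
Qed.

Let w0 := lap phi0.
Definition initial_energy : \bar R := IO L (fun x y => u0 y * w0 x y ^+ 2).

Lemma energy_near0 (eta : R) : 0 < eta ->
  \forall tau \near 0^'+, (e_ tau <= 2%:E * initial_energy + eta%:E)%E.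
Proof.
move=> eta0; case: (lp) => _ _ iv _.
pose d := Num.min 1 (eta / 2).
have d0 : 0 < d by rewrite lt_min ltr01 divr_gt0.
have d2 : 2 * d ^+ 2 <= eta.
  have d1 : d <= 1 by rewrite ge_min lexx.
  have de : d <= eta / 2 by rewrite ge_min lexx orbT.
  have : d ^+ 2 <= d by rewrite expr2 ler_piMr// ltW.
  by move: de; move: (d ^+ 2) (d) => p q h1 h2; lra.
have dnear : \forall tau \near 0^'+,
    (L2norm L (sqrt_wt u0 (sub2 (lap (phi tau)) (lap phi0))) < d%:E)%E.
  have nd : nbhs (0 : \bar R)%E [set x : \bar R | (x < d%:E)%E].
    by apply: (@open_ereal_lt' R 0%E d%:E); rewrite lte_fin.
  exact: (iv_energy iv nd).
have pos : \forall tau \near (0:R)^'+, 0 < tau by exact: nbhs_right_gt.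
apply: filterS2 dnear pos => tau hd t0.
have ct : cont_on (Omega L) (w tau) := cont3_slice t0 cw.
have cu : cont_on (Omega L) (fun=> u0) := cont3_slice t0 cu0.
have cw0 : cont_on (Omega L) w0.
  apply: (@cont_onD _ _ (dx (dx phi0)) (dy (dy phi0))).
    exact: (Ck_cont (Ck_dx (Ck_dx (iv_reg iv)))).
  exact: (Ck_cont (Ck_dy (Ck_dy (iv_reg iv)))).
have c1' : cont_on (Omega L) (fun x y => u0 y * w tau x y ^+ 2) by cont.
have c2' : cont_on (Omega L) (fun x y => u0 y * (w tau x y - w0 x y) ^+ 2) by cont.
have c3' : cont_on (Omega L) (fun x y => u0 y * w0 x y ^+ 2) by cont.
have pp (g : R -> R -> R) x y : Omega L (x, y) -> 0 <= u0 y * g x y ^+ 2.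
  by move=> Oxy; apply: mulr_ge0 (sqr_ge0 _); exact/ltW/(Omega_u0 bf Oxy).
have p2 x y : Omega L (x, y) -> 0 <= u0 y * (w tau x y - w0 x y) ^+ 2.
  exact: (pp (fun x y => w tau x y - w0 x y)).
have c4' := cont_onM (@cont_on_cst _ (Omega L) 2) c2'.
have c5' := cont_onM (@cont_on_cst _ (Omega L) 2) c3'.
have p4 x y : Omega L (x, y) -> 0 <= 2 * (u0 y * (w tau x y - w0 x y) ^+ 2).
  by move=> /p2 h; rewrite mulr_ge0.
have p5 x y : Omega L (x, y) -> 0 <= 2 * (u0 y * w0 x y ^+ 2).
  by move=> /(pp w0) h; rewrite mulr_ge0.
have DE : (IO L (fun x y => u0 y * (w tau x y - w0 x y) ^+ 2) <= (d ^+ 2)%:E)%E.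
  have := L2norm_sqr L (sqrt_wt u0 (sub2 (lap (phi tau)) (lap phi0))).
  set X := L2norm _ _ in hd *; move=> XE.
  have -> : IO L (fun x y => u0 y * (w tau x y - w0 x y) ^+ 2) = (X ^+ 2)%E.
    rewrite XE; apply: eq_integral => -[x y] /set_mem Oxy; congr (_%:E).
    by rewrite /sqrt_wt /sub2 /= [RHS]exprMn sqr_sqrtr// ltW// (Omega_u0 bf Oxy).
  have X0 : (0 <= X)%E by exact: L2norm_ge0.
  have Xd := ltW hd; clear hd XE; case: X X0 Xd => [x| |]//; rewrite !lee_fin => x0 xd.
  have : ((x ^+ 2)%:E <= (d ^+ 2)%:E)%E by rewrite lee_fin ler_sqr ?nnegrE// ltW.
  exact.
apply: (@le_trans _ _ (IO L (fun x y => 2 * (u0 y * (w tau x y - w0 x y) ^+ 2) +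
    2 * (u0 y * w0 x y ^+ 2)))).
  apply: (IO_le c1' (cont_onD c4' c5') (pp (w tau))) => x y Oxy.
  have h0 := ltW (Omega_u0 bf Oxy).
  have -> : 2 * (u0 y * (w tau x y - w0 x y) ^+ 2) + 2 * (u0 y * w0 x y ^+ 2) =
    u0 y * w tau x y ^+ 2 + u0 y * (w tau x y - 2 * w0 x y) ^+ 2 by ring.
  by rewrite lerDl mulr_ge0// sqr_ge0.
rewrite (IO_D c4' c5' p4 p5) (IO_Z _ c2' p2)// (IO_Z _ c3' (pp w0))// addeC.
apply: leeD => //; apply: (@le_trans _ _ (2%:E * (d ^+ 2)%:E)%E); last by rewrite -EFinM lee_fin.
by apply: lee_wpmul2l.
Qed.

Lemma initial_energy_ge0 : (0 <= initial_energy)%E.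
Proof.
apply: (@IO_ge0 _ L (fun x y => u0 y * w0 x y ^+ 2)) => x y Oxy.
by apply: mulr_ge0 (sqr_ge0 _); exact/ltW/(Omega_u0 bf Oxy).
Qed.

Lemma solution_estimate (sg T : R) : 0 < sg -> sg < T ->
  ((gr T / 2)%:E * e_ T + \int[leb R]_(t in `[sg, T]) ((gr t)%:E * hg t)
    <= 4%:E * initial_energy)%E.
Proof.
move=> sg0 sgT.
have [->|i0] := eqVneq initial_energy +oo%E; first by rewrite gt0_muley ?lte_fin// leey.
have [E EE] : exists E : R, initial_energy = E%:E.
  by apply: ereal_fin initial_energy_ge0 _; rewrite ltey.
rewrite EE; apply/lee_addgt0Pr => eta eta0.
have cgr : {for 0, continuous gr} by exact: (der_continuous (der_grow _ _)).
have n1 : \forall tau \near (0:R)^'+, gr tau < 2.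
  have g1 : gr 0 = 1 by rewrite /gr /growth mulr0 expR0.
  have : \forall tau \near (0:R), gr tau < 2.
    have /cvgrPdist_lt/(_ 1 ltr01) := cgr; apply: filterS => tau; rewrite g1 distrC.
    by move=> /(le_lt_trans (ler_norm _)); rewrite ltrBlDr.
  exact: cvg_within.
have n2 : \forall tau \near (0:R)^'+, tau < sg by exact: nbhs_right_lt.
have n3 : \forall tau \near (0:R)^'+, 0 < tau by exact: nbhs_right_gt.
have n4 := energy_near0 (divr_gt0 eta0 (ltr0Sn R 1)).
pose Q := [set tau : R | [/\ gr tau < 2, tau < sg, 0 < tau &
  (e_ tau <= 2%:E * initial_energy + (eta / 2)%:E)%E]].
have nQ : nbhs (0 : R)^'+ Q.
  near=> tau; split; near: tau; [exact: n1|exact: n2|exact: n3|exact: n4].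
have [tau [h1 h2 h3 h4]] := @filter_ex _ (nbhs (0 : R)^'+) _ Q nQ.
apply: (@le_trans _ _ ((gr tau)%:E * e_ tau)%E).
  apply: le_trans (solution_window h3 (lt_trans h2 sgT)).
  rewrite leeD2l//; apply: ge0_subset_integral => //.
  - have J0 : `[tau, T] `<=` `]0, +oo[.
      by move=> t; rewrite /= !in_itv/= andbT => /andP[h _]; exact: lt_le_trans h.
    apply: emeasurable_funM; last first.
      exact: (measurable_half_gain eps cu0 cw cwx cwy u0_us (measurable_itv _) J0).
    apply/measurable_EFinP; apply: measurable_funTS; apply: continuous_measurable_fun => t.
    exact: (der_continuous (der_grow _ t)).
  - move=> t; rewrite /= in_itv/= => /andP[t1 _]; apply: mule_ge0; first by rewrite lee_fin.
    by apply: (half_gain_ge0 w wx wy L0 e0 u0_us); exact: lt_le_trans t1.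
  - by move=> t; rewrite /= !in_itv/= => /andP[t1 ->]; rewrite (le_trans (ltW h2) t1).
rewrite EE in h4; apply: (@le_trans _ _ (2%:E * (2%:E * E%:E + (eta / 2)%:E))%E).
  apply: lee_pmul => //; first by rewrite lee_fin.
    by apply: (@IO_ge0 _ L (fun x y => u0 y * w tau x y ^+ 2)) => x y Oxy;
      apply: mulr_ge0 (sqr_ge0 _); exact/ltW/(Omega_u0 bf Oxy).
  by rewrite lee_fin ltW.
have H : ((2 * (2 * E + eta / 2))%:E <= (4 * E + eta)%:E)%E.
  by rewrite lee_fin le_eqVlt; apply/orP; left; apply/eqP; field.
exact: H.
Unshelve. all: end_near. Qed.

End solution_energy.

(** * Weighted norms, exhaustion in time, absorption constants *)

Section weighted_norms.
Context {R : realType}.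
Variables (u0 : R -> R) (L : R).
Hypothesis bf : base_flow u0.

Lemma L2norm_sqrt_wt (g : R -> R -> R) :
  (L2norm L (sqrt_wt u0 g) ^+ 2)%E = IO L (fun x y => u0 y * g x y ^+ 2).
Proof.
rewrite L2norm_sqr; apply: eq_integral => -[x y] /set_mem Oxy; congr (_%:E).
by rewrite /sqrt_wt [LHS]exprMn sqr_sqrtr// ltW// (Omega_u0 bf Oxy).
Qed.

Lemma L2norm_sqrt_wt_grad (g : R -> R -> R) :
  (L2norm L (sqrt_wt u0 (grad_norm g)) ^+ 2)%E =
  IO L (fun x y => u0 y * (dx g x y ^+ 2 + dy g x y ^+ 2)).
Proof.
rewrite L2norm_sqrt_wt; apply: eq_integral => -[x y] _; congr (_%:E).
by rewrite /grad_norm sqr_sqrtr// addr_ge0 ?sqr_ge0.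
Qed.

Lemma L2norm_grad (g : R -> R -> R) :
  (L2norm L (grad_norm g) ^+ 2)%E = IO L (fun x y => dx g x y ^+ 2 + dy g x y ^+ 2).
Proof.
rewrite L2norm_sqr; apply: eq_integral => -[x y] _; congr (_%:E).
by rewrite /grad_norm sqr_sqrtr// addr_ge0 ?sqr_ge0.
Qed.

Lemma expe2M (k : R) (X : \bar R) : ((k%:E * X) ^+ 2 = (k ^+ 2)%:E * X ^+ 2)%E.
Proof. by rewrite !expe2 EFinM muleACA. Qed.

End weighted_norms.

Lemma time_exhaustion (R : realType) (T : R) (h : R -> \bar R) (X : \bar R) : 0 < T ->
  measurable_fun `]0, T[ h -> (forall t, 0 < t -> (0 <= h t)%E) ->
  (forall sg, 0 < sg -> sg < T -> (\int[leb R]_(t in `[sg, T]) h t <= X)%E) ->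
  measurable_fun `]0, T] h ->
  (\int[leb R]_(t in `]0%R, T[) h t <= X)%E.
Proof.
move=> T0 mh h0 hX mh'.
have m0 n : 0 < (mesh n : R) by exact: mesh_gt0.
apply: (@le_integral_of_exhaustion R _ _ (leb R) (fun n => `[T * mesh n, T[)).
- move=> m n mn; apply/subsetPset => t; rewrite /= !in_itv/= => /andP[h1 ->].
  by rewrite andbT (le_trans _ h1)// ler_pM2l// le_mesh.
- by move=> n; exact: measurable_itv.
- apply/seteqP; split => t /=.
    by move=> [n _]; rewrite /= !in_itv/= => /andP[h1 ->]; rewrite andbT (lt_le_trans _ h1)// mulr_gt0.
  rewrite in_itv/= => /andP[t0 tT].
  have [n hn] := @mesh_small R (t / T) (divr_gt0 t0 T0); exists n => //=.
  by rewrite in_itv/= tT andbT mulrC -ler_pdivlMr.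
- exact: mh.
- by move=> t; rewrite /= in_itv/= => /andP[t0 _]; exact: h0.
- move=> n; apply: le_trans (hX (T * mesh n) _ _).
  + apply: ge0_subset_integral => //.
    * apply: measurable_funS mh' => //.
      by move=> t; rewrite /= !in_itv/= => /andP[h1 ->]; rewrite andbT (lt_le_trans _ h1)// mulr_gt0.
    * by move=> t; rewrite /= in_itv/= => /andP[h1 _]; apply: h0; rewrite (lt_le_trans _ h1)// mulr_gt0.
    * by move=> t; rewrite /= !in_itv/= => /andP[-> /ltW].
  + exact: mulr_gt0.
  + rewrite gtr_pMr//; apply: lt_trans (@mesh_lt R n) _.
    by rewrite invf_lt1// ltr1n.
Qed.

Lemma absorb_small (R : realType) (Q del eps : R) : 0 <= Q -> 0 < del < 6^-1 -> 0 < eps ->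
  eps < Num.min 2^-1 ((8 * (Q + 1))^-1 `^ (6^-1 - del)^-1) ->
  Q * eps `^ (5 / 6 - del) <= 8^-1 * eps `^ (2 / 3).
Proof.
move=> Q0 /andP[d0 d6] e0; rewrite lt_min => /andP[_ eQ].
have g0 : 0 < 6^-1 - del by rewrite subr_gt0.
have Q1 : 0 < Q + 1 by rewrite ltr_wpDl.
have Q8 : 0 < 8 * (Q + 1) by rewrite mulr_gt0.
have -> : 5 / 6 - del = 2 / 3 + (6^-1 - del) by field.
rewrite powRD; last by apply/implyP => _; rewrite gt_eqF.
have h : eps `^ (6^-1 - del) <= (8 * (Q + 1))^-1.
  have -> : (8 * (Q + 1))^-1 = ((8 * (Q + 1))^-1 `^ (6^-1 - del)^-1) `^ (6^-1 - del).
    by rewrite -powRrM mulVf ?gt_eqF// powRr1// invr_ge0 ltW.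
  by apply: ge0_ler_powR; rewrite ?nnegrE ?powR_ge0// ltW.
have -> : Q * (eps `^ (2 / 3) * eps `^ (6^-1 - del)) = Q * eps `^ (6^-1 - del) * eps `^ (2 / 3) by ring.
apply: ler_wpM2r; first exact: powR_ge0.
apply: (@le_trans _ _ (Q * (8 * (Q + 1))^-1)); first exact: ler_wpM2l.
by rewrite invfM mulrCA ler_piMr ?invr_ge0// ler_pdivrMr// mul1r lerDl.
Qed.

Section constants.
Context {R : realType}.
Variables (A K M gC vC : R).
Hypotheses (A0 : 0 < A) (K0 : 0 <= K) (M0 : 0 < M) (gC0 : 0 <= gC) (vC0 : 0 <= vC).

Definition wall_th : R := A ^+ 2 / (64 * M * (vC + 1)).
Definition decay_rate : R := (8 * (vC + 1))^-1.
Definition damping_cost : R := 4^-1 + 2 * K + 2^-1 + 2 * K * gC + 8 * M * gC / (A ^+ 2 * wall_th).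

Let v1 : 0 < vC + 1. Proof. by rewrite ltr_wpDl. Qed.

Lemma wall_th_gt0 : 0 < wall_th.
Proof. by rewrite divr_gt0 ?exprn_gt0// !mulr_gt0. Qed.

Lemma decay_rate_gt0 : 0 < decay_rate.
Proof. by rewrite invr_gt0 mulr_gt0. Qed.

Lemma damping_cost_ge : 4^-1 <= damping_cost.
Proof.
rewrite /damping_cost -!addrA lerDl addr_ge0 ?mulr_ge0// addr_ge0 ?invr_ge0// addr_ge0 ?mulr_ge0//.
- by rewrite ltW.
- by rewrite invr_ge0 mulr_ge0 ?sqr_ge0// ltW// wall_th_gt0.
Qed.

Let th0 := wall_th_gt0.

Lemma hU_holds (L s c1 : R) : 0 < s -> 0 <= c1 <= decay_rate -> 0 < L < (4 * damping_cost)^-1 ->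
  4^-1 + (2 * K + 2^-1 * c1 + K * (2 * gC)
     + 2 * s ^+ 3 * M * (2 / (A * s) ^+ 2) * ((wall_th * s)^-1 * (2 * gC))) <= (4 * L)^-1.
Proof.
move=> s0 /andP[c0 c1d] /andP[L0 LL].
have Y0 : 0 < damping_cost by apply: lt_le_trans damping_cost_ge; rewrite invr_gt0.
have c11 : c1 <= 1.
  apply: (le_trans c1d); rewrite invf_le1 ?mulr_gt0//.
  by move: vC0 => v; rewrite mulrDr mulr1; apply: (@le_trans _ _ 8); [rewrite ler1n|rewrite lerDr mulr_ge0].
have h : damping_cost <= (4 * L)^-1.
  rewrite -[leLHS]invrK lef_pV2 ?posrE ?mulr_gt0 ?invr_gt0//.
  by have := ltW LL; rewrite invfM -ler_pdivlMl ?invr_gt0// invrK.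
apply: le_trans h; rewrite /damping_cost.
have -> : 2 * s ^+ 3 * M * (2 / (A * s) ^+ 2) * ((wall_th * s)^-1 * (2 * gC)) =
    8 * M * gC / (A ^+ 2 * wall_th).
  by move: th0; generalize wall_th => th h; field; rewrite !gt_eqF.
by move: c11; move: (8 * M * gC / _) (K * gC) => p q h; lra.
Qed.

Lemma hG_holds (s c1 B Q : R) : 0 < s -> 0 <= c1 <= decay_rate ->
  vC * (s ^+ 3 * Q + 2 * (B * M) + 2 * B) <= 8^-1 * s ^+ 2 ->
  vC * (s ^+ 3 * Q + 2 * (B * M) + 2^-1 * c1 * s ^+ 2 + 2 * B
    + 2 * s ^+ 3 * M * (2 / (A * s) ^+ 2) * (wall_th * s)) <= 4^-1 * s ^+ 2.
Proof.
move=> s0 /andP[c0 c1d] h.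
have s2 : 0 < s ^+ 2 by rewrite exprn_gt0.
have q : vC / (16 * (vC + 1)) <= 16^-1.
  by rewrite invfM mulrCA ler_piMr ?invr_ge0// ler_pdivrMr// mul1r lerDl.
have t1 : vC * (2^-1 * c1 * s ^+ 2) <= 16^-1 * s ^+ 2.
  rewrite mulrA ler_pM2r//; apply: le_trans q.
  rewrite ler_wpM2l//; apply: (@le_trans _ _ (2^-1 * decay_rate)); first by rewrite ler_pM2l ?invr_gt0.
  by rewrite /decay_rate -invfM mulrA le_eqVlt -natrM eqxx.
have t2 : vC * (2 * s ^+ 3 * M * (2 / (A * s) ^+ 2) * (wall_th * s)) <= 16^-1 * s ^+ 2.
  have -> : vC * (2 * s ^+ 3 * M * (2 / (A * s) ^+ 2) * (wall_th * s)) = vC / (16 * (vC + 1)) * s ^+ 2.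
    by rewrite /wall_th; field; rewrite !gt_eqF.
  by rewrite ler_pM2r.
have -> : vC * (s ^+ 3 * Q + 2 * (B * M) + 2^-1 * c1 * s ^+ 2 + 2 * B
    + 2 * s ^+ 3 * M * (2 / (A * s) ^+ 2) * (wall_th * s)) =
  vC * (s ^+ 3 * Q + 2 * (B * M) + 2 * B) + vC * (2^-1 * c1 * s ^+ 2) +
  vC * (2 * s ^+ 3 * M * (2 / (A * s) ^+ 2) * (wall_th * s)) by ring.
apply: (le_trans (lerD (lerD h t1) t2)).
by move: (s ^+ 2) => p; lra.
Qed.

End constants.

(** * The final estimates *)

Lemma recombine (R : realType) (L eps : R) (e0 e a d : \bar R) : 0 < L -> 0 < eps ->
  (0 <= e0)%E -> (0 <= e)%E -> (0 <= a)%E -> (0 <= d)%E ->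
  (2^-1%:E * e + ((eps / 2)%:E * d + ((4 * L)^-1)%:E * a) <= 4%:E * e0)%E ->
  (e + (L^-1)%:E * a + eps%:E * d <= 16%:E * e0)%E.
Proof.
move=> L0 ep e00 e1 a0 d0 h.
have k1 : (0 <= (eps / 2)%:E * d)%E by apply: mule_ge0 => //; rewrite lee_fin divr_ge0// ltW.
have k2 : (0 <= ((4 * L)^-1)%:E * a)%E.
  by apply: mule_ge0 => //; rewrite lee_fin invr_ge0 mulr_ge0// ltW.
have k3 : (0 <= 2^-1%:E * e)%E by apply: mule_ge0 => //; rewrite lee_fin invr_ge0.
have h4 := lee_wpmul2l (_ : (0 <= 4%:E :> \bar R)%E) h.
have {h4} := h4 ltac:(by rewrite lee_fin).
rewrite (ge0_muleDr _ k3 (adde_ge0 k1 k2)) (ge0_muleDr _ k1 k2) !muleA -!EFinM.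
have -> : (4 * 4 = 16 :> R) by rewrite -natrM.
move=> /(le_trans _); apply; rewrite -addeA; apply: leeD.
  by rewrite -[leLHS]mul1e lee_wpmul2r// lee_fin; lra.
rewrite addeC; apply: leeD; apply: lee_wpmul2r => //; rewrite lee_fin.
  by move: ep; lra.
by rewrite invfM mulrA divff ?mul1r// gt_eqF.
Qed.

Lemma transport_bound (R : realType) (k l m a1 a2 a3 a4 b1 b2 b3 b4 : \bar R) :
  a1 = b1 -> a2 = b2 -> a3 = b3 -> a4 = b4 ->
  (b1 + k * b2 + l * b3 <= m * b4)%E -> (a1 + k * a2 + l * a3 <= m * a4)%E.
Proof. by move=> -> -> -> ->. Qed.

Lemma sqre_le_scaled (R : realType) (k : R) (x y ex ey : \bar R) :
  (0 <= x)%E -> (0 <= y)%E -> 0 <= k -> (x ^+ 2)%E = ex -> (y ^+ 2)%E = ey ->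
  (ex <= (k ^+ 2)%:E * ey)%E -> (x <= k%:E * y)%E.
Proof.
move=> x0 y0 k0 <- <- h; apply: sqre_le => //; first exact: mule_ge0.
by rewrite expe2M.
Qed.

Lemma decay_arith (R : realType) (g E : R) (x y : \bar R) : 0 < E -> g = (E ^+ 2)^-1 ->
  ((g / 2)%:E * x <= 4%:E * y)%E -> (x <= (8 * E ^+ 2)%:E * y)%E.
Proof.
move=> E0 -> h.
have k0 : (0 <= (2 * E ^+ 2)%:E :> \bar R)%E by rewrite lee_fin mulr_ge0 ?sqr_ge0.
have := lee_wpmul2l k0 h; rewrite !muleA -!EFinM.
have -> : 2 * E ^+ 2 * ((E ^+ 2)^-1 / 2) = 1 by field; rewrite gt_eqF.
have -> : 2 * E ^+ 2 * 4 = 8 * E ^+ 2 by ring.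
by rewrite mul1e.
Qed.

Lemma gradient_arith (R : realType) (g M E : R) (d e i : \bar R) :
  0 <= g -> 0 <= M -> 0 <= E -> (0 <= i)%E -> (d <= M%:E * e)%E ->
  (e <= (8 * E ^+ 2)%:E * i)%E ->
  (g%:E * d <= (((1 + g * M) * (3 * E)) ^+ 2)%:E * i)%E.
Proof.
move=> g0 M0 E0 i0 dM eE; apply: (@le_trans _ _ (g%:E * (M%:E * ((8 * E ^+ 2)%:E * i)))%E).
  apply: lee_wpmul2l => //; apply: (le_trans dM).
  by apply: lee_wpmul2l.
rewrite !muleA -!EFinM; apply: lee_wpmul2r => //.
have gM : 0 <= g * M by rewrite mulr_ge0.
have key : 8 * (g * M) <= 9 * (1 + g * M) ^+ 2.
  by move: gM; move: (g * M) => r r0; have := sqr_ge0 r; lra.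
rewrite lee_fin; have := ler_wpM2r (sqr_ge0 E) key; rewrite -subr_ge0 => h.
by rewrite -subr_ge0; move: h; congr (0 <= _); ring.
Qed.

Lemma add_bounds (R : realType) (p q C : R) (x y X : \bar R) : 0 <= p -> 0 <= q ->
  p + q = C -> (x <= p%:E * X)%E -> (y <= q%:E * X)%E -> (x + y <= C%:E * X)%E.
Proof.
by move=> p0 q0 <- h1 h2; rewrite EFinD ge0_muleDl ?lee_fin//; exact: leeD.
Qed.

Section final_estimates.
Context {R : realType}.
Variables (u0 : R -> R) (L A eps K B kap M th cd : R) (us vs : R -> R -> R)
  (phi : R -> R -> R -> R) (phi0 : R -> R -> R).
Hypothesis bf : base_flow u0.
Hypotheses (L0 : 0 < L) (L1 : L <= 1) (kap0 : 0 < kap).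
Hypothesis hkap : forall y : R, 0 <= y <= 1 -> kap <= u0^`()%classic y ^+ 2 + u0 y ^+ 2.
Hypothesis M0 : 0 < M.
Hypothesis hM : forall y : R, 0 <= y <= 1 ->
  [/\ `|u0 y| <= M, `|u0^`()%classic y| <= M & `|u0^`(2)%classic y| <= M].
Hypotheses (e0 : 0 < eps) (e1 : eps <= 1) (K0 : 0 <= K) (B0 : 0 < B) (A0 : 0 < A).
Hypotheses (th0 : 0 < th) (cd0 : 0 < cd).
Hypothesis bg : background u0 L eps K B us vs.
Hypothesis lp : linearized_problem u0 A L eps us vs phi phi0.
Let s := cbrt eps.
Let beta := 2 / (A * s) ^+ 2.
Hypotheses (s0 : 0 < s) (s1 : s <= 1) (eE : eps = s ^+ 3).
Hypothesis hG : forall c1, 0 <= c1 <= cd ->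
  vortC kap M * (eps * (M * K + M / L ^+ 2 + M) + 2 * (B * M) + 2^-1 * c1 * s ^+ 2
    + 2 * B + 2 * eps * M * beta * th) <= 4^-1 * s ^+ 2.
Hypothesis hU : forall c1, 0 <= c1 <= cd ->
  4^-1 + (2 * K + 2^-1 * c1 + K * (2 * gradC kap M)
     + 2 * eps * M * beta * (th^-1 * (2 * gradC kap M))) <= (4 * L)^-1.

Let w t := lap (phi t).
Let wx t := dx (lap (phi t)).
Let wy t := dy (lap (phi t)).
Let hg := half_gain u0 L eps w wx wy.
Let e_ := energy u0 L w.

Let est (c1 : R) (hc : 0 <= c1 <= cd) sg T (sg0 : 0 < sg) (sgT : sg < T) :
  ((growth (c1 * s) T / 2)%:E * e_ T + \int[leb R]_(t in `[sg, T]) ((growth (c1 * s) t)%:E * hg t)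
    <= 4%:E * initial_energy u0 L phi0)%E.
Proof.
have c10 : 0 <= c1 by case/andP: hc.
exact: (solution_estimate bf L0 L1 kap0 hkap M0 hM e0 e1 K0 B0 A0 th0 c10 bg lp s0 s1 eE
  (hG hc) (hU hc) sg0 sgT).
Qed.

Let cu0 : cont3 L (fun _ _ y => u0 y).
Proof.
apply: (@cont3_xy _ L (fun _ y => u0 y)); apply: cont_on_snd => z _.
exact: (base_cont bf z.2).1.
Qed.
Let cw : cont3 L w := @cont3_lap _ _ _ _ _ _ _ _ _ lp.
Let cwx : cont3 L wx := @cont3_dx_lap _ _ _ _ _ _ _ _ _ lp.
Let cwy : cont3 L wy := @cont3_dy_lap _ _ _ _ _ _ _ _ _ lp.
Let u0_us x y : Omega L (x, y) -> 0 <= u0 y <= us x y.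
Proof.
by move=> Oxy; have /andP[h _] := bg_u bg Oxy; rewrite h (ltW (Omega_u0 bf Oxy)).
Qed.
Let hg0 t : 0 < t -> (0 <= hg t)%E := half_gain_ge0 w wx wy L0 e0 u0_us (t := t).
Let e_ge0 t : (0 <= e_ t)%E.
Proof.
apply: (@IO_ge0 _ L (fun x y => u0 y * w t x y ^+ 2)) => x y Oxy.
by apply: mulr_ge0 (sqr_ge0 _); exact/ltW/(Omega_u0 bf Oxy).
Qed.
Let cD : cont3 L (fun t x y => u0 y * (wx t x y ^+ 2 + wy t x y ^+ 2)). Proof. by cont3. Qed.
Let cA : cont3 L (fun t x y => (u0 y * w t x y) ^+ 2). Proof. by cont3. Qed.
Let D0 t x y : 0 < t -> Omega L (x, y) -> 0 <= u0 y * (wx t x y ^+ 2 + wy t x y ^+ 2).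
Proof. by move=> _ /u0_us/andP[h _]; rewrite mulr_ge0// addr_ge0 ?sqr_ge0. Qed.
Let A00 t x y : 0 < t -> Omega L (x, y) -> 0 <= (u0 y * w t x y) ^+ 2.
Proof. by move=> _ _; rewrite sqr_ge0. Qed.

Lemma total_estimate (T : R) : 0 < T ->
  (L2norm L (sqrt_wt u0 (lap (phi T))) ^+ 2
     + (L^-1)%:E * \int[@lebesgue_measure R]_(t in `]0%R, T[)
         L2norm L (wt u0 (lap (phi t))) ^+ 2
     + eps%:E * \int[@lebesgue_measure R]_(t in `]0%R, T[)
         L2norm L (sqrt_wt u0 (grad_norm (lap (phi t)))) ^+ 2
     <= 16%:E * L2norm L (sqrt_wt u0 (lap phi0)) ^+ 2)%E.
Proof.
move=> T0.
have eT : (L2norm L (sqrt_wt u0 (lap (phi T))) ^+ 2)%E = e_ T := L2norm_sqrt_wt L bf (lap (phi T)).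
have e0E : (L2norm L (sqrt_wt u0 (lap phi0)) ^+ 2)%E = initial_energy u0 L phi0 :=
  L2norm_sqrt_wt L bf (lap phi0).
have intA : (\int[leb R]_(t in `]0%R, T[) L2norm L (wt u0 (lap (phi t))) ^+ 2 =
    \int[leb R]_(t in `]0%R, T[) damping u0 L w t)%E.
  by apply: eq_integral => t _; exact: (L2norm_sqr L (wt u0 (lap (phi t)))).
have intD : (\int[leb R]_(t in `]0%R, T[) L2norm L (sqrt_wt u0 (grad_norm (lap (phi t)))) ^+ 2 =
    \int[leb R]_(t in `]0%R, T[) dissipation u0 L wx wy t)%E.
  by apply: eq_integral => t _; exact: (L2norm_sqrt_wt_grad L bf (lap (phi t))).
apply: (transport_bound eT intA intD e0E).
have mJ : measurable (`]0, T[%classic : set R) by exact: measurable_itv.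
have J0 : `]0, T[ `<=` `]0, +oo[ by move=> t; rewrite /= !in_itv/= andbT => /andP[].
have mJ' : measurable (`]0, T]%classic : set R) by exact: measurable_itv.
have J0' : `]0, T] `<=` `]0, +oo[ by move=> t; rewrite /= !in_itv/= andbT => /andP[].
have mhg := measurable_half_gain eps cu0 cw cwx cwy u0_us mJ J0.
have mhg' := measurable_half_gain eps cu0 cw cwx cwy u0_us mJ' J0'.
have md : measurable_fun (`]0, T[%classic : set R) (dissipation u0 L wx wy) :=
  measurable_IO mJ J0 cD D0.
have ma : measurable_fun (`]0, T[%classic : set R) (damping u0 L w) :=
  measurable_IO mJ J0 cA A00.
have d0 (t : R) : (`]0, T[%classic : set R) t -> (0 <= dissipation u0 L wx wy t)%E.
  by move=> /J0; rewrite /= in_itv/= andbT => t0; exact: (dissipation_ge0 wx wy u0_us t0).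
have a0 (t : R) : (`]0, T[%classic : set R) t -> (0 <= damping u0 L w t)%E.
  by move=> _; exact: damping_ge0.
have i0 : (0 <= initial_energy u0 L phi0)%E by exact: initial_energy_ge0.
have ia := integral_ge0 (leb R) a0; have id0 := integral_ge0 (leb R) d0.
apply: (recombine L0 e0 i0 (e_ge0 T) ia id0).
have intE : (\int[leb R]_(t in `]0%R, T[) hg t =
    (eps / 2)%:E * \int[leb R]_(t in `]0%R, T[) dissipation u0 L wx wy t +
    ((4 * L)^-1)%:E * \int[leb R]_(t in `]0%R, T[) damping u0 L w t)%E.
  have ek : 0 <= eps / 2 by rewrite divr_ge0// ltW.
  have lk : 0 <= (4 * L)^-1 by rewrite invr_ge0 mulr_ge0// ltW.
  rewrite -(ge0_integralZl_EFin (leb R) mJ d0 md ek) -(ge0_integralZl_EFin (leb R) mJ a0 ma lk).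
  apply: (@ge0_integralD _ _ R (leb R) _ mJ (fun t => (eps / 2)%:E * dissipation u0 L wx wy t)%E
    (fun t => ((4 * L)^-1)%:E * damping u0 L w t)%E).
  - by move=> t /d0 h; apply: mule_ge0.
  - by apply: measurable_funeM; exact: md.
  - by move=> t /a0 h; apply: mule_ge0.
  - by apply: measurable_funeM; exact: ma.
suff H : (2^-1%:E * e_ T + \int[leb R]_(t in `]0%R, T[) hg t <= 4%:E * initial_energy u0 L phi0)%E.
  by rewrite intE in H; exact: H.
have [E|fin] := eqVneq (initial_energy u0 L phi0) +oo%E.
  by rewrite E gt0_muley ?lte_fin// leey.
have [E EE] : exists E : R, initial_energy u0 L phi0 = E%:E.
  by apply: ereal_fin i0 _; rewrite ltey.
have [x xE] : exists x : R, e_ T = x%:E.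
  apply: ereal_fin (e_ge0 T) _.
  exact: (energy_lty bf L0 hM lp T0).
have gr1 t : growth (0 * s) t = 1 by rewrite /growth !mul0r expR0.
have hyp sg : 0 < sg -> sg < T -> (\int[leb R]_(t in `[sg, T]) hg t <= (4 * E - 2^-1 * x)%:E)%E.
  move=> sg0 sgT; have c00 : 0 <= (0:R) <= cd by rewrite lexx ltW.
  have := est c00 sg0 sgT; rewrite gr1 EE xE.
  under eq_integral do rewrite gr1 mul1e.
  by rewrite mul1r EFinB leeBrDl// addeC.
rewrite EE xE; apply: (@le_trans _ _ ((2^-1 * x)%:E + (4 * E - 2^-1 * x)%:E)%E).
  by rewrite EFinM leeD2l//; exact: time_exhaustion.
have H : ((2^-1 * x + (4 * E - 2^-1 * x))%:E <= (4 * E)%:E)%E by rewrite lee_fin addrC subrK.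
exact: H.
Qed.

Lemma decay_estimate (T : R) : 0 < T ->
  (L2norm L (grad_norm (phi T)) + L2norm L (sqrt_wt u0 (lap (phi T)))
     <= ((3 * (2 + 2 * gradC kap M * M)) * expR (- (cd / 2) * cbrt eps * T))%:E
        * L2norm L (sqrt_wt u0 (lap phi0)))%E.
Proof.
move=> T0; pose X := L2norm L (sqrt_wt u0 (lap phi0)).
have X0 : (0 <= X)%E by exact: L2norm_ge0.
have gC0 : 0 <= 2 * gradC kap M by apply: mulr_ge0 => //; exact: ltW (gradC_gt0 M kap0).
have gM : 0 <= 2 * gradC kap M * M by apply: mulr_ge0 => //; exact: ltW.
pose E := expR (- (cd / 2) * cbrt eps * T); have E0 : 0 < E by exact: expR_gt0.
have cc : 0 <= cd <= cd by rewrite lexx ltW.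
have T2 : T / 2 < T by rewrite ltr_pdivrMr// ltr_pMr// ltr1n.
have gE : growth (cd * s) T = (E ^+ 2)^-1.
  rewrite /E -expRM_natl -expRN /growth; congr (expR _).
  by rewrite /s; field.
have eT : (e_ T <= (8 * E ^+ 2)%:E * initial_energy u0 L phi0)%E.
  have h := est cc (divr_gt0 T0 (ltr0Sn R 1)) T2.
  have h2 : ((growth (cd * s) T / 2)%:E * e_ T <= 4%:E * initial_energy u0 L phi0)%E.
    apply: le_trans h; rewrite leeDl// integral_ge0// => t; rewrite /= in_itv/= => /andP[t1 _].
    apply: mule_ge0; first by rewrite lee_fin ltW// grow_gt0.
    by apply: hg0; apply: lt_le_trans t1; rewrite divr_gt0.
  exact: (decay_arith E0 gE h2).
have iE : (X ^+ 2 = initial_energy u0 L phi0)%E by exact: (L2norm_sqrt_wt L bf).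
have a1 : (L2norm L (sqrt_wt u0 (lap (phi T))) <= (3 * E)%:E * X)%E.
  have k0 : 0 <= 3 * E by rewrite mulr_ge0// ltW.
  apply: (sqre_le_scaled (L2norm_ge0 _ _) X0 k0 (L2norm_sqrt_wt L bf (lap (phi T))) iE).
  apply: (le_trans eT); apply: lee_wpmul2r; first by rewrite -iE sqre_ge0.
  by rewrite lee_fin exprMn ler_wpM2r ?sqr_ge0// -natrX ler_nat.
have ct : cont_on (Omega L) (w T) := cont3_slice T0 cw.
have cu : cont_on (Omega L) (fun=> u0) := cont3_slice T0 cu0.
have aM : (damping u0 L w T <= M%:E * e_ T)%E.
  have c1 : cont_on (Omega L) (fun x y => (u0 y * w T x y) ^+ 2) by cont.
  have c2 : cont_on (Omega L) (fun x y => u0 y * w T x y ^+ 2) by cont.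
  have c3 : cont_on (Omega L) (fun x y => M * (u0 y * w T x y ^+ 2)) by cont.
  have p2 x y : Omega L (x, y) -> 0 <= u0 y * w T x y ^+ 2.
    by move=> /u0_us/andP[h _]; rewrite mulr_ge0 ?sqr_ge0.
  rewrite -(IO_Z (ltW M0) c2 p2); apply: (IO_le c1 c3) => x y Oxy; first exact: sqr_ge0.
  have [h _ _] := hM (Omega_y Oxy).
  rewrite exprMn expr2 -mulrA; apply: ler_wpM2r; first exact: p2.
  exact: le_trans (ler_norm _) h.
have a2 : (L2norm L (grad_norm (phi T)) <= ((1 + 2 * gradC kap M * M) * (3 * E))%:E * X)%E.
  have k0 : 0 <= (1 + 2 * gradC kap M * M) * (3 * E).
    by rewrite mulr_ge0 ?addr_ge0// mulr_ge0// ltW.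
  apply: (sqre_le_scaled (L2norm_ge0 _ _) X0 k0 (L2norm_grad L (phi T)) iE).
  have g1 : (0 <= (2 * gradC kap M)%:E :> \bar R)%E by rewrite lee_fin.
  apply: (le_trans (gradient_le bf L0 L1 (stream_phi L0 lp T0) kap0 hkap hM)).
  have i0 : (0 <= initial_energy u0 L phi0)%E by exact: initial_energy_ge0.
  exact: (gradient_arith gC0 (ltW M0) (ltW E0) i0 aM eT).
have p1 : 0 <= (1 + 2 * gradC kap M * M) * (3 * E) by rewrite mulr_ge0 ?addr_ge0// mulr_ge0// ltW.
have p2 : 0 <= 3 * E by rewrite mulr_ge0// ltW.
have pE : (1 + 2 * gradC kap M * M) * (3 * E) + 3 * E =
    (3 * (2 + 2 * gradC kap M * M)) * expR (- (cd / 2) * cbrt eps * T) by rewrite /E; ring.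
exact: (add_bounds p1 p2 pE a2 a1).
Qed.

End final_estimates.

(** * Stability of the steady state *)

Theorem theorem1p2 (R : realType) :
  exists (delta0 : R) (Nmin : nat), 0 < delta0 /\
  forall u0 : R -> R, base_flow u0 ->
  exists C : R, 0 < C /\
  forall A : R, 0 < A ->
  forall delta : R, 0 < delta < delta0 ->
  forall chi : R -> R, cutoff chi ->
  forall N0 : nat, (Nmin <= N0)%N ->
  forall K : R,
  exists L0 : R, 0 < L0 /\
  forall L : R, 0 < L < L0 ->
  forall C0 : R,
  exists eps0 c1 : R, 0 < eps0 /\ 0 < c1 /\
  forall eps : R, 0 < eps < eps0 ->
  forall us vs : R -> R -> R,
    steady_state u0 chi A delta K L C0 N0 eps us vs ->
  forall (phi : R -> R -> R -> R) (phi0 : R -> R -> R),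
    linearized_problem u0 A L eps us vs phi phi0 ->
  (forall T : R, 0 < T ->
    (L2norm L (sqrt_wt u0 (lap (phi T))) ^+ 2
     + (L^-1)%:E * \int[@lebesgue_measure R]_(t in `]0%R, T[)
         L2norm L (wt u0 (lap (phi t))) ^+ 2
     + eps%:E * \int[@lebesgue_measure R]_(t in `]0%R, T[)
         L2norm L (sqrt_wt u0 (grad_norm (lap (phi t)))) ^+ 2
     <= C%:E * L2norm L (sqrt_wt u0 (lap phi0)) ^+ 2)%E) /\
  (forall T : R, 0 < T ->
    (L2norm L (grad_norm (phi T)) + L2norm L (sqrt_wt u0 (lap (phi T)))
     <= (C * expR (- c1 * cbrt eps * T))%:E
        * L2norm L (sqrt_wt u0 (lap phi0)))%E).
Proof.
exists 6^-1, 0%N; split; first by rewrite invr_gt0.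
move=> u0 bf.
have [kap kap0 hkap] := base_kappa bf; have [M M0 hM] := base_bounds bf.
pose gC := gradC kap M; pose vC := vortC kap M.
have gC0 : 0 <= gC by exact: ltW (gradC_gt0 M kap0).
have vC0 : 0 <= vC by exact: vortC_ge0.
have gM : 0 <= 2 * gC * M by apply: mulr_ge0; [exact: mulr_ge0|exact: ltW].
exists (16 + 3 * (2 + 2 * gC * M)); split.
  by rewrite ltr_pwDl// mulr_ge0// addr_ge0.
move=> A A0 del /andP[del0 del1] chi cc N0 _ K.
pose K' := 1 + `|K|; have K'0 : 0 < K' by rewrite ltr_pwDl.
pose Y := damping_cost A K' M gC vC.
have Y4 : 4^-1 <= Y by exact: (damping_cost_ge A0 (ltW K'0) M0 gC0 vC0).
have Y0 : 0 < Y by apply: lt_le_trans Y4; rewrite invr_gt0.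
exists (4 * Y)^-1; split; first by rewrite invr_gt0 mulr_gt0.
move=> L /andP[L0 LY] C0.
have L1 : L <= 1.
  apply: le_trans (ltW LY) _; rewrite invf_le1 ?mulr_gt0//.
  by move: Y4; lra.
pose Q1 := M * K' + M / L ^+ 2 + M.
have Q10 : 0 <= Q1.
  apply: addr_ge0; last exact: ltW.
  by apply: addr_ge0; [apply: mulr_ge0; exact: ltW|apply: divr_ge0; [exact: ltW|exact: sqr_ge0]].
pose Q := vC * (Q1 + 2 * (K' * M) + 2 * K').
have Q0 : 0 <= Q.
  apply: mulr_ge0 => //; apply: addr_ge0; last by apply: mulr_ge0 => //; exact: ltW.
  by apply: addr_ge0 => //; apply: mulr_ge0 => //; apply: mulr_ge0; exact: ltW.
pose cd := decay_rate vC; have cd0 : 0 < cd by exact: decay_rate_gt0.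
exists (Num.min 2^-1 ((8 * (Q + 1))^-1 `^ (6^-1 - del)^-1)), (cd / 2).
split.
  by rewrite lt_min invr_gt0 ltr0n/= powR_gt0// invr_gt0 mulr_gt0// ltr_wpDl.
split; first by rewrite divr_gt0.
move=> eps /andP[e0 eQ] us vs ss phi phi0 lp.
have e1 : eps < 1.
  by move: eQ; rewrite lt_min => /andP[h _]; apply: (lt_trans h); rewrite invf_lt1// ltr1n.
have bg := steady_background bf cc L0 (introT andP (conj e0 e1)) ss.
pose P := eps `^ (5 / 6 - del); have P0 : 0 < P by exact: powR_gt0.
pose s := cbrt eps; have s0 : 0 < s by exact: powR_gt0.
have eE : eps = s ^+ 3.
  by rewrite /s /cbrt -powR_mulrn ?powR_ge0// -powRrM mulVf// powRr1// ltW.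
have s2 : s ^+ 2 = eps `^ (2 / 3).
  by rewrite /s /cbrt -powR_mulrn ?powR_ge0// -powRrM; congr (_ `^ _); field.
have s1 : s <= 1.
  rewrite -[leRHS](powRr0 eps) /s /cbrt; apply: ger_powR; first by rewrite e0 ltW.
  by rewrite invr_ge0.
have eP : eps <= P.
  rewrite -[leLHS]powRr1 ?(ltW e0)// /P; apply: ger_powR; first by rewrite e0 ltW.
  by move: del0; lra.
have sm := absorb_small Q0 (introT andP (conj del0 del1)) e0 eQ.
have hsm : vC * (s ^+ 3 * Q1 + 2 * (K' * P * M) + 2 * (K' * P)) <= 8^-1 * s ^+ 2.
  rewrite s2; apply: le_trans sm; rewrite -/P /Q -[leRHS]mulrA; apply: ler_wpM2l => //.
  rewrite -eE -subr_ge0.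
  have -> : (Q1 + 2 * (K' * M) + 2 * K') * P - (eps * Q1 + 2 * (K' * P * M) + 2 * (K' * P)) =
    Q1 * (P - eps) by ring.
  by rewrite mulr_ge0// subr_ge0.
have B0 : 0 < K' * P by exact: mulr_gt0.
have th0 : 0 < wall_th A M vC * s by rewrite mulr_gt0// wall_th_gt0.
have hG c1 : 0 <= c1 <= cd -> vC * (eps * Q1 + 2 * (K' * P * M) + 2^-1 * c1 * s ^+ 2
    + 2 * (K' * P) + 2 * eps * M * (2 / (A * s) ^+ 2) * (wall_th A M vC * s)) <= 4^-1 * s ^+ 2.
  by move=> h; have H := hG_holds A0 M0 vC0 s0 h hsm; rewrite -eE in H.
have hU c1 : 0 <= c1 <= cd -> 4^-1 + (2 * K' + 2^-1 * c1 + K' * (2 * gC)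
    + 2 * eps * M * (2 / (A * s) ^+ 2) * ((wall_th A M vC * s)^-1 * (2 * gC))) <= (4 * L)^-1.
  move=> h; have hL : 0 < L < (4 * Y)^-1 by rewrite L0.
  by have H := hU_holds A0 (ltW K'0) M0 gC0 vC0 s0 h hL; rewrite -eE in H.
split => T T0.
- have := total_estimate bf L0 L1 kap0 hkap M0 hM e0 (ltW e1) (ltW K'0) B0 A0 th0 cd0 bg lp
    s0 s1 eE hG hU T0.
  move=> /le_trans; apply; apply: lee_wpmul2r; first exact: sqre_ge0.
  by rewrite lee_fin lerDl mulr_ge0// addr_ge0.
- have := decay_estimate bf L0 L1 kap0 hkap M0 hM e0 (ltW e1) (ltW K'0) B0 A0 th0 cd0 bg lp
    s0 s1 eE hG hU T0.
  move=> /le_trans; apply; apply: lee_wpmul2r; first exact: L2norm_ge0.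
  by rewrite lee_fin ler_wpM2r ?expR_ge0// lerDr.
Qed.
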